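(* Let $A\to B$ be a surjective map of commutative noetherian local rings whose kernel is generated by an $A$-regular sequence. If $M$ is in $\mathsf D^{\mathrm b}(B/A)$ and $\mathrm{cx}^B(M)\ge1$ (so that the Betti degree is defined), then $\beta\mathrm{deg}^B(M)=\beta\mathrm{deg}^B(M^* )$, where $M^*=\mathrm{RHom}_B(M,B)$.
   Context: $k$ is the common residue field of $A$ and $B$. $\mathsf D^{\mathrm b}(B/A)$ is the full subcategory of the derived category $\mathsf D(B)$ of $B$-modules consisting of complexes whose restriction to $\mathsf D(A)$ is perfect, i.e. lies in the smallest thick subcategory of $\mathsf D(A)$ containing $A$; it is closed under $(-)^*=\mathrm{RHom}_B(-,B)$. For $M\in\mathsf D(B)$, $\beta_i^B(M)=\mathrm{rank}_k\mathrm{Ext}^i_B(M,k)$. The complexity $\mathrm{cx}^B(M)$ is the smallest natural number $b$ such that $\{\beta_i^B(M)\}_{i\ge0}$ is eventually bounded by a polynomial of degree $b-1$ (with $b=0$ meaning eventually zero), and $\infty$ if there is none. If $\mathrm{cx}^B(M)=n+1$ with $n\ge0$, the Betti degree is $$\beta\mathrm{deg}^B(M)=2^n\,n!\,\limsup_{i\to\infty}\frac{\beta_i^B(M)}{i^n}.$$ For $M$ in $\mathsf D^{\mathrm b}(B/A)$ the complexity is finite and it is known that $\mathrm{cx}^B(M)=\mathrm{cx}^B(M^* )$, so both Betti degrees are defined once $\mathrm{cx}^B(M)\ge1$. *)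

(* Defs.v *)
From HB Require Import structures.
From mathcomp Require Import all_boot all_order all_algebra.
From mathcomp Require Import all_classical all_reals.
From mathcomp Require Import ereal topology normedtype sequences.

Set Implicit Arguments.
Unset Strict Implicit.
Unset Printing Implicit Defensive.

Import Order.TTheory GRing.Theory Num.Theory.
Local Open Scope classical_set_scope.
Local Open Scope ring_scope.

Section Rings.
Variable R : comNzRingType.

Definition is_ideal (I : set R) : Prop :=
  [/\ I 0, forall x y, I x -> I y -> I (x + y) & forall a x, I x -> I (a * x)].

Definition ideal_gen (s : seq R) : set R :=
  [set x | exists c : 'I_(size s) -> R, x = \sum_(i < size s) c i * s`_i].

Definition maximal_ideal (I : set R) : Prop :=
  [/\ is_ideal I, ~ I 1 &
      forall J, is_ideal J -> I `<=` J -> J = I \/ J = setT].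

Definition noetherian_ring : Prop :=
  forall I, is_ideal I -> exists s : seq R, I = ideal_gen s.

Definition local_ring : Prop := exists! I, maximal_ideal I.

(* [s`_i] is a nonzerodivisor modulo the ideal generated by its predecessors,
   and the whole sequence does not generate the unit ideal. *)
Definition regular_seq (s : seq R) : Prop :=
  (forall i x, (i < size s)%N ->
     ideal_gen (take i s) (s`_i * x) -> ideal_gen (take i s) x)
  /\ ~ ideal_gen s 1.

End Rings.

Section HomModule.
Variables (R : comNzRingType) (U V : lmodType R).

Definition linHom : Type := {linear U -> V}.
HB.instance Definition _ := Choice.on linHom.

Lemma homP (f g : linHom) : (forall x, f x = g x) -> f = g.
Proof.
case: f g => [f [[fa] [fl]]] [g [[ga] [gl]]] /= /funext fg.
rewrite fg in fa fl *; congr (GRing.Linear.Pack (GRing.Linear.Class _ _)).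
  by congr Algebra.isNmodMorphism.Axioms_; apply: Prop_irrelevance.
by congr GRing.isScalable.Axioms_; apply: Prop_irrelevance.
Qed.

Definition mkhom (f : U -> V) (fL : linear f) : linHom :=
  HB.pack f (GRing.isLinear.Build R U V *:%R f fL).

Fact hom_zero_linear : linear (fun _ : U => 0 : V).
Proof. by move=> a x y; rewrite scaler0 addr0. Qed.

Fact hom_opp_linear (f : linHom) : linear (fun x => - f x).
Proof. by move=> a x y; rewrite linearP opprD scalerN. Qed.

Fact hom_add_linear (f g : linHom) : linear (fun x => f x + g x).
Proof. by move=> a x y; rewrite !linearP scalerDr addrACA. Qed.

Fact hom_scale_linear (c : R) (f : linHom) : linear (fun x => c *: f x).
Proof.
by move=> a x y; rewrite linearP scalerDr !scalerA [c * a]mulrC.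
Qed.

Definition hom_zero : linHom := mkhom hom_zero_linear.
Definition hom_opp (f : linHom) : linHom := mkhom (hom_opp_linear f).
Definition hom_add (f g : linHom) : linHom := mkhom (hom_add_linear f g).
Definition hom_scale (c : R) (f : linHom) : linHom :=
  mkhom (hom_scale_linear c f).

Fact hom_addA : associative hom_add.
Proof. by move=> f g h; apply: homP => x; apply: addrA. Qed.
Fact hom_addC : commutative hom_add.
Proof. by move=> f g; apply: homP => x; apply: addrC. Qed.
Fact hom_add0 : left_id hom_zero hom_add.
Proof. by move=> f; apply: homP => x; apply: add0r. Qed.
Fact hom_addN : left_inverse hom_zero hom_opp hom_add.
Proof. by move=> f; apply: homP => x; apply: addNr. Qed.

HB.instance Definition _ :=
  GRing.isZmodule.Build linHom hom_addA hom_addC hom_add0 hom_addN.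

Fact hom_scaleA a b f : hom_scale a (hom_scale b f) = hom_scale (a * b) f.
Proof. by apply: homP => x; apply: scalerA. Qed.
Fact hom_scale1 : left_id 1 hom_scale.
Proof. by move=> f; apply: homP => x; apply: scale1r. Qed.
Fact hom_scaleDr : right_distributive hom_scale +%R.
Proof. by move=> a f g; apply: homP => x; apply: scalerDr. Qed.
Fact hom_scaleDl f : {morph hom_scale^~ f : a b / a + b}.
Proof. by move=> a b; apply: homP => x; apply: scalerDl. Qed.

HB.instance Definition _ := GRing.Zmodule_isLmodule.Build R linHom
  hom_scaleA hom_scale1 hom_scaleDr hom_scaleDl.

End HomModule.

(* [f] only serves to determine the scalar action. *)
Definition restr_mod (A B : comNzRingType) (f : {rmorphism A -> B})
  (V : lmodType B) : Type := V.

Section Restriction.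
Variables (A B : comNzRingType) (f : {rmorphism A -> B}).

Section Instances.
Variable V : lmodType B.
HB.instance Definition _ := GRing.Zmodule.copy (restr_mod f V) V.

Definition restr_scale (a : A) (v : restr_mod f V) : restr_mod f V :=
  f a *: (v : V).

Fact restr_scaleA a b v :
  restr_scale a (restr_scale b v) = restr_scale (a * b) v.
Proof. by rewrite /restr_scale scalerA rmorphM. Qed.
Fact restr_scale1 : left_id 1 restr_scale.
Proof. by move=> v; rewrite /restr_scale rmorph1 scale1r. Qed.
Fact restr_scaleDr : right_distributive restr_scale +%R.
Proof. by move=> a u v; apply: scalerDr. Qed.
Fact restr_scaleDl v : {morph restr_scale^~ v : a b / a + b}.
Proof. by move=> a b; rewrite /restr_scale rmorphD scalerDl. Qed.

HB.instance Definition _ := GRing.Zmodule_isLmodule.Build A (restr_mod f V)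
  restr_scaleA restr_scale1 restr_scaleDr restr_scaleDl.
End Instances.

Fact restr_map_linear (U V : lmodType B) (g : {linear U -> V}) :
  linear (g : restr_mod f U -> restr_mod f V).
Proof. by move=> a x y; rewrite /GRing.scale /= /restr_scale linearP. Qed.

Definition restr_map (U V : lmodType B) (g : {linear U -> V}) :
  {linear restr_mod f U -> restr_mod f V} := mkhom (restr_map_linear g).

End Restriction.

(* Unbounded complexes, graded homologically.  The differential is given for
   every pair of degrees and vanishes unless the degree drops by exactly one;
   this avoids transports along equalities of degrees. *)
Record complex (R : comNzRingType) := Complex {
  cobj :> int -> lmodType R;
  cdiff : forall i j, {linear cobj i -> cobj j};
  diff_shape : forall i j x, i <> j + 1 -> cdiff i j x = 0;
  diff_diff : forall i j l x, cdiff j l (cdiff i j x) = 0 }.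

Section Complexes.
Variable R : comNzRingType.
Implicit Types X Y P : complex R.

Record chain_map X Y := ChainMap {
  cmap :> forall i, {linear X i -> Y i};
  cmap_diff : forall i j x, cmap j (cdiff X i j x) = cdiff Y i j (cmap i x) }.

Definition is_cycle X (i : int) (x : X i) : Prop := cdiff X i (i - 1) x = 0.

Definition is_boundary X (i : int) (x : X i) : Prop :=
  exists y : X (i + 1), cdiff X (i + 1) i y = x.

Definition acyclic X : Prop := forall i (x : X i), is_cycle x -> is_boundary x.

Definition quasi_iso X Y (f : chain_map X Y) : Prop :=
  forall i,
    (forall x : X i, is_cycle x -> is_boundary (f i x) -> is_boundary x) /\
    (forall y : Y i, is_cycle y ->
      exists2 x : X i, is_cycle x & is_boundary (y - f i x)).

Definition null_homotopic X Y (f : chain_map X Y) : Prop :=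
  exists s : forall i j, {linear X i -> Y j},
  forall i x,
    f i x = cdiff Y (i + 1) i (s i (i + 1) x)
            + s (i - 1) i (cdiff X i (i - 1) x).

Definition K_projective P : Prop :=
  forall X (f : chain_map P X), acyclic X -> null_homotopic f.

Definition K_projective_resolution X P : Prop :=
  K_projective P /\ exists f : chain_map P X, quasi_iso f.

(* Every complex has a K-projective resolution, unique up to homotopy
   equivalence (Spaltenstein); one of them is chosen here, and the [else]
   branch is never taken. *)
Definition resolution X : complex R :=
  if pselect (exists P, K_projective_resolution X P) is left h
  then projT1 (cid h) else X.

Section Stalk.
Variable N : lmodType R.

Definition stalk_obj (i : int) : lmodType R := if i == 0 then N else 'rV[R]_0.
Definition stalk_diff i j : {linear stalk_obj i -> stalk_obj j} :=
  hom_zero (stalk_obj i) (stalk_obj j).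

Fact stalk_shape i j x : i <> j + 1 -> stalk_diff i j x = 0.
Proof. by []. Qed.
Fact stalk_dd i j l x : stalk_diff j l (stalk_diff i j x) = 0.
Proof. by []. Qed.

Definition stalk : complex R := Complex stalk_shape stalk_dd.
End Stalk.

Section Shift.
Variable X : complex R.

Definition shift_obj (i : int) : lmodType R := X (i - 1).
Definition shift_diff i j : {linear shift_obj i -> shift_obj j} :=
  hom_opp (cdiff X (i - 1) (j - 1)).

Fact shift_shape i j x : i <> j + 1 -> shift_diff i j x = 0.
Proof.
move=> ij; rewrite /shift_diff /= diff_shape ?oppr0 // => e; apply: ij.
by move/(congr1 (fun z => z + 1)): e; rewrite !subrK.
Qed.
Fact shift_dd i j l x : shift_diff j l (shift_diff i j x) = 0.
Proof. by rewrite /shift_diff /= linearN diff_diff !oppr0. Qed.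

Definition cshift : complex R := Complex shift_shape shift_dd.
End Shift.

Section DirectSum.
Variables X Y : complex R.

Definition dsum_obj (i : int) : lmodType R := (X i * Y i)%type.

Fact dsum_linear i j :
  linear ((fun p => (cdiff X i j p.1, cdiff Y i j p.2)) :
            dsum_obj i -> dsum_obj j).
Proof. by move=> a [x y] [x' y'] /=; rewrite !linearP. Qed.

Definition dsum_diff i j : {linear dsum_obj i -> dsum_obj j} :=
  mkhom (@dsum_linear i j).

Fact dsum_shape i j x : i <> j + 1 -> dsum_diff i j x = 0.
Proof. by move=> ij; rewrite /dsum_diff /= !diff_shape. Qed.
Fact dsum_dd i j l x : dsum_diff j l (dsum_diff i j x) = 0.
Proof. by rewrite /dsum_diff /= !diff_diff. Qed.

Definition dsum : complex R := Complex dsum_shape dsum_dd.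
End DirectSum.

Section Cone.
Variables (X Y : complex R) (f : chain_map X Y).

Definition cmap2 (i j : int) : {linear X i -> Y j} :=
  if pselect (i = j) is left e then ecast j {linear X i -> Y j} e (f i)
  else hom_zero (X i) (Y j).

Lemma cmap2_eq i : cmap2 i i = f i.
Proof.
by rewrite /cmap2; case: pselect => // e; rewrite (eq_axiomK e).
Qed.

Lemma cmap2_neq i j x : i <> j -> cmap2 i j x = 0.
Proof. by rewrite /cmap2; case: pselect. Qed.

Definition cone_obj (i : int) : lmodType R := (X (i - 1) * Y i)%type.

Fact cone_linear i j :
  linear ((fun p => (- cdiff X (i - 1) (j - 1) p.1,
                     cmap2 (i - 1) j p.1 + cdiff Y i j p.2)) :
            cone_obj i -> cone_obj j).
Proof.
move=> a [x y] [x' y']; apply: injective_projections => /=.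
  by rewrite linearP opprD scalerN.
by rewrite !linearP scalerDr addrACA.
Qed.

Definition cone_diff i j : {linear cone_obj i -> cone_obj j} :=
  mkhom (@cone_linear i j).

Fact cone_shape i j x : i <> j + 1 -> cone_diff i j x = 0.
Proof.
move=> ij; have ij' : i - 1 <> j by move=> e; apply: ij; rewrite -e subrK.
rewrite /cone_diff /= cmap2_neq // !diff_shape ?oppr0 ?addr0 //.
by move=> e; apply: ij'; rewrite e subrK.
Qed.

Fact cone_dd i j l x : cone_diff j l (cone_diff i j x) = 0.
Proof.
case: (pselect (i = j + 1)) => [ij|ij]; last first.
  by rewrite (cone_shape x ij) linear0.
case: (pselect (j = l + 1)) => [jl|jl]; last first.
  by rewrite cone_shape.
have e1 : i - 1 = j by rewrite ij addrK.
have e2 : j - 1 = l by rewrite jl addrK.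
rewrite /cone_diff /=; case: x => x y /=; move: x.
rewrite e1 e2 !cmap2_eq => x.
by rewrite !linearN linearD /= cmap_diff !diff_diff !oppr0 addr0 addNr.
Qed.

Definition mcone : complex R := Complex cone_shape cone_dd.
End Cone.

(* A strictly full subcategory of the derived category is a class of complexes
   stable under quasi-isomorphism, because an isomorphism there is a zigzag of
   quasi-isomorphisms; every exact triangle is isomorphic to the one of a cone
   of a chain map. *)
Record thick_class (T : complex R -> Prop) : Prop := Thick {
  thick_quasi_iso : forall X Y (f : chain_map X Y), quasi_iso f -> T X <-> T Y;
  thick_shift : forall X, T X <-> T (cshift X);
  thick_cone : forall X Y (f : chain_map X Y), T X -> T Y -> T (mcone f);
  thick_summand : forall X Y, T (dsum X Y) -> T X }.

Definition perfect X : Prop :=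
  forall T, thick_class T -> T (stalk R^o) -> T X.

Section HomComplex.
Variables (P : complex R) (N : lmodType R).

(* Hom(P, N) for a module N placed in degree 0.  The usual sign in the
   differential is omitted: it does not change the complex up to isomorphism. *)
Definition homc_obj (i : int) : lmodType R := linHom (P (- i)) N.

Fact homc_comp_linear i j (phi : homc_obj i) :
  linear (fun x : P (- j) => phi (cdiff P (- j) (- i) x)).
Proof. by move=> a x y; rewrite !linearP. Qed.

Fact homc_linear i j :
  linear ((fun phi => mkhom (@homc_comp_linear i j phi)) :
            homc_obj i -> homc_obj j).
Proof. by move=> a phi psi; apply: homP. Qed.

Definition homc_diff i j : {linear homc_obj i -> homc_obj j} :=
  mkhom (@homc_linear i j).

Fact homc_shape i j phi : i <> j + 1 -> homc_diff i j phi = 0.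
Proof.
move=> ij; apply: homP => x /=; rewrite diff_shape ?linear0 // => e.
by apply: ij; rewrite -[j]opprK e opprD opprK subrK.
Qed.

Fact homc_dd i j l phi : homc_diff j l (homc_diff i j phi) = 0.
Proof. by apply: homP => x /=; rewrite diff_diff linear0. Qed.

Definition homc : complex R := Complex homc_shape homc_dd.
End HomComplex.

Definition RHom X (N : lmodType R) : complex R := homc (resolution X) N.

End Complexes.

Section RestrictComplex.
Variables (A B : comNzRingType) (f : {rmorphism A -> B}) (X : complex B).

Definition restrc_obj (i : int) : lmodType A := restr_mod f (X i).
Definition restrc_diff i j : {linear restrc_obj i -> restrc_obj j} :=
  restr_map f (cdiff X i j).

Fact restrc_shape i j x : i <> j + 1 -> restrc_diff i j x = 0.
Proof. exact: diff_shape. Qed.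
Fact restrc_dd i j l x : restrc_diff j l (restrc_diff i j x) = 0.
Proof. exact: diff_diff. Qed.

Definition restrc : complex A := Complex restrc_shape restrc_dd.

Definition Db : Prop := perfect restrc.
End RestrictComplex.

Section Betti.
Variables (R : realType) (B : comNzRingType) (k : fieldType).
Variable (pi : {rmorphism B -> k}).

(* The rank over k of the homology in degree [n], for [pi] surjective and
   homology annihilated by the kernel of [pi]: k-linear combinations of
   homology classes are then B-linear combinations of representing cycles, a
   coefficient [b] in B standing for the scalar [pi b]. *)
Definition homology_rank (E : complex B) (n : int) : \bar R :=
  ereal_sup [set m%:R%:E | m in [set m : nat |
    exists z : 'I_m -> E n, (forall j, is_cycle (z j)) /\
      forall b : 'I_m -> B,
        is_boundary (\sum_j b j *: z j) -> forall j, pi (b j) = 0]].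

(* Ext^i(M, k) sits in homological degree -i of RHom(M, k). *)
Definition betti (M : complex B) (i : nat) : \bar R :=
  homology_rank (RHom M (restr_mod pi k^o)) (- i%:Z).

(* [size p = b] says that [p] has degree [b - 1], and that [p = 0] if [b = 0]. *)
Definition betti_poly_bounded (M : complex B) (b : nat) : Prop :=
  exists p : {poly R}, size p = b /\
    \forall i \near \oo, (betti M i <= (p.[i%:R])%:E)%E.

(* [None] stands for infinite complexity. *)
Definition cx (M : complex B) : option nat :=
  if pselect (exists b, `[< betti_poly_bounded M b >]) is left h
  then Some (ex_minn h) else None.

(* Meaningful when [cx M = Some n.+1], and 0 by convention otherwise. *)
Definition betti_deg (M : complex B) : \bar R :=
  if cx M is Some n.+1 then
    ((2 ^ n * n`!)%N%:R%:E *
       limn_esup (fun i : nat => betti M i * ((i%:R ^+ n)^-1)%:E))%E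
  else 0%E.

End Betti.

(* Main.v *)
Require Import Defs.
From HB Require Import structures.
From mathcomp Require Import all_boot all_order all_algebra.
From mathcomp Require Import all_classical all_reals.
From mathcomp Require Import ereal topology normedtype sequences.
From mathcomp Require Import zify lra.
Set Implicit Arguments.
Unset Strict Implicit.
Unset Printing Implicit Defensive.
Import Order.TTheory GRing.Theory Num.Theory.
Local Open Scope ring_scope.

(** Let [x_1 .. x_c] be the regular sequence.  A complex [M] of [D^b(B/A)] is represented, over [A], by
    a finite free complex [F] with square-zero anticommuting operators [e_l] such that
    [d e_l + e_l d = x_l]: cells are attached to kill homology, and the process is stopped by
    projecting a truncation onto its top cycles, which splits off because [M] has bounded projective
    dimension over [A].  Contracting one [x_l] at a time shows that over [B] the divided power complex
    on [F] is a free resolution of [M], and that the norm element [e_1 ... e_c] identifies the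
    divided power complex on the dual of [F] with a resolution of [M^*].

    Over the residue field [F] becomes a finite module [V] over an exterior algebra.  The Betti numbers
    of [M] are the ranks of the homology of the divided power complex on [V], and those of [M^*] are the
    ranks of the cohomology of the polynomial complex on [V].  A generic linear form in the polynomial
    variables, with coefficients in [k(u)], is injective on the cohomology of the polynomial complexes
    on [V] and on its dual in high degrees (graded noetherianity and McCoy's argument); dividing by it
    lowers [c] by one and replaces both sequences of ranks by their differences of step 2.  When these
    differences vanish eventually, multiplication by that form is bijective on the Tate complex, which
    links the two sequences, so that both are 2-periodic with the same values up to a shift.
    Hence on the residue classes mod 2 both sequences are polynomial, with the same pair of leading
    coefficients, possibly exchanged, and the upper limits agree. *)

(** * Equalities in abelian groups, by reflection *)

(** Division by a generic form determines each of the two sequences only up to constants of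
    summation, and nothing relates the constants of one to those of the other a priori. They reach
    the leading coefficients only when the differences vanish eventually; every other leading
    coefficient is inherited from the differences. Hence the Tate complex enters in the periodic
    case alone. The residue field may be finite, and then no form over it need be injective in high
    degrees; hence the extension of scalars. One transcendental is enough: with distinct powers of
    it as coefficients, the form is a polynomial whose coefficients are the variables themselves.
    This is the situation of McCoy's argument, which yields torsion under every variable at once. On
    an arbitrary resolution over [A] the homotopies for the [x_l] anticommute and square to zero
    only up to higher homotopies. Attaching whole exterior blocks of cells keeps the relations
    strict, and the projector that ends the process has a kernel stable under all operators.
    Strictness is what makes the fibre over the residue field a module over an exterior algebra. *)

Inductive zexp := ZVar of nat | ZZero | ZAdd of zexp & zexp | ZOpp of zexp.

Fixpoint zeval (V : zmodType) (env : seq V) (e : zexp) : V :=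
  match e with
  | ZVar n => env`_n
  | ZZero => 0
  | ZAdd a b => zeval env a + zeval env b
  | ZOpp a => - zeval env a
  end.

Fixpoint zadd (s t : seq int) : seq int :=
  match s, t with
  | [::], _ => t
  | _, [::] => s
  | a :: s', b :: t' => (a + b) :: zadd s' t'
  end.

Fixpoint znorm (e : zexp) : seq int :=
  match e with
  | ZVar n => ncons n 0 [:: 1]
  | ZZero => [::]
  | ZAdd a b => zadd (znorm a) (znorm b)
  | ZOpp a => map -%R (znorm a)
  end.

Fixpoint zcomb (V : zmodType) (env : seq V) (s : seq int) : V :=
  match s with
  | [::] => 0
  | a :: s' => head 0 env *~ a + zcomb (behead env) s'
  end.

Lemma zcombD (V : zmodType) (env : seq V) s t :
  zcomb env (zadd s t) = zcomb env s + zcomb env t.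
Proof.
elim: s t env => [|a s IH] [|b t] env /=; rewrite ?add0r ?addr0 //.
by rewrite IH mulrzDr addrACA.
Qed.

Lemma zcombN (V : zmodType) (env : seq V) s :
  zcomb env (map -%R s) = - zcomb env s.
Proof.
by elim: s env => [|a s IH] env /=; rewrite ?oppr0 // IH mulrNz opprD.
Qed.

Lemma zeval_norm (V : zmodType) (env : seq V) e :
  zeval env e = zcomb env (znorm e).
Proof.
elim: e => [n||a IHa b IHb|a IHa] //=; last 2 first.
- by rewrite zcombD IHa IHb.
- by rewrite zcombN IHa.
elim: n env => [|n IH] env /=; first by rewrite addr0 mulr1z; case: env.
by rewrite mulr0z add0r -IH; case: env => //=; rewrite nth_nil.
Qed.

Lemma zeval_eq (V : zmodType) (env : seq V) a b :
  all (pred1 0) (znorm (ZAdd a (ZOpp b))) -> zeval env a = zeval env b.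
Proof.
move=> ab; apply/eqP; rewrite -subr_eq0; apply/eqP.
rewrite -[LHS]/(zeval env (ZAdd a (ZOpp b))) zeval_norm.
elim: (znorm _) env ab => //= c s IH env /andP[/eqP-> sz].
by rewrite mulr0z add0r IH.
Qed.

Ltac zhead x := match x with ?f _ => zhead f | _ => constr:(x) end.

(* Atoms may differ by the path of a canonical instance, whence [unify]. *)
Ltac zsame x y :=
  first [constr_eq x y
        | let f := zhead x in let g := zhead y in constr_eq f g; unify x y].

Ltac zfind x env :=
  match env with
  | [::] => constr:(0%N)
  | ?y :: ?env' =>
      match goal with
      | _ => let _ := match goal with _ => zsame x y end in constr:(0%N)
      | _ => let n := zfind x env' in constr:(S n)
      end
  end.

Ltac zinsert x env :=
  let rec has e :=
    match e with
    | [::] => constr:(x :: env)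
    | ?y :: ?e' =>
        match goal with
        | _ => let _ := match goal with _ => zsame x y end in constr:(env)
        | _ => has e'
        end
    end in has env.

Ltac zatoms t env :=
  match t with
  | (?a + ?b)%R => let e := zatoms a env in zatoms b e
  | (- ?a)%R => zatoms a env
  | 0%R => constr:(env)
  | _ => zinsert t env
  end.

Ltac zreify t env :=
  match t with
  | (?a + ?b)%R =>
      let a' := zreify a env in let b' := zreify b env in constr:(ZAdd a' b')
  | (- ?a)%R => let a' := zreify a env in constr:(ZOpp a')
  | 0%R => constr:(ZZero)
  | _ => let n := zfind t env in constr:(ZVar n)
  end.

Ltac abel :=
  match goal with
  | |- @eq ?T ?a ?b =>
      let env0 := constr:(@nil T) in
      let env1 := zatoms a env0 in
      let env := zatoms b env1 in
      let a' := zreify a env in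
      let b' := zreify b env in
      apply: (@zeval_eq _ env a' b'); vm_compute; reflexivity
  end.

(** * Contraction of one Koszul homotopy against one new variable *)

Section OneVariable.
Variables (N : zmodType) (D E X : {additive N -> N}).
Variables (Q Qx : N -> Prop) (h : int -> N -> Prop) (sD : int) (lo : int).
Hypothesis Q0 : Q 0.
Hypothesis QB : forall a b, Q a -> Q b -> Q (a - b).
Hypothesis DQ : forall a, Q a -> Q (D a).
Hypothesis EQ : forall a, Q a -> Q (E a).
Hypothesis XQ : forall a, Q (X a) -> Q a.
Hypothesis h0 : forall i, h i 0.
Hypothesis hB : forall i a b, h i a -> h i b -> h i (a - b).
Hypothesis hD : forall i a, h i a -> h (i + sD) (D a).
Hypothesis hE : forall i a, h i a -> h (i - sD) (E a).
Hypothesis hlo : forall i a, h i a -> i < lo -> a = 0.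
Hypothesis QxE : forall i a, h i a -> Qx a -> exists2 z, h i z & Q (a - X z).
Hypothesis QxI : forall a z, Q (a - X z) -> Qx a.
Hypothesis QxB : forall a b, Qx a -> Qx b -> Qx (a - b).
Hypothesis DD : forall a, Q (D (D a)).
Hypothesis EE : forall a, E (E a) = 0.
Hypothesis DE : forall a, D (E a) + E (D a) = X a.
Hypothesis DX : forall a, D (X a) = X (D a).
Hypothesis EX : forall a, E (X a) = X (E a).

Lemma QN a : Q a -> Q (- a).
Proof. by move=> Qa; rewrite -sub0r; apply: QB. Qed.

Lemma QD a b : Q a -> Q b -> Q (a + b).
Proof. by move=> Qa Qb; rewrite -[b]opprK; apply/QB/QN. Qed.

Lemma hN i a : h i a -> h i (- a).
Proof. by move=> ha; rewrite -sub0r; apply: hB. Qed.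

Lemma hDr i a b : h i a -> h i b -> h i (a + b).
Proof. by move=> ha hb; rewrite -[b]opprK; apply/hB/hN. Qed.

Lemma Qx_of a : Q a -> Qx a.
Proof. by move=> Qa; apply: (@QxI _ 0); rewrite raddf0 subr0. Qed.

Lemma QxX a : Qx (X a).
Proof. by apply: (@QxI _ a); rewrite subrr. Qed.

Lemma QxN a : Qx a -> Qx (- a).
Proof. by move=> Qa; rewrite -sub0r; apply: QxB => //; apply: Qx_of. Qed.

Lemma QxD a b : Qx a -> Qx b -> Qx (a + b).
Proof. by move=> Qa Qb; rewrite -[b]opprK; apply/QxB/QxN. Qed.

(** The variable has degree 2. Together with the lower bound [lo] this makes every homogeneous
    sequence finitely supported, so that inductions on the length are available although sequences
    are arbitrary functions. *)
Definition hseq (i : int) (g : nat -> N) := forall n, h (i - (2 * n)%N%:Z) (g n).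

Lemma hseq_fin i g : hseq i g -> exists m, forall n, (m < n)%N -> g n = 0.
Proof.
move=> hg; exists `|i - lo|%N => n mn; apply: (hlo (hg n)).
by move: mn; lia.
Qed.

(* If [Da + Eb = X z'] and [Db = X z] modulo [Q], the homotopy [E] shows that
   [b] is [D z' + E z]. *)
Lemma homotopy_step a b z z' :
  Q (D a) -> Q (D b - X z) -> Q (a + E b - X z') -> Q (b - (D z' + E z)).
Proof.
move=> Qa Qb Qab; apply: XQ.
have -> : X (b - (D z' + E z)) = E (D b - X z) + (D (a + E b - X z') - D a).
  by rewrite !(raddfB, raddfD) /= DX EX -(DE b); abel.
by apply: QD; [apply: EQ | apply: QB => //; apply: DQ].
Qed.

Lemma QD_of_QX b z : Q (D b - X z) -> Q (D z).
Proof.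
move=> Qb; apply: XQ; have -> : X (D z) = D (D b) - D (D b - X z).
  by rewrite raddfB /= DX; abel.
by apply: QB; [apply: DD | apply: DQ].
Qed.

Lemma QE_of_QX b z : Q (E b - X z) -> Q (E z).
Proof.
move=> Qb; apply: XQ; have -> : X (E z) = - E (E b - X z).
  by rewrite raddfB /= EE EX; abel.
by apply: QN; apply: EQ.
Qed.

(** The divided power differential in one variable. Here [Q] stands for the multiples of the earlier
    elements of the regular sequence, and [Qx] adds those of the current one. The square of [dgam]
    is [X] composed with the shift, modulo [Q], so it is a differential only modulo [Qx]; the same
    holds for the polynomial version [dw]. *)
Definition dgam (g : nat -> N) n := D (g n) + E (g n.+1).

Definition dw (w : nat -> N) n := D (w n) + (if n is n'.+1 then E (w n') else 0).

Definition two_at m (a b : N) n := if n == m then a else if n == m.+1 then b else 0.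

Lemma h_cast i j a : h i a -> i = j -> h j a.
Proof. by move=> ha <-. Qed.

Lemma hseq_two i m a b : h (i - (2 * m)%N%:Z) a -> h (i - (2 * m)%N%:Z - 2%:Z) b ->
  hseq i (two_at m a b).
Proof.
move=> ha hb n; rewrite /two_at; case: eqP => [->//|_]; case: eqP => [->|_] //.
by apply: (h_cast hb); lia.
Qed.

Section Gamma.
Hypothesis sDN : sD = -1.

Lemma dgam_dgam g n : Qx (dgam (dgam g) n).
Proof.
rewrite /dgam; have -> : D (D (g n) + E (g n.+1)) + E (D (g n.+1) + E (g n.+2)) =
   D (D (g n)) + X (g n.+1).
  by rewrite !raddfD /= EE -(DE (g n.+1)); abel.
by apply: QxD; [apply/Qx_of/DD | apply: QxX].
Qed.

Lemma dgamQ q : (forall n, Q (q n)) -> forall n, Qx (dgam q n).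
Proof. by move=> Qq n; apply/Qx_of/QD; [apply: DQ | apply: EQ]. Qed.

Lemma hseq_dgam i g : hseq i g -> hseq (i - 1) (dgam g).
Proof.
move=> hg n; apply: hDr; first by apply: (h_cast (hD (hg n))); rewrite sDN; lia.
by apply: (h_cast (hE (hg n.+1))); rewrite sDN; lia.
Qed.

(** The two highest cycle conditions provide [z] and [z'], and [homotopy_step] identifies the top
    coefficient with [D z' + E z]. This is the value at [m.+1] of the differential of a sequence
    living in the exponents [m.+1] and [m.+2], so the top coefficient can be subtracted. *)
Lemma gamma_reduce i g m : hseq i g -> (forall n, (m.+1 < n)%N -> g n = 0) ->
  Qx (dgam g m.+1) -> Qx (dgam g m) ->
  exists p g', [/\ hseq (i + 1) p, hseq i g', forall n, (m < n)%N -> g' n = 0 &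
     forall n, Q (g n - g' n - dgam p n)].
Proof.
move=> hg gm c1 c0.
have h1 : h (i - 1 - (2 * m.+1)%N%:Z) (dgam g m.+1) by apply: hseq_dgam.
have h2 : h (i - 1 - (2 * m)%N%:Z) (dgam g m) by apply: hseq_dgam.
have [z hz Qz] := QxE h1 c1; have [z' hz' Qz'] := QxE h2 c0.
move: Qz; rewrite {1}/dgam [g m.+2]gm // raddf0 addr0 => Qz.
have Qst := homotopy_step (DD (g m)) Qz Qz'.
have hp : hseq (i + 1) (two_at m.+1 z' z).
  by apply: hseq_two; [apply: (h_cast hz') | apply: (h_cast hz)]; lia.
exists (two_at m.+1 z' z), (fun n => if (n <= m)%N then g n - dgam (two_at m.+1 z' z) n else 0).
split=> //.
- move=> n; case: ifP => _ //; apply: hB => //.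
  by apply: (h_cast (hseq_dgam hp n)); lia.
- by move=> n; rewrite ltnNge => /negbTE->.
- move=> n; case: leqP => mn.
    by rewrite opprB addrCA subrr addr0 subrr.
  rewrite subr0 /dgam /two_at.
  case: (n =P m.+1) => [->|nm].
    have -> : (m.+2 == m.+1) = false by lia.
    by rewrite eqxx.
  rewrite gm; last by lia.
  case: (n =P m.+2) => [->|nm'].
    have -> : (m.+3 == m.+1) = false by lia.
    have -> : (m.+3 == m.+2) = false by lia.
    rewrite /= raddf0 addr0 sub0r. by apply/QN/(QD_of_QX Qz).
  have -> : (n.+1 == m.+1) = false by lia.
  have -> : (n.+1 == m.+2) = false by lia.
  by rewrite !raddf0 addr0 subrr.
Qed.

(** Repeated shortening leaves a single coefficient [g 0], with [D (g 0)] equal to [X z] modulo [Q];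
    the correction [E z] turns it into a cycle modulo [Q]. Classes over the smaller quotient ring
    therefore come from exponent 0 over the larger one. *)
Lemma gamma_cycle i g : hseq i g -> (forall n, Qx (dgam g n)) ->
  exists v p, [/\ h i v, Q (D v), hseq (i + 1) p &
    forall n, Qx ((if n is 0 then g 0%N - v else g n) - dgam p n)].
Proof.
move=> hg cg.
have [m hm] := hseq_fin hg.
elim: m g hg cg hm => [|m IH] g hg cg gm.
  have g1 n : g n.+1 = 0 by apply: gm.
  have := cg 0%N; rewrite /dgam g1 raddf0 addr0 => Qg.
  have hg0 : h i (g 0%N) by have := hg 0%N; rewrite subr0.
  have [z hz Qz] := QxE (hD hg0) Qg.
  exists (g 0%N - E z), (two_at 1 z 0); split.
  - by apply: hB => //; have := hE hz; rewrite addrK.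
  - rewrite raddfB /=; have -> : D (g 0%N) - D (E z) = (D (g 0%N) - X z) + E (D z).
      by rewrite -(DE z); abel.
    by apply: QD => //; apply: EQ; apply: QD_of_QX Qz.
  - by apply: hseq_two => //; apply: (h_cast hz); rewrite sDN; lia.
  - move=> [|[|n]]; rewrite /dgam /two_at /= ?if_same ?g1 ?raddf0 ?raddf0 ?addr0 ?add0r ?sub0r ?oppr0 ?subr0.
    + have -> : g 0%N - (g 0%N - E z) - E z = 0 by abel. by apply: Qx_of.
    + by apply/QxN/Qx_of/(QD_of_QX Qz).
    + by apply/Qx_of/Q0.
have [p [g' [hp hg' gm' Qg']]] := gamma_reduce hg gm (cg _) (cg _).
have cg' n : Qx (dgam g' n).
  have -> : dgam g' n = dgam g n - dgam (dgam p) n -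
      dgam (fun n => g n - g' n - dgam p n) n.
    by rewrite /dgam !(raddfB, raddfD) /=; abel.
  by apply: QxB; [apply: QxB => //; apply: dgam_dgam | apply: dgamQ].
have [v [p' [hv Qv hp' Qp']]] := IH _ hg' cg' gm'.
exists v, (fun n => p n + p' n); split=> //.
  by move=> n; apply: hDr.
move=> n; set a := (X in Qx X).
have -> : a = (if n is 0 then g' 0%N - v else g' n) - dgam p' n
    + (g n - g' n - dgam p n).
  by rewrite {}/a /dgam !raddfD; case: n => [|n] /=; abel.
by apply: QxD => //; apply: Qx_of.
Qed.

End Gamma.

Section W.
Hypothesis sDP : sD = 1.

Lemma dw_dw g n : Qx (dw (dw g) n).
Proof.
case: n => [|n]; rewrite /dw; first by rewrite !addr0; apply/Qx_of/DD.
have -> : D (D (g n.+1) + E (g n)) + E (D (g n) + (if n is n'.+1 then E (g n') else 0))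
   = D (D (g n.+1)) + X (g n).
  by case: n => [|n]; rewrite !raddfD ?raddf0 /= ?EE -?(DE (g n)) -?(DE (g n.+1)) -?(DE (g 0%N)); abel.
by apply: QxD; [apply/Qx_of/DD | apply: QxX].
Qed.

Lemma dwB g g' n : dw (fun n => g n - g' n) n = dw g n - dw g' n.
Proof. by case: n => [|n]; rewrite /dw !raddfB /=; abel. Qed.

Lemma dwQ q : (forall n, Q (q n)) -> forall n, Qx (dw q n).
Proof.
by move=> Qq n; apply/Qx_of/QD; [apply: DQ | case: n => // n; apply: EQ].
Qed.

Lemma hseq_dw i g : hseq i g -> hseq (i + 1) (dw g).
Proof.
move=> hg n; apply: hDr; first by apply: (h_cast (hD (hg n))); rewrite sDP; lia.
by case: n => // n; apply: (h_cast (hE (hg n))); rewrite sDP; lia.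
Qed.

Lemma w_reduce i g m : hseq i g -> (forall n, (m.+1 < n)%N -> g n = 0) ->
  Qx (dw g m.+2) -> Qx (dw g m.+1) ->
  exists p g', [/\ hseq (i - 1) p, hseq i g', forall n, (m < n)%N -> g' n = 0 &
     forall n, Q (g n - g' n - dw p n)].
Proof.
move=> hg gm c1 c0.
have h1 : h (i + 1 - (2 * m.+2)%N%:Z) (dw g m.+2) by apply: hseq_dw.
have h2 : h (i + 1 - (2 * m.+1)%N%:Z) (dw g m.+1) by apply: hseq_dw.
have [z hz Qz] := QxE h1 c1; have [z' hz' Qz'] := QxE h2 c0.
move: Qz Qz'; rewrite /dw [g m.+2]gm // raddf0 add0r => Qz Qz'.
have Qst : Q (g m.+1 - (D z + E z')).
  apply: XQ; have -> : X (g m.+1 - (D z + E z')) =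
     D (E (g m.+1) - X z) + E (D (g m.+1) + E (g m) - X z').
    by rewrite !(raddfB, raddfD) /= EE DX EX -(DE (g m.+1)); abel.
  by apply: QD; [apply: DQ | apply: EQ].
have hp : hseq (i - 1) (two_at m z' z).
  by apply: hseq_two; [apply: (h_cast hz') | apply: (h_cast hz)]; lia.
exists (two_at m z' z), (fun n => if (n <= m)%N then g n - dw (two_at m z' z) n else 0).
split=> //.
- move=> n; case: ifP => _ //; apply: hB => //.
  by apply: (h_cast (hseq_dw hp n)); lia.
- by move=> n; rewrite ltnNge => /negbTE->.
- move=> n; case: leqP => mn.
    by rewrite opprB addrCA subrr addr0 subrr.
  rewrite subr0; case: n mn => // n mn; rewrite /dw /two_at.
  case: (n =P m) => [->|nm].
    have -> : (m.+1 == m) = false by lia.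
    by rewrite eqxx.
  rewrite gm; last by lia.
  have -> : (n.+1 == m) = false by lia.
  have -> : (n.+1 == m.+1) = false by lia.
  case: (n =P m.+1) => _.
    by rewrite raddf0 sub0r add0r; apply/QN/(QE_of_QX Qz).
  by rewrite !raddf0 addr0 subr0.
Qed.

(** Here the surviving coefficient is [E y] for a cycle [y] one degree higher: when only [g 0] is
    left, both [D (g 0)] and [E (g 0)] are multiples of [X], and the homotopy writes [g 0] as
    [D z + E z']. Iterated over all variables, the factors [E] build up the norm element. *)
Lemma w_cycle i g : hseq i g -> (forall n, Qx (dw g n)) ->
  exists y p, [/\ h (i + 1) y, Q (D y), hseq (i - 1) p &
    forall n, Qx ((if n is 0 then g 0%N - E y else g n) - dw p n)].
Proof.
move=> hg cg.
have [m hm] := hseq_fin hg.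
elim: m g hg cg hm => [|m IH] g hg cg gm.
  have h1 : h (i + 1 - (2 * 1)%N%:Z) (dw g 1%N) by apply: hseq_dw.
  have h2 : h (i + 1 - (2 * 0)%N%:Z) (dw g 0%N) by apply: hseq_dw.
  have [z hz Qz] := QxE h1 (cg 1%N); have [z' hz' Qz'] := QxE h2 (cg 0%N).
  move: Qz Qz'; rewrite /dw [g 1%N]gm // raddf0 add0r addr0 => Qz Qz'.
  have Qst : Q (g 0%N - (D z + E z')).
    apply: XQ; have -> : X (g 0%N - (D z + E z')) =
       D (E (g 0%N) - X z) + E (D (g 0%N) - X z').
      by rewrite !(raddfB, raddfD) /= DX EX -(DE (g 0%N)); abel.
    by apply: QD; [apply: DQ | apply: EQ].
  have g1 n : g n.+1 = 0 by apply: gm.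
  exists z', (two_at 0 z 0); split.
  - by apply: (h_cast hz'); lia.
  - exact: QD_of_QX Qz'.
  - by apply: hseq_two => //; apply: (h_cast hz); lia.
  - move=> [|[|n]]; rewrite /dw /two_at /= ?if_same ?g1 ?raddf0 ?raddf0 ?addr0 ?add0r ?sub0r ?oppr0 ?subr0.
    + by apply: Qx_of; move: Qst; congr Q; abel.
    + by apply/QxN/Qx_of/(QE_of_QX Qz).
    + by apply/Qx_of/Q0.
have [p [g' [hp hg' gm' Qg']]] := w_reduce hg gm (cg _) (cg _).
have cg' n : Qx (dw g' n).
  have -> : dw g' n = dw g n - dw (dw p) n -
      dw (fun n => g n - g' n - dw p n) n.
    by rewrite !dwB; abel.
  by apply: QxB; [apply: QxB => //; apply: dw_dw | apply: dwQ].
have [v [p' [hv Qv hp' Qp']]] := IH _ hg' cg' gm'.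
exists v, (fun n => p n + p' n); split=> //.
  by move=> n; apply: hDr.
move=> n; set a := (X in Qx X).
have -> : a = (if n is 0 then g' 0%N - E v else g' n) - dw p' n
    + (g n - g' n - dw p n).
  by rewrite {}/a /dw !raddfD; case: n => [|n] /=; rewrite ?raddfD /=; abel.
by apply: QxD => //; apply: Qx_of.
Qed.

(** Injectivity of the correspondence in [w_cycle]. Once [p] is reduced to one coefficient,
    [E (y - D z')] is seen to lie in [Q]; then [X (y - D z')] lies in [Q] by the homotopy formula,
    and [X] is cancelled. *)
Lemma w_boundary i y p : h (i + 1) y -> Q (D y) -> hseq (i - 1) p ->
  (forall n, Qx ((if n is 0 then E y else 0) - dw p n)) ->
  exists2 p', h i p' & Q (y - D p').
Proof.
move=> hy Qy hp cp.
have [m hm] := hseq_fin hp.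
elim: m p hp cp hm => [|m IH] p hp cp pm; last first.
  have [p0 [p' [hp0 hp' pm' Qp']]] : exists p0 p', [/\ hseq (i - 1 - 1) p0,
      hseq (i - 1) p', forall n, (m < n)%N -> p' n = 0 &
      forall n, Q (p n - p' n - dw p0 n)].
    by apply: w_reduce => //; [have := cp m.+2 | have := cp m.+1];
      rewrite sub0r => /QxN; rewrite opprK.
  apply: (IH p') => // n.
  have -> : dw p' n = dw p n - dw (dw p0) n -
      dw (fun n => p n - p' n - dw p0 n) n.
    by rewrite !dwB; abel.
  set a := (if n is 0 then _ else _).
  have -> : a - (dw p n - dw (dw p0) n - dw (fun n => p n - p' n - dw p0 n) n) =
    a - dw p n + dw (dw p0) n + dw (fun n => p n - p' n - dw p0 n) n by abel.
  apply: QxD; last exact: dwQ.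
  by apply: QxD; [apply: cp | apply: dw_dw].
have h1 : h (i - 1 + 1 - (2 * 1)%N%:Z) (dw p 1%N) by apply: hseq_dw.
have h2 : h i (E y - dw p 0%N).
  apply: hB; first by apply: (h_cast (hE hy)); rewrite sDP; lia.
  by apply: (h_cast (hseq_dw hp 0%N)); lia.
have c1 : Qx (dw p 1%N).
  by have /QxN := cp 1%N; rewrite sub0r opprK.
have [z hz Qz] := QxE h1 c1; have [z' hz' Qz'] := QxE h2 (cp 0%N).
move: Qz Qz'; rewrite /dw [p 1%N]pm // raddf0 add0r addr0 => Qz Qz'.
exists z' => //.
have Qp0 : Q (p 0%N - (D z - E z')).
  apply: XQ; have -> : X (p 0%N - (D z - E z')) =
     D (E (p 0%N) - X z) - E (E y - D (p 0%N) - X z').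
    by rewrite !(raddfB, raddfD) /= EE DX EX -(DE (p 0%N)); abel.
  by apply: QB; [apply: DQ | apply: EQ].
have Dyz : Q (D (y - D z')) by rewrite raddfB /=; apply: QB => //; apply: DD.
apply: XQ; rewrite -DE; apply: QD; last exact: EQ.
apply: DQ.
have -> : E (y - D z') = (E y - D (p 0%N) - X z') + D (p 0%N - (D z - E z')) + D (D z).
  by rewrite !(raddfB, raddfD) /= -(DE z'); abel.
by apply: QD; [apply: QD => //; apply: DQ | apply: DD].
Qed.
End W.

End OneVariable.

(** * Polynomial functions with values in row vectors *)

Section VV.
Variables (R : comNzRingType) (N : nat).

(* Families of vectors indexed by the monomials in [r] variables, the last
   variable being the outermost argument. *)
Fixpoint VV (r : nat) : lmodType R :=
  if r is r'.+1 then (nat -> VV r' : lmodType R) else 'rV[R]_N.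

Section Lift.
Variables (U V : lmodType R).

Fact lift_linear (p : {linear U -> V}) :
  linear ((fun g n => p (g n)) : (nat -> U) -> (nat -> V)).
Proof. by move=> a x y; apply/funext => n; exact: (linearP p a (x n) (y n)). Qed.

Definition lift (p : {linear U -> V}) : {linear (nat -> U) -> (nat -> V)} :=
  mkhom (lift_linear p).

Fact dgam_linear (p q : {linear U -> U}) : linear (dgam p q).
Proof.
move=> a x y; apply/funext => n.
change (p (a *: x n + y n) + q (a *: x n.+1 + y n.+1) =
  a *: (p (x n) + q (x n.+1)) + (p (y n) + q (y n.+1))).
by rewrite !linearP scalerDr addrACA.
Qed.

Fact dw_linear (p q : {linear U -> U}) : linear (dw p q).
Proof.
move=> a x y; apply/funext => -[|n].
  change (p (a *: x 0%N + y 0%N) + 0 = a *: (p (x 0%N) + 0) + (p (y 0%N) + 0)).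
  by rewrite !addr0 linearP.
change (p (a *: x n.+1 + y n.+1) + q (a *: x n + y n) =
  a *: (p (x n.+1) + q (x n)) + (p (y n.+1) + q (y n))).
by rewrite !linearP scalerDr addrACA.
Qed.

Definition dgamL (p q : {linear U -> U}) : {linear (nat -> U) -> (nat -> U)} :=
  mkhom (dgam_linear p q).

Definition dwL (p q : {linear U -> U}) : {linear (nat -> U) -> (nat -> U)} :=
  mkhom (dw_linear p q).

Fact cst0_linear : linear ((fun x n => if n is 0 then x else 0) : U -> (nat -> U)).
Proof.
by move=> a x y; apply/funext => -[|n] //=; rewrite -[RHS]/(a *: 0 + 0) scaler0 addr0.
Qed.

Definition cst0 : {linear U -> (nat -> U)} := mkhom cst0_linear.

End Lift.

Fixpoint act (M : 'M[R]_N) r : {linear VV r -> VV r} :=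
  if r is r'.+1 then lift (act M r') else mulmxr M : {linear 'rV_N -> 'rV_N}.

Lemma actM M M' r g : act M' r (act M r g) = act (M *m M') r g.
Proof.
elim: r g => [|r IH] g /=; first by rewrite mulmxA.
by apply/funext => n /=; apply: IH.
Qed.

Lemma actDl M M' r g : act (M + M') r g = act M r g + act M' r g.
Proof.
elim: r g => [|r IH] g /=; first by rewrite mulmxDr.
by apply/funext => n /=; apply: IH.
Qed.

Lemma act0l r g : act 0 r g = 0.
Proof.
elim: r g => [|r IH] g /=; first by rewrite mulmx0.
by apply/funext => n /=; apply: IH.
Qed.

Lemma actZl a M r g : act (a *: M) r g = a *: act M r g.
Proof.
elim: r g => [|r IH] g /=; first by rewrite -scalemxAr.
by apply/funext => n /=; apply: IH.
Qed.

Lemma act_scalar a r g : act a%:M r g = a *: g.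
Proof.
elim: r g => [|r IH] g /=; first by rewrite mul_mx_scalar.
by apply/funext => n /=; apply: IH.
Qed.

Variables (d : 'M[R]_N) (e : nat -> 'M[R]_N).

(* [DG] is the differential of the divided power complex, in which the variables act by lowering
   exponents, and [DW] that of the polynomial complex, in which they raise them. *)
Fixpoint DG r : {linear VV r -> VV r} :=
  if r is r'.+1 then dgamL (DG r') (act (e r') r') else act d 0.

Fixpoint DW r : {linear VV r -> VV r} :=
  if r is r'.+1 then dwL (DW r') (act (e r') r') else act d 0.

Lemma DG_act (M : 'M[R]_N) (a : R) r g :
  (forall l, (l < r)%N -> e l *m M + M *m e l = 0) -> d *m M + M *m d = a%:M ->
  DG r (act M r g) + act M r (DG r g) = a *: g.
Proof.
move=> eM dM; elim: r eM g => [|r IH] eM g /=.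
  by rewrite -!mulmxA -mulmxDr addrC dM mul_mx_scalar.
apply/funext => n /=; rewrite /dgam.
rewrite -[RHS]/(a *: g n) -(IH _ (g n)); last by move=> l lr; apply: eM; lia.
have E0 : act (e r) r (act M r (g n.+1)) = - act M r (act (e r) r (g n.+1)).
  by apply/eqP; rewrite -addr_eq0 !actM -actDl addrC eM // act0l.
rewrite -[(_ + _) n]/(_ n + _ n) /= E0 linearD /=; abel.
Qed.

Lemma DW_act (M : 'M[R]_N) (a : R) r g :
  (forall l, (l < r)%N -> e l *m M + M *m e l = 0) -> d *m M + M *m d = a%:M ->
  DW r (act M r g) + act M r (DW r g) = a *: g.
Proof.
move=> eM dM; elim: r eM g => [|r IH] eM g /=.
  by rewrite -!mulmxA -mulmxDr addrC dM mul_mx_scalar.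
apply/funext => n /=; rewrite /dw.
rewrite -[RHS]/(a *: g n) -(IH _ (g n)); last by move=> l lr; apply: eM; lia.
rewrite -[(_ + _) n]/(_ n + _ n) /=.
case: n => [|n]; first by rewrite !addr0.
have E0 : act (e r) r (act M r (g n)) = - act M r (act (e r) r (g n)).
  by apply/eqP; rewrite -addr_eq0 !actM -actDl addrC eM // act0l.
rewrite E0 linearD /=; abel.
Qed.

Section Graded.
Variable wt : 'I_N -> int.

Fixpoint hm r (i : int) : VV r -> Prop :=
  if r is r'.+1 then fun g => forall n, hm (i - (2 * n)%N%:Z) (g n)
  else fun v => forall b, wt b <> i -> (v : 'rV[R]_N) 0 b = 0.

Lemma hm0 r i : hm i (0 : VV r).
Proof.
elim: r i => [|r IH] i /=; first by move=> b _; rewrite mxE.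
by move=> n; apply: IH.
Qed.

Lemma hmD r i (g g' : VV r) : hm i g -> hm i g' -> hm i (g + g').
Proof.
elim: r i g g' => [|r IH] i g g' /= hg hg'.
  by move=> b wb; rewrite mxE hg // hg' // addr0.
by move=> n; apply: IH.
Qed.

Lemma hmZ r i a (g : VV r) : hm i g -> hm i (a *: g).
Proof.
elim: r i g => [|r IH] i g /= hg.
  by move=> b wb; rewrite mxE hg // mulr0.
by move=> n; apply: IH.
Qed.

Lemma hmN r i (g : VV r) : hm i g -> hm i (- g).
Proof. by rewrite -scaleN1r; apply: hmZ. Qed.

Lemma hmB r i (g g' : VV r) : hm i g -> hm i g' -> hm i (g - g').
Proof. by move=> hg hg'; apply/hmD/hmN. Qed.

Lemma hm_sum r i I (s : seq I) (P : pred I) (g : I -> VV r) :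
  (forall j, P j -> hm i (g j)) -> hm i (\sum_(j <- s | P j) g j).
Proof. by move=> hg; elim/big_ind: _ => //; [apply: hm0 | apply: hmD]. Qed.

(** A crude lower bound for all weights; unlike a minimum it makes sense for [N = 0] too. *)
Definition wt_lo : int := - (\sum_b `|wt b|%N)%N%:Z.

Lemma hm_lo r i (g : VV r) : hm i g -> i < wt_lo -> g = 0.
Proof.
elim: r i g => [|r IH] i g /= hg ilo.
  apply/rowP => b; rewrite mxE hg // => wb; move: ilo; rewrite -wb /wt_lo.
  by rewrite (bigD1 b) //=; lia.
by apply/funext => n; apply: IH (hg n) _; apply: le_lt_trans ilo; lia.
Qed.

Definition mx_deg (s : int) (M : 'M[R]_N) :=
  forall b b', wt b' <> wt b + s -> M b b' = 0.

Lemma hm_act s M r i (g : VV r) : mx_deg s M -> hm i g -> hm (i + s) (act M r g).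
Proof.
move=> hM; elim: r i g => [|r IH] i g /= hg.
  move=> b wb; rewrite mxE big1 // => b' _.
  case: (pselect (wt b' = i)) => [wb'|wb']; last by rewrite hg // mul0r.
  by rewrite hM ?mulr0 // wb'.
by move=> n; have := IH _ _ (hg n); congr hm; lia.
Qed.

Lemma hm_DG r i (g : VV r) : mx_deg (-1) d -> (forall l, (l < r)%N -> mx_deg 1 (e l)) ->
  hm i g -> hm (i - 1) (DG r g).
Proof.
move=> hd; elim: r i g => [|r IH] i g he hg; first exact: (@hm_act _ _ 0).
move=> n; apply: hmD.
  have := IH _ _ (fun l lr => he l (ltnW lr)) (hg n); congr hm; lia.
have := hm_act (he r (ltnSn r)) (hg n.+1); congr hm; lia.
Qed.

Lemma hm_DW r i (g : VV r) : mx_deg 1 d -> (forall l, (l < r)%N -> mx_deg (-1) (e l)) ->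
  hm i g -> hm (i + 1) (DW r g).
Proof.
move=> hd; elim: r i g => [|r IH] i g he hg; first exact: (@hm_act _ _ 0).
move=> n; apply: hmD.
  have := IH _ _ (fun l lr => he l (ltnW lr)) (hg n); congr hm; lia.
case: n => [|n]; first exact: hm0.
have := hm_act (he r (ltnSn r)) (hg n); congr hm; lia.
Qed.

Lemma hm_cst0 r i (g : VV r) : hm i g -> hm i (cst0 (VV r) g : VV r.+1).
Proof. by move=> hg [|n] /=; [rewrite subr0 | apply: hm0]. Qed.

End Graded.

Fixpoint ent r : VV r -> seq nat -> 'I_N -> R :=
  if r is r'.+1 then fun g a b => if a is n :: a' then ent (g n) a' b else 0
  else fun v _ b => (v : 'rV[R]_N) 0 b.

Lemma entD r (g g' : VV r) a b : ent (g + g') a b = ent g a b + ent g' a b.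
Proof.
elim: r g g' a => [|r IH] g g' a /=; first by rewrite mxE.
by case: a => [|n a]; [rewrite addr0 | apply: IH].
Qed.

Lemma entZ r c (g : VV r) a b : ent (c *: g) a b = c * ent g a b.
Proof.
elim: r g a => [|r IH] g a /=; first by rewrite mxE.
by case: a => [|n a]; [rewrite mulr0 | apply: IH].
Qed.

Lemma ent0 r a b : ent (0 : VV r) a b = 0.
Proof. by rewrite -(scale0r 0) entZ mul0r. Qed.

Lemma ent_sum r I (s : seq I) (P : pred I) (g : I -> VV r) a b :
  ent (\sum_(j <- s | P j) g j) a b = \sum_(j <- s | P j) ent (g j) a b.
Proof.
by elim/big_rec2: _ => [|j x y _ <-]; [apply: ent0 | rewrite entD].
Qed.

Lemma ent_ext r (g g' : VV r) :
  (forall a b, size a = r -> ent g a b = ent g' a b) -> g = g'.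
Proof.
elim: r g g' => [|r IH] g g' /= gg'.
  by apply/rowP => b; apply: (gg' [::]).
by apply/funext => n; apply: IH => a b sa; apply: (gg' (n :: a)); rewrite /= sa.
Qed.

Lemma hm_ent wt r i (g : VV r) : hm wt i g <->
  forall a b, size a = r -> wt b + (2 * sumn a)%N%:Z <> i -> ent g a b = 0.
Proof.
elim: r i g => [|r IH] i g /=; split.
- by move=> hg [|//] b _ /= wb; apply: hg => wb'; apply: wb; rewrite wb' addr0.
- by move=> hg b wb; apply: (hg [::]) => //=; rewrite addr0.
- move=> hg [|n a] b //= [sa] wb; apply: (IH _ _).1 (hg n) _ _ sa _ => e1.
  by apply: wb; move: e1; lia.
- move=> hg n; apply/IH => a b sa wb; apply: (hg (n :: a)) => /=; first by rewrite sa.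
  by move=> e1; apply: wb; move: e1; lia.
Qed.

Fixpoint delta r (a : seq nat) (b : 'I_N) : VV r :=
  if r is r'.+1 then
    fun n => if a is m :: a' then (if n == m then delta r' a' b else 0) else 0
  else delta_mx 0 b.

Lemma ent_delta r a a' b b' : size a = r -> size a' = r ->
  ent (delta r a b) a' b' = ((a == a') && (b == b'))%:R.
Proof.
elim: r a a' => [|r IH] [|n a] [|n' a'] //= => [_ _|[sa] [sa']].
  by rewrite mxE eqxx /= eq_sym.
rewrite eqseq_cons [n' == n]eq_sym; case: eqP => //= _; first exact: IH.
exact: ent0.
Qed.

End VV.

Fixpoint words (r m : nat) : seq (seq nat) :=
  if r is r'.+1 then [seq n :: a | n <- iota 0 m, a <- words r' m] else [:: [::]].

Lemma mem_words r m a :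
  (a \in words r m) = (size a == r) && all (fun n => n < m)%N a.
Proof.
elim: r a => [|r IH] [|n a] //=.
  by apply/negbTE/negP => /allpairsP[[x y] [_ _]].
apply/allpairsP/idP => [[[x y] /= [xm ym [-> ->]]]|].
  by move: ym; rewrite IH => /andP[/eqP-> ->]; move: xm; rewrite mem_iota eqxx andbT.
move=> /andP[/eqP[sa]] /andP[nm am]; exists (n, a); split=> //=.
  by rewrite mem_iota.
by rewrite IH sa eqxx.
Qed.

Lemma uniq_words r m : uniq (words r m).
Proof.
elim: r => //= r IH; apply: allpairs_uniq => //; first exact: iota_uniq.
by move=> [x y] [x' y'] _ _ /= [-> ->].
Qed.

Section Basis.
Variables (N : nat) (wt : 'I_N -> int) (r : nat).

(** In a monomial of degree [i] every exponent is at most the absolute value of [i] minus a weight,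
    so the finite list of words filtered here contains all of them. *)
Definition basis (i : int) : seq (seq nat * 'I_N) :=
  [seq x <- [seq (a, b) | a <- words r (`|i| + \sum_b `|wt b|).+1, b <- enum 'I_N]
     | wt x.2 + (2 * sumn x.1)%N%:Z == i].

Lemma mem_basis i x :
  (x \in basis i) = (size x.1 == r) && (wt x.2 + (2 * sumn x.1)%N%:Z == i).
Proof.
case: x => a b; rewrite mem_filter andbC /=; apply/andP/andP => [[]|[/eqP sa wi]].
  move/allpairsP => [[a' b'] /= [+ _ [-> ->]]].
  by rewrite mem_words => /andP[].
split=> //; apply/allpairsP; exists (a, b); split=> //=; last by rewrite mem_enum.
rewrite mem_words sa eqxx; apply/allP => n na.
suff : (n <= sumn a)%N.
  by move/eqP: wi => <-; rewrite (bigD1 b) //=; lia.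
by elim: a na {sa wi} => //= m a IH; rewrite inE => /orP[/eqP->|/IH]; lia.
Qed.

Lemma uniq_basis i : uniq (basis i).
Proof.
apply/filter_uniq/allpairs_uniq; [exact: uniq_words | exact: enum_uniq |].
by move=> [x y] [x' y'] _ _ /= [-> ->].
Qed.

Definition bsz i := size (basis i).
Definition bel i (j : 'I_(bsz i)) := tnth (in_tuple (basis i)) j.

Lemma bel_mem i (j : 'I_(bsz i)) : bel j \in basis i.
Proof. exact: mem_tnth. Qed.

Lemma bel_size i (j : 'I_(bsz i)) : size (bel j).1 = r.
Proof. by have := bel_mem j; rewrite mem_basis => /andP[/eqP]. Qed.

Lemma bel_wt i (j : 'I_(bsz i)) : wt (bel j).2 + (2 * sumn (bel j).1)%N%:Z = i.
Proof. by have := bel_mem j; rewrite mem_basis => /andP[_ /eqP]. Qed.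

Lemma bel_inj i : injective (@bel i).
Proof. by apply/tuple_uniqP; apply: uniq_basis. Qed.

Lemma belP i a b : size a = r -> wt b + (2 * sumn a)%N%:Z = i ->
  exists j : 'I_(bsz i), bel j = (a, b).
Proof.
move=> sa wi; have : (a, b) \in in_tuple (basis i).
  by rewrite memtE /= mem_basis /= sa wi !eqxx.
by move=> /tnthP[j ->]; exists j.
Qed.

Section Ring.
Variable R : comNzRingType.
Notation V := (VV R N r).

(** [unc] and [crd] identify the degree [i] part with a free module of finite rank, which turns
    homology into ranks of matrices. *)
Definition unc i (v : 'rV[R]_(bsz i)) : V :=
  \sum_j v 0 j *: delta R r (bel j).1 (bel j).2.

Definition crd i (g : V) : 'rV[R]_(bsz i) := \row_j ent g (bel j).1 (bel j).2.

Fact unc_linear i : linear (@unc i).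
Proof.
move=> a x y; rewrite /unc scaler_sumr -big_split /=; apply: eq_bigr => j _.
by rewrite !mxE scalerDl scalerA.
Qed.

Fact crd_linear i : linear (@crd i).
Proof.
by move=> a x y; apply/rowP => j; rewrite !mxE entD entZ.
Qed.

Definition uncL i : {linear _ -> _} := mkhom (@unc_linear i).
Definition crdL i : {linear _ -> _} := mkhom (@crd_linear i).

Lemma ent_unc i (v : 'rV[R]_(bsz i)) j : ent (unc v) (bel j).1 (bel j).2 = v 0 j.
Proof.
rewrite /unc ent_sum (bigD1 j) //= big1 ?addr0.
  by rewrite entZ ent_delta ?bel_size // !eqxx mulr1.
move=> j' jj; rewrite entZ ent_delta ?bel_size //.
have -> : ((bel j').1 == (bel j).1) && ((bel j').2 == (bel j).2) = false.
  by apply: contraNF jj => e; apply/eqP/bel_inj/eqP; rewrite -pair_eqE.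
by rewrite mulr0.
Qed.

Lemma uncK i : cancel (@unc i) (@crd i).
Proof. by move=> v; apply/rowP => j; rewrite mxE ent_unc. Qed.

Lemma hm_delta a b : size a = r -> hm wt (wt b + (2 * sumn a)%N%:Z) (delta R r a b).
Proof.
move=> sa; apply/hm_ent => a' b' sa' ne.
by rewrite ent_delta //; case: eqP => //= ea; case: eqP => // eb; move: ne; rewrite ea eb.
Qed.

Lemma hm_unc i (v : 'rV[R]_(bsz i)) : hm wt i (unc v).
Proof.
apply: hm_sum => j _; apply: hmZ.
by have := hm_delta (bel j).2 (bel_size j); rewrite bel_wt.
Qed.

Lemma crdK i (g : V) : hm wt i g -> unc (crd i g) = g.
Proof.
move=> hg; apply: ent_ext => a b sa.
case: (pselect (wt b + (2 * sumn a)%N%:Z = i)) => [wi|nwi].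
  by have [j ej] := belP sa wi; have := ent_unc (crd i g) j; rewrite mxE ej.
by rewrite (hm_ent wt i _).1 ?((hm_ent wt i g).1 hg) //; apply: hm_unc.
Qed.

Definition mxof (p : V -> V) i j : 'M[R]_(bsz i, bsz j) :=
  \matrix_(l, l') ent (p (delta R r (bel l).1 (bel l).2)) (bel l').1 (bel l').2.

Lemma mxofE (p : {linear V -> V}) i j v : crd j (p (unc v)) = v *m mxof p i j.
Proof.
apply/rowP => l; rewrite !mxE /unc linear_sum.
rewrite ent_sum; apply: eq_bigr => l' _.
by rewrite mxE linearZ entZ.
Qed.

End Ring.
End Basis.

Lemma ent_act_adj (R : comNzRingType) N (M : 'M[R]_N) r a a' b b' :
  size a = r -> size a' = r ->
  ent (act M r (delta R r a b)) a' b' = ent (act M^T r (delta R r a' b')) a b.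
Proof.
elim: r a a' => [|r IH] [|n a] [|n' a'] //= => [_ _|[sa] [sa']].
  by rewrite -!rowE !mxE.
rewrite [n == n']eq_sym; case: ifP => _; first exact: IH.
by rewrite !raddf0 !ent0.
Qed.

(** In the monomial bases, lowering an exponent is the transpose of raising it. Hence the divided
    power complex on a module is dual to the polynomial complex on the transposed operators. *)
Lemma ent_DG_adj (R : comNzRingType) N (d : 'M[R]_N) e r a a' b b' :
  size a = r -> size a' = r ->
  ent (DG d e r (delta R r a b)) a' b' =
  ent (DW d^T (fun l => (e l)^T) r (delta R r a' b')) a b.
Proof.
elim: r a a' => [|r IH] [|n a] [|n' a'] //= => [_ _|[sa] [sa']].
  by rewrite -!rowE !mxE.
rewrite /dgam /dw !entD.
congr (_ + _).
  rewrite [n == n']eq_sym; case: ifP => _; first exact: IH.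
  by rewrite !raddf0 !ent0.
case: n => [|n] /=; first by rewrite raddf0 !ent0.
rewrite eqSS [n == n']eq_sym; case: ifP => _; first exact: ent_act_adj.
by rewrite !raddf0 !ent0.
Qed.

Lemma mxof_DG_tr (R : comNzRingType) N (wt : 'I_N -> int) (d : 'M[R]_N) e r i j :
  mxof wt (DG d e r) i j = (mxof wt (DW d^T (fun l => (e l)^T) r) j i)^T.
Proof. by apply/matrixP => l l'; rewrite !mxE ent_DG_adj ?bel_size. Qed.

Section BaseChange.
Variables (R R' : comNzRingType) (f : {rmorphism R -> R'}) (N : nat).

Fixpoint vmap r : VV R N r -> VV R' N r :=
  if r is r'.+1 then fun g n => vmap (g n) else fun v => map_mx f (v : 'rV[R]_N).

Lemma ent_vmap r (g : VV R N r) a b : ent (vmap g) a b = f (ent g a b).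
Proof.
elim: r g a => [|r IH] g a /=; first by rewrite mxE.
by case: a => [|n a]; rewrite ?rmorph0 // IH.
Qed.

Lemma vmapD r (g g' : VV R N r) : vmap (g + g') = vmap g + vmap g'.
Proof.
elim: r g g' => [|r IH] g g' /=; first by rewrite map_mxD.
by apply/funext => n; apply: IH.
Qed.

Lemma vmap0 r : vmap (0 : VV R N r) = 0.
Proof.
elim: r => [|r IH] /=; first by rewrite map_mx0.
by apply/funext => n; apply: IH.
Qed.

Lemma vmapZ r a (g : VV R N r) : vmap (a *: g) = f a *: vmap g.
Proof.
elim: r g => [|r IH] g /=; first by rewrite map_mxZ.
by apply/funext => n; apply: IH.
Qed.

Lemma vmap_act M r (g : VV R N r) : vmap (act M r g) = act (map_mx f M) r (vmap g).
Proof.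
elim: r g => [|r IH] g /=; first by rewrite map_mxM.
by apply/funext => n; apply: IH.
Qed.

Lemma vmap_DG d e r (g : VV R N r) :
  vmap (DG d e r g) = DG (map_mx f d) (fun l => map_mx f (e l)) r (vmap g).
Proof.
elim: r g => [|r IH] g /=; first by rewrite map_mxM.
by apply/funext => n; rewrite /dgam vmapD IH vmap_act.
Qed.

Lemma vmap_DW d e r (g : VV R N r) :
  vmap (DW d e r g) = DW (map_mx f d) (fun l => map_mx f (e l)) r (vmap g).
Proof.
elim: r g => [|r IH] g /=; first by rewrite map_mxM.
apply/funext => n; rewrite /dw vmapD IH; case: n => [|n]; rewrite ?vmap0 //.
by rewrite vmap_act.
Qed.

Lemma vmap_delta r a b : vmap (delta R r a b) = delta R' r a b :> VV R' N r.
Proof.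
elim: r a => [|r IH] a /=; first by rewrite map_delta_mx.
by apply/funext => n; case: a => [|m a]; rewrite ?vmap0 //; case: ifP; rewrite ?vmap0.
Qed.

Lemma hm_vmap wt r i (g : VV R N r) : hm wt i g -> hm wt i (vmap g).
Proof.
elim: r i g => [|r IH] i g /= hg; first by move=> b wb; rewrite mxE hg ?rmorph0.
by move=> n; apply: IH.
Qed.

Lemma mxof_DG_map (wt : 'I_N -> int) (d : 'M[R]_N) (e : nat -> 'M[R]_N) r i j :
  mxof wt (DG (map_mx f d) (fun l => map_mx f (e l)) r) i j =
  map_mx f (mxof wt (DG d e r) i j).
Proof. by apply/matrixP => l l'; rewrite !mxE -ent_vmap vmap_DG vmap_delta. Qed.

End BaseChange.

(** * Dimensions of subquotients *)

Section Hdim.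
Variable k : fieldType.

Record subsp (V : lmodType k) (B : V -> Prop) : Prop := Subsp {
  subsp0 : B 0;
  subspD : forall x y, B x -> B y -> B (x + y);
  subspZ : forall a x, B x -> B (a *: x) }.

Lemma subspN (V : lmodType k) (B : V -> Prop) x : subsp B -> B x -> B (- x).
Proof. by move=> sB Bx; rewrite -scaleN1r; apply: subspZ. Qed.

Lemma subspB (V : lmodType k) (B : V -> Prop) x y : subsp B -> B x -> B y -> B (x - y).
Proof. by move=> sB Bx By; apply: subspD => //; apply: subspN. Qed.

Lemma subsp_sum (V : lmodType k) (B : V -> Prop) I (s : seq I) (P : pred I) (g : I -> V) :
  subsp B -> (forall j, P j -> B (g j)) -> B (\sum_(j <- s | P j) g j).
Proof.
by move=> sB Bg; elim/big_ind: _ => //; [apply: subsp0 | move=> x y; apply: subspD].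
Qed.

Definition indep (V : lmodType k) (B : V -> Prop) m (z : 'I_m -> V) :=
  forall c : 'I_m -> k, B (\sum_j c j *: z j) -> forall j, c j = 0.

(** The dimension of [Z] modulo [B], expressed by a basis so that no quotient space has to be
    formed. *)
Definition hdim (V : lmodType k) (Z B : V -> Prop) (m : nat) :=
  exists z : 'I_m -> V, [/\ forall j, Z (z j), indep B z &
    forall x, Z x -> exists c : 'I_m -> k, B (x - \sum_j c j *: z j)].

Lemma indep_le (V : lmodType k) (Z B : V -> Prop) m m' (z : 'I_m' -> V) :
  subsp B -> hdim Z B m -> (forall j, Z (z j)) -> indep B z -> (m' <= m)%N.
Proof.
move=> sB [y [Zy _ span]] Zz iz; rewrite leqNgt; apply/negP => mm.
have [c cz] := choice (fun j => span _ (Zz j)).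
pose C := \matrix_(i, j) c i j.
have /rowV0Pn[v /sub_kermxP vC /negP v0] : kermx C != 0.
  by rewrite -mxrank_eq0 mxrank_ker subn_eq0 -ltnNge (leq_ltn_trans (rank_leq_col _)).
case: v0; apply/eqP/rowP => i; rewrite mxE; apply: (iz (fun i => v 0 i)).
have -> : \sum_j v 0 j *: z j = \sum_j v 0 j *: (z j - \sum_l c j l *: y l).
  rewrite (eq_bigr _ (fun j _ => scalerBr _ _ _)) sumrB [X in _ - X](_ : _ = 0) ?subr0 //.
  rewrite (eq_bigr _ (fun j _ => scaler_sumr _ _ _ _)) exchange_big /= big1 // => l _.
  under eq_bigr do rewrite scalerA.
  by rewrite -scaler_suml; have /rowP/(_ l) := vC; rewrite !mxE;
     under eq_bigr do rewrite mxE; move=> ->; rewrite scale0r.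
by apply: subsp_sum => // j _; apply: subspZ.
Qed.

Lemma hdim_uniq (V : lmodType k) (Z B : V -> Prop) m m' :
  subsp B -> hdim Z B m -> hdim Z B m' -> m = m'.
Proof.
move=> sB hm hm'; case: (hm) => z [Zz iz _]; case: (hm') => z' [Zz' iz' _].
by apply/eqP; rewrite eqn_leq (indep_le sB hm' Zz iz) (indep_le sB hm Zz' iz').
Qed.

Lemma hdim_iso (V W : lmodType k) (Z B : V -> Prop) (Z' B' : W -> Prop)
    (f : {linear V -> W}) m :
  subsp Z -> subsp B' -> (forall x, Z x -> Z' (f x)) -> (forall x, B x -> B' (f x)) ->
  (forall x, Z x -> B' (f x) -> B x) ->
  (forall y, Z' y -> exists2 x, Z x & B' (y - f x)) ->
  hdim Z B m -> hdim Z' B' m.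
Proof.
move=> sZ sB' fZ fB inj surj [z [Zz iz span]].
have fs (c : 'I_m -> k) : f (\sum_j c j *: z j) = \sum_j c j *: f (z j).
  by rewrite linear_sum; apply: eq_bigr => j _; rewrite linearZ.
exists (fun j => f (z j)); split=> [j|c|y /surj[x Zx Bx]]; first exact: fZ.
  rewrite -fs => /inj Bc; apply/iz/Bc.
  by apply: subsp_sum => // j _; apply: subspZ.
have [c Bc] := span x Zx; exists c; rewrite -fs.
have -> : y - f (\sum_j c j *: z j) = (y - f x) + f (x - \sum_j c j *: z j).
  by rewrite linearB /=; abel.
by apply: subspD => //; apply: fB.
Qed.

Lemma hdim_exact (V1 V2 V3 : lmodType k) (Z1 B1 : V1 -> Prop) (Z2 B2 : V2 -> Prop)
    (Z3 B3 : V3 -> Prop) (f : {linear V1 -> V2}) (g : {linear V2 -> V3}) m1 m3 :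
  subsp Z1 -> subsp Z2 -> subsp B2 -> subsp B3 ->
  (forall x, Z1 x -> Z2 (f x)) -> (forall x, B1 x -> B2 (f x)) ->
  (forall x, Z1 x -> B2 (f x) -> B1 x) ->
  (forall x, B2 x -> B3 (g x)) -> (forall x, Z1 x -> B3 (g (f x))) ->
  (forall y, Z2 y -> Z3 (g y)) ->
  (forall y, Z2 y -> B3 (g y) -> exists2 x, Z1 x & B2 (y - f x)) ->
  (forall z, Z3 z -> exists2 y, Z2 y & B3 (z - g y)) ->
  hdim Z1 B1 m1 -> hdim Z3 B3 m3 -> hdim Z2 B2 (m1 + m3).
Proof.
move=> sZ1 sZ2 sB2 sB3 fZ fB finj gB gf gZ ex surj [z1 [Zz1 iz1 sp1]] [z3 [Zz3 iz3 sp3]].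
have surj' j : exists y, Z2 y /\ B3 (z3 j - g y).
  by have [x Zx Bx] := surj _ (Zz3 j); exists x.
have [y yP] := choice surj'.
have fs (c : 'I_m1 -> k) : f (\sum_j c j *: z1 j) = \sum_j c j *: f (z1 j).
  by rewrite linear_sum; apply: eq_bigr => j _; rewrite linearZ.
have gs (c : 'I_m3 -> k) : g (\sum_j c j *: y j) = \sum_j c j *: g (y j).
  by rewrite linear_sum; apply: eq_bigr => j _; rewrite linearZ.
pose z (j : 'I_(m1 + m3)) := match fintype.split j with inl a => f (z1 a) | inr b => y b end.
have zs (c : 'I_(m1 + m3) -> k) : \sum_j c j *: z j =
   f (\sum_j c (lshift m3 j) *: z1 j) + \sum_j c (rshift m1 j) *: y j.
  rewrite big_split_ord fs /z /=; congr (_ + _); apply: eq_bigr => j _.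
    by rewrite -[lshift _ _]/(unsplit (inl j)) unsplitK.
  by rewrite -[rshift _ _]/(unsplit (inr j)) unsplitK.
have Z1s (c : 'I_m1 -> k) : Z1 (\sum_j c j *: z1 j).
  by apply: subsp_sum => // j _; apply: subspZ.
have B3s (c : 'I_m3 -> k) : B3 (\sum_j c j *: z3 j - g (\sum_j c j *: y j)).
  rewrite gs -sumrB; apply: subsp_sum => // j _.
  by rewrite -scalerBr; apply: subspZ => //; case: (yP j).
exists z; split=> [j|c|x Zx].
- by rewrite /z; case: fintype.split => a; [apply: fZ | case: (yP a)].
- rewrite zs => Bc.
  have c3 : forall j, c (rshift m1 j) = 0.
    apply: (iz3 (fun j => c (rshift m1 j))).
    rewrite -[X in B3 X](subrK (g (\sum_j c (rshift m1 j) *: y j))).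
    apply: subspD => //.
    have := gB _ Bc; rewrite linearD /= => /(subspB sB3)/(_ (gf _ (Z1s _))).
    by move=> /(_ (fun j => c (lshift m3 j))); congr B3; abel.
  have c1 : forall j, c (lshift m3 j) = 0.
    apply: (iz1 (fun j => c (lshift m3 j))); apply: finj => //.
    by move: Bc; rewrite [X in _ + X]big1 ?addr0 // => j _; rewrite c3 scale0r.
  by move=> j; case: (split_ordP j) => a ->.
- have [c3 Bc3] := sp3 _ (gZ _ Zx).
  have Zr : Z2 (x - \sum_j c3 j *: y j).
    apply: subspB => //; apply: subsp_sum => // j _; apply: subspZ => //.
    by case: (yP j).
  have [|x1 Zx1 Bx1] := ex _ Zr.
    rewrite linearB /=.
    have -> : g x - g (\sum_j c3 j *: y j) = (g x - \sum_j c3 j *: z3 j) +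
       (\sum_j c3 j *: z3 j - g (\sum_j c3 j *: y j)) by abel.
    exact: subspD.
  have [c1 Bc1] := sp1 _ Zx1.
  exists (fun j => match fintype.split j with inl a => c1 a | inr b => c3 b end).
  rewrite zs.
  have -> : \sum_j (match fintype.split (lshift m3 j) with inl a => c1 a | inr b => c3 b end) *: z1 j
     = \sum_j c1 j *: z1 j.
    by apply: eq_bigr => j _; rewrite -[lshift _ _]/(unsplit (inl j)) unsplitK.
  have -> : \sum_j (match fintype.split (rshift m1 j) with inl a => c1 a | inr b => c3 b end) *: y j
     = \sum_j c3 j *: y j.
    by apply: eq_bigr => j _; rewrite -[rshift _ _]/(unsplit (inr j)) unsplitK.
  set s3 := \sum_j _ *: y j in Bx1 *; set s1 := \sum_j _ in Bc1 *.
  have -> : x - (f s1 + s3) = (x - s3 - f x1) + f (x1 - s1).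
    by rewrite linearB /=; abel.
  by apply: subspD => //; apply: fB.
Qed.

Lemma hdim_mx n0 n n1 (P : 'M[k]_(n0, n)) (Q : 'M[k]_(n, n1)) : P *m Q = 0 ->
  hdim (fun v : 'rV_n => v *m Q = 0) (fun v => exists u, v = u *m P)
    (n - \rank P - \rank Q).
Proof.
move=> PQ.
have sPK : (P <= kermx Q)%MS by apply/sub_kermxP.
pose W := (kermx Q :\: P)%MS.
have rW : \rank W = (n - \rank P - \rank Q)%N.
  have := mxrank_cap_compl (kermx Q) P; rewrite mxrank_ker (capmx_idPr sPK) -/W.
  by move: (rank_leq_row Q); lia.
rewrite -rW; pose z j : 'rV_n := row j (row_base W).
have zs (c : 'I_(\rank W) -> k) :
    \sum_j c j *: z j = (\row_j c j) *m row_base W.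
  by rewrite mulmx_sum_row; apply: eq_bigr => j _; rewrite mxE.
exists z; split=> [j|c|x /sub_kermxP xQ].
- apply/sub_kermxP; apply: submx_trans (row_sub _ _) _.
  by rewrite eq_row_base diffmxSl.
- rewrite zs => -[u eu] j.
  have : ((\row_j c j) *m row_base W <= (0 : 'M[k]_n))%MS.
    rewrite -(capmx_diff (kermx Q) P) sub_capmx; apply/andP; split.
      by apply: submx_trans (submxMl _ _) _; rewrite eq_row_base.
    by rewrite eu submxMl.
  rewrite submx0 => /eqP; rewrite -(mul0mx _ (row_base W)).
  by move/(row_free_inj (row_base_free W))/rowP/(_ j); rewrite !mxE.
- have : (x <= W + (kermx Q :&: P))%MS by rewrite /W addsmx_diff_cap_eq.
  case/sub_addsmxP => -[a b] /= ->.
  have /submxP[a' ea'] : (a *m W <= row_base W)%MS by rewrite eq_row_base submxMl.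
  have /submxP[b' eb'] : (b *m (kermx Q :&: P) <= P)%MS.
    by apply: submx_trans (submxMl _ _) _; apply: capmxSr.
  exists (fun j => a' 0 j), b'; rewrite zs ea' eb'.
  have -> : \row_j a' 0 j = a' by apply/rowP => j; rewrite mxE.
  by rewrite addrC addKr.
Qed.

End Hdim.

(** * Modules over an exterior algebra and their Koszul duals *)

Section Operators.
Variables (R : comNzRingType) (N : nat).
Implicit Types (d E : 'M[R]_N) (e : nat -> 'M[R]_N) (u : nat -> R).
Notation V := (VV R N).

Lemma DWE d e r (w : V r.+1) n :
  DW d e r.+1 w n = DW d e r (w n) + (if n is n'.+1 then act (e r) r (w n') else 0).
Proof. by []. Qed.

Lemma DGE d e r (w : V r.+1) n :
  DG d e r.+1 w n = DG d e r (w n) + act (e r) r (w n.+1).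
Proof. by []. Qed.

Lemma vvD r (g g' : V r.+1) n : (g + g') n = g n + g' n.
Proof. by []. Qed.

Lemma vvB r (g g' : V r.+1) n : (g - g') n = g n - g' n.
Proof. by []. Qed.

Lemma actE M r (w : V r.+1) n : act M r.+1 w n = act M r (w n).
Proof. by []. Qed.

(* Multiplication by, and contraction with, the linear form with coefficients [u]. *)
Definition linW u r : {linear V r -> V r} := DW 0 (fun l => (u l)%:M) r.
Definition linG u r : {linear V r -> V r} := DG 0 (fun l => (u l)%:M) r.

Lemma linWE u r (w : V r.+1) n :
  linW u r.+1 w n = linW u r (w n) + (if n is n'.+1 then u r *: w n' else 0).
Proof. by rewrite /linW DWE; case: n => // n; rewrite act_scalar. Qed.

Lemma linGE u r (w : V r.+1) n : linG u r.+1 w n = linG u r (w n) + u r *: w n.+1.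
Proof. by rewrite /linG DGE act_scalar. Qed.

Lemma linW0 u (v : V 0) : linW u 0 v = 0.
Proof. exact: mulmx0. Qed.

Lemma linG0 u (v : V 0) : linG u 0 v = 0.
Proof. exact: mulmx0. Qed.

Lemma linW_act u M r (g : V r) : act M r (linW u r g) = linW u r (act M r g).
Proof.
elim: r g => [|r IH] g; first by rewrite !linW0 linear0.
apply/funext => n; rewrite actE !linWE linearD IH; congr (_ + _).
by case: n => [|n]; rewrite ?linear0 // linearZ.
Qed.

Lemma linG_act u M r (g : V r) : act M r (linG u r g) = linG u r (act M r g).
Proof.
elim: r g => [|r IH] g; first by rewrite !linG0 linear0.
by apply/funext => n; rewrite actE !linGE linearD IH linearZ.
Qed.

Lemma linW_DW u d e r (g : V r) : DW d e r (linW u r g) = linW u r (DW d e r g).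
Proof.
elim: r g => [|r IH] g; first by rewrite !linW0 linear0.
apply/funext => n; rewrite DWE !linWE !linearD IH -!addrA; congr (_ + _).
case: n => [|n]; first by rewrite !linear0.
rewrite DWE linWE !linearD linW_act linearZ /=; rewrite addrCA; congr (_ + _).
congr (_ + _).
by case: n => [|n]; rewrite ?linear0 ?scaler0 // linearZ.
Qed.

Lemma linG_DG u d e r (g : V r) : DG d e r (linG u r g) = linG u r (DG d e r g).
Proof.
elim: r g => [|r IH] g; first by rewrite !linG0 linear0.
apply/funext => n; rewrite DGE !linGE !linearD IH -!addrA; congr (_ + _).
by rewrite linG_act [DG _ _ _ (_ *: _)]linearZ [act _ _ (_ *: _)]linearZ /= addrCA.
Qed.

Lemma DW_sub d e u E r (g : V r) :
  DW d (fun l => e l - u l *: E) r g = DW d e r g - linW u r (act E r g).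
Proof.
elim: r g => [|r IH] g; first by rewrite linW0 subr0.
apply/funext => n; rewrite vvB linWE !DWE IH opprD addrACA.
congr (_ + _); case: n => [|n]; first by rewrite subr0.
by rewrite actDl -scaleN1r actZl scaleN1r actZl.
Qed.

Lemma DG_sub d e u E r (g : V r) :
  DG d (fun l => e l - u l *: E) r g = DG d e r g - linG u r (act E r g).
Proof.
elim: r g => [|r IH] g; first by rewrite linG0 subr0.
apply/funext => n; rewrite vvB linGE !DGE IH opprD addrACA.
by congr (_ + _); rewrite actDl -scaleN1r actZl scaleN1r actZl.
Qed.

Lemma hm_linW wt u r i (g : V r) : hm wt i g -> hm wt (i + 2%:Z) (linW u r g).
Proof.
elim: r i g => [|r IH] i g hg; first by rewrite linW0; apply: hm0.
move=> n; rewrite linWE; apply: hmD.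
  by have := IH _ _ (hg n); congr (hm wt); lia.
case: n => [|n]; first exact: hm0.
by apply: hmZ; have := hg n; congr (hm wt); lia.
Qed.

Lemma hm_linG wt u r i (g : V r) : hm wt i g -> hm wt (i - 2%:Z) (linG u r g).
Proof.
elim: r i g => [|r IH] i g hg; first by rewrite linG0; apply: hm0.
move=> n; rewrite linGE; apply: hmD.
  by have := IH _ _ (hg n); congr (hm wt); lia.
by apply: hmZ; have := hg n.+1; congr (hm wt); lia.
Qed.

Definition is_ext r d e :=
  [/\ d *m d = 0, forall l, (l < r)%N -> d *m e l + e l *m d = 0,
      forall l m, (l < r)%N -> (m < r)%N -> e l *m e m + e m *m e l = 0 &
      forall l, (l < r)%N -> e l *m e l = 0].

(** These are the operators that remain when the last variable is replaced by minus the linear form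
    [u] in the others. They are linear combinations of the old ones, which is why the exterior
    relations survive. *)
Lemma is_ext_sub r d e u :
  is_ext r.+1 d e -> is_ext r d (fun l => e l - u l *: e r).
Proof.
move=> [dd de ee e2].
have scE (M M' : 'M[R]_N) a b : (M - a *: e r) *m (M' - b *: e r) =
    M *m M' - b *: (M *m e r) - a *: (e r *m M').
  rewrite mulmxBr !mulmxBl -!scalemxAr -!scalemxAl e2 // !scaler0 subr0.
  by abel.
have ac M M' : M *m M' + M' *m M = 0 -> M' *m M = - (M *m M') :> 'M[R]_N.
  by move=> h; apply/eqP; rewrite -addr_eq0 addrC h.
split=> // [l lr|l m lr mr|l lr] /=.
- rewrite mulmxBr mulmxBl -scalemxAr -scalemxAl.
  rewrite (ac _ _ (de l (ltnW lr))) (ac _ _ (de r (ltnSn r))) scalerN; abel.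
- rewrite !scE (ac _ _ (ee l m (ltnW lr) (ltnW mr))) (ac _ _ (ee l r (ltnW lr) (ltnSn r))).
  rewrite (ac _ _ (ee m r (ltnW mr) (ltnSn r))) !scalerN; abel.
- rewrite scE e2; last exact: ltnW.
  rewrite (ac _ _ (ee l r (ltnW lr) (ltnSn r))) !scalerN; abel.
Qed.

Lemma is_ext_le r d e : is_ext r.+1 d e -> is_ext r d e.
Proof.
by move=> [dd de ee e2]; split=> // *; [apply: de|apply: ee|apply: e2]; apply: ltnW.
Qed.

Lemma is_ext_tr r d e : is_ext r d e -> is_ext r d^T (fun l => (e l)^T).
Proof.
move=> [dd de ee e2]; split=> [|l lr|l m lr mr|l lr].
- by rewrite -trmx_mul dd trmx0.
- by rewrite -!trmx_mul -linearD /= addrC de // trmx0.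
- by rewrite -!trmx_mul -linearD /= addrC ee // trmx0.
- by rewrite -trmx_mul e2 // trmx0.
Qed.

Lemma DG_DG r d e (g : V r) : is_ext r d e -> DG d e r (DG d e r g) = 0.
Proof.
elim: r g => [|r IH] g xe; first by case: xe => dd _ _ _; rewrite /= -mulmxA dd mulmx0.
apply/funext => n; rewrite DGE !DGE !linearD IH; last exact: is_ext_le.
case: xe => [dd de ee e2]; rewrite [act _ _ (act _ _ _)]actM e2 // act0l addr0 add0r.
have := @DG_act _ _ d e (e r) 0 r (g n.+1); rewrite scale0r; apply.
  by move=> l lr; apply: ee => //; lia.
by rewrite de // raddf0.
Qed.

Lemma DW_DW r d e (g : V r) : is_ext r d e -> DW d e r (DW d e r g) = 0.
Proof.
elim: r g => [|r IH] g xe; first by case: xe => dd _ _ _; rewrite /= -mulmxA dd mulmx0.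
apply/funext => n; rewrite DWE !DWE !linearD IH ?add0r; last exact: is_ext_le.
case: n => [|n]; first by rewrite linear0 addr0.
case: xe => [dd de ee e2]; rewrite DWE linearD /= addrA [X in _ + X](_ : _ = 0) ?addr0; last first.
  by case: n => [|n]; rewrite ?linear0 // actM e2 // act0l.
have := @DW_act _ _ d e (e r) 0 r (g n); rewrite scale0r; apply.
  by move=> l lr; apply: ee => //; lia.
by rewrite de // raddf0.
Qed.

(** * Division by a linear form which is monic in the last variable *)

Section Division.
Variables (r : nat) (u : nat -> R).

(* The linear form [y] has coefficient 1 at the last variable; [evp] evaluates
   the last variable at [- linW u], that is modulo [y]. *)
Definition monic_form l := if l == r then 1 else u l.
Definition yW : {linear V r.+1 -> V r.+1} := linW monic_form r.+1.
Definition yG : {linear V r.+1 -> V r.+1} := linG monic_form r.+1.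

Lemma linW_eq u' s (w : V s) : (forall l, (l < s)%N -> u l = u' l) -> linW u s w = linW u' s w.
Proof.
elim: s w => [|s IH] w uu; first by rewrite !linW0.
apply/funext => n; rewrite !linWE IH; last by move=> l ls; apply: uu; lia.
by case: n => // n; rewrite uu.
Qed.

Lemma linG_eq u' s (w : V s) : (forall l, (l < s)%N -> u l = u' l) -> linG u s w = linG u' s w.
Proof.
elim: s w => [|s IH] w uu; first by rewrite !linG0.
apply/funext => n; rewrite !linGE IH; last by move=> l ls; apply: uu; lia.
by rewrite uu.
Qed.
End Division.

Lemma yWE r u (w : V r.+1) n :
  yW r u w n = linW u r (w n) + (if n is n'.+1 then w n' else 0).
Proof.
rewrite /yW linWE (@linW_eq _ u); last by move=> l lr; rewrite /monic_form ltn_eqF.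
by case: n => // n; rewrite /monic_form eqxx scale1r.
Qed.

Lemma yGE r u (w : V r.+1) n : yG r u w n = linG u r (w n) + w n.+1.
Proof.
rewrite /yG linGE (@linG_eq _ u); last by move=> l lr; rewrite /monic_form ltn_eqF.
by rewrite /monic_form eqxx scale1r.
Qed.

Lemma hm_yW wt r u i (g : V r.+1) : hm wt i g -> hm wt (i + 2%:Z) (yW r u g).
Proof. exact: hm_linW. Qed.

Lemma hm_yG wt r u i (g : V r.+1) : hm wt i g -> hm wt (i - 2%:Z) (yG r u g).
Proof. exact: hm_linG. Qed.

Section Quotient.
Variables (r : nat) (u : nat -> R).
Notation c := (linW u r).

(** Horner's scheme. The argument [m] bounds the number of coefficients that are read, since a
    function on [nat] carries no degree. *)
Fixpoint evp m (w : nat -> V r) : V r :=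
  if m is m'.+1 then w 0%N - c (evp m' (fun n => w n.+1)) else 0.

Fact evp_linear m : linear (evp m).
Proof.
elim: m => [|m IH] a x y /=; first by rewrite scaler0 addr0.
rewrite [evp m _](IH a (fun n => x n.+1) (fun n => y n.+1)) linearP.
by rewrite scalerBr opprD addrACA.
Qed.

Definition evpL m : {linear V r.+1 -> V r} := mkhom (evp_linear m).

Lemma evpS m w : evp m.+1 w = w 0%N - c (evp m (fun n => w n.+1)).
Proof. by []. Qed.

Lemma evp0 m : evp m (0 : V r.+1) = 0.
Proof. exact: (linear0 (evpL m)). Qed.

Lemma evpD m (w w' : V r.+1) : evp m (w + w') = evp m w + evp m w'.
Proof. exact: (linearD (evpL m)). Qed.

Lemma evpB m (w w' : V r.+1) : evp m (w - w') = evp m w - evp m w'.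
Proof. exact: (linearB (evpL m)). Qed.

Lemma evp_fin m m' (w : nat -> V r) : (forall n, (m <= n)%N -> w n = 0) ->
  (m <= m')%N -> evp m' w = evp m w.
Proof.
elim: m m' w => [|m IH] m' w fw.
  elim: m' w fw => [|m' IH'] w fw _ //=.
  by rewrite IH' ?linear0 ?fw ?subrr ?oppr0 ?addr0 // => n _; apply: fw.
by case: m' => // m' mm /=; rewrite (IH m') // => n mn; apply: fw.
Qed.

Lemma evp_cst0 m x : evp m.+1 (cst0 (V r) x) = x.
Proof. by rewrite /= -[X in evp m X]/(0 : V r.+1) evp0 linear0 subr0. Qed.

Lemma evp_yW m (w : nat -> V r) : (forall n, (m <= n)%N -> w n = 0) ->
  evp m.+1 (yW r u w) = 0.
Proof.
elim: m w => [|m IH] w fw.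
  have -> : w = 0 by apply/funext => n; apply: fw.
  by rewrite linear0 evp0.
pose w' n := w n.+1.
rewrite evpS; have -> : (fun n => yW r u w n.+1) = yW r u w' + cst0 (V r) (w 0%N).
  apply/funext => n; by rewrite vvD !yWE; case: n => [|n] //=; rewrite ?addr0.
rewrite evpD.
by rewrite evp_cst0 IH ?add0r ?yWE ?addr0 ?subrr // => n mn; apply: fw.
Qed.

Variables (d : 'M[R]_N) (e : nat -> 'M[R]_N).
Notation D' := (DW d (fun l => e l - u l *: e r) r).

(** Substituting for the last variable converts the contribution of [e r] into the corrections
    [- u l *: e r] of the other operators, so evaluation is a chain map to the complex with one
    variable less. The differential lengthens a sequence by one, whence [m.+1]. *)
Lemma evp_DW m (w : nat -> V r) : (forall n, (m <= n)%N -> w n = 0) ->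
  evp m.+1 (DW d e r.+1 w) = D' (evp m w).
Proof.
elim: m w => [|m IH] w fw.
  have -> : w = 0 by apply/funext => n; apply: fw.
  by rewrite linear0 evp0 [evp 0 _]/= linear0.
pose w' n := w n.+1.
rewrite evpS; have -> : (fun n => DW d e r.+1 w n.+1) =
    DW d e r.+1 w' + cst0 (V r) (act (e r) r (w 0%N)).
  apply/funext => n; by rewrite vvD !DWE; case: n => [|n] //=; rewrite ?addr0.
rewrite evpD.
rewrite evp_cst0 IH; last by move=> n mn; apply: fw.
rewrite [evp m.+1 w]evpS -/w' [D' (_ - _)]linearB linW_DW DWE addr0 [X in _ = X - _]DW_sub linearD.
abel.
Qed.

(* The quotient of [w] by [y], for [w] supported in degrees below [m]. *)
Definition yquo m (w : V r.+1) : V r.+1 := fun n => evp (m - n.+1) (fun l => w (n.+1 + l)%N).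

Lemma yquoE m (w : V r.+1) : (forall n, (m <= n)%N -> w n = 0) ->
  w = cst0 (V r) (evp m w) + yW r u (yquo m w).
Proof.
move=> fw; apply/funext => n.
have st l : (l < m)%N -> evp (m - l) (fun j => w (l + j)%N) = w l - c (yquo m w l).
  move=> lm; rewrite /yquo; have -> : (m - l = (m - l.+1).+1)%N by lia.
  by rewrite /= addn0; congr (_ - c (evp _ _)); apply/funext => j; rewrite addnS.
have st' l : evp (m - l) (fun j => w (l + j)%N) = w l - c (yquo m w l).
  have [/st//|ml] := ltnP l m.
  rewrite /yquo; have -> : (m - l = 0)%N by lia.
  have -> : (m - l.+1 = 0)%N by lia.
  by rewrite /= linear0 subr0 fw.
rewrite vvD yWE; case: n => [|n] /=.
  by rewrite addr0 -[in X in evp m X](funext (fun j => congr1 w (add0n j))) -{1}(subn0 m) st'; abel.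
by rewrite add0r /yquo -/(yquo m w n.+1) [X in _ + X]st'; abel.
Qed.

(** The form is monic in the last variable, so the coefficients of [w] vanish one after the other
    from the top down. *)
Lemma yW_inj m (w : V r.+1) : (forall n, (m <= n)%N -> w n = 0) -> yW r u w = 0 -> w = 0.
Proof.
move=> fw yw; apply/funext => n.
elim: {n}(m - n)%N {-2}n (leqnn (m - n)) => [|j IH] n mn; first by apply: fw; lia.
have [mn'|nm] := leqP m n; first exact: fw.
have := congr1 (fun f => f n.+1) yw; rewrite yWE IH; last by lia.
by rewrite linear0 add0r.
Qed.

Variable wt : 'I_N -> int.

Lemma hm_evp m i (w : V r.+1) : hm wt i w -> hm wt i (evp m w).
Proof.
elim: m i w => [|m IH] i w hw /=; first exact: hm0.
apply: hmB; first by have := hw 0%N; rewrite subr0.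
have : hm wt (i - 2%:Z) (evp m (fun n => w n.+1)).
  by apply: IH => n; have := hw n.+1; congr (hm wt); lia.
by move/(hm_linW u); rewrite subrK.
Qed.

Lemma hm_yquo m i (w : V r.+1) : hm wt i w -> hm wt (i - 2%:Z) (yquo m w).
Proof.
move=> hw n; apply: (@hm_evp _ _ (fun l => w (n.+1 + l)%N)) => l.
by have := hw (n.+1 + l)%N; congr (hm wt); lia.
Qed.

Lemma hm_fin i (w : V r.+1) m : hm wt i w -> (`|i - wt_lo wt| < m)%N ->
  forall n, (m <= n)%N -> w n = 0.
Proof. by move=> hw im n mn; apply: (hm_lo (hw n)); lia. Qed.

End Quotient.
End Operators.

Section OpDim.
Variables (k : fieldType) (N r : nat) (wt : 'I_N -> int).
Notation V := (VV k N r).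

Definition ocyc (p : V -> V) (i : int) (g : V) := hm wt i g /\ p g = 0.
Definition obd (p : V -> V) (s i : int) (g : V) := exists2 q, hm wt (i - s) q & g = p q.

(** The dimension of the homology in degree [i], by rank and nullity. This expression is visibly
    invariant under transposition and under field extension, the two operations applied to it
    later. *)
Definition opdim (p : V -> V) (s i : int) : nat :=
  bsz wt r i - \rank (mxof wt p (i - s) i) - \rank (mxof wt p i (i + s)).

Lemma subsp_ocyc (p : {linear V -> V}) i : subsp (ocyc p i).
Proof.
split=> [|x y [hx px] [hy py]|a x [hx px]]; split; rewrite ?linear0 //.
- exact: hm0.
- exact: hmD.
- by rewrite linearD /= px py addr0.
- exact: hmZ.
- by rewrite linearZ /= px scaler0.
Qed.

Lemma subsp_obd (p : {linear V -> V}) s i : subsp (obd p s i).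
Proof.
split=> [|x y [q hq ->] [q' hq' ->]|a x [q hq ->]].
- by exists 0; rewrite ?linear0 //; apply: hm0.
- by exists (q + q'); rewrite ?linearD //; apply: hmD.
- by exists (a *: q); rewrite ?linearZ //; apply: hmZ.
Qed.

Variables (p : {linear V -> V}) (s : int).
Hypothesis hp : forall i g, hm wt i g -> hm wt (i + s) (p g).
Hypothesis pp : forall g, p (p g) = 0.

Lemma hdim_op i : hdim (ocyc p i) (obd p s i) (opdim p s i).
Proof.
have PQ : mxof wt p (i - s) i *m mxof wt p i (i + s) = 0.
  apply/row_matrixP => j; rewrite row0 row_mul rowE -!mxofE.
  rewrite crdK; last by have := hp (hm_unc (delta_mx 0 j)); rewrite subrK.
  by rewrite pp; apply/rowP => l; rewrite !mxE ent0.
have unc0 (g : V) j : hm wt j g -> crd wt j g = 0 -> g = 0.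
  by move=> hg c0; rewrite -(crdK hg) c0; apply: (linear0 (uncL wt r k j)).
apply: (hdim_iso (f := uncL wt r k i)) (hdim_mx PQ).
- split=> [|x y xQ yQ|a x xQ]; rewrite ?mul0mx //.
    by rewrite mulmxDl xQ yQ addr0.
  by rewrite -scalemxAl xQ scaler0.
- exact: subsp_obd.
- move=> v; rewrite -mxofE => c0; split; first exact: hm_unc.
  by apply: unc0 c0; apply/hp/hm_unc.
- move=> v [u ->]; exists (unc u); first exact: hm_unc.
  rewrite -mxofE /= crdK //; have := hp (hm_unc u); by rewrite subrK.
- move=> v _ [q hq eq]; exists (crd wt (i - s) q).
  by rewrite -mxofE crdK // -eq /= uncK.
- move=> g [hg pg]; exists (crd wt i g); last first.
    by rewrite /= crdK // subrr; apply: (subsp0 (subsp_obd _ _ _)).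
  by rewrite -mxofE crdK // pg; apply/rowP => l; rewrite !mxE ent0.
Qed.

End OpDim.

Section ExtDim.
Variables (k : fieldType) (N : nat).
Implicit Types (d : 'M[k]_N) (e : nat -> 'M[k]_N) (wt : 'I_N -> int).

Definition gdim wt d e r i := opdim wt (DG d e r) (-1) i.
Definition wdim wt d e r i := opdim wt (DW d e r) 1 i.

Definition gr_ext wt (s : int) r d e :=
  mx_deg wt s d /\ forall l, (l < r)%N -> mx_deg wt (- s) (e l).

Lemma wdim_tr wt d e r i : wdim wt d e r i = gdim wt d^T (fun l => (e l)^T) r i.
Proof.
have e1 : (fun l => ((e l)^T)^T) = e by apply/funext => l; rewrite trmxK.
by rewrite /gdim /wdim /opdim !mxof_DG_tr !mxrank_tr opprK trmxK e1 subnAC.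
Qed.

Lemma gdim_tr wt d e r i : gdim wt d e r i = wdim wt d^T (fun l => (e l)^T) r i.
Proof.
have e1 : (fun l => ((e l)^T)^T) = e by apply/funext => l; rewrite trmxK.
by rewrite wdim_tr trmxK e1.
Qed.

Lemma gdim_map (K : fieldType) (f : {rmorphism k -> K}) wt d e r i :
  opdim wt (DG (map_mx f d) (fun l => map_mx f (e l)) r) (-1) i = gdim wt d e r i.
Proof. by rewrite /gdim /opdim !mxof_DG_map !mxrank_map. Qed.

Lemma gr_ext_sub wt s r d e (u : nat -> k) :
  gr_ext wt s r.+1 d e -> gr_ext wt s r d (fun l => e l - u l *: e r).
Proof.
move=> [hd he]; split=> // l lr b b' wb; rewrite !mxE !he ?mulr0 ?subrr //; lia.
Qed.

Lemma gr_ext_tr wt wt' c0 s r d e : (forall b, wt' b = c0 - wt b) ->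
  gr_ext wt s r d e -> gr_ext wt' s r d^T (fun l => (e l)^T).
Proof.
move=> ww [hd he]; split=> [|l lr] b b' wb; rewrite mxE ?hd ?he //; move: wb;
  rewrite !ww; lia.
Qed.

Lemma gr_ext_opp wt wt' c0 s r d e : (forall b, wt' b = c0 - wt b) ->
  gr_ext wt s r d e -> gr_ext wt' (- s) r d e.
Proof.
move=> ww [hd he]; split=> [|l lr] b b' wb; rewrite ?hd ?he //; move: wb;
  rewrite !ww; lia.
Qed.

Lemma hm_DGx wt r d e i (g : VV k N r) : gr_ext wt (-1) r d e ->
  hm wt i g -> hm wt (i - 1) (DG d e r g).
Proof. by move=> [hd he]; apply: hm_DG. Qed.

Lemma hm_DWx wt r d e i (g : VV k N r) : gr_ext wt 1 r d e ->
  hm wt i g -> hm wt (i + 1) (DW d e r g).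
Proof. by move=> [hd he]; apply: hm_DW. Qed.

Lemma gdimP wt r d e i : is_ext r d e -> gr_ext wt (-1) r d e ->
  hdim (ocyc wt (DG d e r) i) (obd wt (DG d e r) (-1) i) (gdim wt d e r i).
Proof.
move=> xe ge; apply: (hdim_op (p := DG d e r)) => [j g|g]; first exact: hm_DGx.
exact: DG_DG.
Qed.

Lemma wdimP wt r d e i : is_ext r d e -> gr_ext wt 1 r d e ->
  hdim (ocyc wt (DW d e r) i) (obd wt (DW d e r) 1 i) (wdim wt d e r i).
Proof.
move=> xe ge; apply: (hdim_op (p := DW d e r)) => [j g|g]; first exact: hm_DWx.
exact: DW_DW.
Qed.

Section Regular.
Variables (wt : 'I_N -> int) (r : nat) (d : 'M[k]_N) (e : nat -> 'M[k]_N) (u : nat -> k).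
Hypothesis xe : is_ext r.+1 d e.
Hypothesis ge : gr_ext wt 1 r.+1 d e.
Notation D := (DW d e r.+1).
Notation e' := (fun l => e l - u l *: e r).
Notation D' := (DW d e' r).
Notation y := (yW N r u).
Notation iota := (cst0 (VV k N r) : VV k N r -> VV k N r.+1).

Definition y_injective_at (i : int) := forall w, ocyc wt D i w -> obd wt D 1 (i + 2%:Z) (y w) ->
  obd wt D 1 i w.

Lemma xe' : is_ext r d e'. Proof. exact: is_ext_sub. Qed.
Lemma ge' : gr_ext wt 1 r d e'. Proof. exact: gr_ext_sub. Qed.

Lemma yW_D w : y (D w) = D (y w). Proof. by rewrite /yW linW_DW. Qed.

(** The operator [\sum_l e l * chi l] is the sum of [\sum_l (e l - u l *: e r) * chi l], in which
    the term [l = r] has disappeared, and of [e r] times the form. *)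
Lemma DW_iota x : D (iota x) = iota (D' x) + y (iota (act (e r) r x)).
Proof.
apply/funext => n; rewrite vvD DWE yWE DW_sub; case: n => [|[|n]] /=.
- by abel.
- by rewrite !linear0 !add0r.
- by rewrite !linear0 !addr0.
Qed.

Lemma yW_inj_hm i w : hm wt i w -> y w = 0 -> w = 0.
Proof. by move=> hw; apply: yW_inj (hm_fin hw (ltnSn _)). Qed.

(* A cycle of [D'] is the reduction of the cycle [iota w' - y q] as soon as
   [iota (w' e_r)], which becomes a boundary after multiplication by [y], is
   one. *)
Lemma lift_cycle (i : int) w' : y_injective_at (i - 1) -> ocyc wt D' i w' ->
  exists2 q, hm wt (i - 2%:Z) q & ocyc wt D i (iota w' - y q).
Proof.
move=> inj [hw Dw]; pose x : VV k N r.+1 := iota (act (e r) r w').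
have hx : hm wt (i - 1) x by apply: hm_cst0; case: ge => _ /(_ r (ltnSn r)) he; apply: hm_act hw.
have Dwx : D (iota w') = y x by rewrite DW_iota Dw linear0 add0r.
have [| |q hq xq] := inj x.
- split=> //; apply: (@yW_inj_hm (i - 1 + 1)); first exact: hm_DWx.
  by rewrite yW_D -Dwx DW_DW.
- by exists (iota w') => //; have := hm_cst0 hw; congr (hm wt); lia.
have hq' : hm wt (i - 2%:Z) q by move: hq; congr (hm wt); lia.
exists q => //; split; last by rewrite linearB Dwx xq yW_D subrr.
by apply: hmB; [apply: hm_cst0 | have := hm_yW u hq'; rewrite subrK].
Qed.

Lemma evp_big m m' i (w : VV k N r.+1) : hm wt i w -> (`|i - wt_lo wt| < m)%N -> (m <= m')%N ->
  evp u m' w = evp u m w.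
Proof. by move=> hw im mm; apply: evp_fin mm; apply: hm_fin hw im. Qed.

Lemma evp_D_hm i (w : VV k N r.+1) m : hm wt i w -> (`|i - wt_lo wt| < m)%N ->
  evp u m.+1 (D w) = D' (evp u m.+1 w).
Proof.
by move=> hw im; rewrite evp_DW ?(evp_big hw im (leqnSn m)) //; apply: hm_fin hw im.
Qed.

Lemma evp_y_hm i (w : VV k N r.+1) m : hm wt i w -> (`|i - wt_lo wt| < m)%N -> evp u m.+1 (y w) = 0.
Proof. by move=> hw im; apply: evp_yW; apply: hm_fin hw im. Qed.

(** Multiplication by the form gives a short exact sequence of complexes with quotient the complex
    in one variable less. Injectivity from degree [i - 2] makes the left map in degree [i]
    injective; injectivity from degree [i - 1] makes the connecting map vanish, which is
    [lift_cycle]. So the dimensions add up. *)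
Lemma wdim_regular (i : int) : y_injective_at (i - 2%:Z) -> y_injective_at (i - 1) ->
  wdim wt d e r.+1 i = (wdim wt d e r.+1 (i - 2%:Z) + wdim wt d e' r i)%N.
Proof.
move=> inj2 inj1.
apply: hdim_uniq (subsp_obd wt (DW d e r.+1) 1 i) (wdimP i xe ge) _.
(* The summand 5 leaves room for the neighbouring degrees, whose sequences are cut at the same
   length. *)
pose m := (`|i - wt_lo wt| + 5)%N.
have h1 := wdimP (i - 2%:Z) xe ge; have h3 := wdimP i xe' ge'.
refine (hdim_exact (f := y) (g := evpL N r u m.+1) _ _ _ _ _ _ _ _ _ _ _ _ h1 h3).
- exact: subsp_ocyc.
- exact: subsp_ocyc.
- exact: subsp_obd.
- exact: subsp_obd.
- by move=> w [hw Dw]; split; [have := hm_yW u hw; rewrite subrK | rewrite -yW_D Dw linear0].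
- move=> w [q hq ->]; exists (y q); last by rewrite yW_D.
  by have := hm_yW u hq; congr (hm wt); lia.
- by move=> w cw; have := inj2 w cw; rewrite subrK.
- move=> w [q hq ->]; exists (evp u m.+1 q); first exact: hm_evp.
  by rewrite -[LHS]/(evp u m.+1 (D q)) (evp_D_hm hq) // /m; lia.
- move=> w [hw _]; exists 0; first exact: hm0.
  by rewrite linear0 -[LHS]/(evp u m.+1 (y w)) (evp_y_hm hw) // /m; lia.
- move=> w [hw Dw]; split; first exact: hm_evp.
  by rewrite -[evpL _ _ _ _ w]/(evp u m.+1 w) -(evp_D_hm hw) ?Dw ?evp0 // /m; lia.
- move=> w [hw Dw] [q' hq' eq'].
  have fw : forall n, (m.+1 <= n)%N -> w n = 0 by apply: hm_fin hw _; rewrite /m; lia.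
  have hq1 : hm wt (i - 2%:Z) (iota (act (e r) r q')).
    apply: hm_cst0; case: ge => _ /(_ r (ltnSn r)) he; have := hm_act he hq'.
    by congr (hm wt); lia.
  (* Division leaves the remainder [D' q']. By [DW_iota] it is the boundary of [iota q'] up to the
     multiple of the form that is subtracted here. *)
  pose x := yquo u m.+1 w - iota (act (e r) r q').
  have hx : hm wt (i - 2%:Z) x by apply: hmB => //; apply: hm_yquo.
  have ex : w - y x = D (iota q').
    have e2 : evp u m.+1 w = D' q' := eq'.
    rewrite {1}(yquoE u fw) [y x]linearB DW_iota -e2; abel.
  exists x; last by exists (iota q') => //; apply: hm_cst0.
  split=> //; apply: (@yW_inj_hm (i - 2%:Z + 1)); first exact: hm_DWx.
  by rewrite yW_D -[y x](subKr w) ex linearB Dw sub0r DW_DW // oppr0.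
- move=> w' cw'; have [q hq cq] := lift_cycle inj1 cw'; exists (iota w' - y q) => //.
  exists 0; first exact: hm0.
  rewrite linear0 -[evpL _ _ _ _ _]/(evp u m.+1 (iota w' - y q)) evpB.
  rewrite (evp_y_hm hq) ?subr0; last by rewrite /m; lia.
  by rewrite evp_cst0 subrr.
Qed.

End Regular.
End ExtDim.

(** * Noetherian arguments *)

Lemma noeth_fg (A : comNzRingType) : noetherian_ring A ->
  forall n (U : 'rV[A]_n -> Prop), U 0 -> (forall x y, U x -> U y -> U (x + y)) ->
    (forall a x, U x -> U (a *: x)) ->
  exists m (G : 'M[A]_(m, n)), (forall i, U (row i G)) /\
    forall v, U v -> exists c : 'rV_m, v = c *m G.
Proof.
move=> nA; elim=> [|n IH] U U0 UD UZ.
  exists 0%N, 0; split=> [[]//|v _]; exists 0; apply/rowP; case=> //.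
pose h0 : 'I_n.+1 := lshift n (0 : 'I_1).
pose I x := exists2 v : 'rV[A]_n.+1, U v & v 0 h0 = x.
have [s Is] : exists s, I = ideal_gen s.
  apply: nA; split.
  - by exists 0 => //; rewrite mxE.
  - by move=> _ _ [v Uv <-] [w Uw <-]; exists (v + w); [apply: UD | rewrite mxE].
  - by move=> a _ [v Uv <-]; exists (a *: v); [apply: UZ | rewrite mxE].
have sI (i : 'I_(size s)) : exists v, U v /\ v 0 h0 = s`_i.
  suff : I s`_i by case=> v Uv ev; exists v.
  rewrite Is; exists (fun j => (j == i)%:R).
  rewrite (bigD1 i) //= eqxx mul1r big1 ?addr0 // => j /negbTE->.
  by rewrite mul0r.
have [v vP] := choice sI.
have [||| m [G [UG Gsp]]] := IH (fun w => U (row_mx (0 : 'M_1) w)).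
- by rewrite row_mx0.
- by move=> x y Ux Uy; rewrite -[0]addr0 -add_row_mx; apply: UD.
- by move=> a x Ux; rewrite -(scaler0 _ a) -scale_row_mx; apply: UZ.
exists (size s + m)%N, (col_mx (\matrix_i v i) (row_mx (0 : 'M_(m, 1)) G) : 'M_(_, n.+1)); split.
  move=> i; case: (split_ordP i) => j ->.
    by rewrite rowKu rowK; exact: (vP j).1.
  rewrite rowKd; suff -> : row j (row_mx (0 : 'M_(m, 1)) G : 'M_(_, n.+1)) = row_mx (0 : 'M_1) (row j G).
    exact: UG.
  by apply/rowP => l; rewrite !mxE; case: fintype.split => l'; rewrite !mxE.
move=> w Uw.
have [c cE] : ideal_gen s (w 0 h0) by rewrite -Is; exists w.
pose w' : 'rV[A]_(1 + n) := w - \sum_i c i *: v i.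
have Uw' : U w'.
  apply: (UD) => //; rewrite -scaleN1r; apply: (UZ).
  by apply: (big_ind U U0 UD) => i _; apply: (UZ); exact: (vP i).1.
have w'0 : w' = row_mx 0 (rsubmx w').
  rewrite -[LHS]hsubmxK; congr row_mx; apply/rowP => j; rewrite !mxE summxE ord1 cE.
  by apply/eqP; rewrite subr_eq0; apply/eqP/eq_bigr => i _; rewrite mxE (vP i).2.
have [|c' c'E] := Gsp (rsubmx w'); first by rewrite -w'0.
have mr := mul_mx_row c' (0 : 'M[A]_(m, 1)) G; rewrite mulmx0 in mr.
exists (row_mx (\row_i c i) c'); rewrite mul_row_col mr -c'E -w'0 /w'.
rewrite mulmx_sum_row; under eq_bigr do rewrite mxE rowK.
by rewrite addrC subrK.
Qed.

Lemma field_noeth (k : fieldType) : noetherian_ring k.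
Proof.
move=> I [I0 ID IM]; have [[a Ia a0]|nI] := pselect (exists2 a, I a & a != 0).
  exists [:: 1]; apply/seteqP; split=> x _ /=.
    by exists (fun => x); rewrite big_ord1 mulr1.
  by have := IM (x / a) _ Ia; rewrite divfK.
exists [::]; apply/seteqP; split=> x /=.
  move=> Ix; exists (fun => 0); rewrite big_ord0.
  by apply/eqP/negPn/negP => x0; apply: nI; exists x.
by move=> [c]; rewrite big_ord0 => ->.
Qed.

Section Chi.
Variables (R : comNzRingType) (N : nat) (wt : 'I_N -> int).
Notation V := (VV R N).

Definition chi l r : {linear V r -> V r} := linW N (fun m => (m == l)%:R) r.

Lemma linW_sum u r (w : V r) : linW N u r w = \sum_(l < r) u l *: chi l r w.
Proof.
elim: r u w => [|r IH] u w; first by rewrite big_ord0 linW0.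
apply/funext => n; rewrite fct_sumE linWE IH big_ord_recr /=.
congr (_ + _).
  apply: eq_bigr => l _; rewrite -[RHS]/(u l *: chi l r.+1 w n) /chi linWE.
  by case: n => [|n]; rewrite ?addr0 // gtn_eqF // scale0r addr0.
rewrite -[RHS]/(u r *: chi r r.+1 w n) /chi linWE (@linW_eq _ _ _ (fun => 0)).
  rewrite IH big1 ?add0r; last by move=> l _; rewrite scale0r.
  by case: n => [|n]; rewrite ?scaler0 // eqxx scale1r.
by move=> l lr; rewrite ltn_eqF.
Qed.

Lemma chi_lt l r (w : V r.+1) n : (l < r)%N -> chi l r.+1 w n = chi l r (w n).
Proof.
move=> lr; rewrite /chi linWE; case: n => [|n]; rewrite ?addr0 //.
by rewrite gtn_eqF // scale0r addr0.
Qed.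

Lemma chi_last r (w : V r.+1) n : chi r r.+1 w n = if n is n'.+1 then w n' else 0.
Proof.
rewrite /chi linWE (@linW_eq _ _ _ (fun => 0)); last by move=> l lr; rewrite ltn_eqF.
rewrite linW_sum big1 ?add0r => [|l _]; last by rewrite scale0r.
by case: n => [|n] //; rewrite eqxx scale1r.
Qed.

Lemma chi_sum_recr r (z : nat -> V r.+1) :
  \sum_(l < r.+1) chi l r.+1 (z l) = \sum_(l < r) chi l r.+1 (z l) + chi r r.+1 (z r).
Proof. exact: big_ord_recr. Qed.

Lemma hm_chi l r i (w : V r) : hm wt i w -> hm wt (i + 2%:Z) (chi l r w).
Proof. exact: hm_linW. Qed.

Lemma chiC l m r (w : V r) : chi l r (chi m r w) = chi m r (chi l r w).
Proof. exact: linW_DW. Qed.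

End Chi.

Section BoundedGeneration.
Variables (k : fieldType) (N : nat) (wt : 'I_N -> int).
Notation V := (VV k N).

Notation chi := (chi k N).

Lemma hm_span r i (U : V r -> Prop) : subsp U -> (forall w, U w -> hm wt i w) ->
  exists m (z : 'I_m -> V r), (forall j, U (z j)) /\
    forall w, U w -> exists c : 'I_m -> k, w = \sum_j c j *: z j.
Proof.
move=> sU hU.
have u0 : @unc _ wt r k i 0 = 0 := linear0 (uncL wt r k i).
have uD x y : @unc _ wt r k i (x + y) = unc x + unc y := linearD (uncL wt r k i) x y.
have uZ a x : @unc _ wt r k i (a *: x) = a *: unc x := linearZZ (uncL wt r k i) a x.
have [|||m [G [UG sp]]] := @noeth_fg k (@field_noeth k) _ (fun v => U (@unc _ wt r k i v)).
- by rewrite u0; apply: subsp0.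
- by move=> x y Ux Uy; rewrite uD; apply: subspD.
- by move=> a x Ux; rewrite uZ; apply: subspZ.
exists m, (fun j => unc (row j G)); split=> // w Uw.
have [|c cE] := sp (crd wt i w); first by rewrite crdK //; apply: hU.
exists (fun j => c 0 j); rewrite -[LHS](crdK (hU _ Uw)) cE mulmx_sum_row.
by rewrite -[LHS]/(uncL wt r k i _) linear_sum; apply: eq_bigr => j _; rewrite linearZ.
Qed.

Lemma bounded_seq (P : nat -> int -> Prop) n :
  (forall m i j, P m i -> i <= j -> P m j) -> (forall m, exists i, P m i) ->
  exists i, forall m, (m <= n)%N -> P m i.
Proof.
move=> Pm Pex; elim: n => [|n [i Pi]].
  by have [i Pi] := Pex 0%N; exists i => m; rewrite leqn0 => /eqP->.
have [j Pj] := Pex n.+1; exists (Num.max i j) => m.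
rewrite leq_eqVlt => /orP[/eqP->|]; first by apply: Pm Pj _; rewrite le_max lexx orbT.
by rewrite ltnS => /Pi/Pm; apply; rewrite le_max lexx.
Qed.

Definition graded_submod r (U : int -> V r -> Prop) :=
  [/\ forall i, subsp (U i), forall i w, U i w -> hm wt i w &
      forall i l w, (l < r)%N -> U i w -> U (i + 2%:Z) (chi l r w)].

Definition generated_at r (U : int -> V r -> Prop) i :=
  forall w, U i w -> exists z : nat -> V r, (forall l, U (i - 2%:Z) (z l)) /\
    w = \sum_(l < r) chi l r (z l).

(** The lowest coefficients in the last variable of elements of order at least [n], as in Hilbert's
    basis theorem. Lowest terms are used because each subtraction then raises the order, which the
    degree bounds. *)
Definition initials r (U : int -> V r.+1 -> Prop) n (i : int) (x : V r) :=
  exists w, [/\ U (i + (2 * n)%N%:Z) w, forall m, (m < n)%N -> w m = 0 & w n = x].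

Lemma initials_graded r (U : int -> V r.+1 -> Prop) n :
  graded_submod U -> graded_submod (initials U n).
Proof.
move=> [sU hU cU]; split=> [i|i x|i l x lr].
- split.
  + by exists 0; split=> //; apply: subsp0.
  + move=> _ _ [w [Uw w0 <-]] [w' [Uw' w'0 <-]]; exists (w + w'); split=> //.
      exact: subspD.
    by move=> m mn; rewrite vvD w0 // w'0 // addr0.
  + move=> a _ [w [Uw w0 <-]]; exists (a *: w); split=> //; first exact: subspZ.
    by move=> m mn; rewrite -[LHS]/(a *: w m) w0 // scaler0.
- by move=> [w [/hU hw _ <-]]; have := hw n; rewrite addrK.
- move=> [w [Uw w0 <-]]; exists (chi l r.+1 w); split.
  + have := cU _ l _ (ltnW lr) Uw; rewrite addrAC; exact.
  + by move=> m mn; rewrite chi_lt // w0 // linear0.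
  + exact: chi_lt.
Qed.

Lemma initials_mono r (U : int -> V r.+1 -> Prop) n n' i x :
  graded_submod U -> (n <= n')%N -> initials U n i x -> initials U n' i x.
Proof.
move=> [sU hU cU]; elim: n' => [|n' IH]; first by rewrite leqn0 => /eqP->.
rewrite leq_eqVlt => /orP[/eqP-> //|]; rewrite ltnS => nn /IH-/(_ nn) [w [Uw w0 <-]].
exists (chi r r.+1 w); split.
- by have := cU _ r _ (ltnSn r) Uw; congr U; lia.
- by move=> [|m] mn; rewrite chi_last // w0.
- by rewrite chi_last.
Qed.

Lemma hm_hi i (v : V 0) : hm wt i v -> (\sum_b `|wt b|)%N%:Z < i -> v = 0.
Proof.
move=> hv ib; apply/rowP => b; rewrite mxE; apply: hv => wb.
by move: ib; rewrite -wb (bigD1 b) //=; lia.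
Qed.

(** The union of the increasing chain is a graded submodule in one variable less, hence generated in
    bounded degrees. Up to that bound there are finitely many degrees, each of finite dimension, so
    one index serves them all; above it, generation propagates the index. *)
Lemma initials_stable r (U : int -> V r.+1 -> Prop) : graded_submod U ->
  (forall U' : int -> V r -> Prop, graded_submod U' ->
    exists i1 : int, forall i : int, i1 < i -> generated_at U' i) ->
  exists n0, forall n i x, initials U n i x -> initials U n0 i x.
Proof.
move=> gU IH; have gI := initials_graded _ gU.
pose Uo i x := exists n, initials U n i x.
have gUo : graded_submod Uo.
  split=> [i|i x [n xn]|i l x lr [n xn]].
  - split.
    + by exists 0%N; case: (gI 0%N) => s _ _; apply: subsp0.
    + move=> x y [n xn] [n' yn]; exists (maxn n n'); case: (gI (maxn n n')) => s _ _.
      by apply: subspD => //; [apply: initials_mono xn | apply: initials_mono yn];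
         rewrite ?leq_maxl ?leq_maxr.
    + by move=> a x [n xn]; exists n; case: (gI n) => s _ _; apply: subspZ.
  - by case: (gI n) => _ h _; apply: h.
  - by exists n; case: (gI n) => _ _; apply.
have [i1 gen] := IH _ gUo.
have step i : exists n, forall x, Uo i x -> initials U n i x.
  have [sUo hUo _] := gUo.
  have [m [z [Uz sp]]] := hm_span (sUo i) (hUo i).
  have [n nP] := choice Uz.
  exists (\max_j n j)%N => x /sp[c ->]; case: (gI (\max_j n j)%N) => s _ _.
  apply: subsp_sum => // j _; apply: subspZ => //.
  by apply: initials_mono (nP j) => //; apply: leq_bigmax.
have [n0 n0P] : exists n0, forall i x, wt_lo wt <= i -> i <= i1 -> Uo i x -> initials U n0 i x.
  have [n nP] := choice step.
  pose m := `|i1 - wt_lo wt|%N.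
  exists (\max_(j < m.+1) n (wt_lo wt + j%:Z)%R) => i x li il /nP xi.
  have jm : (`|i - wt_lo wt| < m.+1)%N by rewrite /m; lia.
  have ej : i = wt_lo wt + (Ordinal jm)%:Z by rewrite /=; lia.
  by apply: initials_mono xi => //; rewrite {1}ej; apply: (leq_bigmax (Ordinal jm)).
exists n0 => n i x xn.
have {n xn} : Uo i x by exists n.
have [s0 _ c0] := gI n0.
elim: {i}`|i - wt_lo wt|%N {-2}i (leqnn `|i - wt_lo wt|) x => [|j IHj] i ij x xi.
  have [li|li] := lerP (wt_lo wt) i; last first.
    by case: gUo => _ h _; rewrite (hm_lo (h _ _ xi) li); apply: subsp0.
  have [il|il] := lerP i i1; first exact: n0P.
  have [z [Uz ->]] := gen _ il _ xi.
  apply: subsp_sum => // l _; case: gUo => _ h _.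
  by rewrite (hm_lo (h _ _ (Uz l))) ?linear0; [apply: subsp0 | lia].
have [li|li] := lerP (wt_lo wt) i; last first.
  by case: gUo => _ h _; rewrite (hm_lo (h _ _ xi) li); apply: subsp0.
have [il|il] := lerP i i1; first exact: n0P.
have [z [Uz ->]] := gen _ il _ xi.
apply: subsp_sum => // l _.
have [li2|li2] := lerP (wt_lo wt) (i - 2%:Z); last first.
  by case: gUo => _ h _; rewrite (hm_lo (h _ _ (Uz l)) li2) linear0; apply: subsp0.
have := c0 _ l _ (ltn_ord l) (IHj (i - 2%:Z) _ _ (Uz l)); rewrite subrK; apply.
by lia.
Qed.

(** The graded form of Hilbert's basis theorem. For orders up to [n0] the lowest coefficient is a
    combination of multiples by the first [r] variables; beyond [n0] it already occurs in order
    [n.-1], so that the last variable can be split off. *)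
Lemma bounded_generation r (U : int -> V r -> Prop) : graded_submod U ->
  exists i1 : int, forall i : int, i1 < i -> generated_at U i.
Proof.
elim: r U => [|r IH] U gU.
  exists (\sum_b `|wt b|)%N%:Z => i ib w Uw; exists (fun => 0); case: gU => s h _.
  by split=> [l|]; [apply: subsp0 | rewrite big_ord0 (hm_hi (h _ _ Uw) ib)].
have [n0 stab] := initials_stable gU IH.
have [i' genI] : exists i', forall n, (n <= n0)%N -> forall i, i' < i -> generated_at (initials U n) i.
  apply: bounded_seq => [m i j Pi ij l jl|m]; first by apply: Pi; apply: le_lt_trans jl.
  exact/IH/initials_graded.
have [sU hU cU] := gU.
exists (i' + (2 * n0)%N%:Z) => i ii w Uw.
pose M := (`|i - wt_lo wt|).+1.
pose dec (w : V r.+1) := exists z : nat -> V r.+1, (forall l, U (i - 2%:Z) (z l)) /\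
    w = \sum_(l < r.+1) chi l r.+1 (z l).
have decD w1 w2 : dec w1 -> dec w2 -> dec (w1 + w2).
  move=> [z [Uz ->]] [z' [Uz' ->]]; exists (fun l => z l + z' l); split.
    by move=> l; apply: subspD.
  by rewrite -big_split; apply: eq_bigr => l _; rewrite linearD.
have dec0 : dec 0.
  by exists (fun => 0); split=> [l|]; [apply: subsp0 | rewrite big1 // => l _; rewrite linear0].
have UN l z : U (i - 2%:Z) z -> (l <= r)%N -> U i (chi l r.+1 z).
  by move=> Uz lr; have := cU _ l _ lr Uz; rewrite subrK.
suff main j : forall w, U i w -> (forall m, (m + j < M)%N -> w m = 0) -> dec w.
  by apply: (main M) => // m; lia.
elim: j => [|j IHj] {Uw}w Uw w0.
  suff -> : w = 0 by [].
  apply/funext => m; have [mM|Mm] := ltnP m M; first by apply: w0; rewrite addn0.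
  by apply: (hm_lo (hU _ _ Uw m)); rewrite /M in Mm; lia.
have [jM|Mj] := ltnP j M; last by apply: IHj => // m; lia.
pose n := (M - j.+1)%N.
have w0n m : (m < n)%N -> w m = 0 by move=> mn; apply: w0; rewrite /n in mn; lia.
have xn : initials U n (i - (2 * n)%N%:Z) (w n) by exists w; rewrite subrK.
have reduce v : U i v -> dec v -> (forall m, (m < n)%N -> v m = 0) -> v n = w n -> dec w.
  move=> Uv dv v0 vn; rewrite -[w](subrK v); apply: decD => //; apply: IHj.
    by apply: subspB.
  move=> m mj; rewrite vvB; have [mn|nm|->] := ltngtP m n; last by rewrite vn subrr.
    by rewrite w0n // v0 // subrr.
  by move: mj nm; rewrite /n; lia.
have [nn0|n0n] := leqP n n0.
  have [|z [Uz ez]] := genI n nn0 (i - (2 * n)%N%:Z) _ _ xn; first by lia.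
  have [v vP] := choice Uz.
  have Uv l : U (i - 2%:Z) (v l) by case: (vP l) => + _ _; congr U; lia.
  pose x := \sum_(l < r) chi l r.+1 (v l).
  apply: (reduce x).
  - by apply: subsp_sum => // l _; apply: UN => //; apply: ltnW.
  - exists (fun l => if l == r then 0 else v l); split=> [l|].
      by case: ifP => _ //; apply: subsp0.
    rewrite (chi_sum_recr (fun l => if l == r then 0 else v l)) eqxx linear0 addr0.
    by apply: eq_bigr => l _; rewrite ltn_eqF.
  - move=> m mn; rewrite /x fct_sumE big1 // => l _.
    by rewrite chi_lt //; have [_ v0 _] := vP l; rewrite v0 // linear0.
  - rewrite /x fct_sumE ez; apply: eq_bigr => l _.
    by rewrite chi_lt //; case: (vP l) => _ _ ->.
have {}xn : initials U n.-1 (i - (2 * n)%N%:Z) (w n).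
  by apply: initials_mono (stab _ _ _ xn) => //; lia.
have [v [Uv v0 vn]] := xn.
have Uv' : U (i - 2%:Z) v by move: Uv; congr U; lia.
have en : n = n.-1.+1 by lia.
apply: (reduce (chi r r.+1 v)).
- exact: UN.
- exists (fun l => if l == r then v else 0); split=> [l|].
    by case: ifP => _ //; apply: subsp0.
  rewrite (chi_sum_recr (fun l => if l == r then v else 0)) eqxx big1 ?add0r // => l _.
  by rewrite ltn_eqF // linear0.
- by move=> [|m] mn; rewrite chi_last // v0 //; lia.
- by rewrite -vn {1}en chi_last.
Qed.

End BoundedGeneration.

(** * A generic linear form is regular in high degrees *)

Section McCoy.
Variables (V : zmodType) (B : V -> Prop).
Hypothesis B0 : B 0.
Hypothesis BD : forall x y, B x -> B y -> B (x + y).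
Hypothesis BN : forall x, B x -> B (- x).

(** The coefficient of degree [a] in the product of the polynomials with coefficients [c] and
    [w]. *)
Definition conv (c : nat -> {additive V -> V}) t (w : nat -> V) a :=
  \sum_(l < t | (l <= a)%N) c l (w (a - l)%N).

Lemma convS c t w a : conv c t.+1 w a.+1 =
  c 0%N (w a.+1) + conv (fun l => c l.+1) t w a.
Proof.
rewrite /conv big_mkcond big_ord_recl /= subn0; congr (_ + _).
by rewrite [RHS]big_mkcond; apply: eq_bigr => l _; rewrite subSS.
Qed.

Lemma conv0 c t w : conv c t.+1 w 0%N = c 0%N (w 0%N).
Proof. by rewrite /conv big_mkcond big_ord_recl /= big1 ?addr0 // => l. Qed.

Lemma iterC (f g : {additive V -> V}) p x : (forall x, f (g x) = g (f x)) ->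
  iter p f (g x) = g (iter p f x).
Proof. by move=> fg; elim: p => //= p ->. Qed.

Lemma iter_add0 (f : {additive V -> V}) p : iter p f 0 = 0.
Proof. by elim: p => //= p ->; rewrite raddf0. Qed.

Lemma iter_addD (f : {additive V -> V}) p x y : iter p f (x + y) = iter p f x + iter p f y.
Proof. by elim: p => //= p ->; rewrite raddfD. Qed.

Lemma iter_addN (f : {additive V -> V}) p x : iter p f (- x) = - iter p f x.
Proof. by elim: p => //= p ->; rewrite raddfN. Qed.

Lemma iter_sum (f : {additive V -> V}) p I (s : seq I) (P : pred I) (x : I -> V) :
  iter p f (\sum_(i <- s | P i) x i) = \sum_(i <- s | P i) iter p f (x i).
Proof.
by elim/big_rec2: _ => [|i y z _ <-]; rewrite ?iter_add0 ?iter_addD.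
Qed.

Lemma iter_B (f : {additive V -> V}) p x : (forall x, B x -> B (f x)) -> B x -> B (iter p f x).
Proof. by move=> fB Bx; elim: p => //= p; apply: fB. Qed.

Lemma iter_ge (f : {additive V -> V}) p q x : (forall x, B x -> B (f x)) ->
  (p <= q)%N -> B (iter p f x) -> B (iter q f x).
Proof. by move=> fB pq; rewrite -(subnK pq) iterD; apply: iter_B. Qed.

(** The lowest operator [c 0] is nilpotent modulo [B] on each [w a], by induction on [a]. After
    applying a power of it the relation loses its first term, which permits an induction on the
    number of terms. *)
Lemma mccoy t (c : nat -> {additive V -> V}) w A :
  (forall i j x, c i (c j x) = c j (c i x)) -> (forall i x, B x -> B (c i x)) ->
  (forall a, (A <= a)%N -> w a = 0) -> (forall a, B (conv c t w a)) ->
  forall j, (j < t)%N -> exists p, forall a, B (iter p (c j) (w a)).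
Proof.
elim: t c w => // t IH c w cC cB w0 rel.
have conv_iter (f : {additive V -> V}) p v a : (forall i x, f (c i x) = c i (f x)) ->
    iter p f (conv c t.+1 v a) = conv c t.+1 (fun b => iter p f (v b)) a :> V.
  move=> fc; elim: p => //= p ->.
  by rewrite /conv raddf_sum; apply: eq_bigr => l _; rewrite fc.
have st1 a : B (iter a.+1 (c 0%N) (w a)).
  elim/ltn_ind: a => -[|a] IHa; first by have := rel 0%N; rewrite conv0.
  rewrite iterSr; have -> : c 0%N (w a.+1) = conv c t.+1 w a.+1 - conv (fun l => c l.+1) t w a.
    by rewrite convS addrK.
  rewrite iter_addD; apply: BD; first by apply: iter_B => //; apply: cB.
  rewrite iter_addN; apply: BN; rewrite /conv iter_sum.
  apply: (big_ind B) => // l la; rewrite (@iterC (c 0%N) (c l.+1)) //.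
  by apply/cB; apply: iter_ge (IHa (a - l)%N _); rewrite ?ltnS ?leq_subr //; apply: cB.
have st2 a : B (iter A (c 0%N) (w a)).
  have [Aa|aA] := leqP A a; first by rewrite w0 // iter_add0.
  by apply: iter_ge (st1 a) => //; apply: cB.
(* Induction on the power [s] of [c 0] that kills [v]. One power less, applied to [v], satisfies the
   relation without [c 0], hence is killed by a power of [c j.+1]; that power of [c j.+1] applied to
   [v] is then killed by the smaller power of [c 0]. *)
have main s : forall v, (forall a, (A <= a)%N -> v a = 0) -> (forall a, B (conv c t.+1 v a)) ->
    (forall a, B (iter s (c 0%N) (v a))) ->
    forall j, (j < t)%N -> exists p, forall a, B (iter p (c j.+1) (v a)).
  elim: s => [|s IHs] v v0 relv Bv j jt; first by exists 0%N.
  have rel' a : B (conv (fun l => c l.+1) t (fun b => iter s (c 0%N) (v b)) a).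
    have := relv a.+1; move/(@iter_B (c 0%N) s _ (cB 0%N)).
    rewrite conv_iter // convS -iterS => h.
    have := BD h (BN (Bv a.+1)); rewrite addrAC subrr add0r; exact.
  have [|p1 Bp1] := IH (fun l => c l.+1) _ (fun i j => cC i.+1 j.+1) (fun i => cB i.+1) _ rel' j jt.
    by move=> a Aa; rewrite v0 // iter_add0.
  have [||a|p2 Bp2] := IHs (fun b => iter p1 (c j.+1) (v b)) _ _ _ j jt.
  - by move=> a Aa; rewrite v0 // iter_add0.
  - by move=> a; rewrite -conv_iter //; apply: iter_B => //; apply: cB.
  - suff -> : iter s (c 0%N) (iter p1 (c j.+1) (v a)) =
      iter p1 (c j.+1) (iter s (c 0%N) (v a)) by [].
    by elim: (p1) => //= q <-; rewrite iterC.
  by exists (p2 + p1)%N => a; rewrite iterD.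
by move=> [_|j jt]; [exists A | apply: main st2 _ jt].
Qed.

End McCoy.

Section Component.
Variables (R : comNzRingType) (N : nat) (wt : 'I_N -> int).
Notation V := (VV R N).

Fixpoint hcomp r (i : int) : V r -> V r :=
  if r is r'.+1 then fun g n => hcomp (i - (2 * n)%N%:Z) (g n)
  else fun v => \row_b (if wt b == i then (v : 'rV[R]_N) 0 b else 0).

Lemma hm_hcomp r i (g : V r) : hm wt i (hcomp i g).
Proof.
elim: r i g => [|r IH] i g /=; last by move=> n; apply: IH.
by move=> b /eqP/negbTE wb; rewrite mxE wb.
Qed.

Lemma hcomp_id r i (g : V r) : hm wt i g -> hcomp i g = g.
Proof.
elim: r i g => [|r IH] i g /= hg; last by apply/funext => n; apply: IH.
by apply/rowP => b; rewrite mxE; case: eqP => // /hg.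
Qed.

Lemma hcompD r i (g g' : V r) : hcomp i (g + g') = hcomp i g + hcomp i g'.
Proof.
elim: r i g g' => [|r IH] i g g' /=; last by apply/funext => n; apply: IH.
by apply/rowP => b; rewrite !mxE; case: ifP => //; rewrite addr0.
Qed.

Lemma hcomp0 r i : hcomp i (0 : V r) = 0.
Proof. by apply: hcomp_id; apply: hm0. Qed.

Lemma hcomp_act r (s : int) (M : 'M[R]_N) (i : int) (g : V r) : mx_deg wt s M ->
  hcomp (i + s) (act M r g) = act M r (hcomp i g).
Proof.
move=> hM; elim: r i g => [|r IH] i g /=; last first.
  by apply/funext => n; rewrite addrAC; apply: IH.
apply/rowP => b; rewrite !mxE; case: eqP => wb; last first.
  rewrite big1 // => b' _; rewrite mxE; case: eqP => [wb'|]; last by rewrite mul0r.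
  by rewrite hM ?mulr0 // wb'.
apply: eq_bigr => b' _; rewrite mxE; case: eqP => // wb'.
by rewrite hM ?mulr0 // => e; apply: wb'; move: e; rewrite wb => /addIr.
Qed.

Lemma hcomp_DW r d (e : nat -> 'M[R]_N) i (g : V r) :
  mx_deg wt 1 d -> (forall l, (l < r)%N -> mx_deg wt (-1) (e l)) ->
  hcomp (i + 1) (DW d e r g) = DW d e r (hcomp i g).
Proof.
move=> hd; elim: r i g => [|r IH] i g he; first exact: (@hcomp_act 0).
apply/funext => n; rewrite DWE -[LHS]/(hcomp _ (DW d e r.+1 g n)) DWE hcompD; congr (_ + _).
  by rewrite addrAC IH // => l lr; apply: he; lia.
case: n => [|n]; first exact: hcomp0.
rewrite -(hcomp_act _ _ (he r (ltnSn r))).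
by congr (hcomp _ _); lia.
Qed.

End Component.

Section Coefficients.
Variables (k : fieldType) (N : nat) (wt : 'I_N -> int).

Fixpoint vcoef r (a : nat) : VV {poly k} N r -> VV k N r :=
  if r is r'.+1 then fun g n => vcoef a (g n)
  else fun v => \row_b ((v : 'rV[{poly k}]_N) 0 b)`_a.

Lemma vcoefD r a (g g' : VV {poly k} N r) : vcoef a (g + g') = vcoef a g + vcoef a g'.
Proof.
elim: r g g' => [|r IH] g g' /=; last by apply/funext => n; apply: IH.
by apply/rowP => b; rewrite !mxE coefD.
Qed.

Lemma vcoef0 r a : vcoef a (0 : VV {poly k} N r) = 0.
Proof.
elim: r => [|r IH] /=; last by apply/funext => n; apply: IH.
by apply/rowP => b; rewrite !mxE coef0.
Qed.

Lemma vcoef_sum r a I (s : seq I) (P : pred I) (g : I -> VV {poly k} N r) :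
  vcoef a (\sum_(j <- s | P j) g j) = \sum_(j <- s | P j) vcoef a (g j).
Proof. by elim/big_rec2: _ => [|j x y _ <-]; rewrite ?vcoef0 ?vcoefD. Qed.

Lemma vcoef_Xn r a n (g : VV {poly k} N r) :
  vcoef a ('X^n *: g) = if (n <= a)%N then vcoef (a - n) g else 0.
Proof.
elim: r g => [|r IH] g /=.
  apply/rowP => b; rewrite !mxE coefXnM ltnNge.
  by case: (n <= a)%N; rewrite mxE.
by apply/funext => m; rewrite -[_ m]/('X^n *: g m) IH; case: ifP.
Qed.

Lemma vcoef_act r a (M : 'M[k]_N) (g : VV {poly k} N r) :
  vcoef a (act (map_mx polyC M) r g) = act M r (vcoef a g).
Proof.
elim: r g => [|r IH] g /=; last by apply/funext => n; apply: IH.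
apply/rowP => b; rewrite !mxE coef_sum; apply: eq_bigr => b' _.
by rewrite !mxE coefMC.
Qed.

Lemma vcoef_DW r a d (e : nat -> 'M[k]_N) (g : VV {poly k} N r) :
  vcoef a (DW (map_mx polyC d) (fun l => map_mx polyC (e l)) r g) = DW d e r (vcoef a g).
Proof.
elim: r g => [|r IH] g; first exact: (@vcoef_act 0).
apply/funext => n; rewrite DWE -[LHS]/(vcoef a (DW _ _ r.+1 g n)) DWE vcoefD IH.
by congr (_ + _); case: n => [|n]; [apply: vcoef0 | apply: vcoef_act].
Qed.

Lemma hm_vcoef r a i (g : VV {poly k} N r) : hm wt i g -> hm wt i (vcoef a g).
Proof.
elim: r i g => [|r IH] i g /= hg; last by move=> n; apply: IH.
by move=> b wb; rewrite mxE hg // coef0.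
Qed.

Lemma vcoef_fin r i (g : VV {poly k} N r) : hm wt i g ->
  exists A, forall a, (A <= a)%N -> vcoef a g = 0.
Proof.
elim: r i g => [|r IH] i g hg.
  exists (\max_b size ((g : 'rV__) 0%R b)) => a Aa; apply/rowP => b; rewrite !mxE.
  by apply: nth_default; apply: leq_trans Aa; apply: (leq_bigmax b).
have [A AP] := choice (fun n => IH _ _ (hg n)).
pose m := `|i - wt_lo wt|.+1.
exists (\max_(n < m) A n)%N => a Aa; apply/funext => n /=.
have [nm|mn] := ltnP n m.
  by apply: AP; apply: leq_trans Aa; apply: (leq_bigmax (Ordinal nm)).
by rewrite (hm_fin hg (ltnSn _) mn) vcoef0.
Qed.

End Coefficients.

(** * Classes killed by powers of all variables vanish in high degrees *)

Section Torsion.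
Variables (k : fieldType) (N : nat) (wt : 'I_N -> int) (r : nat).
Variables (d : 'M[k]_N) (e : nat -> 'M[k]_N).
Hypothesis ge : gr_ext wt 1 r d e.
Notation D := (DW d e r).
Notation chi := (chi k N).

Definition bdry (x : VV k N r) := exists q, x = D q.

Lemma subsp_bdry : subsp bdry.
Proof.
split=> [|_ _ [q ->] [q' ->]|a _ [q ->]].
- by exists 0; rewrite linear0.
- by exists (q + q'); rewrite linearD.
- by exists (a *: q); rewrite linearZ.
Qed.

Lemma chi_bdry l x : bdry x -> bdry (chi l r x).
Proof. by move=> [q ->]; exists (chi l r q); rewrite /chi linW_DW. Qed.

Lemma bdry_hm i x : hm wt i x -> bdry x -> obd wt D 1 i x.
Proof.
move=> hx [q xq]; exists (hcomp wt (i - 1) q); first exact: hm_hcomp.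
by case: ge => hd he; rewrite -hcomp_DW // -xq subrK hcomp_id.
Qed.

Definition tors i w := [/\ hm wt i w, D w = 0 &
  forall l, (l < r)%N -> exists p, bdry (iter p (chi l r) w)].

Lemma iter_bdry l p q w : (p <= q)%N -> bdry (iter p (chi l r) w) -> bdry (iter q (chi l r) w).
Proof.
by move=> /subnK <-; rewrite iterD; elim: (q - p)%N => //= m IH /IH; apply: chi_bdry.
Qed.

Lemma iter_chi_linear l p a x y :
  iter p (chi l r) (a *: x + y) = a *: iter p (chi l r) x + iter p (chi l r) y.
Proof. by elim: p => //= p ->; rewrite linearP. Qed.

Lemma iter_chi0 l p : iter p (chi l r) 0 = 0.
Proof. by elim: p => //= p ->; rewrite linear0. Qed.

Lemma iter_chiC l m p x : iter p (chi l r) (chi m r x) = chi m r (iter p (chi l r) x).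
Proof. by elim: p => //= p ->; rewrite chiC. Qed.

Lemma tors_graded : graded_submod wt tors.
Proof.
have sB := subsp_bdry.
have lin i a x y : tors i x -> tors i y -> tors i (a *: x + y).
  move=> [hx Dx tx] [hy Dy ty]; split.
  - by apply: hmD => //; apply: hmZ.
  - by rewrite linearP Dx Dy scaler0 addr0.
  - move=> l lr; have [p Bp] := tx l lr; have [q Bq] := ty l lr.
    exists (p + q)%N; rewrite iter_chi_linear; apply: subspD => //.
      by apply: subspZ => //; apply: iter_bdry Bp; rewrite leq_addr.
    by apply: iter_bdry Bq; rewrite leq_addl.
have t0 i : tors i 0.
  split; rewrite ?linear0 //; first exact: hm0.
  by move=> l _; exists 0%N; apply: subsp0.
split=> [i|i w []//|i l w lr [hw Dw tw]].
- split=> // [x y tx ty|a x tx]; first by rewrite -[x]scale1r; apply: lin.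
  by rewrite -[_ *: x]addr0; apply: lin.
- split; first exact: hm_chi.
    by rewrite /chi linW_DW Dw linear0.
  move=> m mr; have [p Bp] := tw m mr; exists p; rewrite iter_chiC.
  exact: chi_bdry.
Qed.

Definition chis (s : seq nat) (w : VV k N r) := foldr (fun l => chi l r) w s.

Lemma chis_linear s a x y : chis s (a *: x + y) = a *: chis s x + chis s y.
Proof. by elim: s => //= l s ->; rewrite linearP. Qed.

Lemma chis_sum s I (t : seq I) (P : pred I) (g : I -> VV k N r) :
  chis s (\sum_(j <- t | P j) g j) = \sum_(j <- t | P j) chis s (g j).
Proof.
have s0 : chis s 0 = 0 by elim: s => //= l s ->; rewrite linear0.
elim/big_rec2: _ => [|j x y _ <-] //.
by rewrite -[g j]scale1r chis_linear !scale1r.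
Qed.

Lemma chis_count s l w : chis s w =
  chis [seq m <- s | m != l] (iter (count_mem l s) (chi l r) w).
Proof.
have chisC s' m x : chis s' (chi m r x) = chi m r (chis s' x).
  by elim: s' => //= l' s' ->; rewrite chiC.
elim: s => // m s IH; rewrite -[LHS]/(chi m r (chis s w)) IH /=.
have [->|ml] := eqVneq m l; last by rewrite add0n.
by rewrite -[iter (true + _)%N _ _]/(chi l r (iter (count_mem l s) (chi l r) w)) chisC.
Qed.

Lemma pigeon s P : (0 < P)%N -> all (fun l => l < r)%N s -> (r * P <= size s)%N -> (0 < size s)%N ->
  exists2 l, (l < r)%N & (P <= count_mem l s)%N.
Proof.
move=> P0 sr rs s0.
have [/existsP[l]|] := boolP [exists l : 'I_r, P <= count_mem (l : nat) s]%N.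
  by exists l.
rewrite negb_exists => /forallP nP; exfalso.
have : (size s <= \sum_(l < r) P.-1)%N.
  have -> : size s = (\sum_(l < r) count_mem (l : nat) s)%N.
    elim: s sr {rs s0 nP} => [|m s IH] /=; first by rewrite big1.
    move=> /andP[mr sr]; rewrite IH // big_split /=.
    have -> : (\sum_(l < r) (m == l :> nat) = 1)%N; last by rewrite add1n.
    rewrite (bigD1 (Ordinal mr)) //= eqxx big1 // => l.
    by rewrite -val_eqE /= eq_sym => /negbTE->.
  by apply: leq_sum => l _; have := nP l; rewrite -ltnNge; lia.
rewrite sum_nat_const card_ord => h.
have r0 : (0 < r)%N by case: (s) sr s0 => //= m s' /andP[mr _] _; lia.
by move: rs h; case: P P0 {nP} => // P _ /=; nia.
Qed.

(** Torsion classes form a graded submodule, hence are generated in bounded degrees. In high degrees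
    they are combinations of long monomials applied to torsion classes of degree [i1] or [i1 - 1],
    one for each parity. By the pigeonhole principle such a monomial contains a variable to a power
    [P] that kills these finitely generated pieces. *)
Lemma tors_vanish : exists i0 : int, forall (i : int) w, i0 <= i -> tors i w -> obd wt D 1 i w.
Proof.
have [i1 gen] := bounded_generation tors_graded.
have sB := subsp_bdry.
have unif (i : int) : exists P, forall w l, tors i w -> (l < r)%N -> bdry (iter P (chi l r) w).
  have [sT hT _] := tors_graded.
  have [m [z [Uz sp]]] := hm_span (sT i) (hT i).
  have ex (x : 'I_m * 'I_r) : exists p, bdry (iter p (chi x.2 r) (z x.1)).
    by case: (Uz x.1) => _ _; apply.
  have [p pP] := choice ex.
  have [Q hQ] : exists Q, forall x, (p x <= Q)%N by exists (\max_x p x)%N => x; apply: leq_bigmax.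
  exists Q => w l /sp[c ->] lr.
  elim/big_rec: _ => [|j y _ IH]; first by rewrite iter_chi0; apply: subsp0.
  rewrite iter_chi_linear; apply: subspD => //; apply: subspZ => //.
  exact: iter_bdry (hQ _) (pP (j, Ordinal lr)).
have [P0 hP0] := unif i1; have [P1 hP1] := unif (i1 - 1).
pose P := (P0 + P1).+1.
have hP (j : int) : (j == i1) || (j == i1 - 1) -> forall w l, tors j w -> (l < r)%N ->
    bdry (iter P (chi l r) w).
  by move=> /orP[/eqP->|/eqP->] w l tw lr; [apply: iter_bdry (hP0 w l tw lr)
    | apply: iter_bdry (hP1 w l tw lr)]; rewrite /P; lia.
(* The word [s] records the variables already split off and [t] counts those still to be split off;
   their total exceeds [r * P]. *)
have main t : forall j : int, (j == i1) || (j == i1 - 1) ->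
   forall w s, tors (j + (2 * t)%N%:Z) w -> all (fun l => l < r)%N s ->
   ((r * P).+1 <= size s + t)%N -> bdry (chis s w).
  elim: t => [|t IH] j ij w s.
    rewrite addr0 addn0 => tw sr rs.
    have [l lr Pl] : exists2 l, (l < r)%N & (P <= count_mem l s)%N.
      by apply: pigeon => //; lia.
    rewrite (chis_count s l).
    elim: [seq m <- s | m != l] => /= [|m s' IH]; last exact: chi_bdry.
    by apply: iter_bdry Pl (hP j ij w l tw lr).
  move=> tw sr rs.
  have ji : i1 < j + (2 * t.+1)%N%:Z by case/orP: ij => /eqP->; lia.
  have [z [Uz ->]] := gen _ ji _ tw.
  rewrite chis_sum; apply: subsp_sum => // l _.
  rewrite -[chi l r (z l)]/(chis [:: (l : nat)] (z l)) /chis -foldr_cat -/(chis _ _).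
  apply: IH ij _ _ _ _ _.
  - by have := Uz l; congr tors; lia.
  - by rewrite all_cat sr /= ltn_ord.
  - by rewrite size_cat /=; lia.
exists (i1 + (2 * (r * P).+1)%N%:Z) => i w ii tw.
apply: bdry_hm; first by case: tw.
pose n := `|i - i1|%N; have hn := odd_double_half n.
pose t := (n./2 + odd n)%N; pose j := i - (2 * t)%N%:Z.
have ej : (j == i1) || (j == i1 - 1) by rewrite /j /t; case: (odd n) hn => /=; lia.
apply: (main t j ej w [::]) => //; first by rewrite subrK.
by rewrite add0n /t; case: (odd n) hn => /=; lia.
Qed.

End Torsion.

(** * The generic linear form over a field of rational functions *)

Section Generic.
Variables (k : fieldType) (N : nat) (wt : 'I_N -> int).
Notation K := {fraction {poly k}}.
Notation tof := (@tofrac {poly k}).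

Lemma fracE (x : K) : exists n d : {poly k}, d != 0 /\ tof d * x = tof n.
Proof.
elim/quotW: x => x; exists \n_x, \d_x; split; first exact: denom_ratioP.
rewrite /tofrac; unlock; rewrite !piE /=; apply/eqmodP => /=.
rewrite /FracField.equivf_def /= /FracField.mulf.
rewrite !numden_Ratio ?mul1r ?mulr1 ?oner_eq0 ?denom_ratioP //.
by rewrite FracField.equivfE !numden_Ratio ?oner_eq0 ?denom_ratioP // mulr1.
Qed.

Lemma clear_den r i (g : VV K N r) : hm wt i g ->
  exists a (g' : VV {poly k} N r), [/\ a != 0, hm wt i g' & vmap tof g' = tof a *: g].
Proof.
elim: r i g => [|r IH] i g hg.
  have [n nP] := choice (fun b : 'I_N => fracE ((g : 'rV_N) 0 b)).
  have [d dP] := choice nP.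
  exists (\prod_b d b), (\row_b (if wt b == i then n b * \prod_(c | c != b) d c else 0)); split.
  - by apply/prodf_neq0 => b _; case: (dP b).
  - by move=> b /eqP/negbTE wb; rewrite mxE wb.
  - apply/rowP => b; rewrite !mxE; case: eqP => wb; last by rewrite hg // mulr0 rmorph0.
    by rewrite [in RHS](bigD1 b) //= !tofracM -(dP b).2 mulrAC.
have [a aP] := choice (fun n => IH _ _ (hg n)).
have [g' gP] := choice aP.
pose m := `|i - wt_lo wt|.+1.
exists (\prod_(n < m) a n), (fun n => if (n < m)%N then (\prod_(l < m | (l : nat) != n) a l) *: g' n else 0); split.
- by apply/prodf_neq0 => b _; case: (gP b).
- by move=> n; case: ifP => _; [apply: hmZ; case: (gP n) | apply: hm0].
- apply/funext => n; rewrite -[LHS]/(vmap _ (if _ then _ else _)) -[RHS]/(_ *: g n).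
  case: ltnP => nm; last by rewrite vmap0 (hm_fin hg (ltnSn _) nm) scaler0.
  rewrite vmapZ; have [_ _ ->] := gP n; rewrite scalerA -tofracM mulrC.
  by rewrite [in RHS](bigD1 (Ordinal nm)).
Qed.

Lemma vmap_inj r (g : VV {poly k} N r) : vmap tof g = 0 -> g = 0.
Proof.
move=> g0; apply: ent_ext => a b _; rewrite ent0.
by have := congr1 (fun f => ent f a b) g0; rewrite ent_vmap ent0 => /eqP; rewrite tofrac_eq0 => /eqP.
Qed.

Lemma ent_vcoef r a (g : VV {poly k} N r) s b : ent (vcoef a g) s b = (ent g s b)`_a.
Proof.
elim: r g s => [|r IH] g s /=; first by rewrite mxE.
by case: s => [|n s]; rewrite ?coef0 // IH.
Qed.

Lemma vcoef_sumX r (g : VV {poly k} N r) A : (forall a, (A <= a)%N -> vcoef a g = 0) ->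
  g = \sum_(a < A) 'X^a *: vmap polyC (vcoef a g).
Proof.
move=> gA; apply: ent_ext => s b _; rewrite ent_sum; apply/polyP => n.
rewrite coef_sum; under eq_bigr do rewrite entZ ent_vmap ent_vcoef mulrC coefMXn coefC.
have [nA|An] := ltnP n A.
  rewrite (bigD1 (Ordinal nA)) //= ltnn subnn eqxx big1 ?addr0 // => l.
  rewrite -val_eqE /= => ln; case: ltnP => // ln'.
  by rewrite subn_eq0 leqNgt ltn_neqAle ln' ln.
rewrite -ent_vcoef gA // ent0 big1 // => l _.
have ln : (l < n)%N by apply: leq_trans An.
by rewrite ltnNge (ltnW ln) /= subn_eq0 leqNgt ln.
Qed.

Lemma vmap_linW (R R' : comNzRingType) (f : {rmorphism R -> R'}) u r (g : VV R N r) :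
  vmap f (linW N u r g) = linW N (fun l => f (u l)) r (vmap f g).
Proof.
rewrite /linW vmap_DW map_mx0; congr (DW _ _ _ _).
by apply/funext => l; rewrite map_scalar_mx.
Qed.

Lemma vcoef_chi r a l (g : VV {poly k} N r) :
  vcoef a (chi {poly k} N l r g) = chi k N l r (vcoef a g).
Proof.
rewrite /chi /linW -vcoef_DW map_mx0; congr (vcoef a (DW _ _ _ _)).
by apply/funext => m; rewrite map_scalar_mx; case: (m == l).
Qed.

Variables (r : nat) (d : 'M[k]_N) (e : nat -> 'M[k]_N).
Hypothesis xe : is_ext r.+1 d e.
Hypothesis ge : gr_ext wt 1 r.+1 d e.

Definition gen_map : {rmorphism k -> K} := tof \o polyC.
(** Exponents start at 1 because the last variable has coefficient 1, the power of exponent 0. The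
    form is then a polynomial in the transcendental whose coefficients are the variables, in the
    order of [cs] below. *)
Definition gen_form l : K := tof ('X^(l.+1)).

Notation dK := (map_mx gen_map d).
Notation eK := (fun l => map_mx gen_map (e l)).
Notation dP := (map_mx polyC d).
Notation eP := (fun l => map_mx polyC (e l)).

Let cs l : {additive VV k N r.+1 -> VV k N r.+1} :=
  if l is l'.+1 then chi k N l' r.+1 else chi k N r r.+1.

Lemma vcoef_y a (g : VV {poly k} N r.+1) :
  vcoef a (yW N r (fun l => 'X^(l.+1)) g) = conv cs r.+1 (fun b => vcoef b g) a.
Proof.
rewrite /yW linW_sum big_ord_recr vcoefD vcoef_sum addrC.
rewrite /conv [RHS]big_mkcond [RHS]big_ord_recl subn0; congr (_ + _).
  by rewrite /monic_form eqxx scale1r vcoef_chi.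
apply: eq_bigr => l _.
have -> : monic_form r (fun l => 'X^(l.+1)) (widen_ord (leqnSn r) l) = 'X^(l.+1) :> {poly k}.
  by rewrite /monic_form /= ltn_eqF.
rewrite vcoef_Xn lift0.
by case: ifP => // _; rewrite vcoef_chi.
Qed.

(** After clearing denominators, the relation lives over polynomials, and its coefficients say that
    a product is a boundary over [k], because [d] and [e] have entries in [k]. McCoy's argument
    makes every coefficient of [W] torsion, hence a boundary in high degrees, and these boundaries
    are reassembled over the function field. *)
Lemma generic_regular : exists i0 : int, forall i : int, i0 <= i ->
  y_injective_at wt r dK eK gen_form i.
Proof.
have [i0 van] := tors_vanish ge; exists i0 => i ii w [hw Dw] [q hq yq].
have [a1 [w1 [a10 hw1 ew1]]] := clear_den hw.
have [a2 [q1 [a20 hq1 eq1]]] := clear_den hq.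
pose W : VV {poly k} N r.+1 := a2 *: w1; pose Q : VV {poly k} N r.+1 := a1 *: q1.
have a0 : a1 * a2 != 0 by rewrite mulf_neq0.
have eW : vmap tof W = tof (a1 * a2) *: w by rewrite vmapZ ew1 scalerA -tofracM mulrC.
have eQ : vmap tof Q = tof (a1 * a2) *: q by rewrite vmapZ eq1 scalerA -tofracM.
have dKE : dK = map_mx tof dP by rewrite -map_mx_comp.
have eKE : eK = fun l => map_mx tof (eP l) by apply/funext => l; rewrite -map_mx_comp.
have DPE (g : VV {poly k} N r.+1) : vmap tof (DW dP eP r.+1 g) = DW dK eK r.+1 (vmap tof g).
  by rewrite vmap_DW dKE eKE.
have DPW : DW dP eP r.+1 W = 0 by apply: vmap_inj; rewrite DPE eW linearZ_LR Dw scaler0.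
have yPE : vmap tof (yW N r (fun l => 'X^(l.+1)) W) = yW N r gen_form (vmap tof W).
  rewrite /yW vmap_linW; apply: linW_eq => l _; rewrite /monic_form.
  by case: ifP => //; rewrite rmorph1.
have yPW : yW N r (fun l => 'X^(l.+1)) W = DW dP eP r.+1 Q.
  apply/eqP; rewrite -subr_eq0; apply/eqP/vmap_inj.
  rewrite vmapD -scaleN1r vmapZ rmorphN1 scaleN1r yPE DPE eW eQ.
  by rewrite !linearZ_LR yq -linearZ_LR subrr.
have [A WA] := vcoef_fin hw1.
have [A' WA'] : exists A, forall a, (A <= a)%N -> vcoef a W = 0.
  by apply: (@vcoef_fin _ _ wt _ i); apply: hmZ.
have tW a : tors wt d e i (vcoef a W).
  have hW : hm wt i (vcoef a W) by apply: hm_vcoef; apply: hmZ.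
  split=> // [|l lr]; first by rewrite -vcoef_DW DPW vcoef0.
  have sB := subsp_bdry r.+1 d e.
  have csC i1 j x : cs i1 (cs j x) = cs j (cs i1 x).
    by case: i1 j => [|i1] [|j]; apply: chiC.
  have csB j x : bdry d e x -> bdry d e (cs j x).
    by case: j => [|j]; apply: chi_bdry.
  have rel b : bdry d e (conv cs r.+1 (fun b => vcoef b W) b).
    by rewrite -vcoef_y yPW; exists (vcoef b Q); rewrite vcoef_DW.
  have mc := mccoy (subsp0 sB) (subspD sB) (fun x => @subspN _ _ _ x sB) csC csB WA' rel.
  have [lr'|lr'] := eqVneq l r.
    by have [p pP] := mc 0%N (ltn0Sn _); exists p; rewrite lr'; apply: pP.
  have lr2 : (l.+1 < r.+1)%N by lia.
  by have [p pP] := mc _ lr2; exists p; apply: (pP a).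
have bW a : exists q', hm wt (i - 1) q' /\ vcoef a W = DW d e r.+1 q'.
  by have [q' hq' eq'] := van i _ ii (tW a); exists q'.
have [q' q'P] := choice bW.
exists ((tof (a1 * a2))^-1 *: \sum_(a < A') tof ('X^a) *: vmap gen_map (q' a)).
  apply: hmZ; apply: hm_sum => a _; apply: hmZ; apply: hm_vmap; by case: (q'P a).
rewrite linearZ_LR linear_sum.
apply: (scalerI (a := tof (a1 * a2))); first by rewrite tofrac_eq0.
rewrite scalerA divff ?tofrac_eq0 // scale1r -eW.
rewrite {1}(vcoef_sumX WA').
have vs I (s : seq I) (P : pred I) (g : I -> VV {poly k} N r.+1) :
    vmap tof (\sum_(j <- s | P j) g j) = \sum_(j <- s | P j) vmap tof (g j).
  by elim/big_rec2: _ => [|j x y _ <-]; rewrite ?vmap0 ?vmapD.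
rewrite vs; apply: eq_bigr => a _.
rewrite vmapZ linearZ_LR; congr (_ *: _).
have [_ ->] := q'P a; rewrite -[DW dK eK r.+1 _]vmap_DW.
by apply: ent_ext => s b _; rewrite !ent_vmap.
Qed.

End Generic.

(** * The Tate complex *)

Section Norm.
Variables (k : comNzRingType) (N : nat).
Implicit Types (d : 'M[k]_N) (e : nat -> 'M[k]_N).
Notation V := (VV k N).

Fixpoint nu e s : 'M[k]_N := if s is s'.+1 then nu e s' *m e s' else 1%:M.

Lemma mulmx_anti (E : 'M[k]_N) e s :
  (forall l, (l < s)%N -> E *m e l = - (e l *m E)) -> E *m nu e s = (-1) ^+ s *: (nu e s *m E).
Proof.
elim: s => [|s IH] Ee /=; first by rewrite mulmx1 mul1mx expr0 scale1r.
rewrite mulmxA IH; last by move=> l ls; apply: Ee; lia.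
by rewrite -scalemxAl -mulmxA Ee // mulmxN scalerN exprS mulN1r scaleNr mulmxA.
Qed.

Lemma nu_e0 r d e s l : is_ext r d e -> (s <= r)%N -> (l < s)%N -> nu e s *m e l = 0.
Proof.
move=> [_ _ ee e2]; elim: s => // s IH sr; rewrite ltnS leq_eqVlt => /orP[/eqP->|ls] /=.
  by rewrite -mulmxA e2 // mulmx0.
rewrite -mulmxA; have /eqP := ee s l sr (leq_trans ls (ltnW sr)).
by rewrite addr_eq0 => /eqP->; rewrite mulmxN mulmxA IH ?mul0mx ?oppr0 //; apply: ltnW.
Qed.

Lemma ext_anti r d e l m : is_ext r d e -> (l < r)%N -> (m < r)%N ->
  e l *m e m = - (e m *m e l).
Proof. by move=> [_ _ ee _] lr mr; apply/eqP; rewrite -addr_eq0 ee. Qed.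

Lemma ext_anti_d r d e l : is_ext r d e -> (l < r)%N -> d *m e l = - (e l *m d).
Proof. by move=> [_ de _ _] lr; apply/eqP; rewrite -addr_eq0 de. Qed.

Lemma e_nu0 r d e l : is_ext r d e -> (l < r)%N -> e l *m nu e r = 0.
Proof.
move=> xe lr; rewrite mulmx_anti; first by rewrite (nu_e0 xe) // scaler0.
by move=> m mr; apply: (ext_anti xe).
Qed.

Lemma d_nu r d e : is_ext r d e -> d *m nu e r = (-1) ^+ r *: (nu e r *m d).
Proof. by move=> xe; apply: mulmx_anti => l lr; apply: (ext_anti_d xe). Qed.

(** The corrections [u l *: e r] are absorbed by the final factor, since [e r] anticommutes with the
    others and squares to zero. *)
Lemma nu_sub r d e u s : is_ext r.+1 d e -> (s <= r)%N ->
  nu (fun l => e l - u l *: e r) s *m e r = nu e s *m e r.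
Proof.
move=> xe; elim: s => // s IH sr /=.
rewrite -!mulmxA mulmxBl -scalemxAl; have [_ _ _ e2] := xe; rewrite e2 // scaler0 subr0.
have sr1 : (s < r.+1)%N by apply: ltnW.
rewrite (ext_anti xe sr1 (ltnSn r)) !mulmxN; congr (- _).
by rewrite !mulmxA IH //; apply: ltnW.
Qed.

Fixpoint top s : V s -> 'rV[k]_N := if s is s'.+1 then fun g => top (g 0%N) else fun v => v.

Fixpoint emb s (x : 'rV[k]_N) : V s := if s is s'.+1 then cst0 (V s') (emb s' x) else x.

Lemma top_linear s : linear (@top s).
Proof. by elim: s => [|s IH] a x y //=; apply: (IH a (x 0%N) (y 0%N)). Qed.

Lemma emb_linear s : linear (@emb s).
Proof.
elim: s => [|s IH] a x y //=; apply/funext => n.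
have h : a *: (0 : V s) + 0 = 0 by rewrite scaler0 addr0.
by case: n => [|n]; [exact: IH | exact: esym h].
Qed.

Definition topL s : {linear V s -> 'rV[k]_N} := mkhom (@top_linear s).
Definition embL s : {linear 'rV[k]_N -> V s} := mkhom (@emb_linear s).

Lemma topD s (x y : V s) : top (x + y) = top x + top y. Proof. exact: (linearD (topL s)). Qed.
Lemma topN s (x : V s) : top (- x) = - top x. Proof. exact: (linearN (topL s)). Qed.
Lemma topZ s a (x : V s) : top (a *: x) = a *: top x. Proof. exact: (linearZ_LR (topL s)). Qed.
Lemma top0 s : top (0 : V s) = 0. Proof. exact: (linear0 (topL s)). Qed.
Lemma embD s x y : emb s (x + y) = emb s x + emb s y. Proof. exact: (linearD (embL s)). Qed.
Lemma embN s x : emb s (- x) = - emb s x. Proof. exact: (linearN (embL s)). Qed.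
Lemma embZ s a x : emb s (a *: x) = a *: emb s x. Proof. exact: (linearZ_LR (embL s)). Qed.
Lemma emb0 s : emb s 0 = 0. Proof. exact: (linear0 (embL s)). Qed.

Lemma top_act (M : 'M[k]_N) s (g : V s) : top (act M s g) = top g *m M.
Proof. by elim: s g => [|s IH] g //; apply: (IH (g 0%N)). Qed.

Lemma top_DG d e s (M M' : 'M[k]_N) t (g : V s) : (forall l, (l < s)%N -> e l *m M = t l *: M') ->
  top (DG d e s g) *m M = top g *m d *m M + top (linG N t s g) *m M'.
Proof.
elim: s g => [|s IH] g eM; first by rewrite linG0 /= mul0mx addr0.
rewrite -[top (DG d e s.+1 g)]/(top (DG d e s.+1 g 0%N)) -[top g]/(top (g 0%N)).
rewrite -[top (linG N t s.+1 g)]/(top (linG N t s.+1 g 0%N)) DGE linGE.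
rewrite !topD !mulmxDl IH; last by move=> l ls; apply: eM; lia.
rewrite -addrA; congr (_ + (_ + _)); rewrite topZ -scalemxAl scalemxAr -eM // mulmxA.
by rewrite top_act.
Qed.

Lemma DW_emb d e s (x z : 'rV[k]_N) t : (forall l, (l < s)%N -> x *m e l = t l *: z) ->
  DW d e s (emb s x) = emb s (x *m d) + linW N t s (emb s z).
Proof.
elim: s => [|s IH] xe; first by rewrite linW0 addr0.
have IH' := IH (fun l ls => xe l (ltnW ls)).
have actemb (M : 'M[k]_N) s' y : act M s' (emb s' y) = emb s' (y *m M).
  elim: s' => //= s' IHs; apply/funext => n; rewrite -[LHS]/(act M s' (cst0 _ _ n)) /=.
  by case: n => [|n]; rewrite ?linear0.
apply/funext => n; rewrite vvD DWE linWE; case: n => [|[|n]] /=.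
- by rewrite !addr0.
- by rewrite !linear0 !add0r actemb xe // -[LHS]/(embL s _) linearZ_LR.
- by rewrite !linear0 !addr0.
Qed.

Lemma hm_top wt s i (g : V s) : hm wt i g -> hm wt i (top g : V 0).
Proof. by elim: s i g => //= s IH i g hg; apply: IH; have := hg 0%N; rewrite subr0. Qed.

Lemma hm_emb wt s i (x : V 0) : hm wt i x -> hm wt i (emb s x).
Proof. by elim: s => //= s IH hx; apply/hm_cst0/IH. Qed.

Lemma mx_deg_nu wt a e s : (forall l, (l < s)%N -> mx_deg wt (- a) (e l)) -> mx_deg wt (- a * s%:Z) (nu e s).
Proof.
elim: s => [|s IH] he b b' wb /=.
  by rewrite mxE; case: eqP => // bb; move: wb; rewrite bb; lia.
rewrite mxE big1 // => c _.
have [wc|wc] := eqVneq (wt c) (wt b + - a * s%:Z); last first.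
  by rewrite IH ?mul0r //; [move=> l ls; apply: he; lia | apply/eqP].
by rewrite he ?mulr0 //; move: wb wc; nia.
Qed.

End Norm.

Arguments top : simpl never.
Arguments emb : simpl never.
Arguments nu : simpl never.
Arguments DG : simpl never.
Arguments DW : simpl never.
Arguments linG : simpl never.
Arguments linW : simpl never.
Arguments yG : simpl never.
Arguments yW : simpl never.
Arguments hm : simpl never.
Arguments cst0 : simpl never.

Section Tate.
Variables (k : fieldType) (N : nat) (deg wt : 'I_N -> int) (c0 : int).
Hypothesis dw0 : forall b, wt b = c0 - deg b.
Implicit Types (d : 'M[k]_N) (e : nat -> 'M[k]_N).
Notation V := (VV k N).

Lemma hm_dw (x : V 0) i : hm deg i x <-> hm wt (c0 - i) x.
Proof.
split=> hx b wb; apply: hx => db; apply: wb; first by rewrite dw0 db.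
by move: db; rewrite dw0; lia.
Qed.

Lemma gr_wt r d e : gr_ext deg (-1) r d e -> gr_ext wt 1 r d e.
Proof. by move=> ge; have := gr_ext_opp dw0 ge; rewrite opprK. Qed.

(* Cycles and boundaries of the cone of the norm map from the divided power complex to the
   polynomial one. *)
Definition tcyc s d e (m : int) (g w : V s) :=
  [/\ hm deg m g, hm wt (c0 - m - s%:Z - 1) w, DG d e s g = 0 &
      emb s (top g *m nu e s) = DW d e s w].

Definition tbd s d e (m : int) (g w : V s) :=
  exists p q, [/\ hm deg (m + 1) p, hm wt (c0 - m - s%:Z - 2%:Z) q, g = DG d e s p &
      w = (-1) ^+ s *: emb s (top p *m nu e s) + DW d e s q].

Definition tacyc s d e := forall m (g w : V s), tcyc d e m g w -> tbd d e m g w.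

(** Without variables the norm map is the identity, and the cone of an identity is contractible. *)
Lemma tacyc0 d e : tacyc 0 d e.
Proof.
move=> m g w [hg hw Dg Dw]; exists w, 0; split.
- by apply/hm_dw; move: hw; congr (hm wt); lia.
- exact: hm0.
- by rewrite -Dw [nu _ _]/(1%:M) mulmx1.
- by rewrite expr0 scale1r [nu _ _]/(1%:M) mulmx1 linear0 addr0.
Qed.

Section Step.
Variables (r : nat) (d : 'M[k]_N) (e : nat -> 'M[k]_N) (u : nat -> k).
Hypothesis xe : is_ext r.+1 d e.
Hypothesis ge : gr_ext deg (-1) r.+1 d e.
Notation e' := (fun l => e l - u l *: e r).
Notation DGr := (DG d e r.+1).
Notation DWr := (DW d e r.+1).
Notation DG' := (DG d e' r).
Notation DW' := (DW d e' r).
Notation yW := (yW N r u).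
Notation yG := (yG N r u).
Notation nr := (nu e r.+1).
Notation n' := (nu e' r).
Notation iota := (cst0 (V r) : V r -> V r.+1).
Notation sg := ((-1) ^+ r : k).

Let xe1 : is_ext r d e' := xe' u xe.
Let gw : gr_ext wt 1 r.+1 d e := gr_wt ge.
Let gw1 : gr_ext wt 1 r d e' := ge' u gw.

Lemma nrE : nr = n' *m e r. Proof. by rewrite (nu_sub u xe). Qed.

(** The product [n'] annihilates [e l - u l *: e r], so [e l] and [u l *: e r] act on it alike; the
    last operator completes [n'] to the norm element. *)
Lemma n'_e l : (l < r.+1)%N -> n' *m e l = monic_form r u l *: nr.
Proof.
rewrite ltnS leq_eqVlt /monic_form => /orP[/eqP->|lr].
  by rewrite eqxx scale1r nrE.
rewrite ltn_eqF // nrE scalemxAr.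
have := nu_e0 xe1 (leqnn r) lr; rewrite mulmxBr => /eqP; rewrite subr_eq0 => /eqP->.
by [].
Qed.

Lemma e_n' l : (l < r.+1)%N -> e l *m n' = monic_form r u l *: (sg *: nr).
Proof.
move=> lr; rewrite scalerA mulrC -scalerA -n'_e //.
apply: mulmx_anti => m mr.
rewrite mulmxBr mulmxBl -scalemxAr -scalemxAl (ext_anti xe lr (ltnW mr : (m < r.+1)%N)).
by rewrite (ext_anti xe lr (ltnSn r)) scalerN opprK opprB addrC.
Qed.

Lemma top_DG_n' (g : V r.+1) :
  top (DGr g) *m n' = top g *m d *m n' + sg *: (top (yG g) *m nr).
Proof. by rewrite (top_DG d g e_n') -scalemxAr. Qed.

Lemma top_DG'_n' (g : V r) : top (DG' g) *m n' = sg *: (top g *m n' *m d).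
Proof.
rewrite (@top_DG _ _ _ _ _ _ 0 (fun => 0)) => [|l lr]; last by rewrite (e_nu0 xe1) // scaler0.
by rewrite mulmx0 addr0 -mulmxA (d_nu xe1) -scalemxAr mulmxA.
Qed.

Lemma DW_emb_n' x : DWr (emb r.+1 (x *m n')) = emb r.+1 (x *m n' *m d) + yW (emb r.+1 (x *m nr)).
Proof.
apply: (@DW_emb _ _ d e r.+1 (x *m n') (x *m nr) (monic_form r u)) => l lr.
by rewrite -mulmxA n'_e // -scalemxAr.
Qed.

Lemma yG_D g : yG (DGr g) = DGr (yG g). Proof. exact: esym (linG_DG _ _ _ _). Qed.

Lemma sgK0 (x : 'rV[k]_N) : sg *: (sg *: x) = x.
Proof. by rewrite scalerA -expr2 sqrr_sign scale1r. Qed.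

(** A section of the contraction with the form: the equation in exponent [n] determines the
    coefficient in exponent [n.+1]. The free coefficient in exponent 0 is set to 0, so [top]
    vanishes on it and it contributes nothing to the norm. *)
Fixpoint glift (g : V r.+1) n : V r :=
  if n is m.+1 then g m - linG N u r (glift g m) else 0.

Lemma glift_y (g : V r.+1) : yG (glift g : V r.+1) = g.
Proof. by apply/funext => n; rewrite yGE /= addrC subrK. Qed.

Lemma hm_glift i (g : V r.+1) : hm deg i g -> hm deg (i + 2%:Z) (glift g : V r.+1).
Proof.
move=> hg; elim=> [|n IH] /=; first exact: hm0.
apply: hmB; first by have := hg n; congr (hm deg); lia.
by have := hm_linG u IH; congr (hm deg); lia.
Qed.

(** The kernel of the contraction with the form: an element of it is determined by its coefficient
    of exponent 0 in the last variable. By [DG_kemb] it is the divided power complex of the reduced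
    operators. *)
Definition kemb (x : V r) : V r.+1 := fun n => iter n (fun z => - linG N u r z) x.

Lemma kerG (g : V r.+1) : yG g = 0 -> g = kemb (g 0%N).
Proof.
move=> yg; apply/funext; elim=> // n IH; rewrite /kemb iterS -/(kemb (g 0%N) n) -IH.
have := congr1 (fun f => f n) yg; rewrite yGE => /eqP; rewrite addr_eq0 => /eqP->.
by rewrite opprK.
Qed.

Lemma kemb_y x : yG (kemb x) = 0.
Proof. by apply/funext => n; rewrite yGE /kemb iterS subrr. Qed.

Lemma DG_kemb x : DGr (kemb x) = kemb (DG' x).
Proof.
apply/funext => n; rewrite DGE /kemb iterS.
elim: n => [|n IH]; first by rewrite /= DG_sub linearN linG_act.
rewrite !iterS -IH linearD !linearN linG_DG !linG_act /=; abel.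
Qed.

Lemma hm_kemb i x : hm deg i x -> hm deg i (kemb x).
Proof.
move=> hx; elim=> [|n IH]; first by rewrite subr0.
by rewrite /kemb iterS; apply: hmN; have := hm_linG u IH; congr (hm deg); lia.
Qed.

(** The norm map exchanges contraction with the form and multiplication by it only up to homotopy.
    The second term is that homotopy, by [DW_emb_n']; with it the action of the form becomes a chain
    map of the cone. *)
Definition yw (g w : V r.+1) : V r.+1 := yW w - emb r.+1 (top g *m n').

Lemma hm_emb_nu m x s' : hm deg m (x : V 0) -> mx_deg wt (- s') n' ->
  hm wt (c0 - m - s') (emb r.+1 (x *m n')).
Proof.
move=> /hm_dw hx hn; apply: hm_emb; apply: (@hm_act _ _ wt (- s') n' 0 _ x hn hx).
Qed.

Lemma hm_n' : mx_deg wt (- r%:Z) n'.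
Proof. by have := mx_deg_nu gw1.2; rewrite mulN1r. Qed.

Lemma hm_nr m (x : V 0) : hm deg m x -> hm wt (c0 - m - r.+1%:Z) (emb r.+1 (x *m nr)).
Proof.
move=> /hm_dw hx; apply: hm_emb.
have := mx_deg_nu gw.2; rewrite mulN1r => hn.
exact: (@hm_act _ _ wt (- r.+1%:Z) nr 0 _ x hn hx).
Qed.

Lemma yhat_cyc m g w : tcyc d e m g w -> tcyc d e (m - 2%:Z) (yG g) (yw g w).
Proof.
case=> hg hw Dg Dw; split.
- exact: hm_yG.
- apply: hmB; first by have := hm_yW u hw; congr (hm wt); lia.
  have := hm_emb_nu (hm_top hg) hm_n'; congr (hm wt); lia.
- by rewrite -yG_D Dg linear0.
- rewrite linearB -[DWr (yW w)]yW_D -Dw DW_emb_n' opprD addrCA subrr addr0.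
  have := top_DG_n' g; rewrite Dg top0 mul0mx => h.
  rewrite -mulmxA (d_nu xe1) -scalemxAr mulmxA in h.
  have {h} /eqP : sg *: (top g *m n' *m d + top (yG g) *m nr) = 0 by rewrite scalerDr -h.
  rewrite scaler_eq0 signr_eq0 /= addrC addr_eq0 => /eqP ->.
  by rewrite embN.
Qed.

Lemma yhat_bd m g w : tbd d e m g w -> tbd d e (m - 2%:Z) (yG g) (yw g w).
Proof.
move=> [p [q [hp hq -> ->]]]; exists (yG p), (yW q - sg *: emb r.+1 (top p *m n')); split.
- by have := hm_yG u hp; congr (hm deg); lia.
- apply: hmB; first by have := hm_yW u hq; congr (hm wt); lia.
  by apply: hmZ; have := hm_emb_nu (hm_top hp) hm_n'; congr (hm wt); lia.
- by rewrite yG_D.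
have e1 : yW (emb r.+1 (top p *m nr)) = DWr (emb r.+1 (top p *m n')) - emb r.+1 (top p *m n' *m d).
  by rewrite DW_emb_n' addrAC subrr add0r.
have e2 : emb r.+1 (top p *m d *m n') = sg *: emb r.+1 (top p *m n' *m d).
  by rewrite -mulmxA (d_nu xe1) -scalemxAr embZ mulmxA.
rewrite /yw (linearD yW) (linearZ_LR yW) (linearB DWr) (linearZ_LR DWr) yW_D e1.
rewrite top_DG_n' embD embZ e2 exprS mulN1r !scaleNr scalerBr.
abel.
Qed.

Hypothesis ac : tacyc r d e'.

(** Lifting [p] through the contraction moves [g] into the kernel of the form, and evaluating [q]
    removes the last variable. What remains is a cycle of the reduced Tate complex, which bounds by
    [ac]; the bounding pair corrects the lift of [p] and the quotient of [q] by the form. *)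
Lemma yhat_inj m g w : tcyc d e m g w -> tbd d e (m - 2%:Z) (yG g) (yw g w) -> tbd d e m g w.
Proof.
case=> hg hw Dg Dw [p [q [hp hq yg ywq]]].
pose ph : V r.+1 := glift p.
have hph : hm deg (m + 1) ph by have := hm_glift hp; congr (hm deg); lia.
have yph : yG ph = p by apply: glift_y.
have tph : top ph = 0 by exact: top0.
pose g1 := g - DGr ph.
have yg1 : yG g1 = 0 by rewrite /g1 linearB yg yG_D yph subrr.
have hg1 : hm deg m g1 by apply: hmB => //; have := hm_DGx ge hph; rewrite addrK.
pose g' := g1 0%N.
have g1E : g1 = kemb g' := kerG yg1.
have hg' : hm deg m g' by have := hg1 0%N; rewrite subr0.
have Dg' : DG' g' = 0.
  have : DGr g1 = 0 by rewrite /g1 linearB Dg DG_DG // subrr.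
  by rewrite g1E DG_kemb => /(congr1 (fun f => f 0%N)).
have tg : top g *m n' = top g' *m n' + sg *: (top p *m nr).
  have -> : top g = top g' + top (DGr ph).
    by rewrite -[top g']/(top g1) /g1 topD topN subrK.
  by rewrite mulmxDl top_DG_n' tph !mul0mx add0r yph.
have ywE : yW w - emb r.+1 (top g' *m n') = DWr q.
  have := ywq; rewrite /yw tg embD embZ exprS mulN1r scaleNr.
  rewrite opprD addrA addrC => /addrI; exact.
have hq' : hm wt (c0 - m - r%:Z - 1) q by move: hq; congr (hm wt); lia.
pose M := (`|(c0 - m - r%:Z - wt_lo wt)%R| + 9)%N.
have hw' : hm wt (c0 - m - r%:Z - 2%:Z) w by move: hw; congr (hm wt); lia.
have evE : emb r (top g' *m n') = DW' (- evp u M.+1 q).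
  have e1 : evp u M.+1 (DWr q) = DW' (evp u M.+1 q).
    by apply: evp_D_hm hq' _; rewrite /M; lia.
  have e2 : evp u M.+1 (yW w) = 0 by apply: evp_y_hm hw' _; rewrite /M; lia.
  by rewrite linearN -e1 -ywE evpB e2 evp_cst0 sub0r opprK.
have [|p' [q' [hp' hq1 g'E qE]]] := ac (m := m) (g := g') (w := - evp u M.+1 q).
  by split=> //; apply/hmN/hm_evp.
exists (ph + kemb p'), (yquo u M.+1 q + iota (act (e r) r q')).
have tpp : top (ph + kemb p') = top p'.
  by rewrite topD tph add0r.
have her : mx_deg wt (-1) (e r) by case: gw => _; apply.
have hq2 : hm wt (c0 - m - r.+1%:Z - 2%:Z) (yquo u M.+1 q + iota (act (e r) r q')).
  apply: hmD; first by have := hm_yquo u M.+1 hq'; congr (hm wt); lia.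
  by apply: hm_cst0; have := hm_act her hq1; congr (hm wt); lia.
split.
- by apply: hmD => //; apply: hm_kemb.
- exact: hq2.
- by rewrite linearD DG_kemb -g'E -g1E /g1 addrC subrK.
rewrite tpp.
have fq : forall n, (M.+1 <= n)%N -> q n = 0 by apply: hm_fin hq' _; rewrite /M; lia.
have qq : q = - (sg *: emb r.+1 (top p' *m n')) - DWr (iota q') +
    yW (yquo u M.+1 q + iota (act (e r) r q')).
  have := yquoE u fq; rewrite -[evp u M.+1 q]opprK qE; move: (yquo u M.+1 q) => Y qY.
  rewrite [LHS]qY (@DW_iota _ _ _ d e u) (linearN iota) (linearD iota) (linearZ_LR iota) (linearD yW).
  rewrite -[emb r.+1 _]/(iota (emb r (top p' *m n'))); abel.
have hx : hm wt (c0 - m - r%:Z - 2%:Z)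
   (w - ((-1) ^+ r.+1 *: emb r.+1 (top p' *m nr) +
     DWr (yquo u M.+1 q + iota (act (e r) r q')))).
  apply: hmB => //; apply: hmD.
    by apply: hmZ; have := hm_nr (hm_top hp'); congr (hm wt); lia.
  by have := hm_DWx gw hq2; congr (hm wt); lia.
apply/eqP; rewrite -subr_eq0; apply/eqP; apply: (yW_inj_hm (u := u) hx).
rewrite (linearB yW) (linearD yW) (linearZ_LR yW) yW_D.
have tg' : top g' *m n' = sg *: (top p' *m n' *m d) by rewrite g'E top_DG'_n'.
have ywE2 : yW w = emb r.+1 (top g' *m n') + DWr q by rewrite -ywE addrC subrK.
have Dq : DWr q = - (sg *: DWr (emb r.+1 (top p' *m n'))) +
    DWr (yW (yquo u M.+1 q + iota (act (e r) r q'))).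
  by rewrite {1}qq (linearD DWr) (linearB DWr) (linearN DWr) (linearZ_LR DWr) DW_DW // subr0.
rewrite ywE2 Dq tg' embZ DW_emb_n' exprS mulN1r scaleNr scalerDr.
abel.
Qed.

(** The differential of a lift [gh] of [g] lies in the kernel of the form. Together with the
    evaluation of [w] it gives a cycle of the reduced Tate complex one degree lower, and a pair
    bounding it supplies the corrections of [gh] and of the quotient of [w]. *)
Lemma yhat_surj m g w : tcyc d e (m - 2%:Z) g w ->
  exists g1 w1, tcyc d e m g1 w1 /\ tbd d e (m - 2%:Z) (g - yG g1) (w - yw g1 w1).
Proof.
case=> hg hw Dg Dw.
pose gh : V r.+1 := glift g.
have hgh : hm deg m gh by have := hm_glift hg; rewrite subrK.
have ygh : yG gh = g by apply: glift_y.
have tgh : top gh = 0 by exact: top0.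
have yD : yG (DGr gh) = 0 by rewrite yG_D ygh.
pose h' := DGr gh 0%N.
have hE : DGr gh = kemb h' := kerG yD.
have hh' : hm deg (m - 1) h' by have := hm_DGx ge hgh 0%N; rewrite subr0.
have Dh' : DG' h' = 0.
  have : DGr (DGr gh) = 0 by apply: DG_DG.
  by rewrite hE DG_kemb => /(congr1 (fun f => f 0%N)).
have th' : top h' *m n' = sg *: (top g *m nr).
  by rewrite -[top h']/(top (DGr gh)) top_DG_n' tgh !mul0mx add0r ygh.
have hw' : hm wt (c0 - m - r%:Z) w by move: hw; congr (hm wt); lia.
pose M := (`|(c0 - m - r%:Z - wt_lo wt)%R| + 5)%N.
have evE : DW' (evp u M.+1 w) = emb r (top g *m nr).
  have <- : evp u M.+1 (DWr w) = DW' (evp u M.+1 w) by apply: evp_D_hm hw' _; rewrite /M; lia.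
  by rewrite -Dw -[emb r.+1 _]/(iota (emb r (top g *m nr))) evp_cst0.
have [|p' [q' [hp' hq' h'E wE]]] := ac (m := m - 1) (g := h') (w := sg *: evp u M.+1 w).
  split=> //; first by apply/hmZ/hm_evp; move: hw'; congr (hm wt); lia.
  by rewrite linearZ_LR evE th' embZ.
have hp1 : hm deg m p' by move: hp'; rewrite subrK.
have wE' : evp u M.+1 w = emb r (top p' *m n') + sg *: DW' q'.
  rewrite -[LHS]scale1r -(sqrr_sign k r) expr2 -scalerA wE scalerDr scalerA -expr2.
  by rewrite sqrr_sign scale1r.
have fw : forall n, (M.+1 <= n)%N -> w n = 0 by apply: hm_fin hw' _; rewrite /M; lia.
have her : mx_deg wt (-1) (e r) by case: gw => _; apply.
pose ws := yquo u M.+1 w - sg *: iota (act (e r) r q').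
have wsE : w = emb r.+1 (top p' *m n') + DWr (sg *: iota q') + yW ws.
  have := yquoE u fw; rewrite wE' /ws; move: (yquo u M.+1 w) => Y wY.
  rewrite [LHS]wY (linearZ_LR DWr) (@DW_iota _ _ _ d e u) (linearB yW) (linearD iota).
  rewrite (linearZ_LR yW) (linearZ_LR iota) scalerDr.
  rewrite -[emb r.+1 _]/(iota (emb r (top p' *m n'))); abel.
have hws : hm wt (c0 - m - r.+1%:Z - 1) ws.
  apply: hmB; first by have := hm_yquo u M.+1 hw'; congr (hm wt); lia.
  apply/hmZ/hm_cst0; have := hm_act her hq'; congr (hm wt); lia.
pose gs := gh - kemb p'.
have tgs : top gs = - top p'.
  by rewrite topD topN tgh sub0r.
have tgp : top g *m nr = top p' *m n' *m d.
  have := th'; rewrite h'E top_DG'_n' => /(congr1 (fun x => sg *: x)).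
  by rewrite !sgK0 => ->.
exists gs, ws; split.
  split.
  - by apply: hmB => //; apply: hm_kemb.
  - exact: hws.
  - by rewrite /gs (linearB DGr) DG_kemb -h'E hE subrr.
  - rewrite tgs mulNmx embN.
    have hx : hm wt (c0 - m - r.+1%:Z) (- emb r.+1 (top p' *m nr) - DWr ws).
      apply: hmB; first by apply: hmN; apply: hm_nr; apply: hm_top.
      by have := hm_DWx gw hws; congr (hm wt); lia.
    apply/eqP; rewrite -subr_eq0; apply/eqP; apply: (yW_inj_hm (u := u) hx).
    rewrite (linearB yW) (linearN yW) yW_D.
    have -> : yW ws = w - emb r.+1 (top p' *m n') - DWr (sg *: iota q').
      by rewrite {1}wsE; abel.
    rewrite (linearB DWr) (linearB DWr) DW_DW // subr0 -Dw DW_emb_n' tgp; abel.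
exists 0, (sg *: iota q'); split.
- exact: hm0.
- by apply/hmZ/hm_cst0; move: hq'; congr (hm wt); lia.
- by rewrite (linear0 DGr) /gs (linearB yG) kemb_y subr0 ygh subrr.
- rewrite top0 mul0mx emb0 scaler0 add0r.
  rewrite /yw {1}wsE tgs mulNmx embN; abel.
Qed.

End Step.

(** Induction on the number of variables with [u = 0], so that the form is the last variable. The
    vanishing passes to the reduced complex by [lift_cycle]. Hence the last variable acts
    injectively on Tate classes, lowering [m] by 2, until the divided power part is zero and the
    polynomial part is in the range where cohomology vanishes. *)
Lemma tacyc_of_vanishing s d e (lo : int) : is_ext s d e -> gr_ext deg (-1) s d e ->
  (forall i : int, lo <= i -> forall w, ocyc wt (DW d e s) i w -> obd wt (DW d e s) 1 i w) ->
  tacyc s d e.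
Proof.
elim: s e lo => [|r IH] e lo xe ge van; first exact: tacyc0.
pose u (l : nat) : k := 0; have gw := gr_wt ge.
have yinj (i : int) : lo <= i -> y_injective_at wt r d e u i by move=> li w cw _; apply: van.
have ac : tacyc r d (fun l => e l - u l *: e r).
  apply: (IH _ (lo + 1)); [exact: xe' | exact: gr_ext_sub |] => i li w' cw.
  have [|q hq] := lift_cycle xe gw _ cw; first by apply: yinj; lia.
  case/van => [|p hp E]; first by lia.
  pose M := (`|(i - wt_lo wt)%R| + 9)%N.
  exists (evp u M.+1 p); first by apply/hm_evp.
  have <- : evp u M.+1 (DW d e r.+1 p) = DW d (fun l => e l - u l *: e r) r (evp u M.+1 p).
    by apply: evp_D_hm hp _; rewrite /M; lia.
  by rewrite -E evpB (evp_y_hm _ hq) ?subr0 ?evp_cst0 // /M; lia.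
(* From [m0] downwards the degree is below all weights of [deg], while the degree of the polynomial
   part exceeds [lo]. *)
pose m0 : int := - (`|wt_lo deg| + `|(c0 - lo)%R| + r + 5)%N%:Z.
move=> m; have [n] : exists n : nat, m <= m0 + n%:Z by exists (`|(m - m0)%R|)%N; lia.
elim: n m => [|n IHn] m mn g w cyc; last first.
  apply: (yhat_inj xe ge ac cyc); apply: (IHn (m - 2%:Z)); first by lia.
  exact: (@yhat_cyc r d e u xe ge m g w cyc).
case: cyc => hg hw Dg Dw.
have g0 : g = 0 by apply: (hm_lo hg); rewrite /m0 in mn; lia.
have [||q hq wq] := van (c0 - m - r.+1%:Z - 1) _ w.
- by rewrite /m0 in mn; lia.
- by split=> //; rewrite -Dw g0 top0 mul0mx emb0.
exists 0, q; split; [exact: hm0 | | by rewrite linear0 | by rewrite top0 mul0mx emb0 scaler0 add0r].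
by move: hq; congr (hm wt); lia.
Qed.

Section Periodic.
Variables (r : nat) (d : 'M[k]_N) (e : nat -> 'M[k]_N) (u : nat -> k).
Hypothesis xe : is_ext r.+1 d e.
Hypothesis ge : gr_ext deg (-1) r.+1 d e.
Hypothesis ac : tacyc r d (fun l => e l - u l *: e r).
Notation W := (V r.+1 * V r.+1)%type.
Notation TZ m := (fun x : W => tcyc d e m x.1 x.2).
Notation TB m := (fun x : W => tbd d e m x.1 x.2).

Lemma subsp_tcyc m : subsp (TZ m).
Proof.
have h0 : tcyc d e m (0 : V r.+1) (0 : V r.+1).
  by split; rewrite ?linear0 ?top0 ?mul0mx ?emb0 //; apply: hm0.
have hD (g w g' w' : V r.+1) : tcyc d e m g w -> tcyc d e m g' w' -> tcyc d e m (g + g') (w + w').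
  move=> [h1 h2 h3 h4] [h1' h2' h3' h4']; split; [exact: hmD | exact: hmD | |].
    by rewrite linearD h3 h3' addr0.
  by rewrite topD mulmxDl embD h4 h4' linearD.
have hZ c (g w : V r.+1) : tcyc d e m g w -> tcyc d e m (c *: g) (c *: w).
  move=> [h1 h2 h3 h4]; split; [exact: hmZ | exact: hmZ | by rewrite linearZ_LR h3 scaler0 |].
  by rewrite topZ -scalemxAl embZ h4 linearZ_LR.
by split=> [|[g w] [g' w']|c [g w]]; [exact: h0 | exact: hD | exact: hZ].
Qed.

Lemma subsp_tbd m : subsp (TB m).
Proof.
have h0 : tbd d e m (0 : V r.+1) (0 : V r.+1).
  exists 0, 0; split; rewrite ?linear0 ?top0 ?mul0mx ?emb0 ?scaler0 ?addr0 //; apply: hm0.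
have hD (g w g' w' : V r.+1) : tbd d e m g w -> tbd d e m g' w' -> tbd d e m (g + g') (w + w').
  move=> [p [q [h1 h2 h3 h4]]] [p' [q' [h1' h2' h3' h4']]].
  exists (p + p'), (q + q'); split; [exact: hmD | exact: hmD | by rewrite linearD h3 h3' |].
  by rewrite topD mulmxDl embD h4 h4' (linearD (DW d e r.+1)) scalerDr addrACA.
have hZ c (g w : V r.+1) : tbd d e m g w -> tbd d e m (c *: g) (c *: w).
  move=> [p [q [h1 h2 h3 h4]]].
  exists (c *: p), (c *: q); split; [exact: hmZ | exact: hmZ | by rewrite linearZ_LR h3 |].
  by rewrite topZ -scalemxAl embZ h4 (linearZ_LR (DW d e r.+1)) scalerDr !scalerA mulrC.
by split=> [|[g w] [g' w']|c [g w]]; [exact: h0 | exact: hD | exact: hZ].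
Qed.

Lemma yhat_linear :
  linear (fun x : W => (yG N r u x.1, yw e u x.1 x.2) : W).
Proof.
have h c (g w g' w' : V r.+1) : yw e u (c *: g + g') (c *: w + w') = c *: yw e u g w + yw e u g' w'.
  rewrite /yw (linearP (yW N r u)) topD topZ mulmxDl embD -scalemxAl embZ scalerBr; abel.
move=> c [g w] [g' w']; apply: injective_projections; last exact: h.
exact: (linearP (yG N r u)).
Qed.

Lemma tdim_step m n : hdim (TZ m) (TB m) n -> hdim (TZ (m - 2%:Z)) (TB (m - 2%:Z)) n.
Proof.
apply: (@hdim_iso _ _ _ _ _ _ _ (mkhom yhat_linear)).
- exact: subsp_tcyc.
- exact: subsp_tbd.
- by move=> [g w]; apply: yhat_cyc.
- by move=> [g w]; apply: yhat_bd.
- by move=> [g w]; apply: yhat_inj.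
- by move=> [g w] /(yhat_surj xe ge ac) [g1 [w1 [c1 b1]]]; exists (g1, w1).
Qed.

(** For such [m] the polynomial part and the norm map vanish for reasons of degree, and only the
    divided power complex is left. At the opposite end [tdim_lo] leaves only the polynomial
    complex. *)
Lemma tdim_hi (m : int) : wt_lo wt > c0 - m - r.+1%:Z -> hdim (TZ m) (TB m) (gdim deg d e r.+1 m).
Proof.
move=> ml; have wemb (p : V 0) : hm deg m p \/ hm deg (m + 1) p -> emb r.+1 (p *m nu e r.+1) = 0.
  by case=> hp; have he := hm_nr ge hp; apply: (hm_lo he); lia.
have lin : linear ((fun g => (g, 0)) : V r.+1 -> W).
  by move=> c g g'; apply: injective_projections; rewrite //= [c *: 0]scaler0 addr0.
apply: (@hdim_iso _ _ _ _ _ _ _ (mkhom lin)) (gdimP _ xe ge).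
- exact: subsp_ocyc.
- exact: subsp_tbd.
- move=> g [hg Dg]; change (tcyc d e m g (0 : V r.+1)); split; [by [] | exact: hm0 | by [] |].
  by rewrite linear0 wemb //; left; apply: hm_top.
- move=> g [p hp gE]; change (tbd d e m g (0 : V r.+1)); rewrite opprK in hp.
  exists p, 0; split; [by [] | exact: hm0 | by [] |].
  by rewrite linear0 addr0 wemb ?scaler0 //; right; apply: hm_top.
- move=> g [hg Dg] H; have {H} : tbd d e m g (0 : V r.+1) by [].
  by move=> [p [q [hp hq gE _]]]; exists p; rewrite ?opprK.
- move=> [g w] H; have {H} : tcyc d e m g w by [].
  move=> [hg hw Dg Dw]; exists g; first by split.
  have -> : w = 0 by apply: (hm_lo hw); lia.
  have E : (g, 0) - (g, 0) = 0 :> W by rewrite subrr.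
  have H : TB m ((g, 0) - (g, 0)) by rewrite E; exact: (subsp0 (subsp_tbd m)).
  exact: H.
Qed.

Lemma tdim_lo (m : int) : m + 1 < wt_lo deg ->
  hdim (TZ m) (TB m) (wdim wt d e r.+1 (c0 - m - r.+1%:Z - 1)).
Proof.
move=> ml; have gw := gr_wt ge.
have lin : linear ((fun g => (0, g)) : V r.+1 -> W).
  by move=> c g g'; apply: injective_projections; rewrite //= [c *: 0]scaler0 addr0.
apply: (@hdim_iso _ _ _ _ _ _ _ (mkhom lin)) (wdimP _ xe gw).
- exact: subsp_ocyc.
- exact: subsp_tbd.
- move=> w [hw Dw]; change (tcyc d e m (0 : V r.+1) w).
  by split; [exact: hm0 | by [] | rewrite linear0 | rewrite Dw top0 mul0mx emb0].
- move=> w [q hq wE]; change (tbd d e m (0 : V r.+1) w); exists 0, q; split.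
  + exact: hm0.
  + by move: hq; congr (hm wt); lia.
  + by rewrite linear0.
  + by rewrite top0 mul0mx emb0 scaler0 add0r.
- move=> w [hw Dw] H; have {H} : tbd d e m (0 : V r.+1) w by [].
  move=> [p [q [hp hq _ wE]]]; exists q; first by move: hq; congr (hm wt); lia.
  by rewrite wE (hm_lo hp ml) top0 mul0mx emb0 scaler0 add0r.
- move=> [g w] H; have {H} : tcyc d e m g w by [].
  move=> [hg hw Dg Dw]; have g0 : g = 0 by apply: (hm_lo hg); lia.
  exists w; first by split=> //; rewrite -Dw g0 top0 mul0mx emb0.
  have E : (g, w) - (0, w) = 0 :> W by rewrite g0 subrr.
  have H : TB m ((g, w) - (0, w)) by rewrite E; exact: (subsp0 (subsp_tbd m)).
  exact: H.
Qed.

(** Periodicity carries the degree [m], where only divided powers are present, down to [m - 2 * j],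
    where only polynomials are; the condition on [m + i] says that these have degree [i]. *)
Lemma gdim_wdim : exists M : int, forall (m i : int) (j : nat), M <= m -> M <= i ->
  m + i = c0 - r.+1%:Z - 1 + 2%:Z * j%:Z -> gdim deg d e r.+1 m = wdim wt d e r.+1 i.
Proof.
exists (`|c0| + r + 5 + `|wt_lo deg| + `|wt_lo wt|)%N%:Z => m i j Mm Mi E.
have h1 : hdim (TZ m) (TB m) (gdim deg d e r.+1 m) by apply: tdim_hi; lia.
have h2 (l : nat) : hdim (TZ (m - 2%:Z * l%:Z)) (TB (m - 2%:Z * l%:Z)) (gdim deg d e r.+1 m).
  elim: l => [|l IH]; first by have -> : m - 2%:Z * 0%N%:Z = m by lia.
  have := tdim_step IH; have -> // : m - 2%:Z * l%:Z - 2%:Z = m - 2%:Z * l.+1%:Z by lia.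
have := @tdim_lo (m - 2%:Z * j%:Z); have -> : c0 - (m - 2%:Z * j%:Z) - r.+1%:Z - 1 = i by lia.
move=> h3; apply: hdim_uniq (h2 j) (h3 _); first exact: subsp_tbd.
lia.
Qed.

End Periodic.
End Tate.

(** * Growth of the dimensions *)

Section Difference.
Variable R : numFieldType.
Implicit Types P Q S : {poly R}.

Definition dif P : {poly R} := P - (P \Po ('X - 1)).

Lemma difD P Q : dif (P + Q) = dif P + dif Q.
Proof. by rewrite /dif comp_polyD; abel. Qed.

Lemma difZ c P : dif (c *: P) = c *: dif P.
Proof. by rewrite /dif comp_polyZ scalerBr. Qed.

Lemma horner_dif P x : (dif P).[x] = P.[x] - P.[x - 1].
Proof. by rewrite /dif hornerD hornerN horner_comp !hornerE. Qed.

Lemma exp_X1 i : exists2 S : {poly R}, (size S <= i)%N &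
  ('X - 1) ^+ i.+1 = 'X^(i.+1) - i.+1%:R *: 'X^i + S :> {poly R}.
Proof.
elim: i => [|i [S sS E]].
  by exists 0; rewrite ?size_poly0 // !expr1 expr0 scale1r addr0.
exists ('X * S + i.+1%:R *: 'X^i - S).
  apply: leq_trans (size_polyD _ _) _; rewrite geq_max size_polyN; apply/andP; split; last exact: leqW.
  apply: leq_trans (size_polyD _ _) _; rewrite geq_max; apply/andP; split.
    by apply: leq_trans (size_polyMleq _ _) _; rewrite size_polyX; lia.
  by apply: leq_trans (size_scale_leq _ _) _; rewrite size_polyXn.
rewrite exprS E -[i.+2%:R]natr1 scalerDl scale1r mulrBl mul1r !mulrDr mulrN -scalerAr -!exprS.
abel.
Qed.

Lemma dif_Xn i : (size (dif 'X^i) <= i)%N /\ (dif 'X^(i.+1))`_i = i.+1%:R.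
Proof.
have E j : exists2 S : {poly R}, (size S <= j)%N & dif 'X^(j.+1) = j.+1%:R *: 'X^j - S.
  have [S sS E] := exp_X1 j; exists S => //.
  by rewrite /dif comp_Xn_poly E; abel.
split.
  case: i => [|i]; first by rewrite /dif expr0 comp_polyC subrr size_poly0.
  have [S sS ->] := E i; apply: leq_trans (size_polyD _ _) _.
  rewrite geq_max size_polyN; apply/andP; split; last exact: leqW.
  by apply: leq_trans (size_scale_leq _ _) _; rewrite size_polyXn.
have [S sS ->] := E i.
by rewrite coefB coefZ coefXn eqxx mulr1 nth_default ?subr0.
Qed.

Lemma dif_lead P m : (size P <= m.+2)%N ->
  (size (dif P) <= m.+1)%N /\ (dif P)`_m = m.+1%:R * P`_m.+1.
Proof.
move=> sP; have E : P = \sum_(i < m.+2) P`_i *: 'X^i.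
  rewrite -poly_def; apply/polyP => i; rewrite coef_poly; case: ltnP => // mi.
  by rewrite nth_default //; apply: leq_trans sP mi.
have dE : dif P = \sum_(i < m.+2) P`_i *: dif 'X^i.
  rewrite {1}E; elim/big_rec2: _ => [|i x y _ <-]; first by rewrite /dif comp_poly0 subr0.
  by rewrite difD difZ.
have sm n (G : 'I_n -> {poly R}) b : (forall i, (size (G i) <= b)%N) -> (size (\sum_i G i)%R <= b)%N.
  move=> sG; elim/big_rec: _ => [|i x _ sx]; first by rewrite size_poly0.
  by apply: leq_trans (size_polyD _ _) _; rewrite geq_max sG.
split.
  rewrite dE; apply: sm => i; apply: leq_trans (size_scale_leq _ _) _.
  by apply: leq_trans (proj1 (dif_Xn i)) _; have := ltn_ord i; lia.
rewrite dE big_ord_recr coefD coefZ /= (proj2 (dif_Xn m)) nth_default ?add0r 1?mulrC //.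
apply: sm => i; apply: leq_trans (size_scale_leq _ _) _.
by apply: leq_trans (proj1 (dif_Xn i)) _; have := ltn_ord i; lia.
Qed.

Lemma dif_onto n P : (size P <= n)%N -> exists S, dif S = P.
Proof.
elim: n P => [|n IH] P sP.
  exists 0; rewrite /dif comp_poly0 subr0; apply/esym/eqP.
  by rewrite -size_poly_eq0 -leqn0.
pose c := P`_n / n.+1%:R.
have [s1 s2] : (size (dif 'X^(n.+1)) <= n.+1)%N /\ (dif 'X^(n.+1))`_n = n.+1%:R * 'X^(n.+1)`_n.+1.
  by apply: dif_lead; rewrite size_polyXn.
have [|S SE] := IH (P - c *: dif 'X^(n.+1)); last by exists (S + c *: 'X^(n.+1)); rewrite difD difZ SE subrK.
apply/leq_sizeP => j nj; rewrite coefB coefZ.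
have [->|jn] := eqVneq j n.
  by rewrite s2 coefXn eqxx mulr1 divfK ?subrr // pnatr_eq0.
by rewrite !nth_default ?mulr0 ?subr0 //; [apply: leq_trans s1 _ | apply: leq_trans sP _]; lia.
Qed.

Lemma poly_eventually P Q i0 : (forall i, (i0 <= i)%N -> P.[i%:R] = Q.[i%:R]) -> P = Q.
Proof.
move=> PQ; apply/eqP; rewrite -subr_eq0; apply/eqP.
apply: (@roots_geq_poly_eq0 _ _ [seq i%:R | i <- iota i0 (size (P - Q))]).
- apply/allP => x /mapP[i]; rewrite mem_iota => /andP[ii _] ->.
  by rewrite /root hornerD hornerN PQ // subrr.
- rewrite map_inj_uniq ?iota_uniq // => i j /eqP; rewrite eqr_nat => /eqP; exact.
- by rewrite size_map size_iota.
Qed.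

Definition evpoly (p : int -> nat) (P : bool -> {poly R}) :=
  exists i0, forall i (s : bool), (i0 <= i)%N -> (p ((2 * i + s)%N%:Z))%:R = (P s).[i%:R].

Lemma evpoly_dif (p p' : int -> nat) (P : bool -> {poly R}) : evpoly p P ->
  (exists i1 : int, forall i : int, i1 <= i -> p i = (p (i - 2%:Z)%R + p' i)%N) ->
  evpoly p' (fun s => dif (P s)).
Proof.
move=> [i0 pP] [i1 pp]; exists (i0 + `|i1| + 1)%N => i s ii.
rewrite horner_dif -!pP; last by lia.
have := pp (2 * i + s)%N%:Z; have -> : (2 * i + s)%N%:Z - 2%:Z = (2 * (i - 1) + s)%N%:Z by lia.
have -> : i%:R - 1 = (i - 1)%N%:R :> R by rewrite natrB //; lia.
rewrite -pP; last by lia.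
by move=> ->; [rewrite natrD addrAC subrr add0r | lia].
Qed.

Lemma evpoly_sum (p p' : int -> nat) (P' : bool -> {poly R}) : evpoly p' P' ->
  (exists i1 : int, forall i : int, i1 <= i -> p i = (p (i - 2%:Z)%R + p' i)%N) ->
  exists P : bool -> {poly R}, evpoly p P.
Proof.
move=> [i0 pP'] [i1 pp].
have [S0 ES0] := dif_onto (leqnn (size (P' false))); have [S1 ES1] := dif_onto (leqnn (size (P' true))).
pose S (s : bool) := if s then S1 else S0.
have ES s : dif (S s) = P' s by case: s.
pose a := (i0 + `|i1| + 1)%N.
(* The constant of summation is read off at the index [a] from which the recursion applies. *)
pose P s := S s + ((p ((2 * a + s)%N%:Z))%:R - (S s).[a%:R])%:P.
exists P, a => i s; elim: i => [|i IH] ai; first by lia.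
have [ai'|ia] := leqP a i; last first.
  have -> : i.+1 = a by lia.
  by rewrite /P hornerD hornerC addrC subrK.
rewrite pp; last by lia.
have -> : (2 * i.+1 + s)%N%:Z - 2%:Z = (2 * i + s)%N%:Z by lia.
rewrite natrD IH // pP'; last by lia.
have E : i.+1%:R - 1 = i%:R :> R by rewrite -natr1 addrK.
by rewrite -ES horner_dif E /P !hornerD !hornerC; abel.
Qed.

End Difference.

Section Balance.
Variable R : numFieldType.

(* The shift [rho] comes from the shift of degrees in the Tate complex. *)
Definition balanced (p q : int -> nat) :=
  exists P Q : bool -> {poly R}, [/\ evpoly p P, evpoly q Q &
    forall n, (forall s, (size (P s) <= n.+1)%N /\ (size (Q s) <= n.+1)%N) ->
      exists rho : bool, forall s, (P s)`_n = (Q (s (+) rho))`_n].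

Lemma evpoly0 p : (exists i0 : int, forall i : int, i0 <= i -> p i = 0%N) -> evpoly p (fun=> 0 : {poly R}).
Proof.
by move=> [i0 p0]; exists `|i0|%N => i s ii; rewrite p0 ?horner0 //; lia.
Qed.

Lemma hm_above (k : fieldType) N (deg : 'I_N -> int) m (v : VV k N 0) : hm deg m v -> - wt_lo deg < m -> v = 0.
Proof.
move=> hv; rewrite /wt_lo opprK => dm; apply/rowP => b; rewrite mxE; apply: (hv b) => bm.
by move: dm; rewrite (bigD1 b) //=; lia.
Qed.

Lemma opdim_vanish (k : fieldType) N (deg : 'I_N -> int) r (p : {linear VV k N r -> VV k N r}) s i :
  (forall i g, hm deg i g -> hm deg (i + s) (p g)) -> (forall g, p (p g) = 0) ->
  (forall g, ocyc deg p i g -> obd deg p s i g) -> opdim deg p s i = 0%N.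
Proof.
move=> hp pp van; apply: (hdim_uniq (subsp_obd _ _ _ _) (hdim_op hp pp i)).
exists (fun=> 0); split=> [[]//|c _ []//|x Zx]; exists (fun=> 0).
by rewrite big_ord0 subr0; apply: van.
Qed.

(** The induction quantifies over all fields because each step enlarges the field. In positive
    degree a leading coefficient is determined by that of the difference, which has one variable
    less; in degree 0 both differences vanish and the Tate complex compares the constant values. *)
Theorem balance r : forall (k : fieldType) N (deg wt : 'I_N -> int) c0 (d : 'M[k]_N) e,
  (forall b, wt b = c0 - deg b) -> is_ext r d e -> gr_ext deg (-1) r d e ->
  balanced (gdim deg d e r) (wdim wt d e r).
Proof.
elim: r => [|r IH] k N deg wt c0 d e dw0 xe ge; have gw := gr_wt dw0 ge.
  exists (fun=> 0), (fun=> 0); split.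
  - apply: evpoly0; exists (1 - wt_lo deg) => i ii.
    apply: opdim_vanish => [j g|g|g [hg _]]; [exact: hm_DGx | exact: DG_DG |].
    exists 0; first exact: hm0.
    by rewrite linear0; apply: (hm_above hg); lia.
  - apply: evpoly0; exists (1 - wt_lo wt) => i ii.
    apply: opdim_vanish => [j g|g|g [hg _]]; [exact: hm_DWx | exact: DW_DW |].
    exists 0; first exact: hm0.
    by rewrite linear0; apply: (hm_above hg); lia.
  - by move=> n _; exists false.
pose f := gen_map k; pose K := {fraction {poly k}}.
pose dK := map_mx f d; pose eK l := map_mx f (e l).
pose u := @gen_form k.
pose e' l := eK l - u l *: eK r.
have xK : is_ext r.+1 dK eK.
  case: xe => d2 de ee e2; split=> [|l lr|l m lr mr|l lr]; rewrite -?map_mxM -?map_mxD.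
  - by rewrite d2 map_mx0.
  - by rewrite de // map_mx0.
  - by rewrite ee // map_mx0.
  - by rewrite e2 // map_mx0.
have gK : gr_ext deg (-1) r.+1 dK eK.
  case: ge => hd he; split=> [b b' bb|l lr b b' bb]; rewrite mxE.
    by rewrite hd ?rmorph0.
  by rewrite he ?rmorph0.
have x' : is_ext r dK e' by apply: is_ext_sub.
have g' : gr_ext deg (-1) r dK e' by apply: gr_ext_sub.
have wdimK i : wdim wt dK eK r.+1 i = wdim wt d e r.+1 i.
  rewrite !wdim_tr -(gdim_map f) /gdim; congr opdim; rewrite map_trmx; congr (GRing.Linear.sort (DG _ _ _)).
  by apply/funext => l; rewrite map_trmx.
have gdimK i : gdim deg dK eK r.+1 i = gdim deg d e r.+1 i by exact: gdim_map.
have recq : exists i1 : int, forall i : int, i1 <= i ->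
    wdim wt d e r.+1 i = (wdim wt d e r.+1 (i - 2%:Z) + wdim wt dK e' r i)%N.
  have [i0 yi] := generic_regular gw; exists (i0 + 2%:Z) => i ii.
  rewrite -!wdimK; apply: wdim_regular => //; first exact: gr_wt gK.
    by apply: yi; lia.
  by apply: yi; lia.
have recp : exists i1 : int, forall i : int, i1 <= i ->
    gdim deg d e r.+1 i = (gdim deg d e r.+1 (i - 2%:Z) + gdim deg dK e' r i)%N.
  (* The recursion for divided powers is the one for polynomials on the dual space, to which
     [generic_regular] applies with the same form. *)
  have xt := is_ext_tr xe; have xKt := is_ext_tr xK.
  have wd b : deg b = c0 - wt b by rewrite dw0; lia.
  have gt : gr_ext deg 1 r.+1 d^T (fun l => (e l)^T).
    have := gr_ext_opp wd (gr_ext_tr dw0 ge); by rewrite opprK.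
  have gKt : gr_ext deg 1 r.+1 dK^T (fun l => (eK l)^T).
    have := gr_ext_opp wd (gr_ext_tr dw0 gK); by rewrite opprK.
  have [i0 yi] := generic_regular gt; exists (i0 + 2%:Z) => i ii.
  rewrite -!gdimK !gdim_tr.
  have -> : (fun l => (e' l)^T) = (fun l => (eK l)^T - u l *: (eK r)^T).
    by apply/funext => l; rewrite /e' linearB linearZ_LR.
  have yi' (j : int) : i0 <= j -> y_injective_at deg r dK^T (fun l => (eK l)^T) u j.
    move=> ij; have := yi j ij; rewrite -map_trmx.
    by have -> : (fun l => map_mx (gen_map k) (e l)^T) = (fun l => (eK l)^T)
      by apply/funext => l; rewrite map_trmx.
  by apply: wdim_regular => //; apply: yi'; lia.
have [P' [Q' [pP' qQ' _]]] := IH K N deg wt c0 dK e' dw0 x' g'.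
have [P pP] := evpoly_sum pP' recp; have [Q qQ] := evpoly_sum qQ' recq.
have pD := evpoly_dif pP recp; have qD := evpoly_dif qQ recq.
have uniqP p (P1 P2 : bool -> {poly R}) s : evpoly p P1 -> evpoly p P2 -> P1 s = P2 s.
  move=> [i1 h1] [i2 h2]; apply: (@poly_eventually _ _ _ (i1 + i2)) => i ii.
  by rewrite -h1 -?h2 //; lia.
exists P, Q; split=> // -[|n] sPQ.
  have {}sPQ s : P s = ((P s)`_0)%:P /\ Q s = ((Q s)`_0)%:P.
    by have [h1 h2] := sPQ s; split; apply: size1_polyC.
  (* Both polynomials being constant, their differences are 0, so the reduced cohomology is zero in
     high degrees. *)
  have [i0 q0] : exists i0 : int, forall i : int, i0 <= i -> wdim wt dK e' r i = 0%N.
    have [i0 h] := qD; exists (2 * i0)%N%:Z => i ii.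
    have [a [s iE]] : exists a : nat, exists s : bool, i = (2 * a + s)%N.
      exists (`|i|./2), (odd `|i|); have := odd_double_half `|i|; rewrite -muln2; lia.
    apply/eqP; rewrite iE -(eqr_nat R) h; last by lia.
    by rewrite horner_dif (proj2 (sPQ s)) !hornerC subrr.
  have ac : tacyc deg wt c0 r dK e'.
    apply: (@tacyc_of_vanishing _ _ _ _ _ dw0 _ _ _ i0) => // i ii w cw.
    have := wdimP i x' (gr_wt dw0 g'); rewrite q0 // => -[z [_ _ span]].
    by have [c] := span w cw; rewrite big_ord0 subr0.
  have [M h] := gdim_wdim dw0 xK gK ac.
  (* The Tate complex pairs [m] with [i] only if [m + i] has the parity of [c0 - r]. *)
  pose rho := odd `|c0 - r%:Z|; exists rho => s.
  have [i1 h1] := pP; have [i2 h2] := qQ.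
  pose a := (`|M| + i1 + i2 + `|c0| + r + 5)%N.
  have [w wE] : exists w : int, c0 - r%:Z = 2%:Z * w + (rho : nat)%:Z.
    have := odd_double_half `|c0 - r%:Z|; rewrite -/rho -muln2 => hh.
    have [ge0|lt0] := lerP 0 (c0 - r%:Z); first by exists (`|c0 - r%:Z|./2)%:Z; lia.
    by exists (- (`|c0 - r%:Z|./2)%:Z - (rho : nat)%:Z); lia.
  have [v vE] : exists v : nat,
      (2 * a + s)%N%:Z + (2 * a + (s (+) rho))%N%:Z = c0 - r.+1%:Z - 1 + 2%:Z * v%:Z.
    exists `|(2 * a + (s && ~~ rho) + 1)%N%:Z - w|%N.
    move: wE; rewrite /a; case: (s); case: (rho) => /=; lia.
  have E : (gdim deg d e r.+1 (2 * a + s)%N%:Z)%:R = (wdim wt d e r.+1 (2 * a + (s (+) rho))%N%:Z)%:R :> R.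
    by congr (_%:R); rewrite -gdimK -wdimK; apply: (h _ _ v) vE; rewrite /a; lia.
  move: E; rewrite h1; last by rewrite /a; lia.
  rewrite h2; last by rewrite /a; lia.
  by rewrite (proj1 (sPQ s)) (proj2 (sPQ _)) !hornerC !coefC.
have [P2 [Q2 [pP2 qQ2 bal]]] := IH K N deg wt c0 dK e' dw0 x' g'.
have eP s : P2 s = dif (P s) := uniqP _ _ _ s pP2 pD.
have eQ s : Q2 s = dif (Q s) := uniqP _ _ _ s qQ2 qD.
have [|rho h] := bal n.
  move=> s; rewrite eP eQ; have [h1 h2] := sPQ s.
  by split; [apply: (proj1 (dif_lead h1)) | apply: (proj1 (dif_lead h2))].
exists rho => s; have := h s; rewrite eP eQ.
rewrite (proj2 (dif_lead (proj1 (sPQ s)))) (proj2 (dif_lead (proj2 (sPQ _)))).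
by move/mulfI; apply; rewrite pnatr_eq0.
Qed.

End Balance.

(** * From Betti numbers to the Betti degree *)

Section Asymptotics.
Variable R : realType.
Implicit Types P Q S : {poly R}.

Lemma poly_lower n S : (size S <= n)%N ->
  exists2 C : R, 0 <= C & forall x, 1 <= x -> `|S.[x]| * x <= C * x ^+ n.
Proof.
move=> sS; exists (\sum_(i < n) `|S`_i|); first by apply: sumr_ge0.
move=> x x1; have x0 : 0 <= x by apply: le_trans x1.
rewrite (horner_coef_wide x sS) mulr_suml.
apply: le_trans (ler_wpM2r x0 (ler_norm_sum _ _ _)) _.
rewrite mulr_suml; apply: ler_sum => i _.
rewrite normrM -mulrA ler_wpM2l // ger0_norm ?exprn_ge0 // -exprSr.
by apply: ler_weXn2l.
Qed.

Lemma poly_ratio n P (e : R) : (size P <= n.+1)%N -> 0 < e ->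
  exists N, forall i, (N <= i)%N -> `|P.[i%:R] / i%:R ^+ n - P`_n| <= e.
Proof.
move=> sP e0.
have [|C C0 hC] := @poly_lower n (P - P`_n *: 'X^n).
  apply/leq_sizeP => j nj; rewrite coefB coefZ coefXn.
  have [->|jn] := eqVneq j n; first by rewrite mulr1 subrr.
  by rewrite mulr0 subr0 nth_default //; apply: leq_trans sP _; lia.
exists (Num.bound (C / e) + 1)%N => i iN.
have i1 : 1 <= i%:R :> R by rewrite ler1n; lia.
have i0 : 0 < i%:R :> R by apply: lt_le_trans i1.
have in0 : 0 < i%:R ^+ n :> R by apply: exprn_gt0.
have := hC _ i1; rewrite hornerD hornerN hornerZ hornerXn => h.
have -> : P.[i%:R] / i%:R ^+ n - P`_n = (P.[i%:R] - P`_n * i%:R ^+ n) / i%:R ^+ n.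
  by rewrite mulrBl mulfK // gt_eqF.
rewrite normrM normfV (ger0_norm (ltW in0)) ler_pdivrMr //.
rewrite -(ler_pM2r i0); apply: le_trans h _.
rewrite -[leRHS]mulrA [_ ^+ n * _]mulrC [leRHS]mulrA ler_pM2r //.
have := archi_boundP (divr_ge0 C0 (ltW e0)); rewrite ltr_pdivrMr // => /ltW Ce.
apply: le_trans Ce _; rewrite mulrC ler_pM2l // ler_nat.
exact: leq_trans (leq_addr _ _) iN.
Qed.

Local Open Scope ereal_scope.

Lemma limn_esup_fin (u : nat -> \bar R) (L : R) :
  (forall e : R, (0 < e)%R -> exists N, forall i, (N <= i)%N -> u i <= (L + e)%:E) ->
  (forall (e : R) N, (0 < e)%R -> exists2 i, (N <= i)%N & (L - e)%:E <= u i) ->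
  limn_esup u = L%:E.
Proof.
move=> hle hge; rewrite /limn_esup /limf_esup; apply/eqP; rewrite eq_le; apply/andP; split.
  apply/lee_addgt0Pr => e e0; have [N uN] := hle e e0.
  apply: (@le_trans _ _ (ereal_sup (u @` [set i : nat | (N <= i)%N]%classic))).
    by apply: ereal_inf_lbound; exists [set i : nat | (N <= i)%N]%classic => //; exact: nbhs_infty_ge.
  by apply: ub_ereal_sup => _ [i /= Ni <-]; rewrite -EFinD; apply: uN.
apply: le_ereal_inf_tmp => _ [V [N _ NV] <-]; apply/lee_addgt0Pr => e e0.
have [i Ni ui] := hge e N e0.
apply: (@le_trans _ _ (u i + e%:E)); first by rewrite -leeBlDr // -EFinB.
by apply: leeD2r; apply: ereal_sup_ubound; exists i => //; apply: NV.
Qed.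

End Asymptotics.

Section BettiDegree.
Variables (R : realType) (B : comNzRingType) (k : fieldType) (pi : {rmorphism B -> k}).
Implicit Types M : complex B.
Local Open Scope ereal_scope.

Lemma cx_eq M m : betti_poly_bounded R pi M m ->
  (forall b, betti_poly_bounded R pi M b -> (m <= b)%N) -> cx R pi M = Some m.
Proof.
move=> bm mb; rewrite /cx; case: pselect => [h|[]]; last by exists m; apply/asboolP.
case: ex_minnP => n /asboolP bn nb; congr Some; apply/eqP; rewrite eqn_leq mb // andbT.
by apply: nb; apply/asboolP.
Qed.

Section Tail.
Variables (M : complex B) (Q : bool -> {poly R}) (i0 : nat).
Hypothesis bQ : forall i, (i0 <= i)%N -> betti R pi M i = ((Q (odd i)).[i%:R])%:E.
Hypothesis Q0 : forall i, (i0 <= i)%N -> (0 <= (Q (odd i)).[i%:R])%R.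
Notation m := (maxn (size (Q false)) (size (Q true))).

Lemma size_Q s : (size (Q s) <= m)%N.
Proof. by case: s; rewrite leq_max leqnn ?orbT. Qed.

Lemma coef_Q0 n s : (m <= n.+1)%N -> (0 <= (Q s)`_n)%R.
Proof.
move=> mn; rewrite leNgt; apply/negP => a0.
have e0 : (0 < - (Q s)`_n / 2)%R by lra.
have [N h] := poly_ratio (leq_trans (size_Q s) mn) e0.
pose i := (2 * (N + i0 + 1) + s)%N.
have os : odd i = s by rewrite /i; case: (s); lia.
have {}h := h i ltac:(rewrite /i; lia).
have q0 := @Q0 i ltac:(rewrite /i; lia); rewrite os in q0.
have : (0 <= (Q s).[i%:R] / i%:R ^+ n)%R by apply: divr_ge0 => //; apply: exprn_ge0.
by move: h; rewrite ler_norml; lra.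
Qed.

(** The residue class whose polynomial has the larger size already grows too fast for any polynomial
    of smaller size, and a multiple of a single power bounds both classes. *)
Lemma cx_tail : cx R pi M = Some m.
Proof.
apply: cx_eq.
  case E : m => [|n].
    exists 0%R; rewrite size_poly0; split=> //; exists i0 => // i /= ii.
    have s0 : Q (odd i) = 0%R by apply/eqP; rewrite -size_poly_eq0 -leqn0 -E size_Q.
    by rewrite bQ // s0.
  have sQ s : (size (Q s) <= n.+1)%N by rewrite -E size_Q.
  have [N0 h0] := poly_ratio (sQ false) ltr01; have [N1 h1] := poly_ratio (sQ true) ltr01.
  (* The summand 1 absorbs the error allowed in [poly_ratio] and keeps [C] positive, so that the
     bound has size exactly [n.+1]. *)
  pose C : R := ((Q false)`_n + (Q true)`_n + 1)%R.
  have c0 s : (0 <= (Q s)`_n)%R by apply: coef_Q0; rewrite E.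
  have C0 : (0 < C)%R by have := c0 false; have := c0 true; rewrite /C; lra.
  exists (C *: 'X^n)%R; split; first by rewrite size_scale ?gt_eqF // size_polyXn.
  exists (N0 + N1 + i0 + 1)%N => // i /= ii; rewrite bQ; last by lia.
  rewrite lee_fin hornerZ hornerXn.
  have i1 : (0 < i%:R ^+ n :> R)%R by apply: exprn_gt0; rewrite ltr0n; lia.
  rewrite -ler_pdivrMr //.
  have := c0 false; have := c0 true; rewrite /C.
  case: (odd i); [have := h1 i ltac:(lia) | have := h0 i ltac:(lia)]; rewrite ler_norml; lra.
move=> b [p [sp [N _ pN]]]; rewrite leqNgt; apply/negP => bm.
have [n [s [nm sn]]] : exists n s, m = n.+1 /\ size (Q s) = n.+1.
  exists m.-1; rewrite prednK; last by apply: leq_ltn_trans bm.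
  by case: (leqP (size (Q false)) (size (Q true))) => _; [exists true | exists false].
have a0 : (0 < (Q s)`_n)%R.
  rewrite lt_def coef_Q0 ?nm // andbT.
  have := lead_coef_eq0 (Q s); rewrite lead_coefE sn /= => ->.
  by rewrite -size_poly_eq0 sn.
have e0 : (0 < (Q s)`_n / 3)%R by lra.
have [N1 h1] := @poly_ratio _ n (Q s) _ ltac:(by rewrite sn) e0.
have [N2 h2] := @poly_ratio _ n p _ ltac:(by rewrite sp; lia) e0.
pose i := (2 * (N + N1 + N2 + i0 + 1) + s)%N.
have os : odd i = s by rewrite /i; case: (s); lia.
have {}h1 := h1 i ltac:(rewrite /i; lia); have {}h2 := h2 i ltac:(rewrite /i; lia).
have Ni : (N <= i)%N by rewrite /i; lia.
have := pN i Ni; rewrite /= bQ; last by rewrite /i; lia.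
rewrite lee_fin os => qp.
have pn : (p`_n = 0)%R by apply: nth_default; rewrite sp; lia.
have i1 : (0 < (i%:R ^+ n)^-1 :> R)%R by rewrite invr_gt0; apply: exprn_gt0; rewrite ltr0n /i; lia.
have := ler_wpM2r (ltW i1) qp.
move: h1 h2; rewrite pn subr0 !ler_norml; lra.
Qed.

Lemma esup_tail n : m = n.+1 ->
  limn_esup (fun i : nat => betti R pi M i * ((i%:R ^+ n)^-1)%:E) =
  (Num.max (Q false)`_n (Q true)`_n)%:E.
Proof.
move=> mn; have sQ s : (size (Q s) <= n.+1)%N by rewrite -mn size_Q.
apply: limn_esup_fin => [e e0|e N e0].
  have [N0 h0] := poly_ratio (sQ false) e0; have [N1 h1] := poly_ratio (sQ true) e0.
  exists (N0 + N1 + i0)%N => i ii; rewrite bQ; last by lia.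
  rewrite -EFinM lee_fin.
  have h : ((Q (odd i)).[i%:R] / i%:R ^+ n <= (Q (odd i))`_n + e)%R.
    case: (odd i); [have := h1 i ltac:(lia) | have := h0 i ltac:(lia)]; rewrite ler_norml; lra.
  apply: le_trans h _; rewrite lerD2r le_max; case: (odd i); rewrite lexx ?orbT //.
have [s ->] : exists s, Num.max (Q false)`_n (Q true)`_n = (Q s)`_n.
  by case: leP => _; [exists true | exists false].
have [N1 h1] := poly_ratio (sQ s) e0.
pose i := (2 * (N + N1 + i0 + 1) + s)%N.
have os : odd i = s by rewrite /i; case: (s); lia.
exists i; first by rewrite /i; lia.
rewrite bQ; last by rewrite /i; lia.
rewrite os -EFinM lee_fin.
by have := h1 i ltac:(rewrite /i; lia); rewrite ler_norml; lra.
Qed.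

End Tail.

Lemma betti_deg_balanced M M' (p q : int -> nat) : balanced R p q ->
  (forall i : nat, betti R pi M i = (p i)%:R%:E) ->
  (forall i : nat, betti R pi M' i = (q i)%:R%:E) ->
  betti_deg R pi M = betti_deg R pi M'.
Proof.
move=> [P [P' [[i1 pP] [i2 qP] bal]]] Mp Mq.
(* [P s] is a polynomial in the half index [j] of [i = 2 * j + s]; [li s] substitutes [(i - s) / 2]
   for [j], which multiplies the coefficient of degree [n] by a power of 1/2 common to both
   parities. *)
pose li (s : bool) : {poly R} := (2^-1 *: 'X - (s%:R / 2)%:P)%R.
have h2 : (2^-1 != 0 :> R)%R by rewrite invr_eq0 pnatr_eq0.
have sli s : size (li s) = 2%N.
  by rewrite /li -polyCN size_polyDl size_scale ?size_polyX // (leq_ltn_trans (size_polyC_leq1 _)).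
have lli s : (lead_coef (li s) = 2^-1)%R.
  rewrite /li -polyCN lead_coefDl ?lead_coefZ ?lead_coefX ?mulr1 // size_scale // size_polyX.
  by rewrite (leq_ltn_trans (size_polyC_leq1 _)).
pose T (P : bool -> {poly R}) s := (P s \Po li s)%R.
have sT P0 s : size (T P0 s) = size (P0 s) by apply: size_comp_poly2.
have cT (P0 : bool -> {poly R}) s n : (size (P0 s) <= n.+1)%N -> ((T P0 s)`_n = (P0 s)`_n * 2^-1 ^+ n)%R.
  rewrite leq_eqVlt => /orP[/eqP sn|]; last first.
    by rewrite ltnS => sn; rewrite !nth_default ?mul0r ?sT.
  have := @lead_coef_comp _ (P0 s) (li s); rewrite sli lli => /(_ isT).
  by rewrite !lead_coefE -/(T P0 s) sT sn.
have eT (P0 : bool -> {poly R}) (f : int -> nat) i3 (i : nat) : (forall j (s : bool), (i3 <= j)%N ->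
    ((f ((2 * j + s)%N%:Z))%:R = (P0 s).[j%:R])%R) -> (2 * i3 + 1 <= i)%N ->
    ((T P0 (odd i)).[i%:R] = (f i)%:R)%R.
  move=> h ii; have iE := odd_double_half i.
  have -> : (f i = f ((2 * i./2 + odd i)%N%:Z)) by congr f; rewrite -{1}iE -muln2; lia.
  rewrite h; last by move: iE; rewrite -muln2; case: (odd i); lia.
  rewrite horner_comp /li; congr (_.[_])%R; rewrite !hornerE.
  rewrite -{1}iE natrD -muln2 natrM; lra.
have bM i : (2 * i1 + 1 <= i)%N -> betti R pi M i = ((T P (odd i)).[i%:R])%:E.
  by move=> ii; rewrite Mp (eT _ p i1).
have bM' i : (2 * i2 + 1 <= i)%N -> betti R pi M' i = ((T P' (odd i)).[i%:R])%:E.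
  by move=> ii; rewrite Mq (eT _ q i2).
have pM i : (2 * i1 + 1 <= i)%N -> (0 <= (T P (odd i)).[i%:R])%R.
  by move=> ii; rewrite (eT _ p i1).
have pM' i : (2 * i2 + 1 <= i)%N -> (0 <= (T P' (odd i)).[i%:R])%R.
  by move=> ii; rewrite (eT _ q i2).
rewrite /betti_deg (cx_tail bM pM) (cx_tail bM' pM') !sT.
set m := maxn _ _; set m' := maxn _ _.
have sm s : (size (P s) <= m)%N by case: s; rewrite leq_max leqnn ?orbT.
have sm' s : (size (P' s) <= m')%N by case: s; rewrite leq_max leqnn ?orbT.
have sz0 (P0 : {poly R}) n : size P0 = n.+1 -> (P0`_n != 0)%R.
  by move=> sn; have := lead_coef_eq0 P0; rewrite lead_coefE sn /= => ->; rewrite -size_poly_eq0 sn.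
(* A polynomial of the largest size on either side has a nonzero coefficient, which the shift [rho]
   transports to the other side. *)
have mm : m = m'.
  case E : (maxn m m') => [|n]; first by move: E; lia.
  have [|rho h] := bal n.
    by move=> s; have := sm s; have := sm' s; move: E; lia.
  have [s [sn|sn]] : exists s, size (P s) = n.+1 \/ size (P' s) = n.+1.
    have mx (P0 : bool -> {poly R}) : exists s, maxn (size (P0 false)) (size (P0 true)) = size (P0 s).
      by case: leqP => _; [exists true | exists false].
    have [s1 e1] := mx P; have [s2 e2] := mx P'; rewrite /m /m' e1 e2 in E.
    by case: (leqP (size (P s1)) (size (P' s2))) E => _ E; [exists s2; right | exists s1; left].
  - have : (P' (s (+) rho))`_n != 0%R by rewrite -h; apply: sz0.
    have [/(nth_default 0%R) -> /eqP//|h1 _] := leqP (size (P' (s (+) rho))) n.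
    by have := sm' (s (+) rho); have := sm s; move: E; lia.
  - have : (P (s (+) rho))`_n != 0%R by rewrite h addbK; apply: sz0.
    have [/(nth_default 0%R) -> /eqP//|h1 _] := leqP (size (P (s (+) rho))) n.
    by have := sm (s (+) rho); have := sm' s; move: E; lia.
rewrite -mm; case E : m => [//|n]; congr (_ * _).
have sP1 : maxn (size (T P false)) (size (T P true)) = n.+1 by rewrite !sT.
have sP2 : maxn (size (T P' false)) (size (T P' true)) = n.+1 by rewrite !sT -/m' -mm.
rewrite (esup_tail bM sP1) (esup_tail bM' sP2).
have {}sm s : (size (P s) <= n.+1)%N by rewrite -E.
have {}sm' s : (size (P' s) <= n.+1)%N by rewrite -E mm.
have [|rho h] := bal n; first by [].
(* The shift at most exchanges the two parities, which their maximum does not notice. *)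
by rewrite !cT // !h; case: (rho); rewrite //= maxC.
Qed.

End BettiDegree.

(** * Complexes *)

Section Basics.
Variable R : comNzRingType.
Implicit Types X Y Z P : complex R.

Definition idc X : chain_map X X :=
  @ChainMap R X X (fun i => idfun : {linear X i -> X i}) (fun i j x => erefl).

Fact compc_diff X Y Z (g : chain_map Y Z) (f : chain_map X Y) i j x :
  (g j \o f j) (cdiff X i j x) = cdiff Z i j ((g i \o f i) x).
Proof. by rewrite /= !cmap_diff. Qed.
Definition compc X Y Z (g : chain_map Y Z) (f : chain_map X Y) : chain_map X Z :=
  @ChainMap R X Z (fun i => g i \o f i : {linear X i -> Z i}) (compc_diff g f).

(** Transport between equal degrees, extended by zero to all pairs of degrees, so that no proof of
    equality enters the terms. *)
Definition tr X (i j : int) : {linear X i -> X j} := cmap2 (idc X) i j.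

Lemma trE X i x : tr X i i x = x. Proof. by rewrite /tr cmap2_eq. Qed.

Lemma tr_tr X (i j k : int) x : i = j -> tr X j k (tr X i j x) = tr X i k x.
Proof. by move=> e; case: _ / e; rewrite trE. Qed.

Lemma tr_diff X (i j i' j' : int) x : i = j -> i' = j' ->
  tr X i' j' (cdiff X i i' x) = cdiff X j j' (tr X i j x).
Proof. by move=> e e'; case: _ / e; case: _ / e'; rewrite !trE. Qed.

Lemma cdiff_tr X (i j k : int) x : i = j -> cdiff X j k (tr X i j x) = cdiff X i k x.
Proof. by move=> e; case: _ / e; rewrite trE. Qed.

Lemma tr_map X Y (f : chain_map X Y) (i j : int) x : tr Y i j (f i x) = f j (tr X i j x).
Proof.
have [e|e] := pselect (i = j); first by case: _ / e; rewrite !trE.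
by rewrite /tr !cmap2_neq ?linear0.
Qed.

Lemma tr_fam (V : lmodType R) Y (s : forall j, V -> Y j) (j j' : int) x :
  j = j' -> tr Y j j' (s j x) = s j' x.
Proof. by move=> e; case: _ / e; rewrite trE. Qed.

Lemma cmap2E X Y (f : chain_map X Y) (i j : int) x : cmap2 f i j x = f j (tr X i j x).
Proof.
have [e|e] := pselect (i = j); first by case: _ / e; rewrite cmap2_eq trE.
by rewrite /tr !cmap2_neq ?linear0.
Qed.

Lemma cycleP X (i : int) (x : X i) : is_cycle x <-> forall j, cdiff X i j x = 0.
Proof.
split=> [cx j|]; last exact.
have [e|e] := pselect (i = j + 1); last exact: diff_shape.
have -> : j = i - 1 by rewrite e addrK.
exact: cx.
Qed.

Lemma boundaryP X (i : int) (x : X i) : is_boundary x <-> exists j y, cdiff X j i y = x.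
Proof.
split=> [[y <-]|[j [y yx]]]; first by exists (i + 1), y.
have [e|e] := pselect (j = i + 1).
  by move: y yx; rewrite e => y yx; exists y.
by exists 0; rewrite linear0 -yx diff_shape.
Qed.

Lemma bd_at X (i j : int) (x : X i) : is_boundary x -> j = i + 1 -> exists y, cdiff X j i y = x.
Proof. by move=> [y yx] ->; exists y. Qed.

Lemma bd_diff X (i j : int) (x : X i) : is_boundary (cdiff X i j x).
Proof. by apply/boundaryP; exists i, x. Qed.

Lemma bd_cyc X (i : int) (x : X i) : is_boundary x -> is_cycle x.
Proof. by move=> [y <-]; apply/cycleP => j; apply: diff_diff. Qed.

Lemma bd0 X (i : int) : is_boundary (0 : X i).
Proof. by exists 0; rewrite linear0. Qed.
Lemma bdD X (i : int) (x y : X i) : is_boundary x -> is_boundary y -> is_boundary (x + y).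
Proof. by move=> [a <-] [b <-]; exists (a + b); rewrite linearD. Qed.
Lemma bdZ X (i : int) a (x : X i) : is_boundary x -> is_boundary (a *: x).
Proof. by move=> [b <-]; exists (a *: b); rewrite linearZ_LR. Qed.
Lemma bdN X (i : int) (x : X i) : is_boundary x -> is_boundary (- x).
Proof. by move=> bx; rewrite -scaleN1r; apply: bdZ. Qed.
Lemma bdB X (i : int) (x y : X i) : is_boundary x -> is_boundary y -> is_boundary (x - y).
Proof. by move=> bx /bdN; apply: bdD. Qed.
Lemma bd_sum X (i : int) I (s : seq I) (p : pred I) (x : I -> X i) :
  (forall j, p j -> is_boundary (x j)) -> is_boundary (\sum_(j <- s | p j) x j).
Proof. by move=> h; elim/big_rec: _ => [|j y pj]; [apply: bd0 | apply/bdD/h]. Qed.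

Lemma cyc0 X (i : int) : is_cycle (0 : X i). Proof. exact: linear0. Qed.
Lemma cycD X (i : int) (x y : X i) : is_cycle x -> is_cycle y -> is_cycle (x + y).
Proof. by move=> cx cy; rewrite /is_cycle linearD cx cy addr0. Qed.
Lemma cycZ X (i : int) a (x : X i) : is_cycle x -> is_cycle (a *: x).
Proof. by move=> cx; rewrite /is_cycle linearZ_LR cx scaler0. Qed.
Lemma cycN X (i : int) (x : X i) : is_cycle x -> is_cycle (- x).
Proof. by move=> cx; rewrite /is_cycle linearN cx oppr0. Qed.
Lemma cycB X (i : int) (x y : X i) : is_cycle x -> is_cycle y -> is_cycle (x - y).
Proof. by move=> cx /cycN; apply: cycD. Qed.
Lemma cyc_sum X (i : int) I (s : seq I) (p : pred I) (x : I -> X i) :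
  (forall j, p j -> is_cycle (x j)) -> is_cycle (\sum_(j <- s | p j) x j).
Proof. by move=> h; elim/big_rec: _ => [|j y pj]; [apply: cyc0 | apply/cycD/h]. Qed.

Lemma map_cyc X Y (f : chain_map X Y) (i : int) (x : X i) : is_cycle x -> is_cycle (f i x).
Proof. by move=> cx; rewrite /is_cycle -cmap_diff cx linear0. Qed.
Lemma map_bd X Y (f : chain_map X Y) (i : int) (x : X i) : is_boundary x -> is_boundary (f i x).
Proof. by move=> [y <-]; rewrite cmap_diff; apply: bd_diff. Qed.

Lemma bd_sub X (i : int) (x y : X i) : is_boundary (x - y) -> is_boundary y -> is_boundary x.
Proof. by move=> h /(bdD h); rewrite subrK. Qed.

Lemma quasi_id X : quasi_iso (idc X).
Proof.
move=> i; split=> // y cy; exists y => //; rewrite subrr; exact: bd0.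
Qed.

Lemma quasi_comp X Y Z (g : chain_map Y Z) (f : chain_map X Y) :
  quasi_iso g -> quasi_iso f -> quasi_iso (compc g f).
Proof.
move=> qg qf i; split=> [x cx bx|z cz].
  by apply: (qf i).1 => //; apply: (qg i).1 => //; apply: map_cyc.
have [y cy by'] := (qg i).2 z cz; have [x cx bx] := (qf i).2 y cy.
exists x => //=; have := bdD by' (map_bd g bx); rewrite linearB; congr is_boundary; abel.
Qed.

Definition exact_at X (i : int) := forall x : X i, is_cycle x -> is_boundary x.

Lemma quasi_exact X Y (f : chain_map X Y) i : quasi_iso f -> exact_at X i <-> exact_at Y i.
Proof.
move=> qf; split=> ex x cx; last by apply: (qf i).1 => //; apply/ex/map_cyc.
by have [z cz bz] := (qf i).2 x cx; apply: bd_sub bz _; apply/map_bd/ex.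
Qed.

(** ** Null homotopies *)

(** A null homotopy for a family of mere functions: differences and composites of chain maps need
    not be packed into chain maps first. *)
Definition nullh X Y (F : forall i, X i -> Y i) :=
  exists s : forall i j, {linear X i -> Y j}, forall i x,
    F i x = cdiff Y (i + 1) i (s i (i + 1) x) + s (i - 1) i (cdiff X i (i - 1) x).

Lemma nullh_bd X Y (F : forall i, X i -> Y i) i (x : X i) : nullh F -> is_cycle x ->
  is_boundary (F i x).
Proof. by move=> [s sF] cx; rewrite sF cx linear0 addr0; apply: bd_diff. Qed.

Lemma nullh_ext X Y (F G : forall i, X i -> Y i) : (forall i x, F i x = G i x) ->
  nullh F -> nullh G.
Proof. by move=> FG [s h]; exists s => i x; rewrite -FG. Qed.

Lemma nullhB X Y (F G : forall i, X i -> Y i) : nullh F -> nullh G ->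
  nullh (fun i x => F i x - G i x).
Proof.
move=> [s hs] [t ht]; exists (fun i j => s i j \- t i j : {linear X i -> Y j}) => i x /=.
by rewrite hs ht linearB; abel.
Qed.

Lemma nullh_post X Y Z (g : chain_map Y Z) (F : forall i, X i -> Y i) : nullh F ->
  nullh (fun i x => g i (F i x)).
Proof.
move=> [s h]; exists (fun i j => g j \o s i j : {linear X i -> Z j}) => i x /=.
by rewrite h linearD cmap_diff.
Qed.

Lemma nullh_pre X Y Z (f : chain_map X Y) (F : forall i, Y i -> Z i) : nullh F ->
  nullh (fun i x => F i (f i x)).
Proof.
move=> [s h]; exists (fun i j => s i j \o f i : {linear X i -> Z j}) => i x /=.
by rewrite h cmap_diff.
Qed.

(** ** Cones *)

Section ConeLemmas.
Variables (X Y : complex R) (f : chain_map X Y).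
Notation C := (mcone f).

Lemma cone_cycP (i : int) (x : X (i - 1)) (y : Y i) :
  is_cycle ((x, y) : C i) <->
  cdiff X (i - 1) (i - 1 - 1) x = 0 /\ f (i - 1) x + cdiff Y i (i - 1) y = 0.
Proof.
rewrite /is_cycle /= cmap2_eq; split=> [[/eqP h1 h2]|[h1 h2]]; last by rewrite h1 h2 oppr0.
by split=> //; apply/eqP; rewrite -oppr_eq0.
Qed.

Lemma cone_bdP (i : int) (x : X (i - 1)) (y : Y i) :
  is_boundary ((x, y) : C i) <->
  exists a b, x = - cdiff X i (i - 1) a /\ y = f i a + cdiff Y (i + 1) i b.
Proof.
have e : i = i + 1 - 1 by rewrite addrK.
split=> [[[a b] /= [xa yb]]|[a [b [-> ->]]]].
  exists (tr X (i + 1 - 1) i a), b; rewrite cdiff_tr // xa; split=> //.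
  by rewrite -yb cmap2E.
exists (tr X i (i + 1 - 1) a, b) => /=; rewrite cdiff_tr // cmap2E tr_tr ?trE //.
Qed.

Fact cone_incl_linear (i : int) : linear ((fun y => (0, y)) : Y i -> C i).
Proof. by move=> a y y'; apply: injective_projections; rewrite //= scaler0 addr0. Qed.
Fact cone_incl_diff (i j : int) y :
  mkhom (@cone_incl_linear j) (cdiff Y i j y) = cdiff C i j (mkhom (@cone_incl_linear i) y).
Proof. by apply: injective_projections; rewrite /= !linear0 ?oppr0 ?add0r. Qed.
Definition cone_incl : chain_map Y C := ChainMap cone_incl_diff.

Fact cone_proj_linear (i : int) : linear ((fun p => p.1) : C i -> cshift X i).
Proof. by []. Qed.
Fact cone_proj_diff (i j : int) p :
  mkhom (@cone_proj_linear j) (cdiff C i j p) = cdiff (cshift X) i j (mkhom (@cone_proj_linear i) p).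
Proof. by []. Qed.
Definition cone_proj : chain_map C (cshift X) := ChainMap cone_proj_diff.

Lemma cone_acyclic : quasi_iso f -> acyclic C.
Proof.
move=> qf i [x y] /cone_cycP[dx fx]; apply/cone_bdP.
have bx : is_boundary x.
  apply: (qf _).1 => //; have -> : f (i - 1) x = - cdiff Y i (i - 1) y.
    by apply/eqP; rewrite -addr_eq0 fx.
  exact/bdN/bd_diff.
have [|a ax] := bd_at bx (j := i); first by rewrite subrK.
have cy : is_cycle (y + f i a) by rewrite /is_cycle linearD -cmap_diff ax [LHS]addrC.
have [z cz [b bE]] := (qf i).2 _ cy.
exists (z - a), b; rewrite (linearB (cdiff X i (i - 1))) (linearB (f i)) cz ax sub0r opprK; split=> //.
by rewrite bE; abel.
Qed.

Lemma quasi_cone_incl : acyclic X -> quasi_iso cone_incl.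
Proof.
move=> aX i; split=> [y cy /cone_bdP[a [b [xa ->]]]|[x y] /cone_cycP[dx fx]].
  apply: bdD; last exact: bd_diff.
  by apply/map_bd/aX; apply/eqP; rewrite -oppr_eq0 -xa.
have [|a ax] := bd_at (aX _ x dx) (j := i); first by rewrite subrK.
exists (y + f i a); first by rewrite /is_cycle linearD -cmap_diff ax [LHS]addrC.
have -> : (x, y) - cone_incl i (y + f i a) = (x, - f i a) :> C i.
  by apply: injective_projections; rewrite /= ?subr0 // opprD addrA subrr sub0r.
by apply/cone_bdP; exists (- a), 0; rewrite linear0 !linearN ax opprK addr0.
Qed.

Lemma cone_null : nullh (fun i x => cone_incl i (f i x)).
Proof.
have lin (i j : int) : linear ((fun x => (tr X i (j - 1) x, 0)) : X i -> C j).
  by move=> a x x'; apply: injective_projections; rewrite /= ?linearP // scaler0 addr0.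
exists (fun i j => mkhom (lin i j)) => i x.
have e : i = i + 1 - 1 by rewrite addrK.
apply: injective_projections => /=.
  by rewrite cdiff_tr // trE addNr.
by rewrite linear0 !addr0 cmap2E tr_tr ?trE.
Qed.

End ConeLemmas.

(** ** Projective modules and homotopies *)

Definition projective (V : lmodType R) := forall (W W' : lmodType R) (p : {linear W -> W'})
  (g : {linear V -> W'}), (forall v, exists w, p w = g v) ->
  exists h : {linear V -> W}, forall v, p (h v) = g v.

Lemma projective_rV n : projective 'rV[R]_n.
Proof.
move=> W W' p g pg; have [w wE] := choice (fun j : 'I_n => pg (delta_mx 0 j)).
have lin : linear (fun v : 'rV[R]_n => \sum_j v 0 j *: w j).
  move=> a u v; rewrite scaler_sumr -big_split; apply: eq_bigr => j _.
  by rewrite !mxE scalerDl scalerA.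
exists (mkhom lin) => v; rewrite /= linear_sum [in RHS](row_sum_delta v) linear_sum.
by apply: eq_bigr => j _; rewrite !linearZ_LR wE.
Qed.

Lemma projective_reg : projective R^o.
Proof.
move=> W W' p g pg; have [w wE] := pg 1.
have lin : linear (fun a : R^o => a *: w) by move=> a u v; rewrite scalerDl scalerA.
exists (mkhom lin) => v; rewrite /= linearZ_LR wE -linearZ_LR; congr (g _); exact: mulr1.
Qed.

Section Lift.
Variables (P X : complex R) (f : chain_map P X) (D : int -> Prop) (lo : int).
Hypothesis pP : forall i, projective (P i).
Hypothesis P0 : forall (i : int) (x : P i), i < lo -> x = 0.
Hypothesis DS : forall i : int, D i -> D (i - 1).
Hypothesis DX : forall i, D i -> exact_at X i.

Notation family := (forall i j, {linear P i -> X j}).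
Definition hom_at (s : family) (i : int) := forall x, D i ->
  f i x = cdiff X (i + 1) i (s i (i + 1) x) + s (i - 1) i (cdiff P i (i - 1) x).
Definition good (s : family) (m : int) := forall i : int, i < m -> hom_at s i.

Lemma good_step s (m : int) : good s m ->
  exists s' : family, good s' (m + 1) /\ forall (i j : int) x, i < m -> s' i j x = s i j x.
Proof.
move=> gs; have [Dm|nD] := pselect (D m); last first.
  exists s; split=> // i im x Di; apply: gs => //.
  have nm : i <> m by move=> e; apply: nD; rewrite -e.
  lia.
pose g : {linear P m -> X m} := f m \- (s (m - 1) m \o cdiff P m (m - 1)).
have [|h hE] := pP (p := cdiff X (m + 1) m) (g := g).
  move=> x; apply: (DX Dm); rewrite /is_cycle /= linearB -cmap_diff gs; [|lia|exact: DS].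
  rewrite diff_diff linear0 addr0 -(@tr_fam _ _ (fun j => s (m - 1) j) (m - 1 + 1) m) ?subrK //.
  by rewrite trE subrr.
pose s' i j : {linear P i -> X j} :=
  if i == m then (tr X (m + 1) j \o h \o tr P i m : {linear P i -> X j}) else s i j.
have s'lt (i j : int) x : i < m -> s' i j x = s i j x.
  by move=> im; rewrite /s'; case: eqP => // e; lia.
exists s'; split=> // i im x Di.
have [e|ne] := eqVneq i m; last by rewrite !s'lt; [apply: gs => //; lia | lia | lia].
move: x Di; rewrite e => x Di; rewrite [s' (m - 1) m _]s'lt; last by lia.
by rewrite /s' eqxx /= !trE hE /= subrK.
Qed.

(** The homotopy is built upwards from [lo], below which [P] is zero, and uses exactness of [X] only
    in the degrees of [D], a set closed downwards. Each stage leaves the lower degrees unchanged, so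
    evaluating every degree at a stage beyond it gives a single family. *)
Lemma lift_homotopy : exists s : family, forall i, hom_at s i.
Proof.
pose T (t : nat) := {s : family | good s (lo + t%:Z)}.
have s0 : good (fun i j => hom_zero (P i) (X j)) (lo + 0%N%:Z).
  by move=> i il x _; rewrite (P0 x) ?linear0 /= ?addr0 //; lia.
have step t (u : T t) : {v : T t.+1 | forall (i j : int) x, i < lo + t%:Z -> sval v i j x = sval u i j x}.
  apply: cid; case: u => s gs; have [s' [gs' e]] := good_step gs.
  by have gs2 : good s' (lo + t.+1%:Z); [move: gs'; congr good; lia | exists (exist _ s' gs2)].
pose S := nat_rect T (exist (fun s : family => good s _) _ s0) (fun t u => sval (step t u)).
have SS t (i j : int) x : i < lo + t%:Z -> sval (S t.+1) i j x = sval (S t) i j x.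
  by move=> il; apply: (svalP (step t (S t))).
have Sm t n (i j : int) x : i < lo + t%:Z -> sval (S (t + n)%N) i j x = sval (S t) i j x.
  by move=> il; elim: n => [|n IH]; rewrite ?addn0 // addnS SS ?IH //; lia.
exists (fun i j => sval (S (`|i - lo|.+1)%N) i j) => i x Di.
have [il|il] := ltrP i lo; first by rewrite (P0 x il) !linear0 addr0.
rewrite (svalP (S (`|i - lo|.+1)%N) i _ x Di); last by lia.
congr (_ + _); have [jl|jl] := ltrP (i - 1) lo; first by rewrite (P0 (cdiff P i (i - 1) x) jl) !linear0.
have -> : (`|(i - lo)%R|.+1 = `|(i - 1 - lo)%R|.+1 + 1)%N by lia.
by rewrite Sm //; lia.
Qed.

End Lift.

Lemma K_projective_free P (lo : int) : (forall i, projective (P i)) ->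
  (forall (i : int) (x : P i), i < lo -> x = 0) -> K_projective P.
Proof.
move=> pP P0 X f aX.
have [|s h] := @lift_homotopy P X f (fun=> True) lo pP P0 (fun _ _ => I); first by move=> i _; apply: aX.
by exists s => i x; apply: h.
Qed.

(** ** Uniqueness of K-projective resolutions *)

(** The cone of [t] is acyclic, so [f] followed by the inclusion into it is null homotopic. The
    first component of that homotopy is the lift, the second one the homotopy that compares [t]
    after the lift with [f]. *)
Lemma K_projective_lift P X' X (t : chain_map X' X) (f : chain_map P X) : K_projective P ->
  quasi_iso t -> exists g : chain_map P X', nullh (fun i x => t i (g i x) - f i x).
Proof.
move=> kP qt.
have [s sE] := kP _ (compc (cone_incl t) f) (cone_acyclic qt).
pose a i j : {linear P i -> X' j} := tr X' (j + 1 - 1) j \o (cone_proj t (j + 1) \o s i (j + 1)).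
pose b i j : {linear P i -> X j} :=
  mkhom (fun c x y => f_equal snd (linearP (s i j) c x y)) : {linear P i -> X j}.
have s1 (i j k : int) x : k = j + 1 -> tr X' (k - 1) j (s i k x).1 = a i j x.
  by move=> ->.
have E1 (i : int) x : cdiff X' i (i - 1) (a i i x) = a (i - 1) (i - 1) (cdiff P i (i - 1) x).
  have h0 : 0 = - cdiff X' (i + 1 - 1) (i - 1) (s i (i + 1) x).1 + (s (i - 1) i (cdiff P i (i - 1) x)).1.
    exact: (congr1 (fun p : (X' (i - 1) * X i)%type => p.1) (sE i x)).
  have h : cdiff X' (i + 1 - 1) (i - 1) (s i (i + 1) x).1 = (s (i - 1) i (cdiff P i (i - 1) x)).1.
    by apply/eqP; rewrite eq_sym -subr_eq0 [X in X == _]addrC -h0.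
  rewrite -(s1 (i - 1) (i - 1) i); last by rewrite subrK.
  rewrite trE -h.
  by rewrite -(s1 i i (i + 1)) // cdiff_tr // addrK.
have E2 (i : int) x : f i x = t i (a i i x) + (cdiff X (i + 1) i (b i (i + 1) x) + b (i - 1) i (cdiff P i (i - 1) x)).
  have h2 : f i x = cmap2 t (i + 1 - 1) i (s i (i + 1) x).1 + cdiff X (i + 1) i (s i (i + 1) x).2 +
      (s (i - 1) i (cdiff P i (i - 1) x)).2.
    exact: (congr1 (fun p : (X' (i - 1) * X i)%type => p.2) (sE i x)).
  by rewrite [LHS]h2 cmap2E -addrA.
have gd (i j : int) x : a j j (cdiff P i j x) = cdiff X' i j (a i i x).
  have [e|e] := pselect (i = j + 1); last by rewrite !diff_shape // linear0.
  have {e} e : i - 1 = j by rewrite e addrK.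
  by case: _ / e; rewrite -E1.
exists (ChainMap gd); exists (fun i j => hom_opp (b i j)) => i x.
change (t i (a i i x) - f i x =
  cdiff X (i + 1) i (- b i (i + 1) x) + - b (i - 1) i (cdiff P i (i - 1) x)).
by rewrite E2 (linearN (cdiff X (i + 1) i)); abel.
Qed.

Lemma quasi_cancel X Y Z (g : chain_map Y Z) (f : chain_map X Y) (h : chain_map X Z) :
  nullh (fun i x => g i (f i x) - h i x) -> quasi_iso g -> quasi_iso h -> quasi_iso f.
Proof.
move=> n qg qh i; split=> [x cx bx|y cy].
  apply: (qh i).1 => //; have := bdB (map_bd g bx) (nullh_bd n cx).
  by rewrite subKr.
have [x cx bx] := (qh i).2 _ (map_cyc g cy); exists x => //.
apply: (qg i).1; first exact/cycB/map_cyc.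
have /= := bdB bx (nullh_bd n cx); rewrite (linearB (g i)); congr is_boundary; abel.
Qed.

(** ** Hom complexes and ranks *)

Section HomMap.
Variables (P P' : complex R) (g : chain_map P P') (N : lmodType R).

Fact homc_map_linear (i : int) :
  linear ((fun phi => mkhom (fun a x y => linearP (phi \o g (- i)) a x y)) : homc P' N i -> homc P N i).
Proof. by move=> a phi psi; apply: homP. Qed.
Fact homc_map_diff (i j : int) phi :
  mkhom (@homc_map_linear j) (cdiff (homc P' N) i j phi) = cdiff (homc P N) i j (mkhom (@homc_map_linear i) phi).
Proof. by apply: homP => x /=; rewrite cmap_diff. Qed.
Definition homc_map : chain_map (homc P' N) (homc P N) := ChainMap homc_map_diff.
End HomMap.

Lemma homc_null P P' (g h : chain_map P P') N : nullh (fun i x => g i x - h i x) ->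
  forall i (phi : homc P' N i), is_cycle phi ->
  is_boundary (homc_map g N i phi - homc_map h N i phi).
Proof.
move=> [s sE] i phi cphi; apply/boundaryP.
have lin : linear (fun x : P (- (i + 1)) => phi (s (- (i + 1)) (- i) x)).
  by move=> a x y; rewrite !linearP.
exists (i + 1), (mkhom lin : homc P N (i + 1)); apply: homP => x /=.
have := sE (- i) x; have e : - i - 1 = - (i + 1) by rewrite opprD.
have c0 : phi (cdiff P' (- i + 1) (- i) (s (- i) (- i + 1) x)) = 0.
  have /cycleP /(_ (i - 1)) := cphi; move/(congr1 (fun p : linHom _ _ => p (s (- i) (- (i - 1)) x))).
  rewrite /=; have -> : - (i - 1) = - i + 1 by rewrite opprB addrC.
  by [].
rewrite -linearB => ->; rewrite linearD c0 add0r; congr (phi _).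
by rewrite -/e; case: _ / e.
Qed.

Lemma homc_idmap P N i (phi : homc P N i) : homc_map (idc P) N i phi = phi.
Proof. exact: homP. Qed.

Lemma homc_compmap P P' P'' (g : chain_map P' P'') (f : chain_map P P') N i phi :
  homc_map f N i (homc_map g N i phi) = homc_map (compc g f) N i phi.
Proof. exact: homP. Qed.

(** Three successive lifts [g], [h], [k], each a right inverse of the preceding one up to homotopy.
    The relation between [g] and [h] makes [homc_map g] injective on homology; surjectivity follows
    because the relation between [h] and [k] makes [homc_map h] injective as well. *)
Lemma K_projective_hom X P P' (f : chain_map P X) (f' : chain_map P' X) :
  K_projective P -> K_projective P' -> quasi_iso f -> quasi_iso f' ->
  exists g : chain_map P' P, forall N, quasi_iso (homc_map g N).
Proof.
move=> kP kP' qf qf'.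
have [g gE] := K_projective_lift f' kP' qf.
have qg := quasi_cancel gE qf qf'.
have [h hE] := K_projective_lift (idc P) kP qg.
have qh : quasi_iso h by apply: (quasi_cancel hE qg); apply: quasi_id.
have [k kE] := K_projective_lift (idc P') kP' qh.
have lh N i (phi : homc P N i) : is_cycle phi ->
    is_boundary (homc_map h N i (homc_map g N i phi) - phi).
  move=> c; rewrite homc_compmap -[X in _ - X]homc_idmap.
  exact: (@homc_null _ _ (compc g h) (idc P)).
have lk N i (phi : homc P' N i) : is_cycle phi ->
    is_boundary (homc_map k N i (homc_map h N i phi) - phi).
  move=> c; rewrite homc_compmap -[X in _ - X]homc_idmap.
  exact: (@homc_null _ _ (compc h k) (idc P')).
exists g => N i; split=> [phi c b|psi c].
  by have := bdB (map_bd (homc_map h N) b) (lh _ _ _ c); rewrite subKr.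
exists (homc_map h N i psi); first exact: map_cyc.
set chi := homc_map g N i _; have cc : is_cycle (psi - chi) by apply/cycB; [|apply/map_cyc/map_cyc].
have bh : is_boundary (homc_map h N i (psi - chi)).
  rewrite linearB -opprB; apply/bdN/lh; exact: map_cyc.
by have := bdB (map_bd (homc_map k N) bh) (lk _ _ _ cc); rewrite subKr.
Qed.

End Basics.

Section Rank.
Variables (R : realType) (B : comNzRingType) (k : fieldType) (pi : {rmorphism B -> k}).
Implicit Types X Y : complex B.
Local Open Scope ereal_scope.

Lemma homology_rank_quasi X Y (u : chain_map X Y) n : quasi_iso u ->
  homology_rank R pi X n = homology_rank R pi Y n.
Proof.
move=> qu; rewrite /homology_rank; congr ereal_sup; congr (image _ _); apply/seteqP; split=> m [z [cz iz]] /=.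
  exists (fun j => u n (z j)); split=> [j|b bd]; first exact: map_cyc.
  apply: iz; apply: (qu n).1.
    by apply: cyc_sum => j _; apply: cycZ.
  rewrite linear_sum; move: bd; congr is_boundary; apply: eq_bigr => j _; by rewrite linearZ_LR.
have [x xP] := choice (fun j => let: ex_intro2 x c b := (qu n).2 _ (cz j) in ex_intro (fun x => is_cycle x /\ is_boundary (z j - u n x)) x (conj c b)).
exists x; split=> [j|b bd]; first by case: (xP j).
apply: iz; have b2 : is_boundary (\sum_j b j *: (z j - u n (x j)))%R.
  by apply: bd_sum => j _; apply/bdZ; case: (xP j).
have := bdD (map_bd u bd) b2.
congr is_boundary; rewrite linear_sum -big_split; apply: eq_bigr => j _ /=.
by rewrite linearZ_LR scalerBr addrC subrK.
Qed.

End Rank.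

(** * Finiteness properties of perfect complexes *)

Section FiniteHomology.
Variable R : comNzRingType.
Hypothesis nR : noetherian_ring R.
Implicit Types X Y Z : complex R.

Lemma cyc_shift X (i : int) (x : X (i - 1)) : is_cycle (x : cshift X i) <-> is_cycle x.
Proof.
rewrite /is_cycle /=; split=> [/eqP|->]; last by rewrite oppr0.
by rewrite oppr_eq0 => /eqP.
Qed.

Lemma bd_shift X (i : int) (x : X (i - 1)) : is_boundary (x : cshift X i) <-> is_boundary x.
Proof.
split=> [[y <-]|bx]; first exact/bdN/bd_diff.
have [|y yx] := bd_at (bdN bx) (j := i + 1 - 1); first by rewrite addrK subrK.
by exists y; rewrite -[LHS]/(- cdiff X (i + 1 - 1) (i - 1) y) yx opprK.
Qed.

Lemma exact_shift X (i : int) : exact_at (cshift X) i <-> exact_at X (i - 1).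
Proof. by split=> h x cx; apply/bd_shift/h/cyc_shift. Qed.

Definition homology_fg X (i : int) := exists n (z : 'I_n -> X i), (forall j, is_cycle (z j)) /\
  forall x, is_cycle x -> exists c : 'I_n -> R, is_boundary (x - \sum_j c j *: z j).

Definition finite_homology X := (exists m : nat, forall i : int, (m < `|i|)%N -> exact_at X i) /\
  forall i, homology_fg X i.

Lemma homology_fg_quasi X Y (f : chain_map X Y) i : quasi_iso f ->
  homology_fg X i <-> homology_fg Y i.
Proof.
move=> qf; split=> [[n [z [cz sp]]]|[n [z [cz sp]]]].
  exists n, (fun j => f i (z j)); split=> [j|y cy]; first exact: map_cyc.
  have [x cx bx] := (qf i).2 y cy; have [c bc] := sp x cx; exists c.
  have := bdD bx (map_bd f bc); rewrite (linearB (f i)) addrA subrK.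
  congr (is_boundary (_ - _)); rewrite linear_sum; apply: eq_bigr => j _; exact: linearZ_LR.
have [x xP] : exists x : 'I_n -> X i, forall j, is_cycle (x j) /\ is_boundary (z j - f i (x j)).
  have h j : exists x, is_cycle x /\ is_boundary (z j - f i x).
    by have [x cx bx] := (qf i).2 _ (cz j); exists x.
  by have [x xP] := choice h; exists x.
exists n, x; split=> [j|y cy]; first by case: (xP j).
have [c bc] := sp _ (map_cyc f cy); exists c; apply: (qf i).1.
  by apply: cycB => //; apply: cyc_sum => j _; apply: cycZ; case: (xP j).
have b2 : is_boundary (\sum_j c j *: (z j - f i (x j))).
  by apply: bd_sum => j _; apply: bdZ; case: (xP j).
have e : \sum_j c j *: (z j - f i (x j)) = \sum_j c j *: z j - f i (\sum_j c j *: x j).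
  rewrite linear_sum -sumrB; apply: eq_bigr => j _.
  by rewrite scalerBr (linearZ_LR (f i)).
by have := bdD bc b2; rewrite e (linearB (f i)) addrA subrK.
Qed.

Lemma finite_homology_quasi X Y (f : chain_map X Y) : quasi_iso f ->
  finite_homology X <-> finite_homology Y.
Proof.
move=> qf; split=> -[[m bm] fg]; split.
- by exists m => i mi; apply/(quasi_exact i qf)/bm.
- by move=> i; apply/(homology_fg_quasi i qf).
- by exists m => i mi; apply/(quasi_exact i qf)/bm.
- by move=> i; apply/(homology_fg_quasi i qf).
Qed.

Lemma homology_fg_shift X (i : int) : homology_fg (cshift X) i <-> homology_fg X (i - 1).
Proof.
split=> [[n [z [cz sp]]]|[n [z [cz sp]]]]; exists n, z; split=> [j|x cx].
- exact/cyc_shift.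
- by have [|c bc] := sp x; [exact/cyc_shift | exists c; exact/bd_shift].
- exact/cyc_shift.
- by have [|c bc] := sp x; [exact/cyc_shift | exists c; exact/bd_shift].
Qed.

Lemma finite_homology_shift X : finite_homology X <-> finite_homology (cshift X).
Proof.
split=> -[[m bm] fg]; split.
- by exists m.+1 => i mi; apply/exact_shift/bm; lia.
- by move=> i; apply/homology_fg_shift/fg.
- exists m.+1 => i mi; have -> : i = i + 1 - 1 by rewrite addrK.
  by apply/exact_shift/bm; lia.
- move=> i; have -> : i = i + 1 - 1 by rewrite addrK.
  exact/homology_fg_shift/fg.
Qed.

Lemma exact_cone X Y (f : chain_map X Y) (i : int) :
  exact_at X (i - 1) -> exact_at Y i -> exact_at (mcone f) i.
Proof.
move=> eX eY [x y] /cone_cycP[dx fx]; apply/cone_bdP.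
have [|a ax] := bd_at (eX x dx) (j := i); first by rewrite subrK.
have cy : is_cycle (y + f i a) by rewrite /is_cycle linearD -cmap_diff ax [LHS]addrC.
have [b bE] := eY _ cy; exists (- a), b; rewrite !linearN ax opprK; split=> //.
by rewrite bE addrC addrK.
Qed.

(** The combinations of the generators [z] that extend to cycles of the cone form a submodule [U] of
    a free module, finitely generated by noetherianity. A cycle of the cone minus such extensions
    comes from [Y] up to a boundary. *)
Lemma homology_fg_cone X Y (f : chain_map X Y) (i : int) :
  homology_fg X (i - 1) -> homology_fg Y i -> homology_fg (mcone f) i.
Proof.
move=> [n [z [cz spX]]] [n' [w [cw spY]]].
pose zz (c : 'rV[R]_n) := \sum_j c 0 j *: z j.
have zzD c c' : zz (c + c') = zz c + zz c'.
  by rewrite -big_split; apply: eq_bigr => j _; rewrite mxE scalerDl.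
have zzZ a c : zz (a *: c) = a *: zz c.
  by rewrite scaler_sumr; apply: eq_bigr => j _; rewrite mxE scalerA.
pose U (c : 'rV[R]_n) := exists y : Y i, f (i - 1) (zz c) + cdiff Y i (i - 1) y = 0.
have cyc_zz c y : f (i - 1) (zz c) + cdiff Y i (i - 1) y = 0 -> is_cycle ((zz c, y) : mcone f i).
  by move=> h; apply/cone_cycP; split=> //; apply: cyc_sum => j _; apply: cycZ.
have [|||m [G [UG sp]]] := @noeth_fg R nR n U.
- exists 0; rewrite linear0 addr0 /zz big1 ?linear0 // => j _; by rewrite mxE scale0r.
- move=> c c' [y yE] [y' yE']; exists (y + y').
  by rewrite zzD !linearD addrACA yE yE' addr0.
- by move=> a c [y yE]; exists (a *: y); rewrite zzZ !linearZ_LR -scalerDr yE scaler0.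
have [y yE] := choice UG.
pose zc (t : 'I_m) : mcone f i := (zz (row t G), y t).
exists (m + n')%N, (fun t => match fintype.split t with inl t => zc t | inr t => cone_incl f i (w t) end).
split=> [t|[x y0] cxy].
  by case: fintype.splitP => s _; [apply: cyc_zz | apply: map_cyc].
have /cone_cycP[dx fx] := cxy.
have [c bc] := spX x dx; pose cc : 'rV_n := \row_j c j.
have ccE : \sum_j c j *: z j = zz cc by apply: eq_bigr => j _; rewrite mxE.
rewrite ccE in bc; have [|a aE] := bd_at bc (j := i); first by rewrite subrK.
have b1 : is_boundary ((x - zz cc, - f i a) : mcone f i).
  by apply/cone_bdP; exists (- a), 0; rewrite linear0 !linearN aE opprK addr0.
have Ucc : f (i - 1) (zz cc) + cdiff Y i (i - 1) (y0 + f i a) = 0.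
  rewrite linearD -cmap_diff aE linearB -fx; abel.
have [|h hE] := sp cc; first by exists (y0 + f i a).
pose S : mcone f i := \sum_t h 0 t *: zc t.
have SE1 : S.1 = zz cc.
  rewrite /S (linear_sum (cone_proj f i)) hE mulmx_sum_row.
  have zz_sum : zz (\sum_t h 0 t *: row t G) = \sum_t h 0 t *: zz (row t G).
    elim/big_rec2: _ => [|t u v _ <-]; last by rewrite zzD zzZ.
    by rewrite /zz big1 // => j _; rewrite mxE scale0r.
  by rewrite zz_sum; apply: eq_bigr => t _; rewrite linearZ_LR.
have cS : is_cycle S by apply: cyc_sum => t _; apply/cycZ/cyc_zz.
have cw' : is_cycle (cone_incl f i (y0 + f i a - S.2)).
  have -> : cone_incl f i (y0 + f i a - S.2) = (x, y0) - (x - zz cc, - f i a) - S :> mcone f i.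
    apply: injective_projections => /=; last by rewrite opprK.
    by rewrite subKr -/S.1 SE1 subrr.
  by apply: cycB => //; apply: cycB => //; apply: bd_cyc.
have [|e be] := spY (y0 + f i a - S.2).
  by have /cone_cycP[_] := cw'; rewrite linear0 add0r.
exists (fun t => match fintype.split t with inl t => h 0 t | inr t => e t end).
rewrite big_split_ord /=.
have -> : \sum_(t < m) match fintype.split (lshift n' t) with inl t => h 0 t | inr t => e t end *:
    match fintype.split (lshift n' t) with inl t => zc t | inr t => cone_incl f i (w t) end = S.
  by apply: eq_bigr => t _; have := unsplitK (inl t : 'I_m + 'I_n'); rewrite /= => ->.
have -> : \sum_(t < n') match fintype.split (rshift m t) with inl t => h 0 t | inr t => e t end *:
    match fintype.split (rshift m t) with inl t => zc t | inr t => cone_incl f i (w t) end =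
    cone_incl f i (\sum_t e t *: w t).
  rewrite linear_sum; apply: eq_bigr => t _; rewrite linearZ_LR.
  by have := unsplitK (inr t : 'I_m + 'I_n'); rewrite /= => ->.
have := bdD b1 (map_bd (cone_incl f) be); congr is_boundary.
apply: injective_projections => /=; first by rewrite -/S.1 SE1 !addr0.
rewrite -/S.2; abel.
Qed.

Lemma finite_homology_cone X Y (f : chain_map X Y) : finite_homology X -> finite_homology Y ->
  finite_homology (mcone f).
Proof.
move=> [[m bm] fg] [[m' bm'] fg']; split.
  by exists (m + m' + 1)%N => i mi; apply: exact_cone; [apply: bm | apply: bm']; lia.
by move=> i; apply: homology_fg_cone.
Qed.

Definition dsum1 X Y : chain_map (dsum X Y) X :=
  @ChainMap R (dsum X Y) X (fun i => mkhom (fun a p q => erefl : ((a *: p + q) : dsum X Y i).1 = _))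
    (fun i j x => erefl).

Lemma dsum_cyc X Y (i : int) (x : X i) : is_cycle x -> is_cycle ((x, 0) : dsum X Y i).
Proof. by move=> cx; apply: injective_projections; rewrite /= ?linear0. Qed.

Lemma dsum_bd X Y (i : int) (p : dsum X Y i) : is_boundary p -> is_boundary p.1.
Proof. exact: (map_bd (dsum1 X Y)). Qed.

Lemma finite_homology_summand X Y : finite_homology (dsum X Y) -> finite_homology X.
Proof.
move=> [[m bm] fg]; split.
  by exists m => i mi x cx; apply: dsum_bd (bm i mi _ (dsum_cyc Y cx)).
move=> i; have [n [z [cz sp]]] := fg i; exists n, (fun j => (z j).1); split=> [j|x cx].
  exact: (map_cyc (dsum1 X Y) (cz j)).
have [c bc] := sp _ (dsum_cyc Y cx); exists c; have := dsum_bd bc.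
rewrite -[((x, 0) - _).1]/(dsum1 X Y i ((x, 0) - _)) linearB linear_sum.
congr is_boundary; congr (_ - _); apply: eq_bigr => j _; exact: linearZ_LR.
Qed.

Lemma stalk_eq0 (N : lmodType R) (i : int) (x : stalk N i) : i <> 0 -> x = 0.
Proof.
rewrite /= /stalk_obj in x *; case: eqP x => // _ x _; exact: thinmx0.
Qed.

Lemma finite_homology_stalk : finite_homology (stalk R^o).
Proof.
split; first by exists 0%N => i i0 x _; rewrite (stalk_eq0 x); [apply: bd0 | lia].
move=> i; have [->|i0] := eqVneq i 0; last first.
  exists 0%N, (fun=> 0); split=> [[]//|x _]; exists (fun=> 0).
  by rewrite big_ord0 subr0 (stalk_eq0 x); [apply: bd0 | apply/eqP].
exists 1%N, (fun=> (1 : R^o)); split=> // x _; exists (fun=> (x : R)).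
rewrite big_ord1; have -> : (x : R) *: (1 : R^o) = x by exact: mulr1.
by rewrite subrr; apply: bd0.
Qed.

Lemma thick_finite_homology : thick_class finite_homology.
Proof.
split; [exact: finite_homology_quasi | exact: finite_homology_shift |
  exact: finite_homology_cone | exact: finite_homology_summand].
Qed.

End FiniteHomology.

(** * Bounded projective dimension as a property stable in thick classes *)

Section Effaceable.
Variable R : comNzRingType.
Implicit Types X Y Z : complex R.

Definition coconnective_from (m : int) Y := forall i : int, i < m -> exact_at Y i.

(* Every morphism in the derived category from [X] to a complex with no homology below
   degree [m] is zero; morphisms are fractions whose denominator is inverted on the right. *)
Definition bounded_dim X := exists m : int, forall Y, coconnective_from m Y ->
  forall g : chain_map X Y, exists Z (s : chain_map Y Z), quasi_iso s /\
    nullh (fun i x => s i (g i x)).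

(** A null homotopy of [s g f] extends [s g] to the cone of [f]. This cone is acyclic, so passing to
    the cone of the extension changes [Z] only by a quasi-isomorphism, and there the map becomes
    null homotopic. *)
Lemma bounded_dim_quasi1 X X' (f : chain_map X X') : quasi_iso f ->
  bounded_dim X -> bounded_dim X'.
Proof.
move=> qf [m h]; exists m => Y cY g; have [Z [s [qs [t tE]]]] := h Y cY (compc g f).
pose c0 (i : int) (p : mcone f i) : Z i := s i (g i p.2) + t (i - 1) i p.1.
have c0_lin i : linear (c0 i).
  by move=> a p q; rewrite /c0 !linearP scalerDr; abel.
have c0_diff (i j : int) p : mkhom (c0_lin j) (cdiff (mcone f) i j p) = cdiff Z i j (mkhom (c0_lin i) p).
  have [e|e] := pselect (i = j + 1); last by rewrite !diff_shape // linear0.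
  have {e} e : i - 1 = j by rewrite e addrK.
  case: _ / e; case: p => x y.
  rewrite -[LHS]/(s (i - 1) (g (i - 1) (cmap2 f (i - 1) (i - 1) x + cdiff X' i (i - 1) y)) +
    t (i - 1 - 1) (i - 1) (- cdiff X (i - 1) (i - 1 - 1) x)).
  rewrite -[RHS]/(cdiff Z i (i - 1) (s i (g i y) + t (i - 1) i x)).
  rewrite cmap2_eq !(linearD (g _)) !(linearD (s _)) (linearD (cdiff Z _ _)) (linearN (t _ _)) -!cmap_diff.
  have := tE (i - 1) x; rewrite /= => ->.
  rewrite -(@tr_fam _ _ _ (fun j => t (i - 1) j) (i - 1 + 1) i) ?subrK //.
  by rewrite trE; abel.
pose c : chain_map (mcone f) Z := ChainMap c0_diff.
exists (mcone c), (compc (cone_incl c) s); split.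
  by apply: quasi_comp => //; apply: quasi_cone_incl; apply: cone_acyclic.
apply: nullh_ext (nullh_pre (cone_incl f) (cone_null c)) => i x /=.
by rewrite /c0 /= linear0 addr0.
Qed.

(** A homotopy pushout: the cone [C] of [(f, - g)] receives [Y] by a quasi-isomorphism [i2] because
    [f] is one. In [C] the map [i2 g] is homotopic to [i1 f], and [i1] starts from [X'], where the
    hypothesis applies. *)
Lemma bounded_dim_quasi2 X X' (f : chain_map X X') : quasi_iso f ->
  bounded_dim X' -> bounded_dim X.
Proof.
move=> qf [m h]; exists m => Y cY g.
have k_lin i : linear (fun x : X i => (f i x, - g i x) : dsum X' Y i).
  move=> a x x'; apply: injective_projections; first exact: (linearP (f i)).
  by rewrite /= (linearP (g i)) opprD scalerN.
have k_diff (i j : int) x : mkhom (k_lin j) (cdiff X i j x) = cdiff (dsum X' Y) i j (mkhom (k_lin i) x).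
  by apply: injective_projections; rewrite /= cmap_diff ?linearN.
pose k : chain_map X (dsum X' Y) := ChainMap k_diff.
pose C := mcone k.
have i1_lin i : linear (fun y : X' i => (0, (y, 0)) : C i).
  by move=> a x x'; apply: injective_projections; [|apply: injective_projections]; rewrite /= ?scaler0 ?addr0.
have i1_diff (i j : int) x : mkhom (i1_lin j) (cdiff X' i j x) = cdiff C i j (mkhom (i1_lin i) x).
  by apply: injective_projections; [|apply: injective_projections]; rewrite /= ?linear0 ?oppr0 ?addr0 ?add0r.
have i2_lin i : linear (fun y : Y i => (0, (0, y)) : C i).
  by move=> a x x'; apply: injective_projections; [|apply: injective_projections]; rewrite /= ?scaler0 ?addr0.
have i2_diff (i j : int) x : mkhom (i2_lin j) (cdiff Y i j x) = cdiff C i j (mkhom (i2_lin i) x).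
  by apply: injective_projections; [|apply: injective_projections]; rewrite /= ?linear0 ?oppr0 ?addr0 ?add0r.
pose i1 : chain_map X' C := ChainMap i1_diff; pose i2 : chain_map Y C := ChainMap i2_diff.
have q2 : quasi_iso i2.
  move=> i; split=> [y cy|[x [x' y]]].
    case/cone_bdP => a [[b b'] [a0 [e1 e2]]].
    have fa : f i a = - cdiff X' (i + 1) i b by apply/eqP; rewrite -addr_eq0 -e1.
    have [a1 aE] : is_boundary a.
      apply: (qf i).1; first by apply/eqP; rewrite -oppr_eq0 -a0.
      by rewrite fa; apply/bdN/bd_diff.
    by rewrite e2 -aE cmap_diff; apply: bdD; [apply/bdN/bd_diff | apply: bd_diff].
  move=> /cone_cycP[dx [e1 e2]].
  have bx : is_boundary x.
    apply: (qf _).1 => //; have -> : f (i - 1) x = - cdiff X' i (i - 1) x' by apply/eqP; rewrite -addr_eq0 e1.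
    exact/bdN/bd_diff.
  have [|a ax] := bd_at bx (j := i); first by rewrite subrK.
  have [z cz [b bE]] : exists2 z, is_cycle z & is_boundary (x' + f i a - f i z).
    by apply: (qf i).2; rewrite /is_cycle linearD -cmap_diff ax [LHS]addrC.
  exists (y - g i a + g i z).
    rewrite /is_cycle linearD linearB -!cmap_diff cz ax linear0 addr0 -e2 [LHS]addrC; abel.
  have -> : (x, (x', y)) - i2 i (y - g i a + g i z) = (x, (x', g i a - g i z)) :> C i.
    apply: injective_projections; [|apply: injective_projections]; rewrite /= ?subr0 //; abel.
  apply/cone_bdP; exists (z - a), (b, 0); split.
    by rewrite (linearB (cdiff X i (i - 1))) cz ax sub0r opprK.
  apply: injective_projections => /=.
    by rewrite (linearB (f i)) bE; abel.
  by rewrite linear0 addr0 (linearB (g i)) opprB.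
have [Z [s [qs ns]]] := h C (fun i im => (quasi_exact i q2).1 (cY i im)) i1.
exists Z, (compc s i2); split; first exact: quasi_comp.
have n1 := nullh_post s (cone_null k).
apply: nullh_ext (nullhB (nullh_pre f ns) n1) => i x /=.
rewrite -linearB; congr (s i _).
apply: injective_projections; [|apply: injective_projections]; rewrite /= ?subrr ?sub0r ?opprK //.
Qed.

Lemma cyc_tr X (i j : int) (x : X i) : i = j -> is_cycle x -> is_cycle (tr X i j x).
Proof. by move=> e; case: _ / e; rewrite trE. Qed.

Lemma bd_tr X (i j : int) (x : X i) : i = j -> is_boundary (tr X i j x) -> is_boundary x.
Proof. by move=> e; case: _ / e; rewrite trE. Qed.

Lemma tr_cshift X (i j : int) x : tr (cshift X) i j x = tr X (i - 1) (j - 1) x.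
Proof.
have [e|e] := pselect (i = j); first by case: _ / e; rewrite !trE.
by rewrite /tr !cmap2_neq // => /addIr.
Qed.

Definition unshift_obj Y (i : int) : lmodType R := Y (i + 1).
Definition unshift_diff Y i j : {linear unshift_obj Y i -> unshift_obj Y j} :=
  hom_opp (cdiff Y (i + 1) (j + 1)).
Fact unshift_shape Y i j x : i <> j + 1 -> unshift_diff Y i j x = 0.
Proof.
move=> ij; rewrite /unshift_diff /= diff_shape ?oppr0 // => e; apply: ij.
exact: (addIr 1).
Qed.
Fact unshift_dd Y i j l x : unshift_diff Y j l (unshift_diff Y i j x) = 0.
Proof. by rewrite /unshift_diff /= linearN diff_diff !oppr0. Qed.
Definition unshift Y : complex R := Complex (@unshift_shape Y) (@unshift_dd Y).

Lemma cyc_unshift Y (i : int) (x : Y (i + 1)) : is_cycle (x : unshift Y i) <-> is_cycle x.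
Proof.
split=> [c|/cycleP c]; last by rewrite /is_cycle /= c oppr0.
apply/cycleP => j; have {c} /cycleP/(_ (j - 1)) h := c.
have {}h : - cdiff Y (i + 1) (j - 1 + 1) x = 0 by exact: h.
have {h} : cdiff Y (i + 1) (j - 1 + 1) x = 0 by rewrite -[LHS]opprK h oppr0.
by rewrite subrK.
Qed.

Lemma bd_unshift Y (i : int) (x : Y (i + 1)) : is_boundary (x : unshift Y i) <-> is_boundary x.
Proof.
split=> [[y <-]|bx]; first exact/bdN/bd_diff.
have [|y yx] := bd_at (bdN bx) (j := i + 1 + 1) => //.
by exists y; rewrite -[LHS]/(- cdiff Y (i + 1 + 1) (i + 1) y) yx opprK.
Qed.

Lemma exact_unshift Y (i : int) : exact_at (unshift Y) i <-> exact_at Y (i + 1).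
Proof. by split=> h x cx; apply/bd_unshift/h/cyc_unshift. Qed.

Lemma bounded_dim_shift1 X : bounded_dim X -> bounded_dim (cshift X).
Proof.
move=> [m h]; exists (m + 1) => Y cY g.
pose g0 i : {linear X i -> unshift Y i} := g (i + 1) \o tr X i (i + 1 - 1).
have g0_diff (i j : int) x : g0 j (cdiff X i j x) = cdiff (unshift Y) i j (g0 i x).
  rewrite -[LHS]/(g (j + 1) (tr X j (j + 1 - 1) (cdiff X i j x))).
  rewrite (@tr_diff _ _ i (i + 1 - 1) j (j + 1 - 1)); [|by rewrite addrK|by rewrite addrK].
  rewrite -[RHS]/(- cdiff Y (i + 1) (j + 1) (g (i + 1) (tr X i (i + 1 - 1) x))) -cmap_diff.
  by rewrite -[cdiff (cshift X) _ _ _]/(- cdiff X (i + 1 - 1) (j + 1 - 1) _) (linearN (g _)) opprK.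
have [|Z [s [qs [t tE]]]] := h (unshift Y) _ (ChainMap g0_diff).
  by move=> i im; apply/exact_unshift/cY; lia.
pose s0 i : {linear Y i -> cshift Z i} := s (i - 1) \o tr Y i (i - 1 + 1).
have s0_diff (i j : int) x : s0 j (cdiff Y i j x) = cdiff (cshift Z) i j (s0 i x).
  rewrite -[LHS]/(s (j - 1) (tr Y j (j - 1 + 1) (cdiff Y i j x))).
  rewrite (@tr_diff _ _ i (i - 1 + 1) j (j - 1 + 1)); [|by rewrite subrK|by rewrite subrK].
  rewrite -[RHS]/(- cdiff Z (i - 1) (j - 1) (s (i - 1) (tr Y i (i - 1 + 1) x))) -cmap_diff.
  by rewrite -[cdiff (unshift Y) _ _ _]/(- cdiff Y (i - 1 + 1) (j - 1 + 1) _) (linearN (s _)) opprK.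
exists (cshift Z), (ChainMap s0_diff); split.
  move=> i; have e : i = i - 1 + 1 by rewrite subrK.
  split=> [y cy /bd_shift bs|z /cyc_shift cz].
    apply: (bd_tr e); apply/bd_unshift; apply: (qs (i - 1)).1 => //.
    exact/cyc_unshift/cyc_tr.
  have [y /cyc_unshift cy bz] := (qs (i - 1)).2 z cz.
  exists (tr Y (i - 1 + 1) i y); first exact/cyc_tr.
  by apply/bd_shift; rewrite /= tr_tr // trE.
exists (fun i j => hom_opp (t (i - 1) (j - 1))) => i x.
have -> : ChainMap s0_diff i (g i x) = s (i - 1) (g0 (i - 1) x).
  rewrite -[LHS]/(s (i - 1) (tr Y i (i - 1 + 1) (g i x))) tr_map tr_cshift.
  by rewrite -[RHS]/(s (i - 1) (g (i - 1 + 1) (tr X (i - 1) (i - 1 + 1 - 1) x))).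
rewrite tE; change (cdiff Z (i - 1 + 1) (i - 1) (t (i - 1) (i - 1 + 1) x) +
  t (i - 1 - 1) (i - 1) (cdiff X (i - 1) (i - 1 - 1) x) =
  - cdiff Z (i + 1 - 1) (i - 1) (- t (i - 1) (i + 1 - 1) x) +
  - t (i - 1 - 1) (i - 1) (- cdiff X (i - 1) (i - 1 - 1) x)).
rewrite (linearN (cdiff Z _ _)) (linearN (t _ _)) !opprK; congr (_ + _).
by have -> : i - 1 + 1 = i + 1 - 1 by rewrite subrK addrK.
Qed.

Lemma bounded_dim_shift2 X : bounded_dim (cshift X) -> bounded_dim X.
Proof.
move=> [m h]; exists (m - 1) => Y cY g.
have g0_diff (i j : int) x : g (j - 1) (cdiff (cshift X) i j x) = cdiff (cshift Y) i j (g (i - 1) x).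
  rewrite -[LHS]/(g (j - 1) (- cdiff X (i - 1) (j - 1) x)) linearN cmap_diff //.
pose g0 : chain_map (cshift X) (cshift Y) := @ChainMap _ (cshift X) (cshift Y) (fun i => g (i - 1)) g0_diff.
have [|Z [s [qs [t tE]]]] := h (cshift Y) _ g0.
  by move=> i im; apply/exact_shift/cY; lia.
pose s0 i : {linear Y i -> unshift Z i} := s (i + 1) \o tr Y i (i + 1 - 1).
have s0_diff (i j : int) x : s0 j (cdiff Y i j x) = cdiff (unshift Z) i j (s0 i x).
  rewrite -[LHS]/(s (j + 1) (tr Y j (j + 1 - 1) (cdiff Y i j x))).
  rewrite (@tr_diff _ _ i (i + 1 - 1) j (j + 1 - 1)); [|by rewrite addrK|by rewrite addrK].
  rewrite -[RHS]/(- cdiff Z (i + 1) (j + 1) (s (i + 1) (tr Y i (i + 1 - 1) x))) -cmap_diff.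
  by rewrite -[cdiff (cshift Y) _ _ _]/(- cdiff Y (i + 1 - 1) (j + 1 - 1) _) (linearN (s _)) opprK.
exists (unshift Z), (ChainMap s0_diff); split.
  move=> i; have e : i = i + 1 - 1 by rewrite addrK.
  split=> [y cy /bd_unshift bs|z /cyc_unshift cz].
    apply: (bd_tr e); apply/bd_shift; apply: (qs (i + 1)).1 => //.
    exact/cyc_shift/cyc_tr.
  have [y /cyc_shift cy bz] := (qs (i + 1)).2 z cz.
  exists (tr Y (i + 1 - 1) i y); first exact/cyc_tr.
  by apply/bd_unshift; rewrite /= tr_tr // trE.
exists (fun i j => hom_opp (t (i + 1) (j + 1) \o tr X i (i + 1 - 1) : {linear X i -> Z (j + 1)})) => i x.
have -> : ChainMap s0_diff i (g i x) = s (i + 1) (g0 (i + 1) (tr X i (i + 1 - 1) x)).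
  by rewrite -[LHS]/(s (i + 1) (tr Y i (i + 1 - 1) (g i x))) tr_map.
rewrite tE; change (cdiff Z (i + 1 + 1) (i + 1) (t (i + 1) (i + 1 + 1) (tr X i (i + 1 - 1) x)) +
  t (i + 1 - 1) (i + 1) (- cdiff X (i + 1 - 1) (i + 1 - 1 - 1) (tr X i (i + 1 - 1) x)) =
  - cdiff Z (i + 1 + 1) (i + 1) (- t (i + 1) (i + 1 + 1) (tr X i (i + 1 - 1) x)) +
  - t (i - 1 + 1) (i + 1) (tr X (i - 1) (i - 1 + 1 - 1) (cdiff X i (i - 1) x))).
rewrite (linearN (cdiff Z _ _)) (linearN (t _ _)) !opprK; congr (_ - _).
have te (a b : int) y : a = b -> t a (i + 1) (tr X (i - 1) (a - 1) y) = t b (i + 1) (tr X (i - 1) (b - 1) y).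
  by move=> ->.
rewrite -(te (i + 1 - 1) (i - 1 + 1)); last by rewrite subrK addrK.
congr (t _ _ _); rewrite (@tr_diff _ _ i (i + 1 - 1) (i - 1) (i + 1 - 1 - 1)) //; by rewrite addrK.
Qed.

(** Since [u] is null homotopic on [X'], subtracting the homotopy along [f] corrects its restriction
    to the other summand into a chain map on the shift of [X]. *)
Lemma cone_factor X X' Z (f : chain_map X X') (u : chain_map (mcone f) Z)
    (t : forall i j, {linear X' i -> Z j}) :
  (forall i (x : X' i), u i (cone_incl f i x) =
     cdiff Z (i + 1) i (t i (i + 1) x) + t (i - 1) i (cdiff X' i (i - 1) x)) ->
  exists v : chain_map (cshift X) Z,
    forall (i : int) (x : X (i - 1)), v i x = u i (x, 0) - t (i - 1) i (f (i - 1) x).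
Proof.
move=> tE; pose v0 (i : int) (x : cshift X i) : Z i := u i (x, 0) - t (i - 1) i (f (i - 1) x).
have v0_lin i : linear (v0 i).
  move=> a x y; rewrite /v0; have -> : (a *: x + y, 0) = a *: (x, 0) + (y, 0) :> mcone f i.
    by apply: injective_projections; rewrite /= ?scaler0 ?addr0.
  rewrite (linearP (u i)) (linearP (f (i - 1))) (linearP (t _ _)) scalerBr; abel.
have v0_diff (i j : int) x : mkhom (v0_lin j) (cdiff (cshift X) i j x) = cdiff Z i j (mkhom (v0_lin i) x).
  have [e|e] := pselect (i = j + 1); last by rewrite !diff_shape // linear0.
  have {e} e : i - 1 = j by rewrite e addrK.
  case: _ / e.
  rewrite -[RHS]/(cdiff Z i (i - 1) (u i (x, 0) - t (i - 1) i (f (i - 1) x))).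
  rewrite (linearB (cdiff Z _ _)) -!cmap_diff.
  have -> : cdiff (mcone f) i (i - 1) (x, 0) =
      (cdiff (cshift X) i (i - 1) x, 0) + cone_incl f (i - 1) (f (i - 1) x) :> mcone f (i - 1).
    by apply: injective_projections; rewrite /= ?linear0 ?addr0 ?add0r // cmap2_eq.
  rewrite (linearD (u _)) tE.
  rewrite -(@tr_fam _ _ _ (fun j => t (i - 1) j) (i - 1 + 1) i) ?subrK // trE.
  rewrite -cmap_diff -[LHS]/(u _ (cdiff (cshift X) i (i - 1) x, 0) -
    t (i - 1 - 1) (i - 1) (f (i - 1 - 1) (- cdiff X (i - 1) (i - 1 - 1) x))).
  rewrite (linearN (f _)) (linearN (t _ _)); abel.
by exists (ChainMap v0_diff).
Qed.

(** The map is first effaced on [X']; by [cone_factor] what is left is a map on the shift of [X],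
    which is effaced in turn. *)
Lemma bounded_dim_cone X X' (f : chain_map X X') : bounded_dim X -> bounded_dim X' ->
  bounded_dim (mcone f).
Proof.
move=> /bounded_dim_shift1[m h] [m' h']; pose mm : int := (`|m| + `|m'|)%N%:Z; exists mm => Y cY g.
have [|Z [s [qs [t tE]]]] := h' Y _ (compc g (cone_incl f)).
  by move=> i im; apply: cY; rewrite /mm; lia.
have [g2 g2E] := cone_factor (u := compc s g) tE.
have [|Z2 [s2 [qs2 [t2 t2E]]]] := h Z _ g2.
  by move=> i im; apply: (quasi_exact i qs).1; apply: cY; rewrite /mm; lia.
exists Z2, (compc s2 s); split; first exact: quasi_comp.
have S_lin i j : linear (fun p : mcone f i => t2 i j p.1 + s2 j (t i j p.2)).
  by move=> a p q; rewrite !linearP scalerDr; abel.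
exists (fun i j => mkhom (S_lin i j)) => i -[x x'].
rewrite -[LHS]/(s2 i (s i (g i (x, x')))).
rewrite -[RHS]/(cdiff Z2 (i + 1) i (t2 i (i + 1) x + s2 (i + 1) (t i (i + 1) x')) +
  (t2 (i - 1) i (cdiff (cshift X) i (i - 1) x) +
   s2 i (t (i - 1) i (cmap2 f (i - 1) (i - 1) x + cdiff X' i (i - 1) x')))).
rewrite cmap2_eq (linearD (cdiff Z2 _ _)) (linearD (t _ _)) (linearD (s2 _)) -cmap_diff.
have -> : (x, x') = (x, 0) + (0, x') :> mcone f i.
  by apply: injective_projections; rewrite /= ?addr0 ?add0r.
have e1 : s i (g i (0, x')) = cdiff Z (i + 1) i (t i (i + 1) x') + t (i - 1) i (cdiff X' i (i - 1) x').
  exact: tE.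
have e2 : s2 i (s i (g i (x, 0)) - t (i - 1) i (f (i - 1) x)) =
    cdiff Z2 (i + 1) i (t2 i (i + 1) x) + t2 (i - 1) i (cdiff (cshift X) i (i - 1) x).
  by have := t2E i x; rewrite g2E.
rewrite (linearD (g i)) (linearD (s i)) e1 !(linearD (s2 i)).
move: e2; rewrite (linearB (s2 i)) => /eqP; rewrite subr_eq => /eqP ->.
abel.
Qed.

Lemma bounded_dim_summand X Y : bounded_dim (dsum X Y) -> bounded_dim X.
Proof.
move=> [m h]; exists m => W cW g; have [Z [s [qs ns]]] := h W cW (compc g (dsum1 X Y)).
exists Z, s; split=> //.
have i_lin i : linear (fun x : X i => (x, 0) : dsum X Y i).
  by move=> a x y; apply: injective_projections; rewrite /= ?scaler0 ?addr0.
have i_diff (i j : int) x : mkhom (i_lin j) (cdiff X i j x) = cdiff (dsum X Y) i j (mkhom (i_lin i) x).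
  by apply: injective_projections; rewrite /= ?linear0.
exact: (@nullh_pre R X (dsum X Y) Z (ChainMap i_diff) (fun i x => s i (compc g (dsum1 X Y) i x)) ns).
Qed.

Lemma bounded_dim_stalk : bounded_dim (stalk R^o).
Proof.
(* The bound 1 makes [Y] exact in degree 0, which is where a map out of [R^o] has to be lifted. *)
exists 1 => Y cY g; exists Y, (idc Y); split; first exact: quasi_id.
have [||||s sE] := @lift_homotopy R (stalk R^o) Y g (fun i => i <= 0) 0.
- move=> i; rewrite /= /stalk_obj; case: eqP => _; [exact: projective_reg | exact: projective_rV].
- by move=> i x i0; apply: stalk_eq0; lia.
- by move=> i /= i0; lia.
- by move=> i /= i0; apply: cY; lia.
exists s => i x; have [i0|i0] := lerP i 0; first exact: sE.
rewrite (stalk_eq0 x) /=; last by lia.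
by rewrite !linear0 addr0.
Qed.

Lemma thick_bounded_dim : thick_class bounded_dim.
Proof.
split=> [X Y f qf|X|X Y f|X Y].
- by split; [apply: bounded_dim_quasi1 qf | apply: bounded_dim_quasi2 qf].
- by split; [apply: bounded_dim_shift1 | apply: bounded_dim_shift2].
- exact: bounded_dim_cone.
- exact: bounded_dim_summand.
Qed.

End Effaceable.

(** * Truncation *)

Record submodule (R : comNzRingType) (V : lmodType R) := Submodule {
  sub_in :> V -> Prop;
  sub_in0 : sub_in 0;
  sub_inD : forall x y, sub_in x -> sub_in y -> sub_in (x + y);
  sub_inZ : forall a x, sub_in x -> sub_in (a *: x) }.

Section Quotient.
Variables (R : comNzRingType) (V : lmodType R) (U : submodule V).

Lemma sub_inN x : U x -> U (- x).
Proof. by rewrite -scaleN1r; apply: sub_inZ. Qed.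

(** A representative chosen once for each coset: congruent elements define the same set, on which
    [xget] makes the same choice. The quotient is then the subtype of fixed points. *)
Definition qrep (x : V) : V := xget 0 [set y | U (x - y)]%classic.

Lemma qrepP x : U (x - qrep x).
Proof.
have h : [set y | U (x - y)]%classic (qrep x).
  by apply: xgetPex; exists x; rewrite /= subrr; apply: sub_in0.
exact: h.
Qed.

Lemma qrep_eq x y : U (x - y) -> qrep x = qrep y.
Proof.
move=> xy; rewrite /qrep; congr xget; apply/seteqP; split=> z /= h.
  by have := sub_inD (sub_inN xy) h; rewrite opprB addrA subrK.
by have := sub_inD xy h; rewrite addrA subrK.
Qed.

Lemma qrepK x : qrep (qrep x) = qrep x.
Proof. by apply/esym/qrep_eq/qrepP. Qed.

Record qmod := QMod { qval : V; _ : `[< qrep qval = qval >] }.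
HB.instance Definition _ := [isSub for qval].
HB.instance Definition _ := [Choice of qmod by <:].

Definition qcl (x : V) : qmod := QMod (asboolT (qrepK x)).

Lemma qclP x y : qcl x = qcl y <-> U (x - y).
Proof.
split=> [/(congr1 qval) /= e|h]; last by apply/val_inj/qrep_eq.
have := sub_inD (qrepP x) (sub_inN (qrepP y)); rewrite e opprB addrA subrK.
by [].
Qed.

Lemma qvalK q : qcl (qval q) = q.
Proof. by apply/val_inj; case: q => x /= /asboolP. Qed.

Lemma qval_cl x : U (qval (qcl x) - x).
Proof. by rewrite /= -opprB; apply/sub_inN/qrepP. Qed.

Definition qadd p q := qcl (qval p + qval q).
Definition qopp p := qcl (- qval p).
Definition qscale (a : R) p := qcl (a *: qval p).

Lemma qclD x y : qadd (qcl x) (qcl y) = qcl (x + y).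
Proof. by apply/qclP; rewrite opprD addrACA; apply: sub_inD; apply: qval_cl. Qed.
Lemma qclN x : qopp (qcl x) = qcl (- x).
Proof. by apply/qclP; rewrite -opprD; apply/sub_inN/qval_cl. Qed.
Lemma qclZ a x : qscale a (qcl x) = qcl (a *: x).
Proof. by apply/qclP; rewrite -scalerBr; apply/sub_inZ/qval_cl. Qed.

Fact qaddA : associative qadd.
Proof. by move=> x y z; rewrite -(qvalK x) -(qvalK y) -(qvalK z) !qclD addrA. Qed.
Fact qaddC : commutative qadd.
Proof. by move=> x y; rewrite -(qvalK x) -(qvalK y) !qclD addrC. Qed.
Fact qadd0 : left_id (qcl 0) qadd.
Proof. by move=> x; rewrite -(qvalK x) qclD add0r. Qed.
Fact qaddN : left_inverse (qcl 0) qopp qadd.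
Proof. by move=> x; rewrite -(qvalK x) qclN qclD addNr. Qed.
HB.instance Definition _ := GRing.isZmodule.Build qmod qaddA qaddC qadd0 qaddN.

Fact qscaleA a b x : qscale a (qscale b x) = qscale (a * b) x.
Proof. by rewrite -(qvalK x) !qclZ scalerA. Qed.
Fact qscale1 : left_id 1 qscale.
Proof. by move=> x; rewrite -(qvalK x) qclZ scale1r. Qed.
Fact qscaleDr : right_distributive qscale +%R.
Proof. by move=> a x y; rewrite -(qvalK x) -(qvalK y) [_ + _]qclD !qclZ [RHS]qclD scalerDr. Qed.
Fact qscaleDl x : {morph qscale^~ x : a b / a + b}.
Proof. by move=> a b; rewrite -(qvalK x) !qclZ [RHS]qclD scalerDl. Qed.
HB.instance Definition _ := GRing.Zmodule_isLmodule.Build R qmod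
  qscaleA qscale1 qscaleDr qscaleDl.

Fact qcl_linear : linear (qcl : V -> qmod).
Proof. by move=> a x y; rewrite -[qcl x in RHS]/(qcl x) [a *: qcl x]qclZ [RHS]qclD. Qed.
Definition qproj : {linear V -> qmod} := mkhom qcl_linear.

Lemma qproj0 x : qproj x = 0 <-> U x.
Proof. by have := qclP x 0; rewrite subr0. Qed.

Section Factor.
Variables (W : lmodType R) (g : {linear V -> W}).
Hypothesis gU : forall x, U x -> g x = 0.
Lemma qlift_cl x : g (qval (qcl x)) = g x.
Proof. by apply/eqP; rewrite -subr_eq0 -linearB gU //; apply: qval_cl. Qed.
Fact qlift_linear : linear (fun q : qmod => g (qval q)).
Proof.
move=> a p q; rewrite -(qvalK p) -(qvalK q) [a *: _]qclZ [qcl _ + _]qclD !qlift_cl.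
exact: linearP.
Qed.
Definition qlift : {linear qmod -> W} := mkhom qlift_linear.
End Factor.
End Quotient.

Section Truncation.
Variables (R : comNzRingType) (X : complex R) (n : int).

(** Dividing by these submodules keeps the degrees below [n], replaces [X n] by its quotient modulo
    boundaries and removes the degrees above, so the homology up to degree [n] is preserved. *)
Definition trunc_sub (i : int) : submodule (X i).
Proof.
refine (@Submodule R (X i) (fun x => (i < n -> x = 0) /\ (i = n -> is_boundary x)) _ _ _).
- by split=> // _; apply: bd0.
- move=> x y [x0 xb] [y0 yb]; split=> [h|h]; first by rewrite x0 // y0 // addr0.
  by apply: bdD; auto.
- move=> a x [x0 xb]; split=> [h|h]; first by rewrite x0 // scaler0.
  by apply: bdZ; auto.
Defined.

Lemma trunc_sub_diff (i j : int) x : trunc_sub i x -> trunc_sub j (cdiff X i j x).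
Proof.
move=> [x0 xb]; split=> h; last exact: bd_diff.
have [e|e] := pselect (i = j + 1); last exact: diff_shape.
have [il|il] := ltrP i n; first by rewrite x0 // linear0.
have ein : i = n by lia.
exact: (proj1 (cycleP _) (bd_cyc (xb ein))).
Qed.

Definition trunc_obj (i : int) : lmodType R := qmod (trunc_sub i).

Fact trunc_kill (i j : int) x : trunc_sub i x -> (qproj (trunc_sub j) \o cdiff X i j) x = 0.
Proof. by move=> h; apply/qproj0/trunc_sub_diff. Qed.

Definition trunc_diff i j : {linear trunc_obj i -> trunc_obj j} := qlift (@trunc_kill i j).

Lemma trunc_diffE i j x : trunc_diff i j (qproj _ x) = qproj _ (cdiff X i j x).
Proof. exact: (qlift_cl (@trunc_kill i j)). Qed.

Lemma qprojP (i : int) (q : trunc_obj i) : exists x, q = qproj (trunc_sub i) x.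
Proof. by exists (qval q); rewrite -[LHS]qvalK. Qed.

Fact trunc_shape i j x : i <> j + 1 -> trunc_diff i j x = 0.
Proof. by move=> ij; have [y ->] := qprojP x; rewrite trunc_diffE diff_shape // linear0. Qed.
Fact trunc_dd i j l x : trunc_diff j l (trunc_diff i j x) = 0.
Proof. by have [y ->] := qprojP x; rewrite !trunc_diffE diff_diff linear0. Qed.
Definition trunc : complex R := Complex trunc_shape trunc_dd.

Fact trunc_proj_diff i j x : qproj (trunc_sub j) (cdiff X i j x) = cdiff trunc i j (qproj _ x).
Proof. by rewrite [RHS]trunc_diffE. Qed.
Definition trunc_proj : chain_map X trunc :=
  @ChainMap R X trunc (fun i => qproj (trunc_sub i)) trunc_proj_diff.

Lemma trunc_eq0 (i : int) (x : trunc i) : n < i -> x = 0.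
Proof. by move=> ni; have [y ->] := qprojP x; apply/qproj0; split=> h; lia. Qed.

Lemma quasi_trunc_proj : (forall i : int, n < i -> exact_at X i) -> quasi_iso trunc_proj.
Proof.
move=> ex i; split=> [x cx [q qE]|q cq].
  have [y yE] := qprojP q; move: qE; rewrite yE -trunc_proj_diff => /eqP.
  rewrite -subr_eq0 -linearB => /eqP/qproj0[h1 h2].
  have [il|il|e] := ltrgtP i n.
  - have /eqP := h1 il; rewrite subr_eq0 => /eqP <-; exact: bd_diff.
  - exact: ex.
  - by have := bdB (bd_diff i y) (h2 e); rewrite subKr.
have [y yE] := qprojP q; have [il|il] := lerP i n; last first.
  exists 0; first exact: cyc0.
  by rewrite (trunc_eq0 q il) (linear0 (trunc_proj i)) subr0; apply: bd0.
exists y; last by rewrite yE subrr; apply: bd0.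
move: cq; rewrite /is_cycle yE -trunc_proj_diff => /qproj0[h _].
by apply: h; lia.
Qed.

End Truncation.

(** * Koszul cells *)

Section Kos.
Variables (A : comNzRingType) (x : nat -> A).

Definition is_kos r N (d : 'M[A]_N) (e : nat -> 'M[A]_N) :=
  [/\ d *m d = 0, forall l, (l < r)%N -> d *m e l + e l *m d = (x l)%:M,
      forall l m, (l < r)%N -> (m < r)%N -> e l *m e m + e m *m e l = 0 &
      forall l, (l < r)%N -> e l *m e l = 0].

Definition gr_kos r N (deg : 'I_N -> int) (d : 'M[A]_N) (e : nat -> 'M[A]_N) :=
  mx_deg deg (-1) d /\ forall l, (l < r)%N -> mx_deg deg 1 (e l).

Definition homog N (deg : 'I_N -> int) (i : int) (v : 'rV[A]_N) := forall b, deg b <> i -> v 0 b = 0.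

Definition kills (W : lmodType A) r (y : W) := forall l, (l < r)%N -> x l *: y = 0.

(* The cells spanned by a set [Z] of cycles: the exterior powers of the Koszul generators
   tensored with [Z].  The rows [j0 j] are the generators themselves. *)
Definition is_cells r N (deg : 'I_N -> int) d e t (Z : 'M[A]_(t, N)) (n : int)
    K (degK : 'I_K -> int) (kap : 'M[A]_K) (eps : nat -> 'M[A]_K) (Th : 'M[A]_(K, N))
    (j0 : 'I_t -> 'I_K) (g0 : 'I_K -> option 'I_t) :=
  [/\ is_kos r kap eps, gr_kos r degK kap eps,
      Th *m d = kap *m Th /\ (forall l, (l < r)%N -> Th *m e l = eps l *m Th),
      (forall b b', deg b' <> degK b - 1 -> Th b b' = 0) /\
      (forall j, degK (j0 j) = n + 1 /\ g0 (j0 j) = Some j) &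
      (forall b, if g0 b is Some j then b = j0 j else n + 1 < degK b)] /\
  [/\ (forall j, row (j0 j) Th = row j Z), (forall j, row (j0 j) kap = 0),
      (forall (W : lmodType A) (y : W) b b', kills r y -> kap b b' *: y = 0),
      (forall l j b, (l < r)%N -> eps l b (j0 j) = 0) &
      (forall (W : lmodType A) (p : {linear 'rV[A]_N -> W}),
        (forall l v, (l < r)%N -> p (v *m e l) = 0) ->
        forall b, g0 b = None -> p (row b Th) = 0)].

Section CellStep.
Variables (r N : nat) (deg : 'I_N -> int) (d : 'M[A]_N) (e : nat -> 'M[A]_N) (t : nat) (Z : 'M[A]_(t, N)) (n : int).
Hypotheses (ke : is_kos r.+1 d e) (ge : gr_kos r.+1 deg d e).
Variables (K : nat) (degK : 'I_K -> int) (kap : 'M[A]_K) (eps : nat -> 'M[A]_K) (Th : 'M[A]_(K, N)).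
Variables (j0 : 'I_t -> 'I_K) (g0 : 'I_K -> option 'I_t).
Hypotheses (kk : is_kos r kap eps) (gk : gr_kos r degK kap eps).
Hypothesis Td : Th *m d = kap *m Th.
Hypothesis Te : forall l, (l < r)%N -> Th *m e l = eps l *m Th.
Hypothesis TD : forall b b', deg b' <> degK b - 1 -> Th b b' = 0.

Definition deg2 (b : 'I_(K + K)) := match fintype.split b with inl b => degK b | inr b => degK b + 1 end.
(** The cone of multiplication by [x r] on the previous cells; the second copy stands for the
    products with a new exterior generator, which explains the sign. *)
Definition kap2 : 'M[A]_(K + K) := block_mx kap 0 (x r)%:M (- kap).
Definition eps2 l : 'M[A]_(K + K) := if l == r then block_mx 0 1%:M 0 0 else block_mx (eps l) 0 0 (- eps l).
Definition Th2 := col_mx Th (Th *m e r).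

Let sl (b : 'I_K) : fintype.split (lshift K b) = inl b. Proof. exact: (unsplitK (inl b)). Qed.
Let sr (b : 'I_K) : fintype.split (rshift K b) = inr b. Proof. exact: (unsplitK (inr b)). Qed.
Let spl (P : 'I_(K + K) -> Prop) : (forall b, P (lshift K b)) -> (forall b, P (rshift K b)) -> forall b, P b.
Proof. by move=> hl hr b; rewrite -(splitK b); case: (fintype.split b). Qed.
Let lt1 l : (l < r.+1)%N -> (l == r) = false -> (l < r)%N.
Proof. by move=> h1 /eqP h2; lia. Qed.

Lemma kap2_sqr : kap2 *m kap2 = 0.
Proof.
have [kk2 _ _ _] := kk; rewrite /kap2 mulmx_block !mulmx0 !mul0mx kk2 !addr0 add0r.
rewrite !mulNmx !mulmxN !opprK kk2 mul_scalar_mx mul_mx_scalar subrr.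
by rewrite block_mx0.
Qed.

Lemma kap2_eps2 l : (l < r.+1)%N -> kap2 *m eps2 l + eps2 l *m kap2 = (x l)%:M.
Proof.
have [_ ke2 _ _] := kk.
move=> lr; rewrite /kap2 /eps2; case: (eqVneq l r) => [->|/negbTE h].
  rewrite !mulmx_block !(mulmx0, mul0mx, mulmx1, mul1mx, addr0, add0r) add_block_mx !(addr0, add0r).
  by rewrite subrr -scalar_mx_block.
rewrite !mulmx_block !(mulmx0, mul0mx, addr0, add0r) add_block_mx !(addr0, add0r) !mulNmx !mulmxN !opprK.
by rewrite ke2 ?lt1 // mul_scalar_mx mul_mx_scalar subrr -scalar_mx_block.
Qed.

Lemma eps2_anti l m : (l < r.+1)%N -> (m < r.+1)%N -> eps2 l *m eps2 m + eps2 m *m eps2 l = 0.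
Proof.
have [_ _ kee ke3] := kk.
move=> lr mr; rewrite /eps2; case: (eqVneq l r) => [_|/negbTE h]; case: (eqVneq m r) => [_|/negbTE h'].
- by rewrite !mulmx_block !(mulmx0, mul0mx, addr0, add0r) add_block_mx !addr0 block_mx0.
- rewrite !mulmx_block !(mulmx0, mul0mx, mulmx1, mul1mx, addr0, add0r) add_block_mx !(addr0, add0r).
  by rewrite addNr block_mx0.
- rewrite !mulmx_block !(mulmx0, mul0mx, mulmx1, mul1mx, addr0, add0r) add_block_mx !(addr0, add0r).
  by rewrite subrr block_mx0.
- rewrite !mulmx_block !(mulmx0, mul0mx, addr0, add0r) add_block_mx !(addr0, add0r) !mulNmx !mulmxN !opprK.
  by rewrite kee ?lt1 // block_mx0.
Qed.

Lemma eps2_sqr l : (l < r.+1)%N -> eps2 l *m eps2 l = 0.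
Proof.
have [_ _ kee ke3] := kk.
move=> lr; rewrite /eps2; case: (eqVneq l r) => [_|/negbTE h].
  by rewrite !mulmx_block !(mulmx0, mul0mx, addr0, add0r) block_mx0.
rewrite !mulmx_block !(mulmx0, mul0mx, addr0, add0r) !mulNmx !mulmxN !opprK.
by rewrite ke3 ?lt1 // block_mx0.
Qed.

Lemma gr_kos2 : gr_kos r.+1 deg2 kap2 eps2.
Proof.
have [gk1 gk2] := gk; rewrite /deg2 /kap2 /eps2; split.
  apply: spl => b; apply: spl => b'; rewrite ?sl ?sr ?block_mxEul ?block_mxEur ?block_mxEdl ?block_mxEdr => h.
  - exact: gk1.
  - by rewrite mxE.
  - rewrite mxE; case: eqP => // e0; move: h; rewrite e0; lia.
  - by rewrite mxE gk1 ?oppr0 //; lia.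
move=> l lr; case: (eqVneq l r) => [_|/negbTE h0]; apply: spl => b; apply: spl => b';
  rewrite ?sl ?sr ?block_mxEul ?block_mxEur ?block_mxEdl ?block_mxEdr => h.
- by rewrite mxE.
- rewrite mxE; case: eqP => // e0; move: h; rewrite e0; lia.
- by rewrite mxE.
- by rewrite mxE.
- by apply: (gk2 l (lt1 lr h0)).
- by rewrite mxE.
- by rewrite mxE.
- by rewrite mxE (gk2 l (lt1 lr h0)) ?oppr0 //; lia.
Qed.

Lemma Th2_d : Th2 *m d = kap2 *m Th2.
Proof.
have [_ de _ _] := ke.
rewrite /Th2 /kap2 mul_col_mx mul_block_col mul0mx addr0 Td mul_scalar_mx mulNmx mulmxA -Td -!mulmxA.
congr col_mx; rewrite -mulmxN -mul_mx_scalar -mulmxDr; congr (_ *m _).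
by rewrite -(de r) // addrC addrA addNr add0r.
Qed.

Lemma Th2_e l : (l < r.+1)%N -> Th2 *m e l = eps2 l *m Th2.
Proof.
have [_ _ ee e2] := ke.
move=> lr; rewrite /Th2 /eps2; case: (eqVneq l r) => [->|/negbTE h].
  by rewrite mul_col_mx mul_block_col !mul0mx mul1mx add0r addr0 -mulmxA e2 // mulmx0.
rewrite mul_col_mx mul_block_col !mul0mx add0r addr0 Te ?lt1 //.
congr col_mx; rewrite mulNmx mulmxA -Te ?lt1 // -!mulmxA -mulmxN; congr (_ *m _).
by apply/eqP; rewrite -addr_eq0 ee.
Qed.

Lemma Th2_deg b b' : deg b' <> deg2 b - 1 -> Th2 b b' = 0.
Proof.
have [_ gee] := ge; move: b b'; rewrite /deg2 /Th2.
apply: spl => b b'; rewrite ?sl ?sr ?col_mxEu ?col_mxEd => h; first exact: TD.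
rewrite mxE big1 // => m _; have [mm|mm] := eqVneq (deg m) (degK b - 1); last first.
  by rewrite TD ?mul0r //; apply/eqP.
by rewrite (gee r (ltnSn r)) ?mulr0 //; lia.
Qed.

Hypothesis jP : forall j, degK (j0 j) = n + 1 /\ g0 (j0 j) = Some j.
Hypothesis gP : forall b, if g0 b is Some j then b = j0 j else n + 1 < degK b.
Hypotheses (TZ : forall j, row (j0 j) Th = row j Z) (kapj : forall j, row (j0 j) kap = 0).
Hypothesis kapW : forall (W : lmodType A) (y : W) b b', kills r y -> kap b b' *: y = 0.
Hypothesis epsj : forall l j b, (l < r)%N -> eps l b (j0 j) = 0.
Hypothesis pT : forall (W : lmodType A) (p : {linear 'rV[A]_N -> W}),
  (forall l v, (l < r)%N -> p (v *m e l) = 0) -> forall b, g0 b = None -> p (row b Th) = 0.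

Lemma cells_step : @is_cells r.+1 N deg d e t Z n (K + K) deg2 kap2 eps2 Th2 (fun j => lshift K (j0 j))
  (fun b => match fintype.split b with inl b => g0 b | inr b => None end).
Proof.
split; split.
- by split; [exact: kap2_sqr | exact: kap2_eps2 | exact: eps2_anti | exact: eps2_sqr].
- exact: gr_kos2.
- by split; [exact: Th2_d | exact: Th2_e].
- by split=> [|j]; [exact: Th2_deg | rewrite /deg2 sl; apply: jP].
- rewrite /deg2; apply: spl => b; rewrite ?sl ?sr; first by have := gP b; case: (g0 b) => // j ->.
  by have := gP b; case: (g0 b) => [j ->|]; [have [-> _] := jP j | ]; lia.
- by move=> j; rewrite -TZ; apply/rowP => b; rewrite /Th2 [LHS]mxE col_mxEu mxE.
- move=> j; apply/rowP; rewrite /kap2; apply: spl => b; rewrite [LHS]mxE [RHS]mxE ?block_mxEul ?block_mxEur;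
    last by rewrite mxE.
  by have := kapj j => /rowP/(_ b); rewrite !mxE.
- move=> W y; rewrite /kap2; apply: spl => b; apply: spl => b' ky;
    rewrite ?block_mxEul ?block_mxEur ?block_mxEdl ?block_mxEdr.
  + by apply: kapW => l lr; apply: ky; lia.
  + by rewrite mxE scale0r.
  + rewrite mxE; case: eqP => _; last by rewrite mulr0n scale0r.
    by rewrite mulr1n ky.
  + rewrite mxE scaleNr kapW ?oppr0 // => l lr; apply: ky; lia.
- move=> l j; rewrite /eps2; apply: spl => b lr; case: (eqVneq l r) => [_|/negbTE h];
    rewrite ?block_mxEul ?block_mxEur ?block_mxEdl ?block_mxEdr ?mxE //.
  by apply/epsj/lt1.
- move=> W p pe; rewrite /Th2; apply: spl => b; rewrite ?sl ?sr => gb.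
    have -> : row (lshift K b) (col_mx Th (Th *m e r)) = row b Th.
      by apply/rowP => m; rewrite [LHS]mxE col_mxEu mxE.
    by apply: pT => // l v lr; apply: pe; lia.
  have -> : row (rshift K b) (col_mx Th (Th *m e r)) = row b Th *m e r.
    by rewrite -row_mul; apply/rowP => m; rewrite ![row _ _ _ _]mxE col_mxEd.
  exact: pe.
Qed.

End CellStep.

(** Each Koszul generator doubles the cells. The new copy is the image of the old one under the new
    operator, so its boundary component is forced to be [Th *m e r]; this is what keeps the
    relations strict after attaching. *)
Lemma cells_exist r N (deg : 'I_N -> int) d e t (Z : 'M[A]_(t, N)) (n : int) :
  is_kos r d e -> gr_kos r deg d e -> (forall j, homog deg n (row j Z)) -> Z *m d = 0 ->
  exists K degK kap eps Th j0 g0, @is_cells r N deg d e t Z n K degK kap eps Th j0 g0.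
Proof.
move=> ke ge hZ Zd; elim: r ke ge => [|r IH] ke ge.
  exists t, (fun=> n + 1), 0, (fun=> 0), Z, id, Some; split; split=> //.
  - by split=> //; rewrite mul0mx.
  - by split=> // b b' _; rewrite mxE.
  - by rewrite Zd mul0mx.
  - split=> // b b' h; have := hZ b b'; rewrite mxE; apply; lia.
  - by move=> j; rewrite row0.
  - by move=> W y b b' _; rewrite mxE scale0r.
have [dd de ee e2] := ke; have [gd gee] := ge.
have ke1 : is_kos r d e by split=> // [l lr|l m lr mr|l lr]; [apply: de | apply: ee | apply: e2]; lia.
have ge1 : gr_kos r deg d e by split=> // l lr; apply: gee; lia.
have [K [degK [kap [eps [Th [j0 [g0 [[kk gk [Td Te] [TD jP] gP] [TZ kapj kapW epsj pT]]]]]]]]] := IH ke1 ge1.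
do 7!eexists; exact: (cells_step ke ge kk gk Td Te TD jP gP TZ kapj kapW epsj pT).
Qed.

End Kos.

(** * Attaching cells *)

Section Attach.
Variables (A : comNzRingType) (x : nat -> A) (r : nat) (Y : complex A).
Hypothesis nA : noetherian_ring A.
Hypothesis kY : forall (i : int) (y : Y i), kills x r y.

Section Phi.
Variables (N : nat) (mm : forall i : int, 'I_N -> Y i).

Fact phi_linear (i : int) : linear (fun v : 'rV[A]_N => \sum_b v 0 b *: mm i b).
Proof.
move=> a u v; rewrite scaler_sumr -big_split; apply: eq_bigr => j _.
by rewrite !mxE scalerDl scalerA.
Qed.
Definition phi (i : int) : {linear 'rV[A]_N -> Y i} := mkhom (@phi_linear i).

Lemma phi_delta i b : phi i (delta_mx 0 b) = mm i b.
Proof.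
rewrite /= (bigD1 b) //= mxE !eqxx scale1r big1 ?addr0 // => b' nb.
by rewrite mxE (negbTE nb) andbF scale0r.
Qed.

Lemma phi_mul i m (v : 'rV[A]_m) (M : 'M[A]_(m, N)) : phi i (v *m M) = \sum_b v 0 b *: phi i (row b M).
Proof. by rewrite mulmx_sum_row linear_sum; apply: eq_bigr => b _; rewrite linearZ_LR. Qed.
End Phi.

(* A finite free complex with Koszul homotopies and a map to [Y] which is bijective on homology
   below degree [n] and surjective in degree [n]. *)
Record kmodel (n : int) N (deg : 'I_N -> int) (d : 'M[A]_N) (e : nat -> 'M[A]_N)
    (mm : forall i : int, 'I_N -> Y i) : Prop := KModel {
  km_kos : is_kos x r d e;
  km_gr : gr_kos r deg d e;
  km_deg : forall (i : int) b, deg b <> i -> mm i b = 0;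
  km_d : forall (i : int) v, phi mm (i - 1) (v *m d) = cdiff Y i (i - 1) (phi mm i v);
  km_e : forall (i : int) l v, (l < r)%N -> phi mm i (v *m e l) = 0;
  km_inj : forall (i : int) v, i < n -> homog deg i v -> v *m d = 0 ->
    is_boundary (phi mm i v) -> exists2 u, homog deg (i + 1) u & v = u *m d;
  km_surj : forall (i : int) (y : Y i), i <= n -> is_cycle y ->
    exists v, [/\ homog deg i v, v *m d = 0 & is_boundary (y - phi mm i v)] }.

Section Step.
Variables (n : int) (N : nat) (deg : 'I_N -> int) (d : 'M[A]_N) (e : nat -> 'M[A]_N).
Variable mm : forall i : int, 'I_N -> Y i.
Hypothesis km : kmodel n deg d e mm.
Variables (t : nat) (Z : 'M[A]_(t, N)) (yy : 'I_t -> Y (n + 1)).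
Hypothesis hZ : forall j, homog deg n (row j Z).
Hypothesis yyZ : forall j, cdiff Y (n + 1) n (yy j) = phi mm n (row j Z).
Variables (K : nat) (degK : 'I_K -> int) (kap : 'M[A]_K) (eps : nat -> 'M[A]_K) (Th : 'M[A]_(K, N)).
Variables (j0 : 'I_t -> 'I_K) (g0 : 'I_K -> option 'I_t).
Hypothesis cells : is_cells x r deg d e Z n degK kap eps Th j0 g0.

Definition degA (b : 'I_(N + K)) := match fintype.split b with inl b => deg b | inr b => degK b end.
(** The attached block carries [- kap], and likewise [- eps l]: since [Th] intertwines the
    operators, the terms off the diagonal cancel in all relations. *)
Definition dA : 'M[A]_(N + K) := block_mx d 0 Th (- kap).
Definition eA l : 'M[A]_(N + K) := block_mx (e l) 0 0 (- eps l).
(** Only the generating cells have a nonzero image in [Y]. This is compatible with the differentials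
    because [Y] is killed by the sequence and the map to [Y] vanishes on the image of each [e l]. *)
Definition mmK (i : int) (b : 'I_K) : Y i := if g0 b is Some j then tr Y (n + 1) i (yy j) else 0.
Definition mmA (i : int) (b : 'I_(N + K)) : Y i :=
  match fintype.split b with inl b => mm i b | inr b => mmK i b end.

Let sl (b : 'I_N) : fintype.split (lshift K b) = inl b. Proof. exact: (unsplitK (inl b)). Qed.
Let sr (b : 'I_K) : fintype.split (rshift N b) = inr b. Proof. exact: (unsplitK (inr b)). Qed.
Let spl (P : 'I_(N + K) -> Prop) : (forall b, P (lshift K b)) -> (forall b, P (rshift N b)) -> forall b, P b.
Proof. by move=> hl hr b; rewrite -(splitK b); case: (fintype.split b). Qed.

Lemma attach_kos : is_kos x r dA eA.
Proof.
have [dd de ee e2] := km_kos km.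
have [[[kk ke kee k2] _ [Td Te] _ _] _] := cells.
rewrite /dA /eA; split=> [|l lr|l m lr mr|l lr];
  rewrite !mulmx_block ?add_block_mx !(mulmx0, mul0mx, addr0, add0r) ?mulNmx ?mulmxN ?opprK.
- by rewrite dd kk Td subrr block_mx0.
- by rewrite de // ke // Te // subrr -scalar_mx_block.
- by rewrite ee // kee // block_mx0.
- by rewrite e2 // k2 // block_mx0.
Qed.

Lemma attach_gr : gr_kos r degA dA eA.
Proof.
have [gd ge] := km_gr km; have [[_ [gk1 gk2] _ [TD _] _] _] := cells.
rewrite /degA /dA /eA; split=> [|l lr]; apply: spl => b; apply: spl => b';
  rewrite ?sl ?sr ?block_mxEul ?block_mxEur ?block_mxEdl ?block_mxEdr => h.
- exact: gd.
- by rewrite mxE.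
- by apply: TD; lia.
- by rewrite mxE gk1 ?oppr0.
- exact: ge.
- by rewrite mxE.
- by rewrite mxE.
- by rewrite mxE gk2 ?oppr0.
Qed.

Lemma phi_row i v w : phi mmA i (row_mx v w) = phi mm i v + phi mmK i w.
Proof.
rewrite /= big_split_ord /=; congr (_ + _); apply: eq_bigr => b _.
  by rewrite row_mxEl /mmA sl.
by rewrite row_mxEr /mmA sr.
Qed.

Lemma homog_row i (v : 'rV[A]_N) (w : 'rV[A]_K) : homog degA i (row_mx v w) <-> homog deg i v /\ homog degK i w.
Proof.
split=> [h|[h1 h2]].
  split=> b db; first by have := h (lshift K b); rewrite row_mxEl /degA sl; apply.
  by have := h (rshift N b); rewrite row_mxEr /degA sr; apply.
by apply: spl => b; rewrite /degA ?sl ?sr ?row_mxEl ?row_mxEr; [apply: h1 | apply: h2].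
Qed.

Lemma row_dA (v : 'rV[A]_N) (w : 'rV[A]_K) : row_mx v w *m dA = row_mx (v *m d + w *m Th) (- (w *m kap)).
Proof. by rewrite mul_row_block mulmx0 add0r mulmxN. Qed.

Lemma row_eA (v : 'rV[A]_N) (w : 'rV[A]_K) l : row_mx v w *m eA l = row_mx (v *m e l) (- (w *m eps l)).
Proof. by rewrite mul_row_block !mulmx0 add0r addr0 mulmxN. Qed.

Lemma mmK_gen i j : mmK i (j0 j) = tr Y (n + 1) i (yy j).
Proof. by have [[_ _ _ [_ /(_ j)[_ gj]] _] _] := cells; rewrite /mmK gj. Qed.

Lemma mmK_deg (i : int) b : degK b <> i -> mmK i b = 0.
Proof.
have [[_ _ _ [_ jP] gP] _] := cells; rewrite /mmK; have := gP b.
case: (g0 b) => // j ->; have [-> _] := jP j => ni.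
by rewrite /tr cmap2_neq.
Qed.

Lemma phiK_kap i w : phi mmK i (w *m kap) = 0.
Proof.
have [_ [_ _ kW _ _]] := cells.
rewrite phi_mul big1 // => b _; rewrite /= big1 ?scaler0 // => b' _.
by rewrite mxE; apply: kW; apply: kY.
Qed.

Lemma phiK_eps i l w : (l < r)%N -> phi mmK i (w *m eps l) = 0.
Proof.
move=> lr; have [[_ _ _ _ gP] [_ _ _ ej _]] := cells.
rewrite phi_mul big1 // => b _; rewrite /= big1 ?scaler0 // => b' _.
rewrite mxE /mmK; have := gP b'; case: (g0 b') => [j ->|_]; last by rewrite scaler0.
by rewrite ej // scale0r.
Qed.

Lemma phi_Th (i : int) w : phi mm (i - 1) (w *m Th) = cdiff Y i (i - 1) (phi mmK i w).
Proof.
have [[_ _ _ _ gP] [TZ _ _ _ pT]] := cells.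
rewrite phi_mul [phi mmK i w]/= linear_sum; apply: eq_bigr => b _.
rewrite [in RHS]linearZ_LR; congr (_ *: _).
rewrite /mmK; have := gP b; case gb: (g0 b) => [j|] hb; last first.
  by rewrite linear0; apply: pT gb => l v lr; apply: (km_e km).
rewrite hb TZ; have [<-|ni] := eqVneq (n + 1) i.
  have h (m : int) : m = n -> phi mm m (row j Z) = cdiff Y (n + 1) m (tr Y (n + 1) (n + 1) (yy j)).
    by move=> ->; rewrite trE yyZ.
  by apply: h; rewrite addrK.
rewrite [in RHS]/tr cmap2_neq ?linear0; last exact/eqP.
rewrite [LHS]/= big1 // => b' _; have [db|db] := eqVneq (deg b') n; last first.
  by rewrite hZ ?scale0r //; apply/eqP.
rewrite (km_deg km) ?scaler0 // db => e1; move/eqP: ni; apply; lia.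
Qed.

Lemma attach_d (i : int) v : phi mmA (i - 1) (v *m dA) = cdiff Y i (i - 1) (phi mmA i v).
Proof.
rewrite -(hsubmxK v) row_dA !phi_row linearD (linearN (phi mmK _)) phiK_kap oppr0 addr0.
by rewrite linearD (km_d km) phi_Th.
Qed.

Lemma attach_e (i : int) l v : (l < r)%N -> phi mmA i (v *m eA l) = 0.
Proof.
move=> lr; rewrite -(hsubmxK v) row_eA !phi_row (linearN (phi mmK _)) phiK_eps // oppr0 addr0.
exact: (km_e km).
Qed.

Definition genmx : 'M[A]_(t, K) := \matrix_(j, b) (b == j0 j)%:R.

Lemma row_gen j : row j genmx = delta_mx 0 (j0 j).
Proof. by apply/rowP => b; rewrite !mxE eqxx. Qed.

Lemma gen_Th : genmx *m Th = Z.
Proof.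
have [_ [TZ _ _ _ _]] := cells; apply/row_matrixP => j.
by rewrite row_mul row_gen -rowE TZ.
Qed.

Lemma gen_kap : genmx *m kap = 0.
Proof.
have [_ [_ kj _ _ _]] := cells; apply/row_matrixP => j.
by rewrite row_mul row_gen -rowE kj row0.
Qed.

Lemma phi_gen (c : 'rV[A]_t) : phi mmK (n + 1) (c *m genmx) = \sum_j c 0 j *: yy j.
Proof. by rewrite phi_mul; apply: eq_bigr => j _; rewrite row_gen phi_delta mmK_gen trE. Qed.

Lemma homog_gen (c : 'rV[A]_t) : homog degK (n + 1) (c *m genmx).
Proof.
have [[_ _ _ [_ jP] _] _] := cells.
move=> b db; rewrite mxE big1 // => j _; rewrite mxE; case: eqP => [e1|_]; last by rewrite mulr0.
by case: db; rewrite e1; have [] := jP j.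
Qed.

Lemma homogK_lo (i : int) (w : 'rV[A]_K) : i <= n -> homog degK i w -> w = 0.
Proof.
have [[_ _ _ [_ jP] gP] _] := cells.
move=> ni hw; apply/rowP => b; rewrite mxE; apply: hw; have := gP b.
by case: (g0 b) => [j ->|]; [have [-> _] := jP j | ]; lia.
Qed.

End Step.

Lemma kmodel_step (n : int) N deg d e mm : @kmodel n N deg d e mm -> homology_fg Y (n + 1) ->
  exists N' deg' d' e' mm', @kmodel (n + 1) N' deg' d' e' mm'.
Proof.
move=> km [q [w [cw spw]]].
pose U (v : 'rV[A]_N) := [/\ homog deg n v, v *m d = 0 & is_boundary (phi mm n v)].
have [|||p [G [UG sp]]] := @noeth_fg A nA N U.
- split=> [b _||]; rewrite ?mxE ?mul0mx ?linear0 //; exact: bd0.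
- move=> u v [h1 h2 h3] [h1' h2' h3']; split=> [b db||].
  + by rewrite mxE h1 ?h1' ?addr0.
  + by rewrite mulmxDl h2 h2' addr0.
  + by rewrite linearD; apply: bdD.
- move=> a u [h1 h2 h3]; split=> [b db||].
  + by rewrite mxE h1 ?mulr0.
  + by rewrite -scalemxAl h2 scaler0.
  + by rewrite linearZ_LR; apply: bdZ.
have [y yE] : exists y : 'I_p -> Y (n + 1), forall j, cdiff Y (n + 1) n (y j) = phi mm n (row j G).
  have h j : exists y, cdiff Y (n + 1) n y = phi mm n (row j G) by have [_ _ [z zE]] := UG j; exists z.
  by have [y yE] := choice h; exists y.
(* Two kinds of cells: those with boundary in [G] kill the kernel in degree [n], and those with
   boundary 0 represent the generators of the homology of [Y] in degree [n + 1]. *)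
pose Z : 'M[A]_(p + q, N) := col_mx G 0.
pose yy (j : 'I_(p + q)) := match fintype.split j with inl j => y j | inr j => w j end.
have sl (j : 'I_p) : fintype.split (lshift q j) = inl j by exact: (unsplitK (inl j)).
have sr (j : 'I_q) : fintype.split (rshift p j) = inr j by exact: (unsplitK (inr j)).
have Zl j : row (lshift q j) Z = row j G by apply/rowP => b; rewrite [LHS]mxE col_mxEu mxE.
have Zr j : row (rshift p j) Z = 0 by apply/rowP => b; rewrite [LHS]mxE col_mxEd !mxE.
have spl (P : 'I_(p + q) -> Prop) : (forall b, P (lshift q b)) -> (forall b, P (rshift p b)) -> forall b, P b.
  by move=> hl hr b; rewrite -(splitK b); case: (fintype.split b).
have hZ : forall j, homog deg n (row j Z).
  by apply: spl => j; rewrite ?Zl ?Zr; [have [] := UG j | move=> b _; rewrite mxE].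
have yyZ : forall j, cdiff Y (n + 1) n (yy j) = phi mm n (row j Z).
  apply: spl => j; rewrite /yy ?sl ?sr ?Zl ?Zr ?yE // linear0.
  by have /cycleP := cw j.
have Zd : Z *m d = 0.
  rewrite mul_col_mx mul0mx -(col_mx0 A); congr col_mx; apply/row_matrixP => j.
  by rewrite row_mul row0; have [] := UG j.
have [K [degK [kap [eps [Th [j0 [g0 cells]]]]]]] := cells_exist (km_kos km) (km_gr km) hZ Zd.
exists (N + K)%N, (degA deg degK), (dA d kap Th), (eA e eps), (mmA mm yy g0).
have low (i : int) (v : 'rV[A]_N) (w' : 'rV[A]_K) : i <= n -> homog (degA deg degK) i (row_mx v w') -> w' = 0.
  by move=> ni /homog_row[_ hw]; apply: (homogK_lo cells ni hw).
have lift0 (i : int) v : homog deg i v -> homog (degA deg degK) i (row_mx v (0 : 'rV[A]_K)).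
  by move=> hv; apply/homog_row; split=> // b _; rewrite mxE.
have z0 i : homog deg i (0 : 'rV[A]_N) by move=> b _; rewrite mxE.
split.
- exact: (attach_kos km cells).
- exact: (attach_gr km cells).
- move=> i b; rewrite -(splitK b); case: (fintype.split b) => b'; rewrite /degA /mmA /unsplit.
    by rewrite (unsplitK (inl b' : 'I_N + 'I_K)); apply: km_deg km _ _.
  rewrite (unsplitK (inr b' : 'I_N + 'I_K)) => h.
  exact: (mmK_deg yy cells h).
- exact: (attach_d km hZ yyZ cells).
- exact: (attach_e km yy cells).
- move=> i v' ni; rewrite -(hsubmxK v'); set v := lsubmx v'; set w' := rsubmx v' => hv.
  have w0 : w' = 0 by apply: (low i v); [lia|].
  rewrite w0 in hv *; move: hv => /homog_row[hv _].
  rewrite row_dA !mul0mx oppr0 addr0 => vd bv.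
  have {}vd : v *m d = 0 by have := congr1 lsubmx vd; rewrite row_mxKl linear0.
  have {}bv : is_boundary (phi mm i v) by move: bv; rewrite phi_row linear0 addr0.
  have [il|il] := ltrP i n.
    have [u hu ->] := km_inj km il hv vd bv; exists (row_mx u 0); first exact: lift0.
    by rewrite row_dA !mul0mx oppr0 addr0.
  have ein : i = n by lia.
  move: v hv vd bv; rewrite ein => v hv vd bv.
  have [c cE] := sp v (And3 hv vd bv).
  exists (row_mx 0 (row_mx c 0 *m genmx j0)); first by apply/homog_row; split=> //; apply: (homog_gen cells).
  rewrite row_dA mul0mx add0r -!mulmxA (gen_Th cells) (gen_kap cells) mulmx0 oppr0.
  by rewrite mul_row_col mul0mx addr0 cE.
- move=> i z ni cz; have [il|il] := lerP i n.
    have [v [hv vd bv]] := km_surj km il cz; exists (row_mx v 0); split; first exact: lift0.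
      by rewrite row_dA !mul0mx vd oppr0 addr0 row_mx0.
    by rewrite phi_row linear0 addr0.
  have ein : i = n + 1 by lia.
  move: z cz; rewrite ein => z cz.
  have [c bc] := spw z cz; pose cc : 'rV[A]_(p + q) := row_mx 0 (\row_j c j).
  exists (row_mx 0 (cc *m genmx j0)); split.
  + by apply/homog_row; split=> //; apply: (homog_gen cells).
  + rewrite row_dA mul0mx add0r -!mulmxA (gen_Th cells) (gen_kap cells) mulmx0 oppr0.
    by rewrite mul_row_col mul0mx mulmx0 addr0 row_mx0.
  + rewrite phi_row linear0 add0r (phi_gen _ cells) big_split_ord /=.
    have e0 : \sum_(j < p) cc 0 (lshift q j) *: yy (lshift q j) = 0.
      by rewrite big1 // => j _; rewrite row_mxEl mxE scale0r.
    have e1 : \sum_(j < q) cc 0 (rshift p j) *: yy (rshift p j) = \sum_j c j *: w j.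
      by apply: eq_bigr => j _; rewrite row_mxEr mxE /yy sr.
    by rewrite e0 e1 add0r.
Qed.

Lemma kmodel_exists (lo : int) : (forall i, homology_fg Y i) -> (forall i : int, i <= lo -> exact_at Y i) ->
  forall j : nat, exists N deg d e mm, @kmodel (lo + j%:Z) N deg d e mm.
Proof.
move=> fg ex; elim=> [|j [N [deg [d [e [mm km]]]]]]; last first.
  have [N' [deg' [d' [e' [mm' km']]]]] := kmodel_step km (fg _).
  have -> : lo + j.+1%:Z = lo + j%:Z + 1 by lia.
  by exists N', deg', d', e', mm'.
exists 0%N, (fun=> 0), 0, (fun=> 0), (fun _ _ => 0); rewrite addr0.
have th v : v = 0 :> 'rV[A]_0 by exact: thinmx0.
split=> //.
- by split=> *; apply/matrixP => -[].
- by split=> [[]//|l lr []//].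
- by move=> i v; rewrite (th v) mul0mx !linear0.
- by move=> i l v _; rewrite (th v) mul0mx !linear0.
- by move=> i v _ _ _ _; exists 0; [move=> [] | rewrite mul0mx].
- move=> i y il cy; exists 0; split; [by move=> [] | by rewrite mul0mx |].
  by rewrite linear0 subr0; apply: ex.
Qed.

End Attach.

(** * Idempotent matrices over a local ring *)

Section Local.
Variables (A : comNzRingType) (k : fieldType) (res : {rmorphism A -> k}).
Hypothesis lA : local_ring A.
Hypothesis sur : forall c : k, exists a, res a = c.

Lemma nonunit_maximal (a : A) : (forall b, a * b <> 1) ->
  exists2 I, maximal_ideal I & I a.
Proof.
move=> na; pose aA := [set x | exists b, x = a * b]%classic.
have iaA : is_ideal aA.
  split=> [|_ _ [b ->] [c ->]|c _ [b ->]]; first by exists 0; rewrite mulr0.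
    by exists (b + c); rewrite mulrDr.
  by exists (c * b); rewrite mulrCA.
have aAa : aA a by exists 1; rewrite mulr1.
have aA1 : ~ aA 1 by move=> [b /esym]; apply: na.
pose P (J : set A) := (J = set0 \/ is_ideal J /\ J a) /\ ~ J 1.
have [F FP tot|J [[J0 J1] Jmax]] := @Zorn_bigcup A P.
  split; last by move=> [J FJ J1]; case: (FP J FJ).
  have [[J FJ [z Jz]]|no] := pselect (exists2 J, F J & exists z, J z); last first.
    left; apply/seteqP; split=> // z [J FJ Jz]; apply: no; exists J => //; by exists z.
  have idl J' : F J' -> (exists z, J' z) -> is_ideal J' /\ J' a.
    by move=> FJ' [z' Jz']; have [[e|//] _] := FP J' FJ'; rewrite e in Jz'.
  have [iJ Ja] : is_ideal J /\ J a by apply: idl => //; exists z.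
  right; split; last by exists J.
  split; first by exists J => //; case: iJ.
    move=> x y [J1 F1 x1] [J2 F2 y2].
    have [[_ D1 _] _] : is_ideal J1 /\ J1 a by apply: idl => //; exists x.
    have [[_ D2 _] _] : is_ideal J2 /\ J2 a by apply: idl => //; exists y.
    have [s|s] := tot _ _ F1 F2; [exists J2 => //; apply: D2 => //; exact: s | exists J1 => //; apply: D1 => //; exact: s].
  move=> c x [J1 F1 x1]; exists J1 => //.
  by have [[_ _ Z1] _] : is_ideal J1 /\ J1 a by [apply: idl => //; exists x]; apply: Z1.
have {J0} [iJ Ja] : is_ideal J /\ J a.
  case: J0 => // e; exfalso; apply: (Jmax aA); last by split; [right|].
  by rewrite e; split=> [x //|]; move/(_ a aAa).
exists J => //; split=> // J' iJ' JJ'.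
have [e|ne] := pselect (J' = J); [by left | right].
have J'1 : J' 1.
  apply: contrapT => n1; apply: (Jmax J'); last by split=> //; right; split=> //; apply: JJ'.
  by split=> // J'J; apply: ne; apply/seteqP.
apply/seteqP; split=> // x _; rewrite -[x]mulr1; case: iJ' => _ _; exact.
Qed.

Lemma ker_maximal : maximal_ideal [set a | res a = 0]%classic.
Proof.
split=> /=.
- split=> /=; first exact: rmorph0.
    by move=> x y x0 y0; rewrite rmorphD x0 y0 addr0.
  by move=> a x x0; rewrite rmorphM x0 mulr0.
- by rewrite rmorph1 => /eqP; rewrite oner_eq0.
move=> J [J0 JD JM] kJ; have [[a Ja na]|no] := pselect (exists2 a, J a & res a <> 0).
  right; apply/seteqP; split=> // x _.
  have [b bE] := sur (res a)^-1.
  have J1 : J 1.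
    rewrite -[1](subrK (b * a)); apply: JD; last exact: JM.
    by apply: kJ; rewrite /= rmorphB rmorphM rmorph1 bE mulVf ?subrr //; apply/eqP.
  by rewrite -[x]mulr1; apply: JM.
left; apply/seteqP; split=> // a Ja /=; apply: contrapT => na; apply: no; by exists a.
Qed.

Lemma local_unit a : res a != 0 -> exists b, a * b = 1.
Proof.
move=> ra; apply: contrapT => no.
have [|I mI Ia] := @nonunit_maximal a; first by move=> b ab; apply: no; exists b.
have [J [_ uJ]] := lA; have := uJ _ mI; rewrite (uJ _ ker_maximal) => e.
by move: Ia; rewrite -e /=; apply/eqP.
Qed.

Lemma local_invmx n (M : 'M[A]_n) : \det (map_mx res M) != 0 ->
  exists M', M *m M' = 1%:M /\ M' *m M = 1%:M.
Proof.
rewrite det_map_mx => /local_unit[b bE]; exists (b *: \adj M).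
by rewrite -scalemxAr -scalemxAl mul_mx_adj mul_adj_mx scale_scalar_mx mulrC bE.
Qed.

(** A projective direct summand over a local ring is free, in matrix form. A submatrix [S] of
    maximal rank over the residue field is invertible; the idempotent [e - C *m S' *m U] then
    vanishes over the residue field, so 1 minus it is invertible and it must be zero. *)
Lemma idempotent_split N (e : 'M[A]_N) : e *m e = e ->
  exists p (I : 'I_p -> 'I_N) (W : 'M[A]_(N, p)),
    rowsub I e *m W = 1%:M /\ W *m rowsub I e = e.
Proof.
move=> ee; pose eb := map_mx res e; pose I := maxrankfun eb.
have fr : row_full (rowsub I eb)^T.
  by rewrite /row_full mxrank_tr; have := maxrowsub_free eb; rewrite /row_free.
pose J := fullrankfun fr; pose S := mxsub I J e.
have SE : map_mx res S = (rowsub J (rowsub I eb)^T)^T by apply/matrixP => i j; rewrite !mxE.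
have dS : \det (map_mx res S) != 0.
  by have := fullrowsub_unit fr; rewrite unitmxE unitfE SE det_tr.
have [S' [SS' S'S]] := local_invmx dS.
pose U := rowsub I e; pose C := colsub J e.
have eeE b b' : e b b' = \sum_l e b l * e l b' by rewrite -{1}ee mxE.
have UC : U *m C = S.
  by apply/matrixP => i j; rewrite mxE [RHS]mxE eeE; apply: eq_bigr => l _; rewrite !mxE.
have Ue : U *m e = U.
  by apply/matrixP => i j; rewrite mxE [RHS]mxE eeE; apply: eq_bigr => l _; rewrite !mxE.
have eC : e *m C = C.
  by apply/matrixP => i j; rewrite mxE [RHS]mxE eeE; apply: eq_bigr => l _; rewrite !mxE.
exists (\rank eb), I, (C *m S'); rewrite -/U mulmxA UC; split=> //.
pose g := e - C *m S' *m U.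
have CUC : (C *m S' *m U) *m (C *m S' *m U) = C *m S' *m U.
  by rewrite -!mulmxA [U *m (C *m _)]mulmxA UC [S *m _]mulmxA SS' mul1mx.
have gg : g *m g = g.
  rewrite /g mulmxBl !mulmxBr ee CUC !mulmxA eC -[C *m S' *m U *m e]mulmxA Ue subrr subr0.
  by [].
have [X XE] : exists X, eb = X *m map_mx res U.
  have /eqmxP/andP[_ /submxP[X XE]] := eq_maxrowsub eb; exists X.
  by rewrite {1}XE; congr (_ *m _); apply/matrixP => i j; rewrite !mxE.
have g0 : map_mx res g = 0.
  have XS : X = map_mx res C *m map_mx res S'.
    have -> : map_mx res C = X *m map_mx res S.
      have -> : map_mx res C = colsub J eb by apply/matrixP => i j; rewrite !mxE.
      apply/matrixP => i j; rewrite [LHS]mxE; have /(congr1 (fun M : 'M_N => M i (J j))) -> := XE.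
      by rewrite !mxE; apply: eq_bigr => l _; rewrite !mxE.
    by rewrite -mulmxA -map_mxM SS' map_mx1 mulmx1.
  have h i j : eb i j = (X *m map_mx res U) i j by exact: (congr1 (fun M : 'M_N => M i j) XE).
  rewrite /g map_mxB !map_mxM -XS; apply/matrixP => i j; rewrite [LHS]mxE [X in _ + X]mxE -h subrr.
  by rewrite mxE.
have [|G [_ G1]] := @local_invmx N (1%:M - g).
  by rewrite map_mxB g0 subr0 map_mx1 det1 oner_eq0.
have gz : g = 0.
  have h : (1%:M - g) *m g = 0 by rewrite mulmxBl mul1mx gg subrr.
  by rewrite -[g]mul1mx -G1 -mulmxA h mulmx0.
by apply/esym/eqP; rewrite -subr_eq0; apply/eqP.
Qed.

End Local.

(** * Complexes of graded pieces *)

Section Graded.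
Variables (R : comNzRingType) (N : nat) (wt : 'I_N -> int) (r : nat).
Variable p : {linear VV R N r -> VV R N r}.
Hypothesis p_deg : forall (i : int) g, hm wt i g -> hm wt (i - 1) (p g).
Hypothesis pp : forall g, p (p g) = 0.

Definition gcx_diff (i j : int) : {linear 'rV[R]_(bsz wt r i) -> 'rV[R]_(bsz wt r j)} :=
  if i == j + 1 then (crdL wt r R j \o (p \o uncL wt r R i) : {linear _ -> _}) else hom_zero _ _.

Lemma gcx_diffE (i j : int) g : hm wt i g -> i = j + 1 -> gcx_diff i j (crd wt i g) = crd wt j (p g).
Proof. by move=> hg e; rewrite /gcx_diff e eqxx /= -e crdK. Qed.

Fact gcx_shape (i j : int) x : i <> j + 1 -> gcx_diff i j x = 0.
Proof. by move=> /eqP/negbTE ij; rewrite /gcx_diff ij. Qed.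
Fact gcx_dd (i j l : int) x : gcx_diff j l (gcx_diff i j x) = 0.
Proof.
have [e|e] := pselect (i = j + 1); last by rewrite (gcx_shape x e) linear0.
have [e'|e'] := pselect (j = l + 1); last by rewrite gcx_shape.
rewrite -(uncK x) gcx_diffE //; last exact: hm_unc.
rewrite gcx_diffE //; last by have := p_deg (hm_unc x); congr hm; lia.
by rewrite pp; apply: (linear0 (crdL wt r R l)).
Qed.

Definition gcx : complex R := @Complex R (fun i => 'rV[R]_(bsz wt r i)) gcx_diff gcx_shape gcx_dd.

Lemma gcx_projective i : projective (gcx i). Proof. exact: projective_rV. Qed.

Lemma gcx_lo (i : int) (x : gcx i) : i < wt_lo wt -> x = 0.
Proof.
move=> il; rewrite -[x](uncK (x : 'rV_(bsz wt r i))) (hm_lo (hm_unc _) il).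
exact: (linear0 (crdL wt r R i)).
Qed.

Lemma gcx_cycP (i : int) g : hm wt i g -> is_cycle (crd wt i g : gcx i) <-> p g = 0.
Proof.
move=> hg; rewrite /is_cycle [cdiff _ _ _ _]gcx_diffE ?subrK //; split=> [h|->].
  by rewrite -[p g](crdK (p_deg hg)) h; apply: (linear0 (uncL wt r R (i - 1))).
exact: (linear0 (crdL wt r R (i - 1))).
Qed.

Lemma gcx_bdP (i : int) g : hm wt i g ->
  is_boundary (crd wt i g : gcx i) <-> exists2 h, hm wt (i + 1) h & p h = g.
Proof.
move=> hg; split=> [[y yE]|[h hh ph]].
  exists (unc y); first exact: hm_unc.
  have hp : hm wt i (p (unc y)) by have := p_deg (hm_unc y); rewrite addrK.
  rewrite -(crdK hg) -yE -[X in cdiff _ _ _ X](uncK (y : 'rV_(bsz wt r (i + 1)))).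
  by rewrite [cdiff _ _ _ _]gcx_diffE ?crdK //; apply: hm_unc.
by exists (crd wt (i + 1) h); rewrite [cdiff _ _ _ _]gcx_diffE // ph.
Qed.

Section Map.
Variables (Y : complex R) (f : forall i : int, {linear VV R N r -> Y i}).
Hypothesis f_diff : forall (i : int) g, hm wt i g -> f (i - 1) (p g) = cdiff Y i (i - 1) (f i g).

Definition gcx_cmap (i : int) : {linear 'rV[R]_(bsz wt r i) -> Y i} := f i \o uncL wt r R i.

Fact gcx_map_diff (i j : int) (x : gcx i) : gcx_cmap j (cdiff gcx i j x) = cdiff Y i j (gcx_cmap i x).
Proof.
have [e|e] := pselect (i = j + 1); last by rewrite !diff_shape // linear0.
have ej : j = i - 1 by rewrite e addrK.
rewrite -[x](uncK (x : 'rV_(bsz wt r i))) ej [cdiff _ _ _ _]gcx_diffE ?subrK //; last exact: hm_unc.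
rewrite /gcx_cmap /= crdK ?f_diff ?uncK //; last exact: p_deg (hm_unc _).
exact: hm_unc.
Qed.
Definition gcx_map : chain_map gcx Y := @ChainMap R gcx Y gcx_cmap gcx_map_diff.

Lemma gcx_mapE (i : int) g : hm wt i g -> gcx_map i (crd wt i g) = f i g.
Proof. by move=> hg; rewrite /= crdK. Qed.

Lemma gcx_map_quasi :
  (forall (i : int) g, hm wt i g -> p g = 0 -> is_boundary (f i g) -> exists2 h, hm wt (i + 1) h & p h = g) ->
  (forall (i : int) (y : Y i), is_cycle y -> exists g, [/\ hm wt i g, p g = 0 & is_boundary (y - f i g)]) ->
  quasi_iso gcx_map.
Proof.
move=> inj surj i; split=> [x|y cy].
  have [g hg ->] : exists2 g, hm wt i g & x = crd wt i g by exists (unc x); [exact: hm_unc | rewrite uncK].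
  by rewrite gcx_mapE // => /(gcx_cycP hg) pg bg; apply/gcx_bdP/inj.
have [g [hg pg bg]] := surj i y cy.
by exists (crd wt i g); [apply/gcx_cycP | rewrite gcx_mapE].
Qed.
End Map.

End Graded.

(** * Cutting down to a bounded model *)

Lemma cyc_at (R : comNzRingType) (X : complex R) (i j : int) (x : X i) :
  i = j + 1 -> cdiff X i j x = 0 -> is_cycle x.
Proof. by move=> e; have -> : j = i - 1 by rewrite e addrK. Qed.

Section Retract.
Variables (A : comNzRingType) (x : nat -> A) (r : nat) (Y : complex A).
Variables (n : int) (N : nat) (deg : 'I_N -> int) (d : 'M[A]_N) (e : nat -> 'M[A]_N).
Variable mm : forall i : int, 'I_N -> Y i.
Hypothesis km : kmodel x r n deg d e mm.
Hypothesis Y0 : forall (i : int) (y : Y i), n <= i -> y = 0.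

(** The cells above degree [n] stay in place with zero differential, so that no nonzero element of
    degree [n] is a boundary any more. *)
Definition cutmx : 'M[A]_N := \matrix_(b, b') if deg b <= n then d b b' else 0.

Lemma cutmx_lo (i : int) v : homog deg i v -> i <= n -> v *m cutmx = v *m d.
Proof.
move=> hv il; apply/rowP => b'; rewrite !mxE; apply: eq_bigr => b _; rewrite mxE.
by have [db|/eqP db] := eqVneq (deg b) i; [rewrite db il | rewrite hv ?mul0r].
Qed.

Lemma cutmx_hi (i : int) v : homog deg i v -> n < i -> v *m cutmx = 0.
Proof.
move=> hv il; apply/rowP => b'; rewrite !mxE big1 // => b _; rewrite mxE.
have [db|/eqP db] := eqVneq (deg b) i; last by rewrite hv ?mul0r.
by rewrite db leNgt il mulr0.
Qed.

Lemma cutmx_deg : mx_deg deg (-1) cutmx.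
Proof. by have [gd _] := km_gr km; move=> b b' h; rewrite mxE gd // if_same. Qed.

Lemma cutmx_sqr : cutmx *m cutmx = 0.
Proof.
have [dd _ _ _] := km_kos km; have [gd _] := km_gr km.
apply/matrixP => b b'; rewrite mxE [RHS]mxE; have [il|il] := lerP (deg b) n; last first.
  by rewrite big1 // => c _; rewrite mxE leNgt il mul0r.
transitivity ((d *m d) b b'); last by rewrite dd mxE.
rewrite [RHS]mxE; apply: eq_bigr => c _; rewrite !mxE il.
have [dc|/eqP dc] := eqVneq (deg c) (deg b + -1); last by rewrite gd ?mul0r.
by have -> : deg c <= n by lia.
Qed.

Fact cut_deg (i : int) (g : VV A N 0) : hm deg i g -> hm deg (i - 1) (act cutmx 0 g).
Proof. exact: hm_act cutmx_deg. Qed.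
Fact cut_sqr (g : VV A N 0) : act cutmx 0 (act cutmx 0 g) = 0.
Proof. by rewrite /= -mulmxA cutmx_sqr mulmx0. Qed.
Definition cutc : complex A := gcx cut_deg cut_sqr.

Fact cut_phi (i : int) (g : VV A N 0) : hm deg i g ->
  phi mm (i - 1) (act cutmx 0 g) = cdiff Y i (i - 1) (phi mm i g).
Proof.
move=> hg; have [il|il] := lerP i n; first by rewrite -(km_d km) [act _ _ _](cutmx_lo hg).
rewrite [act _ _ _](cutmx_hi hg) // [phi mm i g in RHS]Y0 ?linear0 //; exact: ltW.
Qed.
Definition cut_map : chain_map cutc Y := gcx_map cut_deg cut_sqr cut_phi.

Lemma cut_exact (i : int) : i < n + 1 -> exact_at (mcone cut_map) i.
Proof.
move=> il [a y] /cone_cycP[da fa]; apply/cone_bdP.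
have [v hv aE] : exists2 v : VV A N 0, hm deg (i - 1) v & a = crd deg (i - 1) v.
  by exists (unc a); [exact: hm_unc | rewrite uncK].
have vc : v *m cutmx = 0 by apply/(gcx_cycP cut_deg cut_sqr hv); rewrite -aE.
rewrite {}aE in da fa *; rewrite gcx_mapE // in fa.
have vd : v *m d = 0 by rewrite -(cutmx_lo hv) //; lia.
have [||u hu uE] := km_inj km _ hv vd; first by lia.
  have -> : phi mm (i - 1) v = - cdiff Y i (i - 1) y by apply/eqP; rewrite -addr_eq0 fa.
  exact/bdN/bd_diff.
rewrite subrK in hu.
have uE' : cdiff cutc i (i - 1) (crd deg i (u : VV A N 0)) = crd deg (i - 1) v.
  by rewrite [LHS]gcx_diffE ?subrK // [act _ _ _](cutmx_lo hu) ?uE //; lia.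
have cz : is_cycle (y + phi mm i u).
  by rewrite /is_cycle linearD -(km_d km) -uE [LHS]addrC.
have [|w [hw wd [b bE]]] := km_surj km _ cz; first by lia.
exists (crd deg i ((w : VV A N 0) - u)), b; split.
  have -> : crd deg i ((w : VV A N 0) - u) = crd deg i (w : VV A N 0) - crd deg i (u : VV A N 0).
    exact: (linearB (crdL deg 0 A i)).
  rewrite (linearB (cdiff cutc _ _)) uE' opprB [cdiff _ _ _ _]gcx_diffE ?subrK //.
  rewrite [act _ _ _](cutmx_lo hw) ?wd; last by lia.
  by rewrite [crd _ _ 0](linear0 (crdL deg 0 A (i - 1))) subr0.
rewrite gcx_mapE; last by apply: hmB.
by rewrite (linearB (phi mm i)) bE; abel.
Qed.

(* The obstruction to projecting degree [n] of the model onto its cycles is a map from [Y] to the cone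
   of the truncated model, which is exact below degree [n + 1]. *)
Lemma retraction :
  (forall C, coconnective_from (n + 1) C -> forall g : chain_map Y C,
    exists Z (s : chain_map C Z), quasi_iso s /\ nullh (fun i y => s i (g i y))) ->
  exists rho : 'M[A]_N,
    (forall b b', deg b <> n -> rho b b' = 0) /\
    forall v, homog deg n v ->
      [/\ homog deg n (v *m rho), v *m rho *m d = 0 & v *m d = 0 -> v *m rho = v].
Proof.
move=> /(_ _ cut_exact (cone_incl cut_map))[Z [s [qs [t tE]]]].
(* As [s] is null homotopic on [Y], it amounts up to homotopy to a map [mu] on the shifted cut
   model. *)
have [mu muE] := cone_factor tE.
have [|||i ii|sg sgE] := @lift_homotopy A (cshift cutc) Z mu (fun i => i <= n) (wt_lo deg + 1).
- by move=> i; apply: gcx_projective.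
- by move=> i a il; apply: gcx_lo; lia.
- by move=> i; lia.
- by apply/(quasi_exact i qs).1/cut_exact; lia.
pose X : {linear 'rV[A]_N -> cshift cutc (n + 1)} := crdL deg 0 A (n + 1 - 1).
have hX v : homog deg n v -> hm deg (n + 1 - 1) (v : VV A N 0) by rewrite addrK.
have lin : linear (fun v : 'rV[A]_N => s (n + 1) (X v, 0)).
  move=> a u v; rewrite -(linearP (s (n + 1))); congr (s _ _).
  by apply: injective_projections; [apply: linearP | rewrite /= scaler0 addr0].
pose K : {linear 'rV[A]_N -> Z (n + 1)} := mkhom lin.
(* For a cycle [v], [K v] represents its class in [Z]. The map [c] agrees with [K] on cycles and is
   defined on all of degree [n]; subtracting the homotopy [sg], available up to degree [n], makes
   each [c v] a cycle. *)
pose c : {linear 'rV[A]_N -> Z (n + 1)} :=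
  (mu (n + 1) \o X) \- (sg n (n + 1) \o (cdiff (cshift cutc) (n + 1) n \o X)).
have cE v : c v = mu (n + 1) (X v) - sg n (n + 1) (cdiff (cshift cutc) (n + 1) n (X v)) by [].
have cc v : is_cycle (c v).
  apply: (cyc_at (j := n)) => //; rewrite cE (linearB (cdiff Z _ _)) -cmap_diff.
  by rewrite sgE // diff_diff linear0 addr0 subrr.
have Xd v : homog deg n v -> v *m d = 0 -> forall j, cdiff (cshift cutc) (n + 1) j (X v) = 0.
  move=> hv vd j; move: j; apply/cycleP/cyc_shift/(gcx_cycP cut_deg cut_sqr (hX v hv)).
  by rewrite [LHS](cutmx_lo hv).
have cK v : homog deg n v -> v *m d = 0 -> c v = K v.
  move=> hv vd; rewrite cE Xd // linear0 subr0 muE.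
  have -> : cut_map (n + 1 - 1) (X v) = 0 by apply: Y0; lia.
  by rewrite linear0 subr0.
(* Nothing of degree [n] bounds in the cut model and [Y] is zero from degree [n] on, so a cycle is
   determined by its class in [Z]. The class of [c v] thus names a unique cycle, the value of the
   retraction. *)
have uniq v : homog deg n v -> v *m d = 0 -> is_boundary (K v) -> v = 0.
  move=> hv vd bK.
  have /cone_bdP[a [b [Xa _]]] : is_boundary ((X v, 0) : mcone cut_map (n + 1)).
    apply: (qs (n + 1)).1 => //; apply/cone_cycP; split; last first.
      by rewrite linear0 addr0; apply: Y0; lia.
    by apply/(gcx_cycP cut_deg cut_sqr (hX v hv)); rewrite [LHS](cutmx_lo hv).
  have X0 : X v = 0.
    rewrite [X v]Xa -[a](uncK (a : 'rV_(bsz deg 0 (n + 1)))) [cdiff _ _ _ _]gcx_diffE ?subrK //; last exact: hm_unc.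
    have -> : act cutmx 0 (unc a) = 0 by apply: (cutmx_hi (hm_unc a)); lia.
    by rewrite [crd _ _ 0](linear0 (crdL deg 0 A (n + 1 - 1))) oppr0.
  have := crdK (hX v hv); rewrite -[crd _ _ _]/(X v) X0 => <-.
  exact: (linear0 (uncL deg 0 A (n + 1 - 1))).
have ex b : exists w : 'rV[A]_N, (deg b <> n -> w = 0) /\ (deg b = n ->
    [/\ homog deg n w, w *m d = 0 & is_boundary (c (delta_mx 0 b) - K w)]).
  have [db|/eqP db] := eqVneq (deg b) n; last by exists 0; split.
  have [[a y] /cone_cycP[da _] by'] := (qs (n + 1)).2 _ (cc (delta_mx 0 b)).
  have hn u : hm deg (n + 1 - 1) (u : VV A N 0) -> homog deg n u by rewrite addrK.
  have hw := hn _ (hm_unc a).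
  have Xa : X (unc a) = a by rewrite /X /= uncK.
  exists (unc a); split=> // _; split=> //.
    rewrite -(cutmx_lo hw) //; apply/(gcx_cycP cut_deg cut_sqr (hX _ hw)).
    by rewrite -[crd _ _ _]/(X (unc a)) Xa.
  move: by'; congr (is_boundary (_ - _)); rewrite /K /= -[crd _ _ _]/(X (unc a)) Xa.
  by congr (s _ (_, _)); apply: Y0; lia.
have [w wE] := choice ex; exists (\matrix_b w b); split=> [b b' db|v hv].
  by rewrite mxE (wE b).1 // mxE.
have rE : v *m (\matrix_b w b) = \sum_b v 0 b *: w b.
  by rewrite mulmx_sum_row; apply: eq_bigr => b _; rewrite rowK.
have wh b : homog deg n (w b) /\ w b *m d = 0.
  have [db|/eqP db] := eqVneq (deg b) n; first by have [] := (wE b).2 db.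
  by rewrite (wE b).1 // mul0mx; split=> // b' _; rewrite mxE.
have rh : homog deg n (v *m (\matrix_b w b)).
  by move=> b db; rewrite rE summxE big1 // => b' _; rewrite mxE (wh b').1 // mulr0.
have rd : v *m (\matrix_b w b) *m d = 0.
  by rewrite rE mulmx_suml big1 // => b _; rewrite -scalemxAl (wh b).2 scaler0.
split=> // vd; apply/esym/eqP; rewrite -subr_eq0; apply/eqP; apply: uniq.
- exact: (@hmB A N deg 0 n v _ hv rh).
- by rewrite mulmxBl vd rd subrr.
have cs : c v = \sum_b v 0 b *: c (delta_mx 0 b).
  by rewrite {1}[v]row_sum_delta (linear_sum c); apply: eq_bigr => b _; rewrite (linearZ_LR c).
have Ks : K (v *m (\matrix_b w b)) = \sum_b v 0 b *: K (w b).
  by rewrite rE (linear_sum K); apply: eq_bigr => b _; rewrite (linearZ_LR K).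
rewrite (linearB K) -cK // cs Ks -sumrB; apply: bd_sum => b _.
rewrite -scalerBr; have [db|/eqP db] := eqVneq (deg b) n.
  by apply: bdZ; have [] := (wE b).2 db.
by rewrite hv // scale0r; apply: bd0.
Qed.

End Retract.

Section Finite.
Variables (A : comNzRingType) (x : nat -> A) (r : nat) (Y : complex A).
Variables (n : int) (N : nat) (deg : 'I_N -> int) (d : 'M[A]_N) (e : nat -> 'M[A]_N).
Variable mm : forall i : int, 'I_N -> Y i.
Hypothesis km : kmodel x r n deg d e mm.
Hypothesis Y0 : forall (i : int) (y : Y i), n <= i -> y = 0.
Variable rho : 'M[A]_N.
Hypothesis rho0 : forall b b', deg b <> n -> rho b b' = 0.
Hypothesis rhoP : forall v, homog deg n v ->
  [/\ homog deg n (v *m rho), v *m rho *m d = 0 & v *m d = 0 -> v *m rho = v].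

(* The projector whose kernel consists of the degrees above [n] and of the cycles of degree [n]. *)
Definition cutE : 'M[A]_N :=
  \matrix_(b, b') if deg b <= n then (b == b')%:R - rho b b' else 0.

Lemma cutE_lo (i : int) v : homog deg i v -> i < n -> v *m cutE = v.
Proof.
move=> hv il; rewrite -[RHS]mulmx1; apply/rowP => b'; rewrite !mxE; apply: eq_bigr => b _; rewrite !mxE.
have [db|/eqP db] := eqVneq (deg b) i; last by rewrite hv ?mul0r.
by rewrite rho0 ?subr0 ?db ?(ltW il) //; lia.
Qed.

Lemma cutE_eq v : homog deg n v -> v *m cutE = v - v *m rho.
Proof.
move=> hv; rewrite -[X in _ = X - _]mulmx1 -mulmxBr.
apply/rowP => b'; rewrite !mxE; apply: eq_bigr => b _; rewrite !mxE.
have [db|/eqP db] := eqVneq (deg b) n; last by rewrite hv ?mul0r.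
by rewrite db lexx.
Qed.

Lemma cutE_hi (i : int) v : homog deg i v -> n < i -> v *m cutE = 0.
Proof.
move=> hv il; apply/rowP => b'; rewrite !mxE big1 // => b _; rewrite !mxE.
have [db|/eqP db] := eqVneq (deg b) i; last by rewrite hv ?mul0r.
by rewrite db leNgt il mulr0.
Qed.

Lemma homog_delta b : homog deg (deg b) (delta_mx 0 b : 'rV[A]_N).
Proof. by move=> b' db; rewrite mxE eqxx; case: eqP => // e0; case: db; rewrite e0. Qed.

Lemma homog_mul (i s : int) v (M : 'M[A]_N) : mx_deg deg s M -> homog deg i v -> homog deg (i + s) (v *m M).
Proof. by move=> hM hv; apply: (@hm_act A N deg s M 0 i v hM hv). Qed.

Lemma homog_ext (X X' : 'M[A]_N) : (forall (i : int) v, homog deg i v -> v *m X = v *m X') -> X = X'.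
Proof. by move=> h; apply/row_matrixP => b; rewrite !rowE; apply: h (@homog_delta b). Qed.

Lemma cutE_deg : mx_deg deg 0 cutE.
Proof.
move=> b b'; rewrite addr0 mxE => db; case: ifP => // _.
have -> : b == b' = false by apply/eqP => e0; apply: db; rewrite e0.
have [dn|/eqP dn] := eqVneq (deg b) n; last by rewrite rho0 ?subr0.
have [|hr _ _] := @rhoP (delta_mx 0 b); first by rewrite -dn; apply: homog_delta.
have -> : rho b b' = ((delta_mx 0 b : 'rV[A]_N) *m rho) 0 b' by rewrite -rowE mxE.
by rewrite hr ?subr0 // -dn.
Qed.

Lemma cutE_cyc v : homog deg n v -> v *m d = 0 -> v *m cutE = 0.
Proof. by move=> hv vd; rewrite cutE_eq //; have [_ _ ->] := rhoP hv; rewrite ?subrr. Qed.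

Lemma cutE_idem : cutE *m cutE = cutE.
Proof.
apply: homog_ext => i v hv; rewrite mulmxA; have [il|il|e0] := ltrgtP i n.
- by rewrite !(cutE_lo hv il).
- by rewrite (cutE_hi hv il) mul0mx.
rewrite e0 in hv; rewrite {1}(cutE_eq hv) mulmxBl [v *m rho *m _]cutE_cyc ?subr0 //; by have [] := rhoP hv.
Qed.

(** The kernel of the projector is stable under these operators: [d] sends degree [n + 1] into the
    cycles of degree [n] and kills those cycles, while an operator of degree 1 sends them above [n].
    So the operators descend to the quotient by this kernel. *)
Lemma cutE_op (s : int) (M : 'M[A]_N) : mx_deg deg s M -> s = 1 \/ s = -1 /\ M = d ->
  (1%:M - cutE) *m M *m cutE = 0.
Proof.
have [dd _ _ _] := km_kos km.
move=> hM sM; apply: homog_ext => i v hv; rewrite mulmx0 !mulmxA mulmxBr mulmx1 mulmxBl.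
have hvM := homog_mul hM hv; have [il|il|e0] := ltrgtP i n.
- by rewrite (cutE_lo hv il) subrr mul0mx.
- rewrite (cutE_hi hv il) mul0mx subr0; case: sM => [e0|[e0 e1]]; first by apply: (cutE_hi hvM); lia.
  have [il2|il2] := ltrP n (i + s); first exact: (cutE_hi hvM).
  have en : i + s = n by lia.
  by rewrite en in hvM; apply: cutE_cyc => //; rewrite e1 -mulmxA dd mulmx0.
rewrite e0 in hv hvM; have [hr rd _] := rhoP hv.
have -> : v *m M - v *m cutE *m M = v *m rho *m M by rewrite cutE_eq // mulmxBl opprB addrC subrK.
case: sM => [e1|[_ ->]]; last by rewrite rd mul0mx.
by apply: (cutE_hi (homog_mul hM hr)); lia.
Qed.

Lemma phi_cutE (i : int) v : phi mm i (v *m cutE) = phi mm i v.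
Proof.
have [il|il] := ltrP i n; last by rewrite [LHS]Y0 ?[RHS]Y0.
rewrite -[v in RHS]mulmx1 phi_mul [RHS]phi_mul; apply: eq_bigr => b _; congr (_ *: _).
have [db|/eqP db] := eqVneq (deg b) i; first by rewrite !rowE mulmx1 (cutE_lo (@homog_delta b)) ?db.
have ph w : homog deg (deg b) w -> phi mm i w = 0.
  move=> hw; rewrite /= big1 // => b' _; have [db'|/eqP db'] := eqVneq (deg b') (deg b).
    by rewrite (km_deg km) ?scaler0 // db'.
  by rewrite hw // scale0r.
rewrite !rowE mulmx1 !ph //; first exact: homog_delta.
by have := homog_mul cutE_deg (@homog_delta b); rewrite addr0.
Qed.

Variables (p : nat) (I : 'I_p -> 'I_N) (W0 : 'M[A]_(N, p)).
Let U := rowsub I cutE.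
Hypotheses (UW0 : U *m W0 = 1%:M) (WU0 : W0 *m U = cutE).

Let degF j := deg (I j).
(** [W0] need not respect degrees. Its homogeneous part still splits the projector, since [U] and
    [cutE] are homogeneous. *)
Let W : 'M[A]_(N, p) := \matrix_(b, j) if deg b == degF j then W0 b j else 0.

Let U_deg j b : deg b <> degF j -> U j b = 0.
Proof. by move=> h; rewrite mxE cutE_deg // addr0. Qed.

Let UW : U *m W = 1%:M.
Proof.
apply/matrixP => j j'; rewrite -UW0 !mxE; have [e0|/eqP e0] := eqVneq (degF j) (degF j').
  apply: eq_bigr => b _; rewrite [W b j']mxE; have [db|/eqP db] := eqVneq (deg b) (degF j').
    by [].
  by rewrite U_deg ?mul0r // e0.
rewrite big1 => [|b _].
  have -> : \sum_b U j b * W0 b j' = (U *m W0) j j' by rewrite mxE.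
  by rewrite UW0 mxE; case: eqP => // e1; case: e0; rewrite e1.
rewrite [W b j']mxE; case: eqP => db; last by rewrite mulr0.
by rewrite U_deg ?mul0r // db; apply/nesym.
Qed.

Let WU : W *m U = cutE.
Proof.
apply/matrixP => b b'; have [db|/eqP db] := eqVneq (deg b) (deg b'); last first.
  rewrite cutE_deg ?addr0 // ?mxE; last exact/nesym.
  rewrite big1 // => j _; rewrite [W b j]mxE; case: eqP => dj; last by rewrite mul0r.
  by rewrite U_deg ?mulr0 // -dj; apply/nesym.
rewrite -WU0 !mxE; apply: eq_bigr => j _; rewrite [W b j]mxE.
case: eqP => // dj; rewrite [U j b']U_deg ?mulr0 // -db; exact: dj.
Qed.

Let UE : U *m cutE = U. Proof. by rewrite -WU mulmxA UW mul1mx. Qed.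
Let EW : cutE *m W = W. Proof. by rewrite -WU -mulmxA UW mulmx1. Qed.

Let fold (M : 'M[A]_N) := U *m M *m W.

Let op_good (M : 'M[A]_N) := (1%:M - cutE) *m M *m cutE = 0.

Let good_d : op_good d.
Proof. by have [gd _] := km_gr km; apply: (cutE_op gd); right. Qed.
Let good_e l : (l < r)%N -> op_good (e l).
Proof. by move=> lr; have [_ ge] := km_gr km; apply: (cutE_op (ge l lr)); left. Qed.

Let good_mul M : op_good M -> cutE *m M *m cutE = M *m cutE.
Proof. by move=> gM; apply/eqP; rewrite eq_sym -subr_eq0 -{1}[M]mul1mx -!mulmxBl; apply/eqP. Qed.

Let good_W M : op_good M -> cutE *m M *m W = M *m W.
Proof. by move=> gM; rewrite -EW !mulmxA good_mul. Qed.

Let foldM M M' : op_good M' -> fold M *m fold M' = fold (M *m M').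
Proof.
move=> gM; rewrite /fold -!mulmxA [W *m (U *m _)]mulmxA WU.
by congr (_ *m (_ *m _)); rewrite mulmxA good_W.
Qed.

Let foldD M M' : fold (M + M') = fold M + fold M'.
Proof. by rewrite /fold mulmxDr mulmxDl. Qed.

Let homogU (i : int) v : homog degF i v -> homog deg i (v *m U).
Proof.
move=> hv b db; rewrite mxE big1 // => j _; have [dj|/eqP dj] := eqVneq (degF j) i.
  by rewrite U_deg ?mulr0 // dj.
by rewrite hv ?mul0r.
Qed.

Let homogW (i : int) v : homog deg i v -> homog degF i (v *m W).
Proof.
move=> hv j dj; rewrite mxE big1 // => b _; rewrite mxE; have [db|/eqP db] := eqVneq (deg b) i.
  by rewrite db; case: eqP => [e0|]; [case: dj | rewrite mulr0].
by rewrite hv ?mul0r.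
Qed.

Let fold_deg (s : int) M : mx_deg deg s M -> mx_deg degF s (fold M).
Proof.
move=> hM j j' dj; have -> : fold M j j' = ((delta_mx 0 j : 'rV[A]_p) *m U *m M *m W) 0 j'.
  by rewrite /fold -!mulmxA -rowE [RHS]mxE.
apply: (homogW (homog_mul hM (homogU (i := degF j) _))) => // b db.
by rewrite mxE eqxx; case: eqP => // e0; case: db; rewrite e0.
Qed.

(** Below degree [n] the comparison with [Y] is inherited. From degree [n] on the folded model has
    no nonzero cycles and [Y] is zero, so the comparison holds for every bound [n']. *)
Lemma kmodel_retract n' : kmodel x r n' degF (fold d) (fun l => fold (e l))
  (fun i j => phi mm i (row j U)).
Proof.
have [dd de ee e2] := km_kos km; have [gd ge] := km_gr km.
have phE (i : int) v : phi (fun i j => phi mm i (row j U)) i v = phi mm i (v *m U) by rewrite phi_mul.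
have phf (i : int) v M : phi mm i (v *m fold M *m U) = phi mm i (v *m U *m M).
  by rewrite /fold -!mulmxA WU !mulmxA phi_cutE.
have Wd (v : 'rV[A]_N) : v *m W *m fold d = v *m d *m W.
  by rewrite /fold -!mulmxA [W *m (U *m _)]mulmxA WU [cutE *m (d *m W)]mulmxA good_W.
split.
- split=> [|l lr|l m lr mr|l lr]; rewrite ?foldM -?foldD ?dd ?de ?ee ?e2 //; try exact: good_e;
    rewrite /fold ?mulmx0 ?mul0mx // mul_mx_scalar -scalemxAl UW.
  by rewrite scalemx1.
- by split=> [|l lr]; apply: fold_deg; [|apply: ge].
- move=> i j dj; rewrite /= big1 // => b _; rewrite mxE; have [db|/eqP db] := eqVneq (deg b) (degF j).
    by rewrite (km_deg km) ?scaler0 // db.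
  by rewrite U_deg // scale0r.
- by move=> i v; rewrite !phE phf (km_d km).
- by move=> i l v lr; rewrite phE phf (km_e km).
- move=> i v _ hv vd; rewrite phE => bv; have hU := homogU hv.
  have vU : v = v *m U *m W by rewrite -mulmxA UW mulmx1.
  have vUE : v *m U *m cutE = v *m U by rewrite -mulmxA UE.
  have vUd : i <= n -> v *m U *m d = 0.
    move=> il; rewrite -(cutE_lo (homog_mul gd hU)); last by lia.
    have h : v *m U *m d *m W = 0 by rewrite -vd /fold !mulmxA.
    by rewrite -WU mulmxA h mul0mx.
  have [il|il] := ltrP i n; last first.
    exists 0; first by move=> b _; rewrite mxE.
    rewrite mul0mx vU -vUE; have [e0|ne] := eqVneq i n.
      by rewrite e0 in hU; rewrite cutE_cyc ?mul0mx // vUd ?e0.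
    by rewrite (cutE_hi hU) ?mul0mx //; lia.
  have [u hu uE] := km_inj km il hU (vUd (ltW il)) bv.
  by exists (u *m W); [apply: homogW | rewrite Wd -uE].
- move=> i y _ cy; have [il|il] := ltrP i n; last first.
    exists 0; split; [by move=> b _; rewrite mxE | by rewrite mul0mx |].
    by rewrite (Y0 y il) linear0 subr0; apply: bd0.
  have [v [hv vd bv]] := km_surj km (ltW il) cy.
  exists (v *m W); split; [exact: homogW | by rewrite Wd vd mul0mx |].
  by rewrite phE -mulmxA WU phi_cutE.
Qed.

End Finite.

Lemma finite_model (A : comNzRingType) (k : fieldType) (res : {rmorphism A -> k})
    (x : nat -> A) r (Y : complex A) n N deg d e (mm : forall i : int, 'I_N -> Y i) :
  local_ring A -> (forall c : k, exists a, res a = c) ->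
  kmodel x r n deg d e mm -> (forall (i : int) (y : Y i), n <= i -> y = 0) ->
  (forall C, coconnective_from (n + 1) C -> forall g : chain_map Y C,
    exists Z (s : chain_map C Z), quasi_iso s /\ nullh (fun i y => s i (g i y))) ->
  exists N' deg' d' e' mm', forall n', @kmodel A x r Y n' N' deg' d' e' mm'.
Proof.
move=> lA sur km Y0 bY; have [rho [rho0 rhoP]] := retraction km Y0 bY.
have [p [I [W [UW WU]]]] := idempotent_split lA sur (cutE_idem rho0 rhoP).
do 5!eexists; exact: (kmodel_retract km Y0 rho0 rhoP UW WU).
Qed.

(** * Contraction modulo a regular sequence *)

Section Ideals.
Variable A : comNzRingType.
Implicit Types (s : seq A) (P : A -> Prop).

Lemma ideal_genP s a : ideal_gen s a <-> exists c : nat -> A, a = \sum_(0 <= i < size s) c i * s`_i.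
Proof.
split=> [[c ->]|[c ->]]; last by exists (fun i => c i); rewrite big_mkord.
exists (fun i => if insub i is Some j then c j else 0); rewrite big_mkord.
by apply: eq_bigr => i _; rewrite valK.
Qed.

Lemma ideal_gen_is_ideal s : is_ideal (ideal_gen s).
Proof.
split=> [|a b /ideal_genP[c ->] /ideal_genP[c' ->]|a b /ideal_genP[c ->]]; apply/ideal_genP.
- by exists (fun=> 0); rewrite big1 // => i _; rewrite mul0r.
- by exists (fun i => c i + c' i); rewrite -big_split; apply: eq_bigr => i _; rewrite mulrDl.
- by exists (fun i => a * c i); rewrite mulr_sumr; apply: eq_bigr => i _; rewrite mulrA.
Qed.

Lemma ideal_gen_rcons s y a : ideal_gen (rcons s y) a <-> exists z, ideal_gen s (a - y * z).
Proof.
split=> [/ideal_genP[c ->]|[z /ideal_genP[c cE]]].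
  exists (c (size s)); apply/ideal_genP; exists c.
  rewrite size_rcons big_nat_recr //= nth_rcons ltnn eqxx [y * _]mulrC addrK.
  by apply: eq_big_nat => i /andP[_ il]; rewrite nth_rcons il.
apply/ideal_genP; exists (fun i => if i == size s then z else c i).
rewrite size_rcons big_nat_recr //= nth_rcons ltnn eqxx [z * _]mulrC -[LHS](subrK (y * z)) cE.
by congr (_ + _); apply: eq_big_nat => i /andP[_ il]; rewrite nth_rcons il ltn_eqF.
Qed.

Variable N : nat.
Notation V := (VV A N).

Fixpoint inI P r : V r -> Prop :=
  if r is r'.+1 then fun g => forall n, inI P (g n) else fun v => forall b, P ((v : 'rV[A]_N) 0 b).

Section Ideal.
Variable P : A -> Prop.
Hypothesis iP : is_ideal P.

Lemma inI0 r : inI P (0 : V r).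
Proof. by elim: r => [|r IH] => [b|n]; [rewrite mxE; case: iP | apply: IH]. Qed.
Lemma inID r (g h : V r) : inI P g -> inI P h -> inI P (g + h).
Proof.
elim: r g h => [|r IH] g h hg hh => [b|n]; last exact: IH.
by rewrite mxE; case: iP => _ D _; apply: D.
Qed.
Lemma inIZ r a (g : V r) : inI P g -> inI P (a *: g).
Proof.
elim: r g => [|r IH] g hg => [b|n]; last exact: IH.
by rewrite mxE; case: iP => _ _ Z; apply: Z.
Qed.
Lemma inIN r (g : V r) : inI P g -> inI P (- g).
Proof. by rewrite -scaleN1r; apply: inIZ. Qed.
Lemma inIB r (g h : V r) : inI P g -> inI P h -> inI P (g - h).
Proof. by move=> hg hh; apply/inID/inIN. Qed.
Lemma inI_act M r (g : V r) : inI P g -> inI P (act M r g).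
Proof.
elim: r g => [|r IH] g hg => [b|n]; last exact: IH.
have [P0 PD PM] := iP; rewrite mxE; elim/big_rec: _ => // b' y _ Py.
by apply: PD => //; rewrite mulrC; apply: PM.
Qed.
Lemma inI_DG d e r (g : V r) : inI P g -> inI P (DG d e r g).
Proof.
elim: r g => [|r IH] g hg; first exact: (@inI_act d 0).
by move=> n; rewrite DGE; apply: inID; [apply: IH | apply: inI_act].
Qed.
Lemma inI_DW d e r (g : V r) : inI P g -> inI P (DW d e r g).
Proof.
elim: r g => [|r IH] g hg; first exact: (@inI_act d 0).
move=> n; rewrite DWE; apply: inID; first exact: IH.
by case: n => [|n]; [apply: inI0 | apply: inI_act].
Qed.
End Ideal.

Section Extend.
Variables (P P' : A -> Prop) (y : A).
Hypothesis PP' : forall a, P' a <-> exists z, P (a - y * z).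

Lemma inI_ext wt r (i : int) (g : V r) : is_ideal P -> hm wt i g -> inI P' g ->
  exists2 z, hm wt i z & inI P (g - y *: z).
Proof.
move=> [P0 _ _]; elim: r i g => [|r IH] i g hg Pg.
  have h b : exists z, (wt b <> i -> z = 0) /\ P ((g : 'rV[A]_N) 0 b - y * z).
    have [wb|/eqP wb] := eqVneq (wt b) i; first by have [z Pz] := (PP' _).1 (Pg b); exists z.
    by exists 0; split=> //; rewrite hg // mulr0 subr0.
  have [z zE] := choice h; exists (\row_b z b) => [b wb|b]; first by rewrite mxE (zE b).1.
  by rewrite !mxE; case: (zE b).
have h n : exists z, hm wt (i - (2 * n)%N%:Z) z /\ inI P (g n - y *: z).
  by have [z hz Pz] := IH _ _ (hg n) (Pg n); exists z.
by have [z zE] := choice h; exists z => n; case: (zE n).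
Qed.

Lemma inI_add r (g z : V r) : inI P (g - y *: z) -> inI P' g.
Proof.
elim: r g z => [|r IH] g z h => [b|n]; last exact: IH (h n).
by apply/PP'; exists ((z : 'rV[A]_N) 0 b); have := h b; rewrite !mxE.
Qed.

Lemma inI_cancel r (g : V r) : (forall a, P (y * a) -> P a) -> inI P (y *: g) -> inI P g.
Proof.
move=> yP; elim: r g => [|r IH] g h => [b|n]; last exact: IH (h n).
by apply: yP; have := h b; rewrite mxE.
Qed.
End Extend.

End Ideals.

Section Contract.
Variables (A : comNzRingType) (s : seq A) (N : nat) (deg : 'I_N -> int).
Notation V := (VV A N).
Notation Id j := (ideal_gen (take j s)).
Notation x := (fun l => s`_l).
Hypothesis reg : forall i a, (i < size s)%N -> Id i (s`_i * a) -> Id i a.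

Let iI j : is_ideal (Id j). Proof. exact: ideal_gen_is_ideal. Qed.

Let IdS r : (r < size s)%N -> forall a, Id r.+1 a <-> exists z, Id r (a - s`_r * z).
Proof. by move=> rs a; rewrite (take_nth 0 rs); apply: ideal_gen_rcons. Qed.

Section Step.
Variables (r : nat) (D : {linear V r -> V r}) (E0 : 'M[A]_N) (sD : int).
Hypothesis rs : (r < size s)%N.
Hypothesis DQ : forall a, inI (Id r) a -> inI (Id r) (D a).
Hypothesis hD : forall (i : int) a, hm deg i a -> hm deg (i + sD) (D a).
Hypothesis hE : mx_deg deg (- sD) E0.
Hypothesis DD : forall a, inI (Id r) (D (D a)).
Hypothesis EE : E0 *m E0 = 0.
Hypothesis DE : forall a, D (act E0 r a) + act E0 r (D a) = s`_r *: a.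

Let E := act E0 r.
Let X := act (s`_r)%:M r : {linear V r -> V r}.
Let Q : V r -> Prop := @inI A N (Id r) r.
Let Qx : V r -> Prop := @inI A N (Id r.+1) r.

Let XE a : X a = s`_r *: a. Proof. exact: act_scalar. Qed.
Let Q0 : Q 0. Proof. exact: inI0. Qed.
Let QB a b : Q a -> Q b -> Q (a - b). Proof. exact: inIB. Qed.
Let EQ a : Q a -> Q (E a). Proof. exact: inI_act. Qed.
Let XQ a : Q (X a) -> Q a.
Proof. by rewrite XE; apply: inI_cancel => c; apply: reg. Qed.
Let h0 (i : int) : hm deg i (0 : V r). Proof. exact: hm0. Qed.
Let hB (i : int) (a b : V r) : hm deg i a -> hm deg i b -> hm deg i (a - b). Proof. exact: hmB. Qed.
Let hEE (i : int) a : hm deg i a -> hm deg (i - sD) (E a). Proof. exact: hm_act. Qed.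
Let hlo (i : int) (a : V r) : hm deg i a -> i < wt_lo deg -> a = 0. Proof. exact: hm_lo. Qed.
Let QxE (i : int) a : hm deg i a -> Qx a -> exists2 z, hm deg i z & Q (a - X z).
Proof. by move=> ha /(inI_ext (IdS rs) (iI r) ha)[z hz Qz]; exists z; rewrite ?XE. Qed.
Let QxI a z : Q (a - X z) -> Qx a. Proof. by rewrite XE; apply: (inI_add (IdS rs)). Qed.
Let QxB a b : Qx a -> Qx b -> Qx (a - b). Proof. exact: inIB. Qed.
Let EE' a : E (E a) = 0. Proof. by rewrite /E actM EE act0l. Qed.
Let DE' a : D (E a) + E (D a) = X a. Proof. by rewrite XE DE. Qed.
Let DX a : D (X a) = X (D a). Proof. by rewrite !XE linearZ_LR. Qed.
Let EX a : E (X a) = X (E a). Proof. by rewrite !XE linearZ_LR. Qed.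

Definition gamma_cycleI := gamma_cycle (D := D) (E := E) (X := X) (Q := Q) (Qx := Qx) (h := @hm A N deg r)
  Q0 QB DQ EQ XQ h0 hB hD hEE hlo QxE QxI QxB DD EE' DE' DX EX.
Definition w_cycleI := w_cycle (D := D) (E := E) (X := X) (Q := Q) (Qx := Qx) (h := @hm A N deg r)
  Q0 QB DQ EQ XQ h0 hB hD hEE hlo QxE QxI QxB DD EE' DE' DX EX.
Definition w_boundaryI := w_boundary (D := D) (E := E) (X := X) (Q := Q) (Qx := Qx) (h := @hm A N deg r)
  Q0 QB DQ EQ XQ h0 hB hD hEE hlo QxE QxI QxB DD EE' DE' DX EX.
Definition dgam_dgamI := dgam_dgam (D := D) (E := E) (X := X) (Q := Q) (Qx := Qx) Q0 QxI QxB DD EE' DE'.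
Definition dw_dwI := dw_dw (D := D) (E := E) (X := X) (Q := Q) (Qx := Qx) Q0 QxI QxB DD EE' DE'.
End Step.

Variables (d : 'M[A]_N) (e : nat -> 'M[A]_N).

Lemma is_kosW r : is_kos x r.+1 d e -> is_kos x r d e.
Proof. by move=> [dd de ee e2]; split=> // [l lr|l m lr mr|l lr]; [apply: de | apply: ee | apply: e2]; lia. Qed.

Lemma kos_DG_act r (a : V r) : is_kos x r.+1 d e ->
  DG d e r (act (e r) r a) + act (e r) r (DG d e r a) = s`_r *: a.
Proof. by move=> [_ de ee _]; apply: DG_act => [l lr|]; [apply: ee; lia | apply: de]. Qed.

Lemma kos_DW_act r (a : V r) : is_kos x r.+1 d e ->
  DW d e r (act (e r) r a) + act (e r) r (DW d e r a) = s`_r *: a.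
Proof. by move=> [_ de ee _]; apply: DW_act => [l lr|]; [apply: ee; lia | apply: de]. Qed.

Lemma DG_DGI r (a : V r) : (r <= size s)%N -> is_kos x r d e -> inI (Id r) (DG d e r (DG d e r a)).
Proof.
elim: r a => [|r IH] a rs ke.
  have [dd _ _ _] := ke; have -> : DG d e 0 (DG d e 0 a) = 0 by rewrite [LHS]actM dd act0l.
  exact: inI0.
have [_ _ _ e2] := ke; move=> n.
exact: (dgam_dgamI (D := DG d e r) rs (fun a => IH a (ltnW rs) (is_kosW ke)) (e2 r (ltnSn r)) (fun a => kos_DG_act a ke)).
Qed.

Lemma DW_DWI r (a : V r) : (r <= size s)%N -> is_kos x r d e -> inI (Id r) (DW d e r (DW d e r a)).
Proof.
elim: r a => [|r IH] a rs ke.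
  have [dd _ _ _] := ke; have -> : DW d e 0 (DW d e 0 a) = 0 by rewrite [LHS]actM dd act0l.
  exact: inI0.
have [_ _ _ e2] := ke; move=> n.
exact: (dw_dwI (D := DW d e r) rs (fun a => IH a (ltnW rs) (is_kosW ke)) (e2 r (ltnSn r)) (fun a => kos_DW_act a ke)).
Qed.

Lemma inI_eq0 (g : V 0) : inI (Id 0) g -> g = 0.
Proof.
move=> h; apply/rowP => b; rewrite mxE; have /ideal_genP[c ->] := h b.
by rewrite take0 big_nil.
Qed.

Lemma emb0E v : emb 0 v = v :> V 0. Proof. by []. Qed.
Lemma nu0E : nu e 0 = 1%:M. Proof. by []. Qed.
Lemma embE r v n : emb r.+1 v n = (if n is 0 then emb r v else 0) :> V r. Proof. by []. Qed.

Section Gamma.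
Hypothesis gd : mx_deg deg (-1) d.

(** Variables are removed from the last to the first: [gamma_cycle] moves the cycle to exponent 0 of
    the last one, where it is a cycle modulo one element less and the induction hypothesis
    applies. *)
Lemma DG_contract_cycle r : (r <= size s)%N -> is_kos x r d e -> (forall l, (l < r)%N -> mx_deg deg 1 (e l)) ->
  forall (i : int) g, hm deg i g -> inI (Id r) (DG d e r g) ->
  exists v p, [/\ homog deg i v, v *m d = 0, hm deg (i + 1) p & inI (Id r) (g - emb r v - DG d e r p)].
Proof.
elim: r => [|r IH] rs ke ge i g hg Dg.
  exists g, 0; split=> //; first exact: (inI_eq0 Dg); first exact: hm0.
  by rewrite linear0 subr0 emb0E subrr; apply: inI0.
have [_ _ _ e2] := ke; have ge' l : (l < r)%N -> mx_deg deg 1 (e l) by move=> lr; apply: ge; lia.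
have [v [p [hv Qv hp Qp]]] := gamma_cycleI (D := DG d e r) (E0 := e r) (sD := -1) rs
  (fun a => @inI_DG A N _ (iI r) d e r a) (fun i a => hm_DG gd ge') (ge r (ltnSn r))
  (fun a => DG_DGI a (ltnW rs) (is_kosW ke)) (e2 r (ltnSn r)) (fun a => kos_DG_act a ke) erefl hg Dg.
have [v0 [p0 [hv0 v0d hp0 Qp0]]] := IH (ltnW rs) (is_kosW ke) ge' i v hv Qv.
exists v0, ((p : V r.+1) + cst0 (V r) p0); split=> //.
  by apply: hmD => //; apply: hm_cst0.
have Qp0' : inI (Id r.+1) (v - emb r v0 - DG d e r p0).
  by apply: (inI_add (IdS rs) (z := 0)); rewrite scaler0 subr0.
move=> n; rewrite (linearD (DG d e r.+1)).
change (inI (Id r.+1) (g n - emb r.+1 v0 n - (DG d e r.+1 (p : V r.+1) n + DG d e r.+1 (cst0 (V r) p0) n))).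
have := Qp n; rewrite /dgam -[_ (p n) + _]/(DG d e r.+1 (p : V r.+1) n).
case: n => [|n] h.
  rewrite -[emb r.+1 v0 0%N]/(emb r v0) [DG d e r.+1 (cst0 _ p0) 0%N]DGE -[cst0 _ p0 0%N]/p0 -[cst0 _ p0 1%N]/0 linear0 addr0.
  by have := inID (iI r.+1) h Qp0'; congr inI; abel.
rewrite -[emb r.+1 v0 n.+1]/0 [DG d e r.+1 (cst0 _ p0) n.+1]DGE -[cst0 _ p0 n.+1]/0 -[cst0 _ p0 n.+2]/0 !linear0 !addr0 ?subr0; exact: h.
Qed.

Lemma DG_emb r v : DG d e r (emb r v) = emb r (v *m d) :> V r.
Proof.
elim: r => [|r IH]; first by [].
apply/funext => -[|n]; rewrite DGE !embE.
  by rewrite IH linear0 addr0.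
by rewrite !linear0 addr0.
Qed.

End Gamma.

Section W.
Hypothesis gd : mx_deg deg 1 d.

Lemma act_emb (M : 'M[A]_N) r v : act M r (emb r v) = emb r (v *m M) :> V r.
Proof.
elim: r => [|r IH]; first by [].
apply/funext => -[|n]; first exact: IH.
exact: (linear0 (act M r)).
Qed.

(** The differential of [e r] applied to [a] is the multiple of [a] by the new element minus [e r]
    applied to the differential of [a]; the first term dies in the new quotient, the second by
    induction. *)
Lemma DW_emb_nu r v : (r <= size s)%N -> is_kos x r d e -> v *m d = 0 ->
  inI (Id r) (DW d e r (emb r (v *m nu e r)) : V r).
Proof.
elim: r => [|r IH] rs ke vd.
  by rewrite emb0E nu0E mulmx1 [DW _ _ _ _]vd; apply: inI0.
have [_ _ _ e2] := ke; have ke' := is_kosW ke.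
have eE : emb r (v *m nu e r.+1) = act (e r) r (emb r (v *m nu e r)) by rewrite act_emb -mulmxA.
move=> [|[|n]]; rewrite DWE !embE.
- rewrite addr0 eE; apply: (inI_add (IdS rs) (z := emb r (v *m nu e r))); rewrite -(kos_DW_act _ ke).
  have h := inI_act (iI r) (e r) (IH (ltnW rs) ke' vd).
  by have := inIN (iI r) h; congr inI; abel.
- by rewrite eE actM e2 // act0l linear0 addr0; apply: inI0.
- by rewrite !linear0 addr0; apply: inI0.
Qed.

(** Each use of [w_cycle] trades the cycle for the image under [e r] of a cycle one degree higher.
    After all variables these factors assemble to the norm element, and the degree has moved by
    [r]. *)
Lemma DW_contract_cycle r : (r <= size s)%N -> is_kos x r d e -> (forall l, (l < r)%N -> mx_deg deg (-1) (e l)) ->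
  forall (i : int) w, hm deg i w -> inI (Id r) (DW d e r w) ->
  exists y q, [/\ homog deg (i + r%:Z) y, y *m d = 0, hm deg (i - 1) q &
    inI (Id r) (w - emb r (y *m nu e r) - DW d e r q)].
Proof.
elim: r => [|r IH] rs ke ge i w hw Dw.
  exists w, 0; split=> //; first by rewrite addr0.
  - exact: (inI_eq0 Dw).
  - exact: hm0.
  by rewrite linear0 subr0 emb0E nu0E mulmx1 subrr; apply: inI0.
have [_ _ _ e2] := ke; have ge' l : (l < r)%N -> mx_deg deg (-1) (e l) by move=> lr; apply: ge; lia.
have [y [p [hy Qy hp Qp]]] := w_cycleI (D := DW d e r) (E0 := e r) (sD := 1) rs
  (fun a => @inI_DW A N _ (iI r) d e r a) (fun i a => hm_DW gd ge') (ge r (ltnSn r))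
  (fun a => DW_DWI a (ltnW rs) (is_kosW ke)) (e2 r (ltnSn r)) (fun a => kos_DW_act a ke) erefl hw Dw.
have [y0 [q0 [hy0 y0d hq0 Qq0]]] := IH (ltnW rs) (is_kosW ke) ge' (i + 1) y hy Qy.
rewrite addrK in hq0.
have hEq : hm deg (i - 1) (act (e r) r q0) by apply: hm_act hq0; apply: ge.
(* The induction leaves an error, [e r] applied to the boundary of [q0]. By the homotopy formula it
   is minus the boundary of [e r] applied to [q0], modulo the new element, whence the sign. *)
exists y0, ((p : V r.+1) - cst0 (V r) (act (e r) r q0)); split=> //.
- by move: hy0; congr homog; lia.
- by apply: hmB => //; apply: hm_cst0.
have eE : emb r (y0 *m nu e r.+1) = act (e r) r (emb r (y0 *m nu e r)) by rewrite act_emb -mulmxA.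
have Qq' : inI (Id r.+1) (act (e r) r y - emb r (y0 *m nu e r.+1) + DW d e r (act (e r) r q0)).
  apply: (inI_add (IdS rs) (z := q0)); rewrite -(kos_DW_act q0 ke) eE.
  have := inI_act (iI r) (e r) Qq0; congr inI; rewrite !linearB; abel.
have comb0 (a t : V r) : inI (Id r.+1) (a - t) -> inI (Id r.+1) (a - 0 - (t - 0)) by rewrite !subr0.
move=> n; rewrite linearB !vvB.
have := Qp n; rewrite /dw -[_ (p n) + _]/(DW d e r.+1 (p : V r.+1) n).
case: n => [|[|n]] h.
- rewrite -[emb r.+1 _ 0%N]/(emb r (y0 *m nu e r.+1)) [DW d e r.+1 (cst0 _ _) 0%N]DWE addr0 -[cst0 _ _ 0%N]/(act (e r) r q0).
  have comb (a b c t u : V r) : inI (Id r.+1) (a - b - t) -> inI (Id r.+1) (b - c + u) ->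
      inI (Id r.+1) (a - c - (t - u)).
    by move=> h1 h2; have := inID (iI r.+1) h1 h2; congr inI; abel.
  exact: comb h Qq'.
- rewrite -[emb r.+1 _ 1%N]/0 [DW d e r.+1 (cst0 _ _) 1%N]DWE -[cst0 _ _ 0%N]/(act (e r) r q0) -[cst0 _ _ 1%N]/0.
  have -> : DW d e r 0 + act (e r) r (act (e r) r q0) = 0 by rewrite actM e2 // act0l linear0 addr0.
  exact: comb0 h.
- rewrite -[emb r.+1 _ n.+2]/0 [DW d e r.+1 (cst0 _ _) n.+2]DWE -[cst0 _ _ n.+2]/0 -[cst0 _ _ n.+1]/0.
  have -> : DW d e r 0 + act (e r) r 0 = 0 by rewrite !linear0 addr0.
  exact: comb0 h.
Qed.

Lemma DW_contract_boundary r : (r <= size s)%N -> is_kos x r d e -> (forall l, (l < r)%N -> mx_deg deg (-1) (e l)) ->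
  forall (i : int) y q, homog deg (i + r%:Z) y -> y *m d = 0 -> hm deg (i - 1) q ->
  inI (Id r) (emb r (y *m nu e r) - DW d e r q) -> exists2 u, homog deg (i + r%:Z - 1) u & y = u *m d.
Proof.
elim: r => [|r IH] rs ke ge i y q hy yd hq Qq.
  exists q; first by move: hq; congr homog; lia.
  by have /eqP := inI_eq0 Qq; rewrite subr_eq0 emb0E nu0E mulmx1 => /eqP.
have [_ _ _ e2] := ke; have ge' l : (l < r)%N -> mx_deg deg (-1) (e l) by move=> lr; apply: ge; lia.
have hn : mx_deg deg (- r%:Z) (nu e r) by have := mx_deg_nu (a := 1) ge'; rewrite mulN1r.
have hev : hm deg (i + 1) (emb r (y *m nu e r) : V r).
  apply: hm_emb; have := @hm_act A N deg _ _ 0 _ y hn hy; congr hm; lia.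
have [|p' hp' Qp'] := w_boundaryI (D := DW d e r) (E0 := e r) (sD := 1) rs
  (fun a => @inI_DW A N _ (iI r) d e r a) (fun i a => hm_DW gd ge') (ge r (ltnSn r))
  (fun a => DW_DWI a (ltnW rs) (is_kosW ke)) (e2 r (ltnSn r)) (fun a => kos_DW_act a ke) erefl hev
  (DW_emb_nu (ltnW rs) (is_kosW ke) yd) hq.
  have eE : emb r (y *m nu e r.+1) = act (e r) r (emb r (y *m nu e r)) by rewrite act_emb -mulmxA.
  by move=> n; have := Qq n; rewrite vvB embE; case: n => [|n]; rewrite ?eE.
have [||u hu uE] := IH (ltnW rs) (is_kosW ke) ge' (i + 1) y p' _ yd _ Qp'.
- by move: hy; congr homog; lia.
- by rewrite addrK.
by exists u => //; move: hu; congr homog; lia.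
Qed.
End W.

End Contract.

(** * Pairing the two Koszul complexes *)

Section Pairing.
Variables (B K : comNzRingType) (g : {rmorphism B -> K}) (Nm : lmodType B) (th : K -> Nm).
Hypothesis thD : forall a b, th (a + b) = th a + th b.
Hypothesis thZ : forall b c, th (g b * c) = b *: th c.
Hypothesis th_inj : forall c, th c = 0 -> c = 0.
Hypothesis th_surj : forall y, exists c, th c = y.
Variables (N : nat) (wt : 'I_N -> int) (r : nat) (d : 'M[B]_N) (e : nat -> 'M[B]_N).
Hypothesis p_deg : forall (i : int) v, hm wt i v -> hm wt (i - 1) (DG d e r v).
Hypothesis pp : forall v : VV B N r, DG d e r (DG d e r v) = 0.
Notation G := (gcx p_deg pp).
Notation V := (VV K N r).
Let dK : 'M[K]_N := (map_mx g d)^T.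
Let eK l : 'M[K]_N := (map_mx g (e l))^T.
Notation DWK := (DW dK eK r).

Let th_sum I (q : seq I) (F : I -> K) : th (\sum_(j <- q) F j) = \sum_(j <- q) th (F j).
Proof.
have th0 : th 0 = 0 by rewrite -(mulr0 (g 0)) thZ scale0r.
by elim: q => [|j q IH]; rewrite ?big_nil // !big_cons thD IH.
Qed.

Fact pair_linear (i : int) (w : V) :
  linear (fun x : 'rV[B]_(bsz wt r i) => th ((map_mx g x *m (crd wt i w)^T) 0 0)).
Proof.
move=> a x y; rewrite -thZ -thD; congr th.
by rewrite map_mxD map_mxZ mulmxDl -scalemxAl !mxE.
Qed.
(** Through [th], linear maps from the graded piece to [Nm] become elements of the polynomial
    complex over [K] on the transposed operators. It is applied with [K] the residue field, for
    Betti numbers, and with [K] the ring [B], for the dual. *)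
Definition pair (i : int) (w : V) : linHom (G i) Nm := mkhom (@pair_linear i w).

Lemma pairE (i : int) w x : pair i w x = th ((map_mx g x *m (crd wt i w)^T) 0 0).
Proof. by []. Qed.

Lemma pair_diff (i j : int) w (x : G i) : i = j + 1 -> hm wt j w ->
  pair j w (cdiff G i j x) = pair i (DWK w) x.
Proof.
move=> ij hw; have -> : cdiff G i j x = (x : 'rV_(bsz wt r i)) *m mxof wt (DG d e r) i j.
  by rewrite -{1}[x](uncK (x : 'rV_(bsz wt r i))) [LHS]gcx_diffE ?mxofE //; apply: hm_unc.
rewrite !pairE map_mxM -mulmxA; congr (th ((_ *m _) 0 0)).
by rewrite -mxof_DG_map mxof_DG_tr -trmx_mul -mxofE crdK.
Qed.

Lemma pairD (i : int) u w x : pair i (u + w) x = pair i u x + pair i w x.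
Proof.
rewrite !pairE -thD; have -> : crd wt i (u + w) = crd wt i u + crd wt i w by exact: (linearD (crdL wt r K i)).
by rewrite linearD mulmxDr [in LHS]mxE.
Qed.

Lemma pairZ (i : int) b w x : pair i (g b *: w) x = b *: pair i w x.
Proof.
rewrite !pairE -thZ; have -> : crd wt i (g b *: w) = g b *: crd wt i w by exact: (linearZ_LR (crdL wt r K i)).
by rewrite linearZ -scalemxAr [in LHS]mxE.
Qed.

Lemma pair0 (i : int) x : pair i 0 x = 0.
Proof. by rewrite -(scale0r 0) -(rmorph0 g) pairZ scale0r. Qed.

Lemma pairB (i : int) u w x : pair i (u - w) x = pair i u x - pair i w x.
Proof. by rewrite -scaleN1r -(rmorph1 g) -rmorphN pairD pairZ scaleN1r. Qed.

Lemma pair_eq (i : int) w w' : hm wt i w -> hm wt i w' -> (forall x, pair i w x = pair i w' x) -> w = w'.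
Proof.
move=> hw hw' h; apply/eqP; rewrite -subr_eq0; apply/eqP.
have p0 x : pair i (w - w') x = 0.
  by rewrite pairB h subrr.
have c0 : crd wt i (w - w') = 0.
  apply/rowP => j; rewrite [RHS]mxE; apply: th_inj.
  have := p0 (delta_mx 0 j : 'rV[B]_(bsz wt r i)); rewrite pairE.
  by rewrite map_delta_mx -rowE mxE [_^T _ _]mxE.
by rewrite -(crdK (hmB hw hw')) c0; apply: (linear0 (uncL wt r K i)).
Qed.

Lemma pair_surj (i : int) (phi : linHom (G i) Nm) : exists2 w, hm wt i w & forall x, phi x = pair i w x.
Proof.
have [c cE] := choice (fun j : 'I_(bsz wt r i) => th_surj (phi (delta_mx 0 j))).
exists (unc (\row_j c j)) => [|x]; first exact: hm_unc.
rewrite pairE uncK mxE th_sum [in LHS](row_sum_delta (x : 'rV[B]_(bsz wt r i))) linear_sum.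
by apply: eq_bigr => j _; rewrite !mxE thZ cE linearZ_LR.
Qed.

Lemma hm_DW_adj (i : int) w : hm wt i w -> hm wt (i + 1) (DWK w).
Proof.
move=> hw; rewrite -(crdK hw); apply/hm_ent => a b sa nab.
have hG (q : VV B N r) : hm wt (wt b + (2 * sumn a)%N%:Z) q -> hm wt (wt b + (2 * sumn a)%N%:Z - 1) (DG d e r q).
  exact: p_deg.
rewrite linear_sum ent_sum big1 // => j _; rewrite linearZ_LR entZ.
rewrite -ent_DG_adj ?bel_size //.
have hd : hm wt (wt b + (2 * sumn a)%N%:Z) (delta B r a b) by apply: hm_delta.
have := hm_vmap g (hG _ hd); rewrite vmap_DG vmap_delta.
move/(hm_ent _ _ _).1 => /(_ (bel j).1 (bel j).2) ->; rewrite ?mulr0 ?bel_size //.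
by rewrite bel_wt => e0; apply: nab; rewrite e0 subrK.
Qed.

Lemma homc_cycP (n : int) (phi : homc G Nm n) w : hm wt (- n) w -> (forall x, phi x = pair (- n) w x) ->
  is_cycle phi <-> DWK w = 0.
Proof.
move=> hw pw; rewrite /is_cycle; have e1 : - (n - 1) = - n + 1 by rewrite opprB addrC.
have dE x : cdiff (homc G Nm) n (n - 1) phi x = pair (- (n - 1)) (DWK w) x.
  by rewrite -[LHS]/(phi (cdiff G (- (n - 1)) (- n) x)) pw pair_diff.
split=> [c|D0]; last by apply: homP => x; rewrite dE D0 pair0.
apply: (pair_eq (i := - (n - 1))); [by rewrite e1; apply: hm_DW_adj | exact: hm0 | move=> x].
by rewrite -dE c pair0.
Qed.

Lemma homc_bdP (n : int) (phi : homc G Nm n) w : hm wt (- n) w -> (forall x, phi x = pair (- n) w x) ->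
  is_boundary phi <-> exists2 q, hm wt (- n - 1) q & DWK q = w.
Proof.
move=> hw pw; have e1 : - (n + 1) = - n - 1 by rewrite opprD.
have dE (psi : homc G Nm (n + 1)) q x : hm wt (- (n + 1)) q -> (forall y, psi y = pair (- (n + 1)) q y) ->
    cdiff (homc G Nm) (n + 1) n psi x = pair (- n) (DWK q) x.
  by move=> hq pq; rewrite -[LHS]/(psi (cdiff G (- n) (- (n + 1)) x)) pq pair_diff //; lia.
split=> [[psi psiE]|[q hq qE]].
  have [q hq qE] := pair_surj psi; exists q; first by rewrite -e1.
  apply: (pair_eq (i := - n)) => // [|x]; first by have := hm_DW_adj hq; congr hm; lia.
  by rewrite -pw -psiE (dE _ q).
rewrite -e1 in hq; exists (pair (- (n + 1)) q : homc G Nm (n + 1)).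
by apply: homP => x; rewrite (dE _ q) // qE pw.
Qed.

End Pairing.

Lemma hom_sumE (R : comNzRingType) (U V : lmodType R) I (q : seq I) (F : I -> linHom U V) x :
  (\sum_(j <- q) F j) x = \sum_(j <- q) F j x.
Proof. exact: (big_morph (fun p : linHom U V => p x)). Qed.

Lemma hom_subE (R : comNzRingType) (U V : lmodType R) (g h : linHom U V) x : (g - h) x = g x - h x.
Proof. by []. Qed.

Section Rank.
Variables (R : realType) (B : comNzRingType) (k : fieldType) (pi : {rmorphism B -> k}).
Hypothesis pi_surj : forall c, exists b, pi b = c.
Variables (N : nat) (wt : 'I_N -> int) (r : nat) (d : 'M[B]_N) (e : nat -> 'M[B]_N).
Hypothesis p_deg : forall (i : int) v, hm wt i v -> hm wt (i - 1) (DG d e r v).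
Hypothesis pp : forall v : VV B N r, DG d e r (DG d e r v) = 0.
Let dk := map_mx pi d.
Let ek l := map_mx pi (e l).
Hypothesis xe : is_ext r dk ek.
Notation G := (gcx p_deg pp).
Notation kN := (restr_mod pi k^o).

Let th : k -> kN := id.
Let thD a b : th (a + b) = th a + th b. Proof. by []. Qed.
Let thZ b c : th (pi b * c) = b *: th c. Proof. by []. Qed.
Let th_inj c : th c = 0 -> c = 0. Proof. by []. Qed.
Let th_surj y : exists c, th c = y. Proof. by exists y. Qed.
Notation pairk := (pair thD thZ p_deg pp).

(** The pairing turns cocycles into homogeneous elements of the polynomial complex over [k]. As [pi]
    is onto, independence tested with coefficients in [B] is linear independence over [k], so the
    supremum is attained by a basis; transposition returns to divided powers. *)
Lemma homology_rank_homc (n : int) :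
  homology_rank R pi (homc G kN) n = (gdim wt dk ek r (- n))%:R%:E.
Proof.
have [dd de ee e2] := xe.
have xt : is_ext r dk^T (fun l => (ek l)^T).
  split=> [|l lr|l m lr mr|l lr]; rewrite -?trmx_mul.
  - by rewrite dd trmx0.
  - by rewrite addrC -linearD /= de // trmx0.
  - by rewrite addrC -linearD /= ee // trmx0.
  - by rewrite e2 // trmx0.
pose D := DW dk^T (fun l => (ek l)^T) r.
have hD (i : int) w : hm wt i w -> hm wt (i + 1) (D w) by apply: hm_DW_adj p_deg i w.
have DD w : D (D w) = 0 by apply: DW_DW.
have hd := hdim_op hD DD (- n); rewrite gdim_tr -/D.
have sumP m (z : 'I_m -> homc G kN n) (w : 'I_m -> VV k N r) (b : 'I_m -> B) x :
    (forall j y, z j y = pairk (- n) (w j) y) ->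
    (\sum_j b j *: z j) x = pairk (- n) (\sum_j pi (b j) *: w j) x.
  move=> zw; rewrite hom_sumE.
  have pD u v : pairk (- n) (u + v) x = pairk (- n) u x + pairk (- n) v x by exact: pairD.
  have p0 : pairk (- n) 0 x = 0 by exact: pair0.
  rewrite (big_morph (fun v => pairk (- n) v x) pD p0).
  by apply: eq_bigr => j _; rewrite pairZ -zw.
apply/eqP; rewrite eq_le; apply/andP; split.
  apply: ge_ereal_sup => _ [m [z [cz iz]] <-]; rewrite lee_fin ler_nat.
  have h j : exists w, hm wt (- n) w /\ forall x, z j x = pairk (- n) w x.
    by have [w hw pw] := pair_surj thD thZ th_surj (z j); exists w.
  have [w wP] := choice h.
  apply: (indep_le (subsp_obd _ _ _ _) hd (z := w)) => [j|c [q hq qE] j].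
    have [hw pw] := wP j; split=> //.
    exact: (proj1 (homc_cycP th_inj hw pw) (cz j)).
  have [b bE] := choice (fun j => pi_surj (c j)).
  rewrite -bE; apply: iz; have hs : hm wt (- n) (\sum_j pi (b j) *: w j).
    by apply: hm_sum => l _; apply: hmZ; case: (wP l).
  apply: (proj2 (homc_bdP th_inj th_surj hs (fun x => sumP m z w b x (fun j => (wP j).2)))).
  exists q => //; rewrite -/dk -/D -qE; apply: eq_bigr => l _; by rewrite bE.
apply: ereal_sup_ubound; have [w [Zw iw _]] := hd.
exists (wdim wt dk^T (fun l => (ek l)^T) r (- n)) => //=.
exists (fun j => pairk (- n) (w j)); split=> [j|b bd j].
  by have [hw Dw] := Zw j; apply: (proj2 (homc_cycP th_inj hw (fun x => erefl))).
apply: (iw (fun j => pi (b j))).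
have hs : hm wt (- n) (\sum_j pi (b j) *: w j).
  by apply: hm_sum => l _; apply: hmZ; case: (Zw l).
have [q hq qE] := proj1 (homc_bdP th_inj th_surj hs (fun x => sumP _ _ w b x (fun j y => erefl))) bd.
by exists q.
Qed.

End Rank.

(** * Reduction modulo the regular sequence *)

Section Quotient.
Variables (A B : comNzRingType) (f : {rmorphism A -> B}) (s : seq A).
Hypothesis reg : forall i a, (i < size s)%N -> ideal_gen (take i s) (s`_i * a) -> ideal_gen (take i s) a.
Hypothesis f_surj : forall b, exists a, f a = b.
Hypothesis f_ker : forall a, f a = 0 <-> ideal_gen s a.
Variables (N : nat) (deg : 'I_N -> int) (d : 'M[A]_N) (e : nat -> 'M[A]_N).
Notation c := (size s).
Hypothesis ke : is_kos (fun l => s`_l) c d e.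
Let dB := map_mx f d.
Let eB l := map_mx f (e l).

Lemma vmap_eq0 r (g : VV A N r) : vmap f g = 0 <-> inI (ideal_gen s) g.
Proof.
elim: r g => [|r IH] g; split=> [h|h].
- by move=> b; apply/f_ker; have := congr1 (fun v : 'rV[B]_N => v 0 b) h; rewrite !mxE.
- by apply/rowP => b; rewrite mxE [RHS]mxE; apply/f_ker/h.
- by move=> n; apply/IH; apply: (congr1 (fun v : VV B N r.+1 => v n) h).
- by apply/funext => n; apply/IH/h.
Qed.

Lemma vmapB r (g h : VV A N r) : vmap f (g - h) = vmap f g - vmap f h.
Proof. by rewrite vmapD -scaleN1r vmapZ rmorphN1 scaleN1r. Qed.

Lemma vmap_lift r (i : int) (g : VV B N r) : hm deg i g -> exists2 g', hm deg i g' & vmap f g' = g.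
Proof.
elim: r i g => [|r IH] i g hg.
  have h b : exists a, (deg b <> i -> a = 0) /\ f a = (g : 'rV[B]_N) 0 b.
    have [db|/eqP db] := eqVneq (deg b) i; first by have [a aE] := f_surj ((g : 'rV[B]_N) 0 b); exists a.
    by exists 0; rewrite rmorph0 hg.
  have [a aP] := choice h; exists (\row_b a b) => [b db|]; first by rewrite mxE (aP b).1.
  by apply/rowP => b; rewrite !mxE (aP b).2.
have h n : exists a, hm deg (i - (2 * n)%N%:Z) a /\ vmap f a = g n.
  by have [a ha aE] := IH _ _ (hg n); exists a.
have [a aP] := choice h; exists a; first by move=> n; case: (aP n).
by apply/funext => n; case: (aP n).
Qed.

Lemma vmap_emb r (v : 'rV[A]_N) : vmap f (emb r v) = emb r (map_mx f v).
Proof. by elim: r => // r IH; apply/funext => -[|n]; [exact: IH | exact: vmap0]. Qed.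

Lemma map_nu r : map_mx f (nu e r) = nu eB r.
Proof.
by elim: r => [|r IH]; [exact: map_mx1 | rewrite -[nu e r.+1]/(nu e r *m e r) map_mxM IH].
Qed.

Lemma quotient_gen l : (l < c)%N -> f s`_l = 0.
Proof.
move=> lc; apply/f_ker/ideal_genP; exists (fun i => (i == l)%:R).
rewrite (bigD1_seq l) ?mem_index_iota ?iota_uniq //= eqxx mul1r big1 ?addr0 // => i' /negbTE ->.
by rewrite mul0r.
Qed.

Lemma kos_ext : is_ext c dB eB.
Proof.
have [dd de ee e2] := ke; split=> [|l lr|l m lr mr|l lr]; rewrite -?map_mxM -?map_mxD.
- by rewrite dd map_mx0.
- by rewrite de // map_scalar_mx quotient_gen //; apply: raddf0.
- by rewrite ee // map_mx0.
- by rewrite e2 // map_mx0.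
Qed.

Let inI_take r (g : VV A N r) : inI (ideal_gen (take c s)) g <-> vmap f g = 0.
Proof. by rewrite take_size; split=> /vmap_eq0. Qed.

Let sub0 (V : zmodType) (a b t : V) : a - b - t = 0 -> a = b + t.
Proof. by move=> h; apply/eqP; rewrite -subr_eq0 opprD addrA h. Qed.

(** A homogeneous lift to [A] of a cycle over [B] is a cycle modulo the ideal of the sequence, so it
    can be contracted over [A] and the result reduced to [B]. *)
Lemma DG_quotient_cycle (i : int) g : gr_kos c deg d e -> hm deg i g -> DG dB eB c g = 0 ->
  exists v p, [/\ homog deg i v, v *m d = 0, hm deg (i + 1) p & g = emb c (map_mx f v) + DG dB eB c p].
Proof.
move=> [gd ge] hg Dg; have [g' hg' gE] := vmap_lift hg.
have [|v [p [hv vd hp /inI_take q]]] := DG_contract_cycle reg gd (leqnn c) ke ge hg' (i := i).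
  by apply/inI_take; rewrite vmap_DG gE.
exists v, (vmap f p); split=> //; first exact: hm_vmap.
by apply: sub0; rewrite -q !vmapB vmap_emb vmap_DG gE.
Qed.

Lemma DW_quotient_cycle (i : int) w : mx_deg deg 1 d -> (forall l, (l < c)%N -> mx_deg deg (-1) (e l)) ->
  hm deg i w -> DW dB eB c w = 0 ->
  exists y q, [/\ homog deg (i + c%:Z) y, y *m d = 0, hm deg (i - 1) q &
    w = emb c (map_mx f y *m nu eB c) + DW dB eB c q].
Proof.
move=> gd ge hw Dw; have [w' hw' wE] := vmap_lift hw.
have [|y [q [hy yd hq /inI_take h]]] := DW_contract_cycle reg gd (leqnn c) ke ge hw' (i := i).
  by apply/inI_take; rewrite vmap_DW wE.
exists y, (vmap f q); split=> //; first exact: hm_vmap.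
by apply: sub0; rewrite -h !vmapB vmap_emb vmap_DW wE map_mxM map_nu.
Qed.

Lemma DW_quotient_boundary (i : int) y q : mx_deg deg 1 d -> (forall l, (l < c)%N -> mx_deg deg (-1) (e l)) ->
  homog deg (i + c%:Z) y -> y *m d = 0 -> hm deg (i - 1) q ->
  emb c (map_mx f y *m nu eB c) = DW dB eB c q -> exists2 u, homog deg (i + c%:Z - 1) u & y = u *m d.
Proof.
move=> gd ge hy yd hq yq; have [q' hq' qE] := vmap_lift hq.
apply: (DW_contract_boundary reg gd (leqnn c) ke ge hy yd hq').
by apply/inI_take; rewrite vmapB vmap_emb vmap_DW qE map_mxM map_nu yq subrr.
Qed.

End Quotient.

(** * The resolution and its dual *)

Lemma mx_deg_map (A B : comNzRingType) (f : {rmorphism A -> B}) N (wt : 'I_N -> int) (t : int) (M : 'M[A]_N) :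
  mx_deg wt t M -> mx_deg wt t (map_mx f M).
Proof. by move=> h b b' db; rewrite mxE h ?rmorph0. Qed.

Lemma top_DG_kill (R : comNzRingType) N (W : lmodType R) (q : {linear 'rV[R]_N -> W}) (d : 'M[R]_N)
    (e : nat -> 'M[R]_N) r (g : VV R N r) :
  (forall l v, (l < r)%N -> q (v *m e l) = 0) -> q (top (DG d e r g)) = q (top g *m d).
Proof.
elim: r g => [|r IH] g qe; first by [].
rewrite -[top (DG d e r.+1 g)]/(top (DG d e r.+1 g 0%N)) DGE topD linearD top_act qe // addr0.
by apply: IH => l v lr; apply: qe; lia.
Qed.

Lemma top_emb (R : comNzRingType) N r (v : 'rV[R]_N) : top (emb r v) = v.
Proof. by elim: r. Qed.

Section Model.
Variables (A B : comNzRingType) (f : {rmorphism A -> B}) (s : seq A).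
Hypothesis reg : forall i a, (i < size s)%N -> ideal_gen (take i s) (s`_i * a) -> ideal_gen (take i s) a.
Hypothesis f_surj : forall b, exists a, f a = b.
Hypothesis f_ker : forall a, f a = 0 <-> ideal_gen s a.
Notation c := (size s).
Notation x := (fun l => s`_l).
Variables (N : nat) (deg : 'I_N -> int) (d : 'M[A]_N) (e : nat -> 'M[A]_N).

Section Resolution.
Hypotheses (ke : is_kos x c d e) (ge : gr_kos c deg d e).
Let dB := map_mx f d.
Let eB l := map_mx f (e l).

Fact model_deg (i : int) (g : VV B N c) : hm deg i g -> hm deg (i - 1) (DG dB eB c g).
Proof.
by have [gd gee] := ge; apply: hm_DG => [|l lr]; apply: mx_deg_map; [exact: gd | exact: gee].
Qed.

Fact model_sqr (g : VV B N c) : DG dB eB c (DG dB eB c g) = 0.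
Proof. exact/DG_DG/(kos_ext f_ker ke). Qed.

Definition model : complex B := gcx model_deg model_sqr.

Lemma K_projective_model : K_projective model.
Proof. by apply: (K_projective_free (lo := wt_lo deg)) => [i|i y]; [exact: gcx_projective | exact: gcx_lo]. Qed.

Section Augmentation.
Variable X : complex B.
Variable mm : forall i : int, 'I_N -> restrc f X i.
Hypothesis km : forall n : int, kmodel x c n deg d e mm.

Definition augm (i : int) : {linear VV B N c -> X i} := @phi B X N mm i \o topL B N c.

Lemma phi_map (i : int) v : @phi B X N mm i (map_mx f v) = phi mm i v.
Proof. by apply: eq_bigr => b _; rewrite mxE. Qed.

Lemma map_mx_lift (u : 'rV[B]_N) : exists v, map_mx f v = u.
Proof.
have [a aE] := choice (fun b => f_surj (u 0 b)).
by exists (\row_b a b); apply/rowP => b; rewrite !mxE.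
Qed.

Fact augm_diff (i : int) g : hm deg i g -> augm (i - 1) (DG dB eB c g) = cdiff X i (i - 1) (augm i g).
Proof.
move=> _; rewrite -[LHS]/(@phi B X N mm (i - 1) (top (DG dB eB c g))) top_DG_kill => [|l u lr].
  rewrite -[augm i g]/(@phi B X N mm i (top g)); have [v <-] := map_mx_lift (top g).
  by rewrite -map_mxM !phi_map (km_d (km 0)).
by have [v <-] := map_mx_lift u; rewrite -map_mxM phi_map (km_e (km 0)).
Qed.

Definition augmentation : chain_map model X := gcx_map model_deg model_sqr augm_diff.

(** Contraction brings a cycle into exponent 0, where it comes from a cycle of the finite model over
    [A]; there the comparison with [X] is the one of [km], in all degrees. *)
Lemma quasi_augmentation : quasi_iso augmentation.
Proof.
apply: gcx_map_quasi => [i g hg Dg bg|i y cy].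
  have [v [p [hv vd hp gE]]] := DG_quotient_cycle reg f_surj f_ker ke ge hg Dg.
  have bv : is_boundary (phi mm i v).
    have h : augm i g = phi mm i v + augm i (DG dB eB c p).
      by rewrite gE linearD; congr (_ + _); rewrite -[LHS]/(phi _ _ (top _)) top_emb phi_map.
    have h2 : is_boundary (augm i (DG dB eB c p)).
      by have := augm_diff hp; rewrite addrK => ->; apply: bd_diff.
    by have := bdB bg h2; rewrite h addrK.
  have [|u hu uE] := km_inj (km (i + 1)) _ hv vd bv; first by lia.
  exists (p + emb c (map_mx f u)).
    by apply: hmD => //; apply/hm_emb/(@hm_vmap _ _ f N deg 0).
  by rewrite linearD DG_emb -map_mxM -uE gE addrC.
have [v [hv vd bv]] := km_surj (km i) (lexx i) cy.
exists (emb c (map_mx f v)); split.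
- exact/hm_emb/(@hm_vmap _ _ f N deg 0).
- by rewrite DG_emb -map_mxM vd map_mx0 emb0.
- by rewrite -[augm i _]/(phi _ _ (top _)) top_emb phi_map.
Qed.
End Augmentation.
End Resolution.
End Model.

Section Dual.
Variables (A B : comNzRingType) (f : {rmorphism A -> B}) (s : seq A).
Hypothesis reg : forall i a, (i < size s)%N -> ideal_gen (take i s) (s`_i * a) -> ideal_gen (take i s) a.
Hypothesis f_surj : forall b, exists a, f a = b.
Hypothesis f_ker : forall a, f a = 0 <-> ideal_gen s a.
Notation c := (size s).
Notation x := (fun l => s`_l).
Variables (N : nat) (deg : 'I_N -> int) (d : 'M[A]_N) (e : nat -> 'M[A]_N).
Hypotheses (ke : is_kos x c d e) (ge : gr_kos c deg d e).

(** The shift by the number of variables compensates the degree of the norm element. *)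
Definition ddeg b := c%:Z - deg b.
(* The sign compensates the one in [d nu = (-1)^c nu d]. *)
Definition dsg : A := (-1) ^+ c.
Definition dd : 'M[A]_N := dsg *: d^T.
Definition de l : 'M[A]_N := dsg *: (e l)^T.

Lemma dsgK : dsg * dsg = 1. Proof. by rewrite -expr2 sqrr_sign. Qed.

Lemma kos_tr : is_kos x c d^T (fun l => (e l)^T).
Proof.
have [d2 dee ee e2] := ke; split=> [|l lr|l m lr mr|l lr]; rewrite -?trmx_mul.
- by rewrite d2 trmx0.
- by rewrite addrC -linearD /= dee // tr_scalar_mx.
- by rewrite addrC -linearD /= ee // trmx0.
- by rewrite e2 // trmx0.
Qed.

Lemma kos_dual : is_kos x c dd de.
Proof.
have sc (M M' : 'M[A]_N) : (dsg *: M) *m (dsg *: M') = M *m M'.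
  by rewrite -scalemxAl -scalemxAr scalerA dsgK scale1r.
by have [d2 dee ee e2] := kos_tr; split=> *; rewrite !sc; auto.
Qed.

Lemma deg_tr (t : int) (M : 'M[A]_N) : mx_deg deg t M -> mx_deg deg (- t) M^T.
Proof. by move=> h b b' db; rewrite mxE h //; lia. Qed.

Let gdT : mx_deg deg 1 d^T. Proof. by have [gd _] := ge; have := deg_tr gd; rewrite opprK. Qed.
Let geT l : (l < c)%N -> mx_deg deg (-1) (e l)^T. Proof. by move=> lc; have [_ gee] := ge; apply/deg_tr/gee. Qed.

Lemma gr_dual : gr_kos c ddeg dd de.
Proof.
by have [gd gee] := ge; split=> [|l lc] b b' db; rewrite !mxE ?gd ?gee ?mulr0 //; move: db; rewrite /ddeg; lia.
Qed.

Lemma homog_dual (i : int) (v : 'rV[A]_N) : homog ddeg i v <-> homog deg (- i + c%:Z) v.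
Proof. by split=> h b db; apply: h; move: db; rewrite /ddeg; lia. Qed.

Notation G := (model f_ker ke ge).
Notation G2 := (model f_ker kos_dual gr_dual).
Notation dT := (map_mx f d^T).
Notation eT := (fun l => map_mx f (e l)^T).
Notation nuT := (nu eT c).
Notation DG2 := (DG (map_mx f dd) (fun l => map_mx f (de l)) c).
Notation V := (VV B N c).

Let xT : is_ext c dT eT. Proof. exact: (kos_ext f_ker kos_tr). Qed.

Let DWT : DW ((map_mx idfun (map_mx f d))^T) (fun l => (map_mx idfun (map_mx f (e l)))^T) c = DW dT eT c.
Proof.
by congr (DW _ _ c); [|apply/funext => l]; rewrite map_mx_id // map_trmx.
Qed.

Let th : B -> B^o := id.
Let thD a b : th (a + b) = th a + th b. Proof. by []. Qed.
Let thZ b a : th ((idfun : {rmorphism B -> B}) b * a) = b *: th a. Proof. by []. Qed.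
Let th_inj a : th a = 0 -> a = 0. Proof. by []. Qed.
Let th_surj y : exists a, th a = y. Proof. by exists y. Qed.
Notation pairT := (pair thD thZ (model_deg f ge) (model_sqr f_ker ke)).

(** The norm map from the divided power complex on the dual to the polynomial complex on the dual,
    which computes the linear forms on the resolution. *)
Definition dvec (g : V) : V := emb c (top g *m nuT).

Lemma hm_dvec (i : int) g : hm ddeg i g -> hm deg (- i) (dvec g).
Proof.
move=> /hm_top hg; apply: hm_emb.
have hn : mx_deg deg (- c%:Z) nuT.
  by have := mx_deg_nu (a := 1) (fun l lc => mx_deg_map f (geT lc)); rewrite mulN1r.
have hg' : hm deg (- i + c%:Z) (top g : VV B N 0).
  by move=> b db; apply: hg; move: db; rewrite /ddeg; lia.
by have := hm_act hn hg'; rewrite addrK.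
Qed.

Lemma dvec_linear : linear dvec.
Proof. by move=> a u v; rewrite /dvec topD topZ mulmxDl -scalemxAl embD embZ. Qed.

Lemma dvec_DG g : dvec (DG2 g) = DW dT eT c (dvec g).
Proof.
have zd : top (DG2 g) *m nuT = top g *m nuT *m dT.
  have := @top_DG_kill B N _ (mulmxr nuT) (map_mx f dd) (fun l => map_mx f (de l)) c g.
  rewrite /= => -> => [|l v lc]; last first.
    by rewrite map_mxZ -scalemxAr -scalemxAl -mulmxA (e_nu0 xT) // mulmx0 scaler0.
  rewrite map_mxZ rmorph_sign -scalemxAr -scalemxAl -!mulmxA (d_nu xT) -scalemxAr scalerA.
  by rewrite -expr2 sqrr_sign scale1r.
rewrite /dvec zd (@DW_emb _ _ dT eT c _ 0 (fun=> 0)) ?emb0 ?linear0 ?addr0 // => l lc.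
by rewrite -mulmxA (nu_e0 xT) // mulmx0.
Qed.

Fact dual_linear (i : int) : linear (fun g : V => pairT (- i) (dvec g) : homc G B^o i).
Proof.
by move=> a u v; apply: homP => y; rewrite dvec_linear pairD -[a *: dvec u]/((idfun a) *: dvec u) pairZ.
Qed.
Definition dualf (i : int) : {linear V -> homc G B^o i} := mkhom (@dual_linear i).

Fact dual_diff (i : int) g : hm ddeg i g -> dualf (i - 1) (DG2 g) = cdiff (homc G B^o) i (i - 1) (dualf i g).
Proof.
move=> hg; apply: homP => y.
rewrite -[RHS]/(pairT (- i) (dvec g) (cdiff G (- (i - 1)) (- i) y)) pair_diff; [|by lia|exact: hm_dvec].
by rewrite DWT -dvec_DG.
Qed.
Definition dual_map : chain_map G2 (homc G B^o) := gcx_map (model_deg f gr_dual) (model_sqr f_ker kos_dual) dual_diff.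

(** Both sides reduce to the homology of [d^T] on the dual of the finite model over [A]: divided
    powers through exponent 0, polynomials through multiples of the norm element. The map [dvec]
    matches the two reductions. *)
Lemma quasi_dual_map : quasi_iso dual_map.
Proof.
apply: gcx_map_quasi => [i g hg Dg bg|i phi cphi].
  have [q hq qE] := proj1 (homc_bdP th_inj th_surj (hm_dvec hg) (fun y => erefl)) bg.
  rewrite DWT in qE.
  have [v [p [hv vd hp gE]]] := DG_quotient_cycle reg f_surj f_ker kos_dual gr_dual hg Dg.
  have vE : emb c (map_mx f v *m nuT) = DW dT eT c (q - dvec p).
    rewrite linearB qE -dvec_DG -[LHS]/(emb c _); have -> : dvec g = emb c (map_mx f v *m nuT) + dvec (DG2 p).
      by rewrite gE -[X in dvec (X + _)]scale1r dvec_linear scale1r /dvec top_emb.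
    by rewrite addrK.
  have vdT : v *m d^T = 0.
    by have := congr1 ( *:%R dsg) vd; rewrite -scalemxAr scalerA dsgK scale1r scaler0.
  have hqp : hm deg (- i - 1) (q - dvec p).
    by apply: hmB => //; have := hm_dvec hp; rewrite opprD.
  have [u hu uE] := DW_quotient_boundary reg f_surj f_ker kos_tr gdT geT ((homog_dual i v).1 hv) vdT hqp vE.
  have hu2 : homog ddeg (i + 1) (dsg *: u).
    by apply/homog_dual => b db; rewrite mxE hu ?mulr0 //; lia.
  exists (p + emb c (map_mx f (dsg *: u))).
    by apply: hmD => //; apply/hm_emb/(@hm_vmap _ _ f N ddeg 0).
  rewrite linearD DG_emb -map_mxM; have -> : dsg *: u *m dd = v.
    by rewrite -scalemxAl -scalemxAr scalerA dsgK scale1r.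
  by rewrite gE addrC.
have [w hw phiE] := pair_surj thD thZ th_surj phi.
have := proj1 (homc_cycP th_inj hw phiE) cphi; rewrite DWT => Dw.
have [y [q [hy yd hq wE]]] := DW_quotient_cycle reg f_surj f_ker kos_tr gdT geT hw Dw.
have hg : hm ddeg i (emb c (map_mx f y) : V).
  by apply/hm_emb/(@hm_vmap _ _ f N ddeg 0)/homog_dual.
exists (emb c (map_mx f y)); split=> //.
  by rewrite DG_emb -map_mxM -scalemxAr yd scaler0 map_mx0 emb0.
have hb : hm deg (- i) (w - dvec (emb c (map_mx f y))) by apply: hmB => //; apply: hm_dvec.
have pE z : (phi - dualf i (emb c (map_mx f y))) z = pairT (- i) (w - dvec (emb c (map_mx f y))) z.
  rewrite hom_subE phiE; apply: esym; exact: pairB.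
apply: (proj2 (homc_bdP th_inj th_surj hb pE)).
by exists q => //; rewrite DWT wE /dvec top_emb [RHS]addrC addKr.
Qed.

End Dual.

(** * Resolutions and Betti numbers *)

Section Resolutions.
Variable R : comNzRingType.
Implicit Types X P : complex R.

(** The model resolves a truncation, and the complex maps to its truncation rather than from it;
    K-projectivity lifts the augmentation back along that map. *)
Lemma resolution_pull M X P (t : chain_map M X) (a : chain_map P X) :
  quasi_iso t -> K_projective P -> quasi_iso a -> K_projective_resolution M P.
Proof.
move=> qt kP qa; have [g gE] := K_projective_lift a kP qt.
by split=> //; exists g; apply: (quasi_cancel gE).
Qed.

Lemma RHom_resolution X P N : K_projective_resolution X P ->
  exists h : chain_map (homc P N) (RHom X N), quasi_iso h.
Proof.
move=> kP; have [kP1 [a qa]] := kP.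
have [kX [b qb]] : K_projective_resolution X (resolution X).
  by rewrite /resolution; case: pselect => [h|[]]; [case: (cid h) | exists P].
by have [g qg] := K_projective_hom kP1 kX qa qb; exists (homc_map g N).
Qed.
End Resolutions.

Section RestrictMap.
Variables (A B : comNzRingType) (f : {rmorphism A -> B}) (X X' : complex B) (g : chain_map X X').

Definition restrc_map : chain_map (restrc f X) (restrc f X') :=
  @ChainMap A (restrc f X) (restrc f X') (fun i => restr_map f (g i)) (cmap_diff g).

Lemma quasi_restrc_map : quasi_iso g -> quasi_iso restrc_map.
Proof. by []. Qed.
End RestrictMap.

Lemma DW_scale (R : comNzRingType) N (a : R) (d : 'M[R]_N) e r g :
  DW (a *: d) (fun l => a *: e l) r g = a *: DW d e r g.
Proof.
elim: r g => [|r IH] g; first exact: actZl.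
apply/funext => n; rewrite DWE IH -[RHS]/(a *: DW d e r.+1 g n) DWE scalerDr; congr (_ + _).
by case: n => [|n]; [rewrite scaler0 | rewrite actZl].
Qed.

Lemma wdim_scale (k : fieldType) N wt (a : k) (d : 'M[k]_N) e r i : a != 0 ->
  wdim wt (a *: d) (fun l => a *: e l) r i = wdim wt d e r i.
Proof.
move=> a0; have h j l : mxof wt (DW (a *: d) (fun l => a *: e l) r) j l = a *: mxof wt (DW d e r) j l.
  by apply/matrixP => b b'; rewrite !mxE DW_scale entZ.
by rewrite /wdim /opdim !h !mxrank_scale_nz.
Qed.

Lemma is_ext_map (R S : comNzRingType) (g : {rmorphism R -> S}) N r (d : 'M[R]_N) e :
  is_ext r d e -> is_ext r (map_mx g d) (fun l => map_mx g (e l)).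
Proof.
by move=> [dd de ee e2]; split=> [|l lr|l m lr mr|l lr];
  rewrite -?map_mxM -?map_mxD ?dd ?de ?ee ?e2 // map_mx0.
Qed.

Section BettiModel.
Variables (R : realType) (A B : comNzRingType) (k : fieldType).
Variables (f : {rmorphism A -> B}) (pi : {rmorphism B -> k}) (s : seq A).
Hypothesis pi_surj : forall a, exists b, pi b = a.
Hypothesis f_ker : forall a, f a = 0 <-> ideal_gen s a.
Notation c := (size s).
Notation x := (fun l => s`_l).
Variables (N : nat) (deg : 'I_N -> int) (d : 'M[A]_N) (e : nat -> 'M[A]_N).
Hypotheses (ke : is_kos x c d e) (ge : gr_kos c deg d e).

Lemma betti_model (M : complex B) (i : nat) : K_projective_resolution M (model f_ker ke ge) ->
  betti R pi M i = (gdim deg (map_mx pi (map_mx f d)) (fun l => map_mx pi (map_mx f (e l))) c i)%:R%:E.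
Proof.
move=> /(RHom_resolution (restr_mod pi k^o))[h qh].
rewrite /betti -(homology_rank_quasi R pi (- i%:Z) qh).
have xe := is_ext_map pi (kos_ext f_ker ke).
by rewrite (homology_rank_homc R pi_surj (model_deg f ge) (model_sqr f_ker ke) xe) opprK.
Qed.
End BettiModel.

Section Main.
Variables (R : realType) (A B : comNzRingType) (k : fieldType).
Variables (f : {rmorphism A -> B}) (pi : {rmorphism B -> k}) (s : seq A).
Hypotheses (nA : noetherian_ring A) (lA : local_ring A).
Hypothesis pi_surj : forall a, exists b, pi b = a.
Hypothesis f_surj : forall b, exists a, f a = b.
Hypothesis reg : forall i a, (i < size s)%N -> ideal_gen (take i s) (s`_i * a) -> ideal_gen (take i s) a.
Hypothesis f_ker : forall a, f a = 0 <-> ideal_gen s a.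
Notation c := (size s).
Notation x := (fun l => s`_l).

Lemma model_exists (M : complex B) : Db f M -> exists N deg d e (ke : is_kos x c d e) (ge : @gr_kos A c N deg d e),
  K_projective_resolution M (model f_ker ke ge).
Proof.
move=> hM.
have [[m0 ex0] fg0] := hM _ (thick_finite_homology nA) (finite_homology_stalk A).
have bM := hM _ (thick_bounded_dim A) (bounded_dim_stalk A).
(* The truncation is taken over [B], before restriction to [A], so that its terms are still killed
   by the sequence when cells are attached. *)
pose X := trunc M m0%:Z; pose t : chain_map M X := trunc_proj M m0%:Z.
have qt : quasi_iso t by apply: quasi_trunc_proj => i im; apply: ex0; lia.
pose Y := restrc f X; have qY : quasi_iso (restrc_map f t) by apply: quasi_restrc_map.
have fgY i : homology_fg Y i by apply/(homology_fg_quasi i qY).1/fg0.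
have [mY bY] := bounded_dim_quasi1 qY bM.
(* [lo] is below all homology. [n] exceeds the top degree [m0] of the truncation and is large enough
   for the bound [mY] on the projective dimension to apply to complexes exact below [n + 1]. *)
pose lo : int := - m0%:Z - 1; pose n : int := (m0.+1 + `|mY|)%N%:Z.
have exY (i : int) : i <= lo -> exact_at Y i.
  by rewrite /lo => il; apply/(quasi_exact i qY).1/ex0; lia.
have kY (i : int) (y : Y i) : kills x c y.
  move=> l lc; have h : f s`_l *: (y : X i) = 0 by rewrite (quotient_gen f_ker lc) scale0r.
  exact: h.
have [N0 [deg0 [d0 [e0 [mm0 km0]]]]] := kmodel_exists nA kY fgY exY `|n - lo|%N.
have en : lo + `|n - lo|%N%:Z = n by rewrite /lo /n; lia.
rewrite en in km0.
have Y0 (i : int) (y : Y i) : n <= i -> y = 0 by move=> ni; apply: (@trunc_eq0 _ M m0%:Z i y); rewrite /n in ni; lia.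
have sur (a : k) : exists b, (pi \o f : {rmorphism A -> k}) b = a.
  by have [b <-] := pi_surj a; have [a' <-] := f_surj b; exists a'.
have [|N [deg [d [e [mm km]]]]] := finite_model lA sur km0 Y0.
  by move=> C cC; apply: bY => i im; apply: cC; rewrite /n; lia.
exists N, deg, d, e, (km_kos (km 0)), (km_gr (km 0)).
apply: (resolution_pull qt (a := augmentation f_surj f_ker (km_kos (km 0)) (km_gr (km 0)) km)).
  exact: K_projective_model.
exact: quasi_augmentation.
Qed.

Lemma betti_deg_dual (M : complex B) : Db f M -> betti_deg R pi M = betti_deg R pi (RHom M B^o).
Proof.
move=> /model_exists[N [deg [d [e [ke [ge rM]]]]]].
pose dk := map_mx pi (map_mx f d); pose ek l := map_mx pi (map_mx f (e l)).
have xe : is_ext c dk ek := is_ext_map pi (kos_ext f_ker ke).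
have gk : gr_ext deg (-1) c dk ek.
  have [gd gee] := ge; split=> [|l lc]; first exact/mx_deg_map/mx_deg_map.
  by rewrite opprK; apply/mx_deg_map/mx_deg_map/gee.
(* The constant [c0] is the number of variables, which makes the opposite weights those of the dual
   model. *)
have bal := balance R (fun b => erefl : ddeg s deg b = c%:Z - deg b) xe gk.
apply: (betti_deg_balanced bal) => i; first exact: (betti_model R pi_surj i rM).
have [h qh] := RHom_resolution B^o rM.
have rD : K_projective_resolution (RHom M B^o) (model f_ker (kos_dual ke) (gr_dual ge)).
  split; first exact: K_projective_model.
  exists (compc h (dual_map f_ker ke ge)); apply: quasi_comp => //.
  exact: quasi_dual_map.
(* The dual model has the transposed operators; transposing ranks gives the polynomial complex on
   the original ones, up to the sign [dsg], which does not change ranks. *)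
rewrite (betti_model R pi_surj i rD) gdim_tr; congr (_%:R%:E).
have sg0 : pi (f (dsg s)) != 0 by rewrite !rmorph_sign signr_eq0.
rewrite -(wdim_scale _ dk ek c _ sg0); congr (wdim _ _ _ _ _).
  by rewrite !map_mxZ linearZ /= !map_trmx trmxK.
by apply/funext => l; rewrite !map_mxZ linearZ /= !map_trmx trmxK.
Qed.

End Main.

Theorem theorem3p6 (R : realType) (A B : comNzRingType) (k : fieldType)
    (f : {rmorphism A -> B}) (pi : {rmorphism B -> k})
    (hA : noetherian_ring A) (hA' : local_ring A)
    (hB : noetherian_ring B) (hB' : local_ring B)
    (hpi : forall c : k, exists b : B, pi b = c)
    (hf : forall b : B, exists a : A, f a = b)
    (hker : exists s : seq A, regular_seq s /\
              forall a : A, f a = 0 <-> ideal_gen s a)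
    (M : complex B) (hM : Db f M) (hcx : cx R pi M <> Some 0%N) :
  betti_deg R pi M = betti_deg R pi (RHom M B^o).
Proof.
have [s [[reg _] ker]] := hker.
exact: (betti_deg_dual R hA hA' hpi hf reg ker).
Qed.
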